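(* (Absolute Yoneda Lemma for two-sided families.) Let $P:A\times B\to\mathcal U$ be a two-sided cartesian family over Rezk types $A$ and $B$. For any $a:A$ and $b:B$, the evaluation map $$\mathrm{ev}_{\langle\mathrm{id}_a,\mathrm{id}_b\rangle}:\Big(\prod^{\mathrm{2sCart}}_{u:a\downarrow A,\ v:B\downarrow b}P(\partial_1u,\partial_0v)\Big)\to P(a,b)$$ from the type of two-sided cartesian sections is an equivalence.
   Context: Setting: simplicial homotopy type theory of Riehl–Shulman, i.e. homotopy type theory with a univalent universe $\mathcal U$, extended by strict shapes (the directed interval $\Delta^1$ with endpoints $0,1$; $\Delta^2$; the horn $\Lambda^2_1\subset\Delta^2$; etc.) and extension types (types of sections over a shape restricting judgmentally to a given section on a subshape). All statements are internal to this type theory. For $x,y:A$, $(x\to_A y)$ is the type of maps $\Delta^1\to A$ from $x$ to $y$. For $P:B\to\mathcal U$, $u:b\to_B b'$, $e:P(b)$, $e':P(b')$, the type $(e\to^P_u e')$ of dependent arrows consists of sections of $P$ over $u$ with endpoints $e,e'$; such an arrow is vertical if $u$ is an identity. A type $A$ is Segal if $A^{\Delta^2}\to A^{\Lambda^2_1}$ is an equivalence, and Rezk if moreover the canonical maps from $(x=_Ay)$ to the type of isomorphisms from $x$ to $y$ are equivalences. A family is isoinner if it is right orthogonal (unique lifting) to $\Lambda^2_1\hookrightarrow\Delta^2$ and to $\mathbb E\to\mathbf 1$, $\mathbb E$ the free bi-invertible arrow (over a Rezk base: the total type is Rezk). Families and maps into the base are identified via total types. Let $P$ be isoinner over a Rezk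 type $B$. An arrow $f:e\to^P_u e'$ over $u:b\to b'$ is $P$-cocartesian if for all $v:b'\to b''$, $e'':P(b'')$, $h:e\to^P_{vu}e''$ the type of $g:e'\to^P_v e''$ with $gf=h$ is contractible. $P$ is cocartesian if every $u:b\to b'$ and $e:P(b)$ admit a $P$-cocartesian arrow over $u$ with source $e$ (necessarily unique), written $e\to u_!e$. Cartesian arrows and families are defined dually, with lifts $u^*e'\to e'$ having prescribed target. Two-sided cartesian families. For Rezk $A,B$ and isoinner $P:A\times B\to\mathcal U$ with total type $E=\sum_{a,b}P(a,b)$ and projections $\xi:E\to A$, $\pi:E\to B$: $P$ is cocartesian on the left if $\xi$ is a cocartesian fibration and every $\xi$-cocartesian arrow is $\pi$-vertical; cartesian on the right if $\pi$ is a cartesian fibration and every $\pi$-cartesian arrow is $\xi$-vertical. If both hold, for $u:a\to_Aa'$, $v:b'\to_Bb$, $e:P(a,b)$ there are lifts $e\to u_!e$ ($\xi$-cocartesian) and $v^*e\to e$ ($\pi$-cartesian), and a unique arrow $\kappa:u_!v^*e\to_{P(a',b')}v^*u_!e$ such that $v^*e\to u_!v^*e\xrightarrow{\kappa}v^*u_!e\to u_!e$ equals $v^*e\to e\to u_!e$. $P$ is two-sided cartesian (''two-sided family'') if both conditions hold and every $\kappa$ is an isomorphism. A section $\sigma:\prod_{a:A,b:B}P(a,b)$ is two-sided cartesian if for all arrows $u:\Delta^1\to A$, $v:\Delta^1\to B$ and elements $a:A$, $b:B$ the dependent arrow $\sigma(u,\mathrm{id}_b):\prod_{t:\Delta^1}P(u(t),b)$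 is $\xi$-cocartesian and $\sigma(\mathrm{id}_a,v):\prod_{t:\Delta^1}P(a,v(t))$ is $\pi$-cartesian. The (sub)type of these sections is $\prod^{\mathrm{2sCart}}_{A\times B}P$; the same notion is used for families over other products of two Rezk types. Commas: $a\downarrow A:=\sum_{x:A}(a\to_Ax)$ with $\partial_1(x,u):=x$, and $B\downarrow b:=\sum_{y:B}(y\to_Bb)$ with $\partial_0(y,v):=y$; these are Rezk types. The family $\lambda u,v.P(\partial_1u,\partial_0v)$ over $(a\downarrow A)\times(B\downarrow b)$ is the pullback of $P$ along $\partial_1\times\partial_0$ and is a two-sided cartesian family. *)

(* Defs.v *)
From Stdlib Require Import List.
Import ListNotations.

(** Simplicial type theory (Riehl-Shulman) cannot be identified with the type
    theory of Rocq: univalence, strict shapes and judgmental boundary conditions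
    have no counterpart there.  It is therefore defined here as an object theory:
    raw syntax and derivable judgments.  "The statement holds" means that its
    translation is an inhabited type of the object theory. *)

(** * Raw syntax *)

(** De Bruijn indices, with one index space for cube variables ([PVar]) and a
    separate one for term variables ([Var]). *)

Inductive cube : Type :=
| C1
| C2 (** the directed interval *)
| CProd (K J : cube).

Inductive pt : Type :=
| PVar (n : nat)
| PStar
| PZero
| POne
| PPair (s t : pt)
| PFst (s : pt)
| PSnd (s : pt).

Inductive tope : Type :=
| TTop
| TBot
| TAnd (p q : tope)
| TOr (p q : tope)
| TEq (s t : pt)
| TLe (s t : pt).

(** [Ext K psi A phi a] is the type of sections of [A] over the shape
    [{t : K | psi}] that restrict judgmentally to [a] on [{t : K | phi}]; it binds
    a cube variable in [A] and in [a].  As in Riehl-Shulman, shapes are closed: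
    the only variable of [phi] and [psi] is [PVar 0], of cube [K].
    [J C d p] is based path induction; its motive [C] binds the right endpoint
    (index 1) and the path (index 0). *)
Inductive tm : Type :=
| Var (n : nat)
| Univ (i : nat)
| Pi (A B : tm)
| Lam (b : tm)
| App (f a : tm)
| Sig (A B : tm)
| Pair (a b : tm)
| Fst (p : tm)
| Snd (p : tm)
| Id (A a b : tm)
| Refl (a : tm)
| J (C d p : tm)
| Ext (K : cube) (psi : tope) (A : tm) (phi : tope) (a : tm)
| ELam (b : tm)
| EApp (f : tm) (s : pt)
| RecBot
| RecOr (p q : tope) (a b : tm)
| FunExt (i : nat)
| RelFunExt (i : nat) (K : cube) (psi phi : tope)
| Univalence (i : nat).

(** * Renaming and substitution *)

Definition scons {X : Type} (x : X) (f : nat -> X) (n : nat) : X :=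
  match n with 0 => x | S m => f m end.

Definition upren (r : nat -> nat) : nat -> nat := scons 0 (fun n => S (r n)).

Fixpoint psubst (r : nat -> pt) (s : pt) : pt :=
  match s with
  | PVar n => r n
  | PStar => PStar
  | PZero => PZero
  | POne => POne
  | PPair s t => PPair (psubst r s) (psubst r t)
  | PFst s => PFst (psubst r s)
  | PSnd s => PSnd (psubst r s)
  end.

Fixpoint tsubst (r : nat -> pt) (p : tope) : tope :=
  match p with
  | TTop => TTop
  | TBot => TBot
  | TAnd p q => TAnd (tsubst r p) (tsubst r q)
  | TOr p q => TOr (tsubst r p) (tsubst r q)
  | TEq s t => TEq (psubst r s) (psubst r t)
  | TLe s t => TLe (psubst r s) (psubst r t)
  end.

Fixpoint ren (r q : nat -> nat) (t : tm) : tm :=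
  match t with
  | Var n => Var (q n)
  | Univ i => Univ i
  | Pi A B => Pi (ren r q A) (ren r (upren q) B)
  | Lam b => Lam (ren r (upren q) b)
  | App f a => App (ren r q f) (ren r q a)
  | Sig A B => Sig (ren r q A) (ren r (upren q) B)
  | Pair a b => Pair (ren r q a) (ren r q b)
  | Fst p => Fst (ren r q p)
  | Snd p => Snd (ren r q p)
  | Id A a b => Id (ren r q A) (ren r q a) (ren r q b)
  | Refl a => Refl (ren r q a)
  | J C d p => J (ren r (upren (upren q)) C) (ren r q d) (ren r q p)
  | Ext K psi A phi a => Ext K psi (ren (upren r) q A) phi (ren (upren r) q a)
  | ELam b => ELam (ren (upren r) q b)
  | EApp f s => EApp (ren r q f) (psubst (fun n => PVar (r n)) s)
  | RecBot => RecBot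
  | RecOr p p' a b =>
      RecOr (tsubst (fun n => PVar (r n)) p) (tsubst (fun n => PVar (r n)) p')
            (ren r q a) (ren r q b)
  | FunExt i => FunExt i
  | RelFunExt i K psi phi => RelFunExt i K psi phi
  | Univalence i => Univalence i
  end.

Definition pshift : pt -> pt := psubst (fun n => PVar (S n)).
Definition tshift : tope -> tope := tsubst (fun n => PVar (S n)).
(** Weakening by a cube variable and by a term variable. *)
Definition cwk : tm -> tm := ren S (fun n => n).
Definition wk : tm -> tm := ren (fun n => n) S.

Definition pup (r : nat -> pt) : nat -> pt := scons (PVar 0) (fun n => pshift (r n)).
Definition up (q : nat -> tm) : nat -> tm := scons (Var 0) (fun n => wk (q n)).

Fixpoint subst (r : nat -> pt) (q : nat -> tm) (t : tm) : tm :=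
  match t with
  | Var n => q n
  | Univ i => Univ i
  | Pi A B => Pi (subst r q A) (subst r (up q) B)
  | Lam b => Lam (subst r (up q) b)
  | App f a => App (subst r q f) (subst r q a)
  | Sig A B => Sig (subst r q A) (subst r (up q) B)
  | Pair a b => Pair (subst r q a) (subst r q b)
  | Fst p => Fst (subst r q p)
  | Snd p => Snd (subst r q p)
  | Id A a b => Id (subst r q A) (subst r q a) (subst r q b)
  | Refl a => Refl (subst r q a)
  | J C d p => J (subst r (up (up q)) C) (subst r q d) (subst r q p)
  | Ext K psi A phi a =>
      Ext K psi (subst (pup r) (fun n => cwk (q n)) A)
          phi (subst (pup r) (fun n => cwk (q n)) a)
  | ELam b => ELam (subst (pup r) (fun n => cwk (q n)) b)
  | EApp f s => EApp (subst r q f) (psubst r s)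
  | RecBot => RecBot
  | RecOr p p' a b =>
      RecOr (tsubst r p) (tsubst r p') (subst r q a) (subst r q b)
  | FunExt i => FunExt i
  | RelFunExt i K psi phi => RelFunExt i K psi phi
  | Univalence i => Univalence i
  end.

Definition inst1 (b a : tm) : tm := subst PVar (scons a Var) b.
Definition inst2 (C b p : tm) : tm := subst PVar (scons p (scons b Var)) C.
Definition pinst (b : tm) (s : pt) : tm := subst (scons s PVar) Var b.
Definition tinst (p : tope) (s : pt) : tope := tsubst (scons s PVar) p.

(** * Named object-level binders *)

(** A [dtm] is a term that can be placed under any number of binders: its
    arguments are the numbers of enclosing cube binders and term binders.  A bound
    variable remembers the level at which it was bound, so Rocq functions can play
    the role of object-level binders; applying a closed [dtm] to [0 0] yields the
    de Bruijn term. *)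

Definition dpt : Type := nat -> pt.
Definition dtope : Type := nat -> tope.
Definition dtm : Type := nat -> nat -> tm.

Definition pvar (k : nat) : dpt := fun c => PVar (c - S k).
Definition var (k : nat) : dtm := fun _ n => Var (n - S k).

Definition p0 : dpt := fun _ => PZero.
Definition p1 : dpt := fun _ => POne.
Definition ppair (s t : dpt) : dpt := fun c => PPair (s c) (t c).
Definition pfst (s : dpt) : dpt := fun c => PFst (s c).
Definition psnd (s : dpt) : dpt := fun c => PSnd (s c).
Definition teq (s t : dpt) : dtope := fun c => TEq (s c) (t c).
Definition tor (p q : dtope) : dtope := fun c => TOr (p c) (q c).

Definition U (i : nat) : dtm := fun _ _ => Univ i.
Definition pi (A : dtm) (B : dtm -> dtm) : dtm :=
  fun c n => Pi (A c n) (B (var n) c (S n)).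
Definition lam (b : dtm -> dtm) : dtm := fun c n => Lam (b (var n) c (S n)).
Definition app (f a : dtm) : dtm := fun c n => App (f c n) (a c n).
Definition sig (A : dtm) (B : dtm -> dtm) : dtm :=
  fun c n => Sig (A c n) (B (var n) c (S n)).
Definition pair (a b : dtm) : dtm := fun c n => Pair (a c n) (b c n).
Definition fst (p : dtm) : dtm := fun c n => Fst (p c n).
Definition snd (p : dtm) : dtm := fun c n => Snd (p c n).
Definition eqt (A a b : dtm) : dtm := fun c n => Id (A c n) (a c n) (b c n).
Definition refl (a : dtm) : dtm := fun c n => Refl (a c n).
Definition jel (C : dtm -> dtm -> dtm) (d p : dtm) : dtm :=
  fun c n => J (C (var n) (var (S n)) c (S (S n))) (d c n) (p c n).
Definition ext (K : cube) (psi : tope) (A : dpt -> dtm) (phi : tope) (a : dpt -> dtm) : dtm :=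
  fun c n => Ext K psi (A (pvar c) (S c) n) phi (a (pvar c) (S c) n).
Definition elam (b : dpt -> dtm) : dtm := fun c n => ELam (b (pvar c) (S c) n).
Definition eapp (f : dtm) (s : dpt) : dtm := fun c n => EApp (f c n) (s c).
Definition recbot : dtm := fun _ _ => RecBot.
Definition recor (p q : dtope) (a b : dtm) : dtm :=
  fun c n => RecOr (p c) (q c) (a c n) (b c n).

Declare Scope stt_scope.
Delimit Scope stt_scope with stt.
Bind Scope stt_scope with dtm.

Notation "'Π' x : A , B" := (pi A (fun x => B))
  (at level 200, x name, A at level 200, B at level 200) : stt_scope.
Notation "'Σ' x : A , B" := (sig A (fun x => B))
  (at level 200, x name, A at level 200, B at level 200) : stt_scope.
Notation "A ⇒ B" := (pi A (fun _ => B))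
  (at level 99, B at level 200, right associativity) : stt_scope.
Notation "A ⊗ B" := (sig A (fun _ => B)) (at level 60, right associativity) : stt_scope.
Notation "⟪ a , .. , b , c ⟫" := (pair a .. (pair b c) ..) : stt_scope.

Local Open Scope stt_scope.

(** * Homotopy type theory *)

Definition isContr (A : dtm) : dtm := Σ x : A, Π y : A, eqt A x y.

Definition isEquiv (A B : dtm) (f : dtm -> dtm) : dtm :=
  Π y : B, isContr (Σ x : A, eqt B (f x) y).

Definition Equiv (A B : dtm) : dtm := Σ f : (A ⇒ B), isEquiv A B (app f).

Definition idEquiv (A : dtm) : dtm :=
  let F y := Σ x : A, eqt A x y in
  ⟪ lam (fun x => x),
    lam (fun y => ⟪ ⟪ y, refl y ⟫,
      lam (fun z =>
        jel (fun y' q => eqt (F y') ⟪ y', refl y' ⟫ ⟪ fst z, q ⟫)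
            (refl ⟪ fst z, refl (fst z) ⟫) (snd z)) ⟫) ⟫.

Definition univalence (i : nat) : dtm :=
  Π A : U i, Π B : U i,
    isEquiv (eqt (U i) A B) (Equiv A B)
            (fun p => jel (fun X _ => Equiv A X) (idEquiv A) p).

(** Sections over the shape [{t : K | psi}] with no boundary condition. *)
Definition sections (K : cube) (psi : tope) (A : dpt -> dtm) : dtm :=
  ext K psi A TBot (fun _ => recbot).

Definition funext (i : nat) : dtm :=
  Π A : U i, Π B : (A ⇒ U i),
    (Π x : A, isContr (app B x)) ⇒ isContr (Π x : A, app B x).

(** Relative function extensionality (Riehl-Shulman's axiom). *)
Definition relfunext (i : nat) (K : cube) (psi phi : tope) : dtm :=
  Π A : sections K psi (fun _ => U i),
  Π a : sections K phi (eapp A),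
    sections K psi (fun t => isContr (eapp A t)) ⇒
    isContr (ext K psi (eapp A) phi (eapp a)).

(** * Judgments *)

(** [X], [F], [G] are the cube, tope and type contexts, innermost entry first;
    entry [n] of [G] lives over the entries of [G] after it. *)

Inductive has_cube (X : list cube) : pt -> cube -> Prop :=
| c_var n K : nth_error X n = Some K -> has_cube X (PVar n) K
| c_star : has_cube X PStar C1
| c_zero : has_cube X PZero C2
| c_one : has_cube X POne C2
| c_pair s t K L : has_cube X s K -> has_cube X t L -> has_cube X (PPair s t) (CProd K L)
| c_fst s K L : has_cube X s (CProd K L) -> has_cube X (PFst s) K
| c_snd s K L : has_cube X s (CProd K L) -> has_cube X (PSnd s) L.

Inductive is_tope (X : list cube) : tope -> Prop :=
| w_top : is_tope X TTop
| w_bot : is_tope X TBot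
| w_and p q : is_tope X p -> is_tope X q -> is_tope X (TAnd p q)
| w_or p q : is_tope X p -> is_tope X q -> is_tope X (TOr p q)
| w_eq s t K : has_cube X s K -> has_cube X t K -> is_tope X (TEq s t)
| w_le s t : has_cube X s C2 -> has_cube X t C2 -> is_tope X (TLe s t).

(** Coherent logic of the tope layer: [C2] is a strict linear interval. *)
Inductive entails (X : list cube) : list tope -> tope -> Prop :=
| e_hyp F p : In p F -> entails X F p
| e_top F : entails X F TTop
| e_bot F p : is_tope X p -> entails X F TBot -> entails X F p
| e_and F p q : entails X F p -> entails X F q -> entails X F (TAnd p q)
| e_and1 F p q : entails X F (TAnd p q) -> entails X F p
| e_and2 F p q : entails X F (TAnd p q) -> entails X F q
| e_or1 F p q : is_tope X q -> entails X F p -> entails X F (TOr p q)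
| e_or2 F p q : is_tope X p -> entails X F q -> entails X F (TOr p q)
| e_case F p q r :
    entails X F (TOr p q) -> entails X (p :: F) r -> entails X (q :: F) r -> entails X F r
| e_refl F s K : has_cube X s K -> entails X F (TEq s s)
| e_subst F s t K p :
    has_cube X s K -> has_cube X t K -> is_tope (K :: X) p ->
    entails X F (TEq s t) -> entails X F (tinst p s) -> entails X F (tinst p t)
| e_star F s : has_cube X s C1 -> entails X F (TEq s PStar)
| e_fst F s t K L :
    has_cube X s K -> has_cube X t L -> entails X F (TEq (PFst (PPair s t)) s)
| e_snd F s t K L :
    has_cube X s K -> has_cube X t L -> entails X F (TEq (PSnd (PPair s t)) t)
| e_eta F s K L :
    has_cube X s (CProd K L) -> entails X F (TEq s (PPair (PFst s) (PSnd s)))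
| e_le_refl F s : has_cube X s C2 -> entails X F (TLe s s)
| e_le_trans F s t u : entails X F (TLe s t) -> entails X F (TLe t u) -> entails X F (TLe s u)
| e_le_anti F s t : entails X F (TLe s t) -> entails X F (TLe t s) -> entails X F (TEq s t)
| e_le_total F s t :
    has_cube X s C2 -> has_cube X t C2 -> entails X F (TOr (TLe s t) (TLe t s))
| e_le_zero F s : has_cube X s C2 -> entails X F (TLe PZero s)
| e_le_one F s : has_cube X s C2 -> entails X F (TLe s POne)
| e_zero_one F : entails X F (TEq PZero POne) -> entails X F TBot.

Reserved Notation "X ∥ F ∥ G ⊢ a ∈ A"
  (at level 70, F at level 69, G at level 69, a at level 69, A at level 69).
Reserved Notation "X ∥ F ∥ G ⊢ a ≡ b ∈ A"
  (at level 70, F at level 69, G at level 69, a at level 69, b at level 69, A at level 69).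

(** Martin-Löf type theory with Russell universes, cumulative as in the HoTT book,
    together with tope elimination, extension types, function extensionality,
    relative function extensionality and univalence.  Every rule that extends a
    context requires the new entry to be well formed, so derivations that start
    from the empty context only meet well-formed contexts. *)
Inductive has_type : list cube -> list tope -> list tm -> tm -> tm -> Prop :=
| t_conv X F G a A B i :
    X ∥ F ∥ G ⊢ a ∈ A -> X ∥ F ∥ G ⊢ A ≡ B ∈ Univ i -> X ∥ F ∥ G ⊢ a ∈ B
| t_var X F G n A :
    nth_error G n = Some A -> X ∥ F ∥ G ⊢ Var n ∈ ren (fun k => k) (fun k => S n + k) A
| t_univ X F G i : X ∥ F ∥ G ⊢ Univ i ∈ Univ (S i)
| t_cumul X F G A i : X ∥ F ∥ G ⊢ A ∈ Univ i -> X ∥ F ∥ G ⊢ A ∈ Univ (S i)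
| t_pi X F G A B i :
    X ∥ F ∥ G ⊢ A ∈ Univ i -> X ∥ F ∥ A :: G ⊢ B ∈ Univ i -> X ∥ F ∥ G ⊢ Pi A B ∈ Univ i
| t_lam X F G A B b i :
    X ∥ F ∥ G ⊢ A ∈ Univ i -> X ∥ F ∥ A :: G ⊢ b ∈ B -> X ∥ F ∥ G ⊢ Lam b ∈ Pi A B
| t_app X F G A B f a :
    X ∥ F ∥ G ⊢ f ∈ Pi A B -> X ∥ F ∥ G ⊢ a ∈ A -> X ∥ F ∥ G ⊢ App f a ∈ inst1 B a
| t_sig X F G A B i :
    X ∥ F ∥ G ⊢ A ∈ Univ i -> X ∥ F ∥ A :: G ⊢ B ∈ Univ i -> X ∥ F ∥ G ⊢ Sig A B ∈ Univ i
| t_pair X F G A B a b i :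
    X ∥ F ∥ A :: G ⊢ B ∈ Univ i ->
    X ∥ F ∥ G ⊢ A ∈ Univ i -> X ∥ F ∥ G ⊢ a ∈ A -> X ∥ F ∥ G ⊢ b ∈ inst1 B a ->
    X ∥ F ∥ G ⊢ Pair a b ∈ Sig A B
| t_fst X F G A B p : X ∥ F ∥ G ⊢ p ∈ Sig A B -> X ∥ F ∥ G ⊢ Fst p ∈ A
| t_snd X F G A B p : X ∥ F ∥ G ⊢ p ∈ Sig A B -> X ∥ F ∥ G ⊢ Snd p ∈ inst1 B (Fst p)
| t_id X F G A a b i :
    X ∥ F ∥ G ⊢ A ∈ Univ i -> X ∥ F ∥ G ⊢ a ∈ A -> X ∥ F ∥ G ⊢ b ∈ A ->
    X ∥ F ∥ G ⊢ Id A a b ∈ Univ i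
| t_refl X F G A a : X ∥ F ∥ G ⊢ a ∈ A -> X ∥ F ∥ G ⊢ Refl a ∈ Id A a a
| t_J X F G A a b C d p i j :
    X ∥ F ∥ G ⊢ A ∈ Univ i -> X ∥ F ∥ G ⊢ a ∈ A ->
    X ∥ F ∥ Id (wk A) (wk a) (Var 0) :: A :: G ⊢ C ∈ Univ j ->
    X ∥ F ∥ G ⊢ d ∈ inst2 C a (Refl a) ->
    X ∥ F ∥ G ⊢ p ∈ Id A a b ->
    X ∥ F ∥ G ⊢ J C d p ∈ inst2 C b p
| t_ext X F G K psi A phi a i :
    is_tope [K] psi -> is_tope [K] phi -> entails [K] [phi] psi ->
    K :: X ∥ psi :: map tshift F ∥ map cwk G ⊢ A ∈ Univ i ->
    K :: X ∥ phi :: map tshift F ∥ map cwk G ⊢ a ∈ A ->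
    X ∥ F ∥ G ⊢ Ext K psi A phi a ∈ Univ i
| t_elam X F G K psi A phi a b i :
    X ∥ F ∥ G ⊢ Ext K psi A phi a ∈ Univ i ->
    K :: X ∥ psi :: map tshift F ∥ map cwk G ⊢ b ∈ A ->
    K :: X ∥ phi :: map tshift F ∥ map cwk G ⊢ b ≡ a ∈ A ->
    X ∥ F ∥ G ⊢ ELam b ∈ Ext K psi A phi a
| t_eapp X F G K psi A phi a f s :
    X ∥ F ∥ G ⊢ f ∈ Ext K psi A phi a ->
    has_cube X s K -> entails X F (tinst psi s) ->
    X ∥ F ∥ G ⊢ EApp f s ∈ pinst A s
| t_recbot X F G A i :
    entails X F TBot -> X ∥ F ∥ G ⊢ A ∈ Univ i -> X ∥ F ∥ G ⊢ RecBot ∈ A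
| t_recor X F G p q a b A i :
    is_tope X p -> is_tope X q -> entails X F (TOr p q) ->
    X ∥ F ∥ G ⊢ A ∈ Univ i ->
    X ∥ p :: F ∥ G ⊢ a ∈ A -> X ∥ q :: F ∥ G ⊢ b ∈ A ->
    X ∥ TAnd p q :: F ∥ G ⊢ a ≡ b ∈ A ->
    X ∥ F ∥ G ⊢ RecOr p q a b ∈ A
| t_funext X F G i : X ∥ F ∥ G ⊢ FunExt i ∈ funext i 0 0
| t_relfunext X F G i K psi phi :
    is_tope [K] psi -> is_tope [K] phi -> entails [K] [phi] psi ->
    X ∥ F ∥ G ⊢ RelFunExt i K psi phi ∈ relfunext i K psi phi 0 0
| t_univalence X F G i : X ∥ F ∥ G ⊢ Univalence i ∈ univalence i 0 0

with has_eq : list cube -> list tope -> list tm -> tm -> tm -> tm -> Prop :=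
| q_refl X F G a A : X ∥ F ∥ G ⊢ a ∈ A -> X ∥ F ∥ G ⊢ a ≡ a ∈ A
| q_sym X F G a b A : X ∥ F ∥ G ⊢ a ≡ b ∈ A -> X ∥ F ∥ G ⊢ b ≡ a ∈ A
| q_trans X F G a b c A :
    X ∥ F ∥ G ⊢ a ≡ b ∈ A -> X ∥ F ∥ G ⊢ b ≡ c ∈ A -> X ∥ F ∥ G ⊢ a ≡ c ∈ A
| q_conv X F G a b A B i :
    X ∥ F ∥ G ⊢ a ≡ b ∈ A -> X ∥ F ∥ G ⊢ A ≡ B ∈ Univ i -> X ∥ F ∥ G ⊢ a ≡ b ∈ B
| q_cumul X F G A B i :
    X ∥ F ∥ G ⊢ A ≡ B ∈ Univ i -> X ∥ F ∥ G ⊢ A ≡ B ∈ Univ (S i)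
| q_pi X F G A A' B B' i :
    X ∥ F ∥ G ⊢ A ∈ Univ i ->
    X ∥ F ∥ G ⊢ A ≡ A' ∈ Univ i -> X ∥ F ∥ A :: G ⊢ B ≡ B' ∈ Univ i ->
    X ∥ F ∥ G ⊢ Pi A B ≡ Pi A' B' ∈ Univ i
| q_lam X F G A B b b' i :
    X ∥ F ∥ G ⊢ A ∈ Univ i -> X ∥ F ∥ A :: G ⊢ b ≡ b' ∈ B ->
    X ∥ F ∥ G ⊢ Lam b ≡ Lam b' ∈ Pi A B
| q_app X F G A B f f' a a' :
    X ∥ F ∥ G ⊢ f ≡ f' ∈ Pi A B -> X ∥ F ∥ G ⊢ a ≡ a' ∈ A ->
    X ∥ F ∥ G ⊢ App f a ≡ App f' a' ∈ inst1 B a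
| q_pi_beta X F G A B b a i :
    X ∥ F ∥ G ⊢ A ∈ Univ i -> X ∥ F ∥ A :: G ⊢ b ∈ B -> X ∥ F ∥ G ⊢ a ∈ A ->
    X ∥ F ∥ G ⊢ App (Lam b) a ≡ inst1 b a ∈ inst1 B a
| q_pi_eta X F G A B f :
    X ∥ F ∥ G ⊢ f ∈ Pi A B -> X ∥ F ∥ G ⊢ f ≡ Lam (App (wk f) (Var 0)) ∈ Pi A B
| q_sig X F G A A' B B' i :
    X ∥ F ∥ G ⊢ A ∈ Univ i ->
    X ∥ F ∥ G ⊢ A ≡ A' ∈ Univ i -> X ∥ F ∥ A :: G ⊢ B ≡ B' ∈ Univ i ->
    X ∥ F ∥ G ⊢ Sig A B ≡ Sig A' B' ∈ Univ i
| q_pair X F G A B a a' b b' i :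
    X ∥ F ∥ A :: G ⊢ B ∈ Univ i ->
    X ∥ F ∥ G ⊢ A ∈ Univ i -> X ∥ F ∥ G ⊢ a ≡ a' ∈ A -> X ∥ F ∥ G ⊢ b ≡ b' ∈ inst1 B a ->
    X ∥ F ∥ G ⊢ Pair a b ≡ Pair a' b' ∈ Sig A B
| q_fst X F G A B p p' :
    X ∥ F ∥ G ⊢ p ≡ p' ∈ Sig A B -> X ∥ F ∥ G ⊢ Fst p ≡ Fst p' ∈ A
| q_snd X F G A B p p' :
    X ∥ F ∥ G ⊢ p ≡ p' ∈ Sig A B -> X ∥ F ∥ G ⊢ Snd p ≡ Snd p' ∈ inst1 B (Fst p)
| q_fst_beta X F G A B a b i :
    X ∥ F ∥ A :: G ⊢ B ∈ Univ i ->
    X ∥ F ∥ G ⊢ A ∈ Univ i -> X ∥ F ∥ G ⊢ a ∈ A -> X ∥ F ∥ G ⊢ b ∈ inst1 B a ->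
    X ∥ F ∥ G ⊢ Fst (Pair a b) ≡ a ∈ A
| q_snd_beta X F G A B a b i :
    X ∥ F ∥ A :: G ⊢ B ∈ Univ i ->
    X ∥ F ∥ G ⊢ A ∈ Univ i -> X ∥ F ∥ G ⊢ a ∈ A -> X ∥ F ∥ G ⊢ b ∈ inst1 B a ->
    X ∥ F ∥ G ⊢ Snd (Pair a b) ≡ b ∈ inst1 B a
| q_sig_eta X F G A B p :
    X ∥ F ∥ G ⊢ p ∈ Sig A B -> X ∥ F ∥ G ⊢ p ≡ Pair (Fst p) (Snd p) ∈ Sig A B
| q_id X F G A A' a a' b b' i :
    X ∥ F ∥ G ⊢ A ≡ A' ∈ Univ i -> X ∥ F ∥ G ⊢ a ≡ a' ∈ A -> X ∥ F ∥ G ⊢ b ≡ b' ∈ A ->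
    X ∥ F ∥ G ⊢ Id A a b ≡ Id A' a' b' ∈ Univ i
| q_Refl X F G A a a' :
    X ∥ F ∥ G ⊢ a ≡ a' ∈ A -> X ∥ F ∥ G ⊢ Refl a ≡ Refl a' ∈ Id A a a
| q_J X F G A a b C C' d d' p p' i j :
    X ∥ F ∥ G ⊢ A ∈ Univ i -> X ∥ F ∥ G ⊢ a ∈ A ->
    X ∥ F ∥ Id (wk A) (wk a) (Var 0) :: A :: G ⊢ C ≡ C' ∈ Univ j ->
    X ∥ F ∥ G ⊢ d ≡ d' ∈ inst2 C a (Refl a) ->
    X ∥ F ∥ G ⊢ p ≡ p' ∈ Id A a b ->
    X ∥ F ∥ G ⊢ J C d p ≡ J C' d' p' ∈ inst2 C b p
| q_J_beta X F G A a C d i j :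
    X ∥ F ∥ G ⊢ A ∈ Univ i -> X ∥ F ∥ G ⊢ a ∈ A ->
    X ∥ F ∥ Id (wk A) (wk a) (Var 0) :: A :: G ⊢ C ∈ Univ j ->
    X ∥ F ∥ G ⊢ d ∈ inst2 C a (Refl a) ->
    X ∥ F ∥ G ⊢ J C d (Refl a) ≡ d ∈ inst2 C a (Refl a)
| q_ext X F G K psi A A' phi a a' i :
    is_tope [K] psi -> is_tope [K] phi -> entails [K] [phi] psi ->
    K :: X ∥ psi :: map tshift F ∥ map cwk G ⊢ A ≡ A' ∈ Univ i ->
    K :: X ∥ phi :: map tshift F ∥ map cwk G ⊢ a ≡ a' ∈ A ->
    X ∥ F ∥ G ⊢ Ext K psi A phi a ≡ Ext K psi A' phi a' ∈ Univ i
| q_elam X F G K psi A phi a b b' :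
    X ∥ F ∥ G ⊢ ELam b ∈ Ext K psi A phi a ->
    K :: X ∥ psi :: map tshift F ∥ map cwk G ⊢ b ≡ b' ∈ A ->
    X ∥ F ∥ G ⊢ ELam b ≡ ELam b' ∈ Ext K psi A phi a
| q_eapp X F G K psi A phi a f f' s s' :
    X ∥ F ∥ G ⊢ f ≡ f' ∈ Ext K psi A phi a ->
    has_cube X s K -> has_cube X s' K ->
    entails X F (TEq s s') -> entails X F (tinst psi s) ->
    X ∥ F ∥ G ⊢ EApp f s ≡ EApp f' s' ∈ pinst A s
| q_ext_boundary X F G K psi A phi a f s :
    X ∥ F ∥ G ⊢ f ∈ Ext K psi A phi a ->
    has_cube X s K -> entails X F (tinst phi s) ->
    X ∥ F ∥ G ⊢ EApp f s ≡ pinst a s ∈ pinst A s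
| q_ext_beta X F G K psi A phi a b s :
    X ∥ F ∥ G ⊢ ELam b ∈ Ext K psi A phi a ->
    K :: X ∥ psi :: map tshift F ∥ map cwk G ⊢ b ∈ A ->
    has_cube X s K -> entails X F (tinst psi s) ->
    X ∥ F ∥ G ⊢ EApp (ELam b) s ≡ pinst b s ∈ pinst A s
| q_ext_eta X F G K psi A phi a f :
    X ∥ F ∥ G ⊢ f ∈ Ext K psi A phi a ->
    X ∥ F ∥ G ⊢ f ≡ ELam (EApp (cwk f) (PVar 0)) ∈ Ext K psi A phi a
| q_recor1 X F G p q a b A :
    X ∥ F ∥ G ⊢ RecOr p q a b ∈ A -> X ∥ F ∥ G ⊢ a ∈ A -> entails X F p ->
    X ∥ F ∥ G ⊢ RecOr p q a b ≡ a ∈ A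
| q_recor2 X F G p q a b A :
    X ∥ F ∥ G ⊢ RecOr p q a b ∈ A -> X ∥ F ∥ G ⊢ b ∈ A -> entails X F q ->
    X ∥ F ∥ G ⊢ RecOr p q a b ≡ b ∈ A
(** The uniqueness rules of tope elimination: equality is local. *)
| q_case X F G p q a b A :
    entails X F (TOr p q) -> X ∥ F ∥ G ⊢ a ∈ A -> X ∥ F ∥ G ⊢ b ∈ A ->
    X ∥ p :: F ∥ G ⊢ a ≡ b ∈ A -> X ∥ q :: F ∥ G ⊢ a ≡ b ∈ A ->
    X ∥ F ∥ G ⊢ a ≡ b ∈ A
| q_bot X F G a b A :
    entails X F TBot -> X ∥ F ∥ G ⊢ a ∈ A -> X ∥ F ∥ G ⊢ b ∈ A -> X ∥ F ∥ G ⊢ a ≡ b ∈ A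

where "X ∥ F ∥ G ⊢ a ∈ A" := (has_type X F G a A)
and "X ∥ F ∥ G ⊢ a ≡ b ∈ A" := (has_eq X F G a b A).

(** A closed object-level type is provable if it has an element in the empty context. *)
Definition provable (T : dtm) : Prop :=
  exists t : tm, [] ∥ [] ∥ [] ⊢ t ∈ T 0 0.

(** * Shapes *)

(** A point of the square [C2 x C2] is [(t, s)], with [t] the first coordinate; the
    2-simplex is [s <= t], with vertices (0,0), (1,0), (1,1) in this order. *)

Definition boundary1 : tope := TOr (TEq (PVar 0) PZero) (TEq (PVar 0) POne).
Definition square : cube := CProd C2 C2.
Definition Delta2 : tope := TLe (PSnd (PVar 0)) (PFst (PVar 0)).
Definition Horn : tope := TOr (TEq (PSnd (PVar 0)) PZero) (TEq (PFst (PVar 0)) POne).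
Definition boundary2 : tope := TOr Horn (TEq (PSnd (PVar 0)) (PFst (PVar 0))).

(** * Arrows and simplices *)

(** An arrow is used through its application to points of the interval, so it is
    passed as a Rocq function [dpt -> dtm]; [eapp f] is the one underlying an
    element [f] of a type of arrows. *)

(** Dependent arrows from [e] to [e'] over an arrow [u], where [T t] is the fiber
    over [u t]. *)
Definition dhom (T : dpt -> dtm) (e e' : dtm) : dtm :=
  ext C2 TTop T boundary1 (fun t => recor (teq t p0) (teq t p1) e e').

Definition hom (A x y : dtm) : dtm := dhom (fun _ => A) x y.

(** Dependent 2-simplices with edges [f], [g] and [h]: the witnesses of "[gf = h]". *)
Definition dhom2 (T : dpt -> dtm) (f g h : dpt -> dtm) : dtm :=
  ext square Delta2 T boundary2
      (fun x =>
         let t := pfst x in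
         let s := psnd x in
         recor (tor (teq s p0) (teq t p1)) (teq s t)
               (recor (teq s p0) (teq t p1) (f t) (g s))
               (h t)).

Definition hom2 (A : dtm) (f g h : dpt -> dtm) : dtm := dhom2 (fun _ => A) f g h.

Definition idArr (x : dtm) : dtm := elam (fun _ => x).

Definition arrows (A : dtm) : dtm := sections C2 TTop (fun _ => A).

(** [w] is an identity arrow: it lies in the image of [A -> (Delta^1 -> A)]. *)
Definition isIdentity (A : dtm) (w : dpt -> dtm) : dtm :=
  Σ x : A, eqt (arrows A) (elam w) (idArr x).

(** * Segal and Rezk types *)

Definition isSegal (A : dtm) : dtm :=
  isEquiv (sections square Delta2 (fun _ => A)) (sections square Horn (fun _ => A))
          (fun f => elam (eapp f)).

(** Bi-invertibility of [f], with a left inverse [g] and a right inverse [h]. *)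
Definition isIso (A x y f : dtm) : dtm :=
  (Σ g : hom A y x, hom2 A (eapp f) (eapp g) (fun _ => x)) ⊗
  (Σ h : hom A y x, hom2 A (eapp h) (eapp f) (fun _ => y)).

Definition Iso (A x y : dtm) : dtm := Σ f : hom A x y, isIso A x y f.

Definition idIso (x : dtm) : dtm :=
  let c := elam (fun _ => x) in
  ⟪ idArr x, ⟪ idArr x, c ⟫, ⟪ idArr x, c ⟫ ⟫.

Definition isRezk (A : dtm) : dtm :=
  isSegal A ⊗
  (Π x : A, Π y : A,
     isEquiv (eqt A x y) (Iso A x y) (fun p => jel (fun z _ => Iso A x z) (idIso x) p)).

(** * Isoinner families *)

(** A family over [X] is a Rocq function [Q : dtm -> dtm]. *)

(** Unique lifting against the inclusion of the inner horn in the 2-simplex. *)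
Definition isInner (X : dtm) (Q : dtm -> dtm) : dtm :=
  Π r : sections square Delta2 (fun _ => X),
  Π d : sections square Horn (fun x => Q (eapp r x)),
    isContr (ext square Delta2 (fun x => Q (eapp r x)) Horn (eapp d)).

(** Maps into [A] out of the free bi-invertible arrow, i.e. [A^E]. *)
Definition biinvertibles (A : dtm) : dtm := Σ x : A, Σ y : A, Iso A x y.

(** Unique lifting against [E -> 1]: the bottom edge of a lifting square is a point
    [x] of the base, its top edge a bi-invertible arrow in the fiber over [x]. *)
Definition liftsFreeIso (X : dtm) (Q : dtm -> dtm) : dtm :=
  Π x : X, isEquiv (Q x) (biinvertibles (Q x)) (fun e => ⟪ e, e, idIso e ⟫).

Definition isIsoinner (X : dtm) (Q : dtm -> dtm) : dtm :=
  isInner X Q ⊗ liftsFreeIso X Q.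

(** * Cocartesian and cartesian families *)

(** The composite of [u] and [v] is any [w] with a witness [r] in [hom2]; over a
    Segal type the pair [(w, r)] is determined by [u] and [v] up to contractible
    choice. *)
Definition isCocartArr (X : dtm) (Q : dtm -> dtm) (u f : dpt -> dtm) : dtm :=
  Π x : X,
  Π v : hom X (u p1) x,
  Π w : hom X (u p0) x,
  Π r : hom2 X u (eapp v) (eapp w),
  Π e : Q x,
  Π h : dhom (fun t => Q (eapp w t)) (f p0) e,
    isContr (Σ g : dhom (fun t => Q (eapp v t)) (f p1) e,
             dhom2 (fun z => Q (eapp r z)) f (eapp g) (eapp h)).

Definition isCartArr (X : dtm) (Q : dtm -> dtm) (u f : dpt -> dtm) : dtm :=
  Π x : X,
  Π v : hom X x (u p0),
  Π w : hom X x (u p1),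
  Π r : hom2 X (eapp v) u (eapp w),
  Π e : Q x,
  Π h : dhom (fun t => Q (eapp w t)) e (f p1),
    isContr (Σ g : dhom (fun t => Q (eapp v t)) e (f p0),
             dhom2 (fun z => Q (eapp r z)) (eapp g) f (eapp h)).

Definition isCocartFam (X : dtm) (Q : dtm -> dtm) : dtm :=
  isIsoinner X Q ⊗
  (Π x : X, Π y : X, Π u : hom X x y, Π e : Q x,
     Σ e' : Q y, Σ f : dhom (fun t => Q (eapp u t)) e e',
       isCocartArr X Q (eapp u) (eapp f)).

Definition isCartFam (X : dtm) (Q : dtm -> dtm) : dtm :=
  isIsoinner X Q ⊗
  (Π x : X, Π y : X, Π u : hom X x y, Π e' : Q y,
     Σ e : Q x, Σ f : dhom (fun t => Q (eapp u t)) e e',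
       isCartArr X Q (eapp u) (eapp f)).

(** * Two-sided cartesian families *)

(** [P a b] is the fiber over [(a, b)].  The projections from the total type to [A]
    and to [B] are the families [left B P] over [A] and [right A P] over [B]. *)
Definition left (B : dtm) (P : dtm -> dtm -> dtm) (a : dtm) : dtm := Σ b : B, P a b.
Definition right (A : dtm) (P : dtm -> dtm -> dtm) (b : dtm) : dtm := Σ a : A, P a b.
Definition total (A B : dtm) (P : dtm -> dtm -> dtm) : dtm := Σ a : A, Σ b : B, P a b.

(** An arrow of [P] over [(u, idArr b)], resp. over [(idArr a, v)], that is
    cocartesian for the projection to [A], resp. cartesian for the one to [B]. *)
Definition isLeftCocartArr (A B : dtm) (P : dtm -> dtm -> dtm) (b : dtm) (u f : dpt -> dtm) : dtm :=
  isCocartArr A (left B P) u (fun t => ⟪ b, f t ⟫).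
Definition isRightCartArr (A B : dtm) (P : dtm -> dtm -> dtm) (a : dtm) (v f : dpt -> dtm) : dtm :=
  isCartArr B (right A P) v (fun t => ⟪ a, f t ⟫).

Definition isCocartOnLeft (A B : dtm) (P : dtm -> dtm -> dtm) : dtm :=
  isCocartFam A (left B P) ⊗
  (Π x : A, Π y : A, Π u : hom A x y, Π e : left B P x, Π e' : left B P y,
   Π f : dhom (fun t => left B P (eapp u t)) e e',
     isCocartArr A (left B P) (eapp u) (eapp f) ⇒
     isIdentity B (fun t => fst (eapp f t))).

Definition isCartOnRight (A B : dtm) (P : dtm -> dtm -> dtm) : dtm :=
  isCartFam B (right A P) ⊗
  (Π x : B, Π y : B, Π v : hom B x y, Π e : right A P x, Π e' : right A P y,
   Π f : dhom (fun t => right A P (eapp v t)) e e',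
     isCartArr B (right A P) (eapp v) (eapp f) ⇒
     isIdentity A (fun t => fst (eapp f t))).

(** The equation that characterizes the comparison arrow [k]: in the total type, the
    composites of [f'], [k], [g'] and of [g], [f] are the same arrow [d]. *)
Definition isComparison (A B : dtm) (P : dtm -> dtm -> dtm)
    (a a' b' b u v f f' g g' k e1 e2 e4 : dtm) : dtm :=
  let E := total A B P in
  Σ m : hom E ⟪ a, b', e2 ⟫ ⟪ a', b', e4 ⟫,
  Σ d : hom E ⟪ a, b', e2 ⟫ ⟪ a', b, e1 ⟫,
    hom2 E (fun t => ⟪ eapp u t, b', eapp f' t ⟫) (fun t => ⟪ a', b', eapp k t ⟫) (eapp m) ⊗
    hom2 E (eapp m) (fun t => ⟪ a', eapp v t, eapp g' t ⟫) (eapp d) ⊗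
    hom2 E (fun t => ⟪ a, eapp v t, eapp g t ⟫) (fun t => ⟪ eapp u t, b, eapp f t ⟫) (eapp d).

(** [f : e -> e1] is the cocartesian lift to [u_! e], [g : e2 -> e] the cartesian
    lift from [v^* e], [f' : e2 -> e3] and [g' : e4 -> e1] those to [u_! v^* e] and
    from [v^* u_! e].  Lifts are unique up to isomorphism, so all of them are
    considered. *)
Definition comparisonsAreIsos (A B : dtm) (P : dtm -> dtm -> dtm) : dtm :=
  Π a : A, Π a' : A, Π u : hom A a a',
  Π b' : B, Π b : B, Π v : hom B b' b,
  Π e : P a b,
  Π e1 : P a' b, Π f : dhom (fun t => P (eapp u t) b) e e1,
    isLeftCocartArr A B P b (eapp u) (eapp f) ⇒
  Π e2 : P a b', Π g : dhom (fun t => P a (eapp v t)) e2 e,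
    isRightCartArr A B P a (eapp v) (eapp g) ⇒
  Π e3 : P a' b', Π f' : dhom (fun t => P (eapp u t) b') e2 e3,
    isLeftCocartArr A B P b' (eapp u) (eapp f') ⇒
  Π e4 : P a' b', Π g' : dhom (fun t => P a' (eapp v t)) e4 e1,
    isRightCartArr A B P a' (eapp v) (eapp g') ⇒
  Π k : hom (P a' b') e3 e4,
    isComparison A B P a a' b' b u v f f' g g' k e1 e2 e4 ⇒
    isIso (P a' b') e3 e4 k.

Definition isTwoSided (A B : dtm) (P : dtm -> dtm -> dtm) : dtm :=
  isIsoinner (A ⊗ B) (fun z => P (fst z) (snd z)) ⊗
  isCocartOnLeft A B P ⊗
  isCartOnRight A B P ⊗
  comparisonsAreIsos A B P.

(** * Two-sided cartesian sections and commas *)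

Definition isTwoSidedSection (A B : dtm) (P : dtm -> dtm -> dtm) (s : dtm) : dtm :=
  (Π u : arrows A, Π b : B,
     isLeftCocartArr A B P b (eapp u) (fun t => app (app s (eapp u t)) b)) ⊗
  (Π a : A, Π v : arrows B,
     isRightCartArr A B P a (eapp v) (fun t => app (app s a) (eapp v t))).

Definition twoSidedSections (A B : dtm) (P : dtm -> dtm -> dtm) : dtm :=
  Σ s : (Π a : A, Π b : B, P a b), isTwoSidedSection A B P s.

Definition coslice (A a : dtm) : dtm := Σ x : A, hom A a x.
Definition slice (B b : dtm) : dtm := Σ y : B, hom B y b.
Definition idPoint (x : dtm) : dtm := ⟪ x, idArr x ⟫.

(* Main.v *)
From Stdlib Require Import List Arith Lia Bool FunctionalExtensionality.
Import ListNotations.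
Require Import Defs.

(** Why the theorem holds.  For [e : P a b] let [sec e] be the section whose value at
    [x : a -> x'] and [y : y' -> b] is [x_! (y^* e)].  At the identities its value is [e].
    Conversely a two-sided section [s] has this form with [e = s id id]: it maps the arrow
    from [y] to [id_b] in the slice to a cartesian lift of [e], so that [s id y = y^* e], and
    it maps the arrow from [id_a] to [x] in the coslice to a cocartesian lift of that element.
    Being a two-sided section is a proposition, so evaluation and [sec] are inverse to each
    other ([evEquiv_entry]).  What needs proof is that [sec e] is a two-sided section.

    - In the direction of [x] ([secLeft_entry]): along an arrow [α] of the coslice the lifts
      over [x] form a triangle, with edges from the fixed source to the targets of the lifts.
      Two of its edges are cocartesian, hence so is the third, which is the arrow of targets
      ([liftsFill_entry], by the cancellation law [fillsCancel_entry]).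
    - In the direction of [y] ([secRight_entry]): the arrow of the elements [y^* e] is
      cartesian by the mirror image of the same argument, and [x_!] preserves this because
      the comparison arrows are isomorphisms ([baseChange_entry]).

    Cocartesian arrows of the total types [Σ b, P a b] are hard to compose, since equations
    in them hold up to paths.  They are replaced by arrows that fill horns strictly
    ([fillsHorns]), over triangles of the base that are given in advance; the two notions
    agree by [cocartToFills_entry] and [fillsToCocart_entry].  Three-dimensional fillings are
    families of triangles over an interval with prescribed ends, which exist uniquely by
    relative function extensionality.  Equality of lifts is obtained from
    [uniqueTarget_entry], which turns a pair of mutually inverse arrows into a path by unique
    lifting against the free isomorphism.

    Why this is a proof.  The theorem asserts that a type of the object theory has an element
    in the empty context.  The elements for all lemmas above are written as raw terms, in
    [library]; their derivations are far too large to be written, so a type checker for the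
    object theory is defined and proved sound.  Its functions only have to be sound, but
    soundness of conversion meets an obstacle: injectivity of the type formers is not
    available for derivations.  The checker therefore works on annotated terms ([syn], [chk],
    [wf]), which record the types of introduction forms in redexes and can be inverted; an
    annotation is itself a raw term that computes to the term annotated ([Ann]).  Annotated
    terms are derivable ([annotated_sound]), reduction and conversion yield derivable
    equalities ([check_with_sound]), elaboration turns raw terms into annotated ones
    ([elab_sound]), and the lemmas of a checked sequence can be substituted into each other
    ([checked_sound]).  All of this is done for the lowest universe and then moved to the
    universe of level [i] by shifting levels in derivations ([typing_raise]). *)

(** * Substitution calculus *)

Lemma psubst_comp r2 r1 s : psubst r2 (psubst r1 s) = psubst (fun n => psubst r2 (r1 n)) s.
Proof. induction s; cbn; congruence. Qed.

Lemma psubst_id s : psubst PVar s = s.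
Proof. induction s; cbn; congruence. Qed.

Lemma tsubst_comp r2 r1 p : tsubst r2 (tsubst r1 p) = tsubst (fun n => psubst r2 (r1 n)) p.
Proof. induction p; cbn; rewrite ?psubst_comp; congruence. Qed.

Lemma tsubst_id p : tsubst PVar p = p.
Proof. induction p; cbn; rewrite ?psubst_id; congruence. Qed.

Lemma up_var q : up (fun n => Var (q n)) = fun n => Var (upren q n).
Proof. extensionality n; destruct n; reflexivity. Qed.

Lemma pup_var r : pup (fun n => PVar (r n)) = fun n => PVar (upren r n).
Proof. extensionality n; destruct n; reflexivity. Qed.

(** Renamings are special substitutions.  The composition laws are proved for renamings
    first because [up] and [pup] contain renamings. *)
Lemma ren_as_subst t : forall r q,
  ren r q t = subst (fun n => PVar (r n)) (fun n => Var (q n)) t.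
Proof.
  induction t; intros rr qq; cbn [ren subst];
    rewrite ?up_var, ?up_var, ?pup_var, ?IHt, ?IHt1, ?IHt2, ?IHt3; reflexivity.
Qed.

Lemma up_upren q2 q1 : (fun n => up q2 (upren q1 n)) = up (fun n => q2 (q1 n)).
Proof. extensionality n; destruct n; reflexivity. Qed.

Lemma pup_upren r2 r1 : (fun n => pup r2 (upren r1 n)) = pup (fun n => r2 (r1 n)).
Proof. extensionality n; destruct n; reflexivity. Qed.

Lemma subst_ren t : forall r2 q2 r1 q1,
  subst r2 q2 (ren r1 q1 t) = subst (fun n => r2 (r1 n)) (fun n => q2 (q1 n)) t.
Proof.
  induction t; intros rr2 qq2 rr1 qq1; cbn [subst ren];
    rewrite ?psubst_comp, ?tsubst_comp; try reflexivity;
    rewrite ?IHt, ?IHt1, ?IHt2, ?IHt3, ?up_upren, ?up_upren, ?pup_upren; reflexivity.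
Qed.

Lemma ren_ren t r2 q2 r1 q1 :
  ren r2 q2 (ren r1 q1 t) = ren (fun n => r2 (r1 n)) (fun n => q2 (q1 n)) t.
Proof. rewrite (ren_as_subst (ren r1 q1 t)), subst_ren, ren_as_subst; reflexivity. Qed.

Lemma up_ren r2 q2 q1 :
  (fun n => ren r2 (upren q2) (up q1 n)) = up (fun n => ren r2 q2 (q1 n)).
Proof.
  extensionality n; destruct n; [reflexivity|]; cbn; unfold wk.
  rewrite !ren_ren; reflexivity.
Qed.

Lemma pup_ren r2 r1 :
  (fun n => psubst (fun k => PVar (upren r2 k)) (pup r1 n))
  = pup (fun n => psubst (fun k => PVar (r2 k)) (r1 n)).
Proof.
  extensionality n; destruct n; [reflexivity|]; cbn; unfold pshift.
  rewrite !psubst_comp; reflexivity.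
Qed.

Lemma cwk_ren r2 q2 (q1 : nat -> tm) :
  (fun n => ren (upren r2) q2 (cwk (q1 n))) = fun n => cwk (ren r2 q2 (q1 n)).
Proof. extensionality n; unfold cwk; rewrite !ren_ren; reflexivity. Qed.

Lemma ren_subst t : forall r2 q2 r1 q1,
  ren r2 q2 (subst r1 q1 t)
  = subst (fun n => psubst (fun k => PVar (r2 k)) (r1 n)) (fun n => ren r2 q2 (q1 n)) t.
Proof.
  induction t; intros rr2 qq2 rr1 qq1; cbn [subst ren];
    rewrite ?psubst_comp, ?tsubst_comp; try reflexivity;
    rewrite ?IHt, ?IHt1, ?IHt2, ?IHt3, ?up_ren, ?up_ren, ?pup_ren, ?cwk_ren; reflexivity.
Qed.

Lemma up_subst r2 q2 q1 :
  (fun n => subst r2 (up q2) (up q1 n)) = up (fun n => subst r2 q2 (q1 n)).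
Proof.
  extensionality n; destruct n; [reflexivity|]; cbn; unfold wk.
  rewrite subst_ren, ren_subst; cbn. f_equal.
  extensionality k. induction (r2 k); cbn; congruence.
Qed.

Lemma pup_subst r2 r1 :
  (fun n => psubst (pup r2) (pup r1 n)) = pup (fun n => psubst r2 (r1 n)).
Proof.
  extensionality n; destruct n; [reflexivity|]; cbn; unfold pshift.
  rewrite !psubst_comp; reflexivity.
Qed.

Lemma cwk_subst r2 q2 (q1 : nat -> tm) :
  (fun n => subst (pup r2) (fun k => cwk (q2 k)) (cwk (q1 n)))
  = fun n => cwk (subst r2 q2 (q1 n)).
Proof. extensionality n; unfold cwk; rewrite subst_ren, ren_subst; reflexivity. Qed.

Lemma subst_subst t : forall r2 q2 r1 q1,
  subst r2 q2 (subst r1 q1 t)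
  = subst (fun n => psubst r2 (r1 n)) (fun n => subst r2 q2 (q1 n)) t.
Proof.
  induction t; intros rr2 qq2 rr1 qq1; cbn [subst];
    rewrite ?psubst_comp, ?tsubst_comp; try reflexivity;
    rewrite ?IHt, ?IHt1, ?IHt2, ?IHt3, ?up_subst, ?up_subst, ?pup_subst, ?cwk_subst;
    reflexivity.
Qed.

Lemma up_id : up Var = Var.
Proof. extensionality n; destruct n; reflexivity. Qed.

Lemma pup_id : pup PVar = PVar.
Proof. extensionality n; destruct n; reflexivity. Qed.

Lemma subst_id t : subst PVar Var t = t.
Proof.
  induction t; cbn; rewrite ?up_id, ?up_id, ?pup_id, ?psubst_id, ?tsubst_id; cbn;
    try reflexivity; f_equal; assumption.
Qed.

Lemma subst_ext r r' q q' t :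
  (forall n, r n = r' n) -> (forall n, q n = q' n) -> subst r q t = subst r' q' t.
Proof.
  intros H H'; replace r' with r by (extensionality n; apply H).
  replace q' with q by (extensionality n; apply H'); reflexivity.
Qed.

Lemma psubst_inst s x : psubst (scons x PVar) (pshift s) = s.
Proof. unfold pshift; rewrite psubst_comp; apply psubst_id. Qed.

Lemma tsubst_inst p x : tinst (tshift p) x = p.
Proof. unfold tshift, tinst; rewrite tsubst_comp; apply tsubst_id. Qed.

Lemma tsubst_tinst r p s : tsubst r (tinst p s) = tinst (tsubst (pup r) p) (psubst r s).
Proof.
  unfold tinst; rewrite !tsubst_comp; f_equal; extensionality n; destruct n; [reflexivity|].
  cbn; rewrite psubst_inst; reflexivity.
Qed.

Lemma subst_wk r q a t : subst r (scons a q) (wk t) = subst r q t.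
Proof. unfold wk; rewrite subst_ren; reflexivity. Qed.

Lemma subst_cwk r q s t : subst (scons s r) q (cwk t) = subst r q t.
Proof. unfold cwk; rewrite subst_ren; reflexivity. Qed.

Lemma inst1_wk t a : inst1 (wk t) a = t.
Proof. unfold inst1; rewrite subst_wk; apply subst_id. Qed.

Lemma subst_inst1 r q b a : subst r q (inst1 b a) = inst1 (subst r (up q) b) (subst r q a).
Proof.
  unfold inst1; rewrite !subst_subst; apply subst_ext; intro n; cbn.
  - symmetry; apply psubst_id.
  - destruct n; [reflexivity|]; cbn; rewrite subst_wk; symmetry; apply subst_id.
Qed.

Lemma subst_pinst r q b s :
  subst r q (pinst b s) = pinst (subst (pup r) (fun n => cwk (q n)) b) (psubst r s).
Proof.
  unfold pinst; rewrite !subst_subst; apply subst_ext; intro n; cbn.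
  - destruct n; [reflexivity|]; cbn; rewrite psubst_inst; reflexivity.
  - rewrite subst_cwk; symmetry; apply subst_id.
Qed.

Lemma subst_inst2 r q c b p :
  subst r q (inst2 c b p) = inst2 (subst r (up (up q)) c) (subst r q b) (subst r q p).
Proof.
  unfold inst2; rewrite !subst_subst; apply subst_ext; intro n; cbn.
  - symmetry; apply psubst_id.
  - destruct n as [|[|n]]; try reflexivity; cbn; rewrite !subst_wk; symmetry; apply subst_id.
Qed.

Lemma subst_up_wk r q t : subst r (up q) (wk t) = wk (subst r q t).
Proof.
  unfold wk; rewrite subst_ren, ren_subst; apply subst_ext; intro n; [|reflexivity].
  symmetry; apply (psubst_id (r n)).
Qed.

Lemma subst_pup_cwk r q t :
  subst (pup r) (fun n => cwk (q n)) (cwk t) = cwk (subst r q t).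
Proof. unfold cwk; rewrite subst_ren, ren_subst; reflexivity. Qed.

Lemma tsubst_pup_shift r p : tsubst (pup r) (tshift p) = tshift (tsubst r p).
Proof. unfold tshift; rewrite !tsubst_comp; reflexivity. Qed.

(** The type of variable [n] whose context entry is [A], as in the rule [t_var]. *)
Definition shiftn (n : nat) (A : tm) : tm := ren (fun k => k) (fun k => S n + k) A.

Lemma shiftn_0 A : shiftn 0 A = wk A.
Proof. reflexivity. Qed.

Lemma shiftn_S n A : shiftn (S n) A = wk (shiftn n A).
Proof. unfold shiftn, wk; rewrite ren_ren; reflexivity. Qed.

Lemma shiftn_cwk n A : shiftn n (cwk A) = cwk (shiftn n A).
Proof. unfold shiftn, cwk; rewrite !ren_ren; reflexivity. Qed.

(** * Closure of cubes and topes under substitution *)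

Lemma has_cube_subst X X' r s K :
  (forall n L, nth_error X n = Some L -> has_cube X' (r n) L) ->
  has_cube X s K -> has_cube X' (psubst r s) K.
Proof. intros H; induction 1; cbn; eauto using has_cube. Qed.

Lemma has_cube_pup X X' r K :
  (forall n L, nth_error X n = Some L -> has_cube X' (r n) L) ->
  forall n L, nth_error (K :: X) n = Some L -> has_cube (K :: X') (pup r n) L.
Proof.
  intros H [|n] L E; cbn in *.
  - injection E as <-; constructor; reflexivity.
  - unfold pshift; eapply has_cube_subst; [|eauto]; intros; constructor; assumption.
Qed.

Lemma is_tope_subst X X' r p :
  (forall n L, nth_error X n = Some L -> has_cube X' (r n) L) ->
  is_tope X p -> is_tope X' (tsubst r p).
Proof. intros H; induction 1; cbn; econstructor; eauto using has_cube_subst. Qed.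

Lemma entails_incl X F p : entails X F p -> forall F', incl F F' -> entails X F' p.
Proof.
  unfold incl; induction 1; intros F' I; try solve [econstructor; eauto].
  - eapply e_case; eauto; [apply IHentails2|apply IHentails3];
      intros x [<-|Hx]; cbn; auto.
  - eapply e_subst with (s := s); eauto.
Qed.

(** The rule [e_subst] lets a tope under a binder be instantiated, hence the detour through
    [pup] in its case. *)
Lemma entails_subst X F p : entails X F p -> forall X' F' r,
  (forall n L, nth_error X n = Some L -> has_cube X' (r n) L) ->
  (forall g, In g F -> entails X' F' (tsubst r g)) ->
  entails X' F' (tsubst r p).
Proof.
  induction 1; intros X' F' rr HX HF; cbn in *;
    try solve [econstructor; eauto using has_cube_subst, is_tope_subst]; auto.
  - eapply e_case; [eauto|apply IHentails2; auto|apply IHentails3; auto];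
      (intros g [<-|Hg]; [apply e_hyp; left; reflexivity|]);
      eapply entails_incl; eauto; intros x Hx; right; exact Hx.
  - rewrite tsubst_tinst; eapply e_subst with (s := psubst rr s);
      [eapply has_cube_subst; eassumption|eapply has_cube_subst; eassumption| |eauto|].
    + eapply is_tope_subst; [|eassumption]; apply has_cube_pup; assumption.
    + rewrite <- tsubst_tinst; eauto.
Qed.

Lemma psubst_closed K s L r : has_cube [K] s L -> r 0 = PVar 0 -> psubst r s = s.
Proof.
  intros H E; remember [K] as X; induction H; subst; cbn;
    rewrite ?IHhas_cube, ?IHhas_cube1, ?IHhas_cube2; auto.
  destruct n as [|[|]]; cbn in *; congruence.
Qed.

(** A closed shape depends on its own variable only. *)
Lemma tsubst_closed K p r : is_tope [K] p -> r 0 = PVar 0 -> tsubst r p = p.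
Proof.
  intros H E; remember [K] as X; induction H; subst; cbn;
    rewrite ?IHis_tope1, ?IHis_tope2; auto.
  all: erewrite !psubst_closed; eauto.
Qed.

Lemma tinst_closed K p r s : is_tope [K] p -> tsubst r (tinst p s) = tinst p (psubst r s).
Proof.
  intro H; rewrite tsubst_tinst; erewrite (tsubst_closed K p (pup r)); eauto.
Qed.

(** * Closure of derivations under substitution *)

(** Substitution leaves the shapes of extension types alone, so it commutes with
    instantiation only because the shapes in derivable judgments are closed. *)
Fixpoint closed_shapes (t : tm) : Prop :=
  match t with
  | Var _ | Univ _ | RecBot | FunExt _ | RelFunExt _ _ _ _ | Univalence _ => True
  | Pi A B | Sig A B => closed_shapes A /\ closed_shapes B
  | App a b | Pair a b => closed_shapes a /\ closed_shapes b
  | Lam b | Fst b | Snd b | Refl b | ELam b | EApp b _ => closed_shapes b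
  | Id A a b => closed_shapes A /\ closed_shapes a /\ closed_shapes b
  | J C d p => closed_shapes C /\ closed_shapes d /\ closed_shapes p
  | Ext K psi A phi a =>
      is_tope [K] psi /\ is_tope [K] phi /\ closed_shapes A /\ closed_shapes a
  | RecOr _ _ a b => closed_shapes a /\ closed_shapes b
  end.

Lemma closed_shapes_subst t : forall r q, (forall n, closed_shapes (q n)) ->
  closed_shapes t -> closed_shapes (subst r q t).
Proof.
  assert (R : forall t r q, closed_shapes t -> closed_shapes (ren r q t)).
  { clear; induction t; intros rr qq H; cbn in *; intuition. }
  assert (U : forall q, (forall n, closed_shapes (q n)) -> forall n, closed_shapes (up q n)).
  { intros q H [|n]; cbn; [exact I|apply R, H]. }
  induction t; intros rr qq Hq H; cbn in *; unfold cwk; intuition.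
Qed.

Lemma closed_shapes_ren t r q : closed_shapes t -> closed_shapes (ren r q t).
Proof. rewrite ren_as_subst; apply closed_shapes_subst; intro; exact I. Qed.

Lemma closed_shapes_inst1 b a : closed_shapes b -> closed_shapes a -> closed_shapes (inst1 b a).
Proof.
  intros; apply closed_shapes_subst; auto; intros [|n]; cbn; auto.
Qed.

Lemma closed_shapes_inst2 c b a : closed_shapes c -> closed_shapes b -> closed_shapes a ->
  closed_shapes (inst2 c b a).
Proof. intros; apply closed_shapes_subst; auto; intros [|[|n]]; cbn; auto. Qed.

Lemma closed_shapes_pinst b s : closed_shapes b -> closed_shapes (pinst b s).
Proof. intros; apply closed_shapes_subst; auto; intros; exact I. Qed.

Lemma closed_shapes_map_cwk G : Forall closed_shapes G -> Forall closed_shapes (map cwk G).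
Proof. induction 1; constructor; auto; apply closed_shapes_ren; assumption. Qed.

Scheme has_type_mind := Minimality for has_type Sort Prop
with has_eq_mind := Minimality for has_eq Sort Prop.
Combined Scheme typing_ind from has_type_mind, has_eq_mind.

#[local] Hint Resolve closed_shapes_inst1 closed_shapes_inst2 closed_shapes_pinst
  closed_shapes_ren closed_shapes_map_cwk : shapes.

(** Nothing but closed shapes can enter a derivation, by the premises of the rules for
    extension types. *)
Lemma derivable_closed_shapes :
  (forall X F G a A, X ∥ F ∥ G ⊢ a ∈ A -> Forall closed_shapes G ->
    closed_shapes a /\ closed_shapes A) /\
  (forall X F G a b A, X ∥ F ∥ G ⊢ a ≡ b ∈ A -> Forall closed_shapes G ->
    closed_shapes a /\ closed_shapes b /\ closed_shapes A).
Proof.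
  apply typing_ind; intros;
    try (assert (Forall closed_shapes (map cwk G)) by auto with shapes);
    repeat match goal with
    | H : ?P -> _, H' : ?P |- _ => specialize (H H')
    | H : _ /\ _ |- _ => destruct H; cbn [closed_shapes] in *
    | H : Forall closed_shapes (?A :: ?G) -> _, HA : closed_shapes ?A |- _ =>
        specialize (H ltac:(auto))
    | H : Forall closed_shapes (_ :: _ :: ?G) -> _, HA : closed_shapes ?A, Ha : closed_shapes ?a |- _ =>
        specialize (H ltac:(repeat constructor; cbn; unfold wk; auto with shapes))
    end; cbn [closed_shapes]; repeat split; unfold wk, cwk; cbn; auto with shapes;
    try (repeat split; auto with shapes; fail).
  all: try apply w_bot.
  match goal with E : nth_error ?G ?n = Some ?A |- _ =>
    change (closed_shapes (shiftn n A)); apply closed_shapes_ren;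
    rewrite Forall_forall in *; eauto using nth_error_In end.
Qed.
Section Closure.
(** [good] is instantiated twice.  For substitutions, the condition of going under a binder
    is weakening, which is the instance for renamings. *)
Variable good : list cube -> list tope -> list tm -> list cube -> list tope -> list tm ->
  (nat -> pt) -> (nat -> tm) -> Prop.
Hypothesis good_cube : forall X F G X' F' G' r q, good X F G X' F' G' r q ->
  forall n K, nth_error X n = Some K -> has_cube X' (r n) K.
Hypothesis good_tope : forall X F G X' F' G' r q, good X F G X' F' G' r q ->
  forall p, In p F -> entails X' F' (tsubst r p).
Hypothesis good_var : forall X F G X' F' G' r q, good X F G X' F' G' r q ->
  forall n A, nth_error G n = Some A -> has_type X' F' G' (q n) (subst r q (shiftn n A)).
Hypothesis good_up : forall X F G X' F' G' r q A, closed_shapes A -> good X F G X' F' G' r q ->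
  good X F (A :: G) X' F' (subst r q A :: G') r (up q).
Hypothesis good_pup : forall X F G X' F' G' r q K p, good X F G X' F' G' r q ->
  good (K :: X) (p :: map tshift F) (map cwk G)
       (K :: X') (tsubst (pup r) p :: map tshift F') (map cwk G')
       (pup r) (fun n => cwk (q n)).
Hypothesis good_hyp : forall X F G X' F' G' r q p, good X F G X' F' G' r q ->
  good X (p :: F) G X' (tsubst r p :: F') G' r q.

Lemma good_entails X F G X' F' G' r q p :
  good X F G X' F' G' r q -> entails X F p -> entails X' F' (tsubst r p).
Proof. intros; eapply entails_subst; eauto. Qed.

Lemma good_has_cube X F G X' F' G' r q s K :
  good X F G X' F' G' r q -> has_cube X s K -> has_cube X' (psubst r s) K.
Proof. intros; eapply has_cube_subst; eauto. Qed.

Lemma good_is_tope X F G X' F' G' r q p :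
  good X F G X' F' G' r q -> is_tope X p -> is_tope X' (tsubst r p).
Proof. intros; eapply is_tope_subst; eauto. Qed.

Lemma good_closed_pup X F G X' F' G' r q K p : is_tope [K] p ->
  good X F G X' F' G' r q ->
  good (K :: X) (p :: map tshift F) (map cwk G)
       (K :: X') (p :: map tshift F') (map cwk G') (pup r) (fun n => cwk (q n)).
Proof.
  intros H g. pose proof (good_pup _ _ _ _ _ _ _ _ K p g) as h.
  erewrite (tsubst_closed K p (pup r)) in h; eauto.
Qed.

Lemma good_motive X F G X' F' G' r q A a :
  closed_shapes A -> closed_shapes a -> good X F G X' F' G' r q ->
  good X F (Id (wk A) (wk a) (Var 0) :: A :: G) X' F'
       (Id (wk (subst r q A)) (wk (subst r q a)) (Var 0) :: subst r q A :: G')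
       r (up (up q)).
Proof.
  intros cA ca g.
  assert (c : closed_shapes (Id (wk A) (wk a) (Var 0)))
    by (cbn; unfold wk; auto with shapes).
  pose proof (good_up _ _ _ _ _ _ _ _ _ c (good_up _ _ _ _ _ _ _ _ A cA g)) as h.
  cbn in h; rewrite !subst_up_wk in h; exact h.
Qed.

Lemma good_tinst X F G X' F' G' r q K p s : is_tope [K] p ->
  good X F G X' F' G' r q -> entails X F (tinst p s) -> entails X' F' (tinst p (psubst r s)).
Proof.
  intros H g E; erewrite <- tinst_closed by eassumption; eapply good_entails; eauto.
Qed.

Ltac under_motive :=
  match goal with IH : forall X' F' G' r q, good _ _ (Id _ _ _ :: _) _ _ _ _ _ -> _ |- _ =>
    eapply IH; eapply good_motive; [| |eassumption]; assumption end.

Ltac good_ctx := first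
  [ eassumption
  | eapply good_up; [assumption|eassumption]
  | eapply good_closed_pup; [assumption|eassumption]
  | eapply good_hyp; eassumption
  | eapply good_motive; [assumption|assumption|eassumption] ].

Ltac good_premise := first
  [ eassumption
  | match goal with
    | |- entails _ _ _ => eapply good_entails; eassumption
    | |- has_cube _ _ _ => eapply good_has_cube; eassumption
    | |- is_tope _ _ => eapply good_is_tope; eassumption
    end
  | match goal with
    | IH : forall X' F' G' r q, good _ _ _ _ _ _ _ _ -> _ |- _ => solve [eapply IH; good_ctx]
    end ].

(* Marks the derivations whose shapes have been examined, so that the search ends. *)
Inductive seen (P : Prop) : Prop := Seen.

Ltac shape_facts :=
  try match goal with H : Forall closed_shapes ?G |- _ =>
    assert (Forall closed_shapes (map cwk G)) by auto with shapes end;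
  repeat match goal with
  | H : has_type ?X ?F ?G ?a ?A, HG : Forall closed_shapes ?G |- _ =>
      lazymatch goal with
      | _ : seen (has_type X F G a A) |- _ => fail
      | _ => assert (seen (has_type X F G a A)) by constructor;
             destruct (proj1 derivable_closed_shapes _ _ _ _ _ H HG)
      end
  | H : has_eq ?X ?F ?G ?a ?b ?A, HG : Forall closed_shapes ?G |- _ =>
      lazymatch goal with
      | _ : seen (has_eq X F G a b A) |- _ => fail
      | _ => assert (seen (has_eq X F G a b A)) by constructor;
             destruct (proj2 derivable_closed_shapes _ _ _ _ _ _ H HG) as (? & ? & ?)
      end
  | H : has_type ?X ?F (?A :: ?G) _ _, HG : Forall closed_shapes ?G, HA : closed_shapes ?A |- _ =>
      lazymatch goal with
      | _ : Forall closed_shapes (A :: G) |- _ => fail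
      | _ => assert (Forall closed_shapes (A :: G)) by auto
      end
  | H : has_eq ?X ?F (?A :: ?G) _ _ _, HG : Forall closed_shapes ?G, HA : closed_shapes ?A |- _ =>
      lazymatch goal with
      | _ : Forall closed_shapes (A :: G) |- _ => fail
      | _ => assert (Forall closed_shapes (A :: G)) by auto
      end
  end; cbn [closed_shapes] in *;
  repeat match goal with H : _ /\ _ |- _ => destruct H end.

Lemma ctx_motive A a G : closed_shapes A -> closed_shapes a -> Forall closed_shapes G ->
  Forall closed_shapes (Id (wk A) (wk a) (Var 0) :: A :: G).
Proof. intros; repeat constructor; cbn; unfold wk; auto with shapes. Qed.

Lemma closure :
  (forall X F G a A, X ∥ F ∥ G ⊢ a ∈ A -> Forall closed_shapes G ->
    forall X' F' G' r q, good X F G X' F' G' r q ->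
    X' ∥ F' ∥ G' ⊢ subst r q a ∈ subst r q A) /\
  (forall X F G a b A, X ∥ F ∥ G ⊢ a ≡ b ∈ A -> Forall closed_shapes G ->
    forall X' F' G' r q, good X F G X' F' G' r q ->
    X' ∥ F' ∥ G' ⊢ subst r q a ≡ subst r q b ∈ subst r q A).
Proof.
  apply typing_ind; intros; cbn [subst] in *.
  all: try (match goal with
    | HA : has_type ?X ?F ?G ?A (Univ _), Ha : has_type ?X ?F ?G ?a ?A,
      HC : context [Id (wk ?A) (wk ?a) (Var 0) :: ?A :: ?G], HG : Forall closed_shapes ?G |- _ =>
      assert (Forall closed_shapes (Id (wk A) (wk a) (Var 0) :: A :: G))
        by (apply ctx_motive; auto;
            first [apply (proj1 derivable_closed_shapes _ _ _ _ _ HA HG)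
                  |apply (proj1 derivable_closed_shapes _ _ _ _ _ Ha HG)])
    end).
  all: shape_facts.
  all: repeat match goal with H : Forall _ _ -> _ , H' : Forall _ _ |- _ => specialize (H H') end.
  all: rewrite ?subst_inst1, ?subst_inst2, ?subst_pinst in *; cbn [subst] in *.
  all: try solve [econstructor; good_premise].
  - eapply good_var; eassumption.
  - eapply t_pair; eauto; rewrite <- subst_inst1; eauto.
  - eapply t_J; [| |under_motive| |]; eauto.
    change (Refl (subst r q a)) with (subst r q (Refl a)); rewrite <- subst_inst2; eauto.
  - eapply t_eapp; eauto using good_has_cube, good_tinst.
  - eapply t_recbot; [change TBot with (tsubst r TBot); eapply good_entails; eauto|eauto].
  - eapply t_recor; eauto using good_is_tope.
    + change (TOr (tsubst r p) (tsubst r q)) with (tsubst r (TOr p q)).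
      eapply good_entails; eauto.
    + match goal with IH : forall X' F' G' r q, good _ (TAnd _ _ :: _) _ _ _ _ _ _ -> _ |- _ =>
        eapply IH end.
      apply (good_hyp _ _ _ _ _ _ _ _ (TAnd p q)); assumption.
  - rewrite subst_up_wk; apply q_pi_eta; eauto.
  - eapply q_pair; eauto; rewrite <- subst_inst1; eauto.
  - eapply q_fst_beta; eauto; rewrite <- subst_inst1; eauto.
  - eapply q_snd_beta; eauto; rewrite <- subst_inst1; eauto.
  - eapply q_J; [| |under_motive| |]; eauto.
    change (Refl (subst r q a)) with (subst r q (Refl a)); rewrite <- subst_inst2; eauto.
  - eapply q_J_beta; [| |under_motive|]; eauto.
    change (Refl (subst r q a)) with (subst r q (Refl a)); rewrite <- subst_inst2; eauto.
  - eapply q_eapp; eauto using good_has_cube, good_tinst.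
    change (TEq (psubst r s) (psubst r s')) with (tsubst r (TEq s s')); eapply good_entails; eauto.
  - eapply q_ext_boundary; eauto using good_has_cube, good_tinst.
  - eapply q_ext_beta; eauto using good_has_cube, good_tinst, good_closed_pup.
  - rewrite subst_pup_cwk; cbn; apply q_ext_eta; eauto.
  - apply (q_case X' F' G' (tsubst r p) (tsubst r q)); eauto.
    change (TOr (tsubst r p) (tsubst r q)) with (tsubst r (TOr p q)); eapply good_entails; eauto.
  - eapply q_bot; [change TBot with (tsubst r TBot); eapply good_entails; eauto|eauto|eauto].
Qed.
End Closure.

(** ** Renamings *)

Definition cubes_good (X X' : list cube) (r : nat -> pt) : Prop :=
  forall n K, nth_error X n = Some K -> has_cube X' (r n) K.
Definition topes_good (F : list tope) X' (F' : list tope) (r : nat -> pt) : Prop :=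
  forall p, In p F -> entails X' F' (tsubst r p).

Lemma entails_tshift X F p K g : entails X F g ->
  entails (K :: X) (p :: map tshift F) (tshift g).
Proof.
  intro H; unfold tshift; eapply entails_subst; [exact H| |].
  - intros; constructor; assumption.
  - intros q Hq; apply e_hyp; right. apply (in_map tshift _ _ Hq).
Qed.

Lemma topes_good_pup F X' F' r K p : topes_good F X' F' r ->
  topes_good (p :: map tshift F) (K :: X') (tsubst (pup r) p :: map tshift F') (pup r).
Proof.
  intros H g [<-|Hg]; [apply e_hyp; left; reflexivity|].
  apply in_map_iff in Hg; destruct Hg as (h & <- & Hh).
  rewrite tsubst_pup_shift; apply entails_tshift; auto.
Qed.

Lemma topes_good_hyp F X' F' r p : topes_good F X' F' r ->
  topes_good (p :: F) X' (tsubst r p :: F') r.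
Proof.
  intros H g [<-|Hg]; [apply e_hyp; left; reflexivity|].
  eapply entails_incl; [apply H, Hg|]; intros x Hx; right; exact Hx.
Qed.

Definition renaming (X : list cube) F G X' F' (G' : list tm) (r : nat -> pt) (q : nat -> tm) : Prop :=
  cubes_good X X' r /\ topes_good F X' F' r /\
  exists v, (forall n, q n = Var (v n)) /\
    forall n A, nth_error G n = Some A -> exists A', nth_error G' (v n) = Some A' /\
      shiftn (v n) A' = subst r q (shiftn n A).

Lemma renaming_up X F G X' F' G' r q A :
  renaming X F G X' F' G' r q -> renaming X F (A :: G) X' F' (subst r q A :: G') r (up q).
Proof.
  intros (H1 & H2 & v & H3 & H4); split; [exact H1|]; split; [exact H2|].
  exists (upren v); split.
  - intros [|n]; [reflexivity|]; cbn; rewrite H3; reflexivity.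
  - intros [|n] B E; cbn in E.
    + injection E as <-; exists (subst r q A); split; [reflexivity|].
      cbn [upren scons]; rewrite !shiftn_0, subst_up_wk; reflexivity.
    + destruct (H4 n B E) as (A' & E' & H'); exists A'; split; [exact E'|].
      cbn [upren scons]; rewrite !shiftn_S, subst_up_wk, H'; reflexivity.
Qed.

Lemma renaming_pup X F G X' F' G' r q K p : renaming X F G X' F' G' r q ->
  renaming (K :: X) (p :: map tshift F) (map cwk G)
    (K :: X') (tsubst (pup r) p :: map tshift F') (map cwk G') (pup r) (fun n => cwk (q n)).
Proof.
  intros (H1 & H2 & v & H3 & H4); split; [intros n L E; eapply has_cube_pup; [exact H1|exact E]|].
  split; [apply topes_good_pup; exact H2|].
  exists v; split; [intro n; rewrite H3; reflexivity|].
  intros n A E; rewrite nth_error_map in E; destruct (nth_error G n) as [A0|] eqn:E0;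
    [|discriminate]; injection E as <-.
  destruct (H4 n A0 E0) as (A' & E' & H'); exists (cwk A').
  rewrite nth_error_map, E', !shiftn_cwk, subst_pup_cwk, H'; split; reflexivity.
Qed.

Lemma renaming_hyp X F G X' F' G' r q p : renaming X F G X' F' G' r q ->
  renaming X (p :: F) G X' (tsubst r p :: F') G' r q.
Proof.
  intros (H1 & H2 & H3); split; [exact H1|]; split; [apply topes_good_hyp, H2|exact H3].
Qed.

Lemma typing_renaming :
  (forall X F G a A, X ∥ F ∥ G ⊢ a ∈ A -> Forall closed_shapes G ->
    forall X' F' G' r q, renaming X F G X' F' G' r q ->
    X' ∥ F' ∥ G' ⊢ subst r q a ∈ subst r q A) /\
  (forall X F G a b A, X ∥ F ∥ G ⊢ a ≡ b ∈ A -> Forall closed_shapes G ->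
    forall X' F' G' r q, renaming X F G X' F' G' r q ->
    X' ∥ F' ∥ G' ⊢ subst r q a ≡ subst r q b ∈ subst r q A).
Proof.
  apply closure.
  - intros X F G X' F' G' r q H; apply H.
  - intros X F G X' F' G' r q H; apply H.
  - intros X F G X' F' G' r q (_ & _ & v & H3 & H4) n A E; destruct (H4 n A E) as (A' & E' & <-).
    rewrite H3; apply t_var, E'.
  - intros; apply renaming_up; assumption.
  - intros; apply renaming_pup; assumption.
  - intros; apply renaming_hyp; assumption.
Qed.

Lemma renaming_wk X F G A : renaming X F G X F (A :: G) PVar (fun n => Var (S n)).
Proof.
  split; [intros n K E; constructor; exact E|].
  split; [intros p Hp; rewrite tsubst_id; apply e_hyp, Hp|].
  exists S; split; [reflexivity|]; intros n B E; exists B; split; [exact E|].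
  rewrite shiftn_S; unfold wk; rewrite ren_as_subst; reflexivity.
Qed.

Lemma renaming_cwk X F G K p :
  renaming X F G (K :: X) (p :: map tshift F) (map cwk G) (fun n => PVar (S n)) Var.
Proof.
  split; [intros n L E; constructor; exact E|].
  split; [intros g Hg; apply e_hyp; right; apply (in_map tshift _ _ Hg)|].
  exists (fun n => n); split; [reflexivity|]; intros n B E; exists (cwk B); split.
  - rewrite nth_error_map, E; reflexivity.
  - rewrite shiftn_cwk; unfold cwk; rewrite ren_as_subst; reflexivity.
Qed.

Lemma renaming_topes X F G F' : (forall p, In p F -> entails X F' p) ->
  renaming X F G X F' G PVar Var.
Proof.
  intro H; split; [intros n K E; constructor; exact E|].
  split; [intros p Hp; rewrite tsubst_id; auto|].
  exists (fun n => n); split; [reflexivity|]; intros n B E; exists B.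
  rewrite subst_id; split; [exact E|reflexivity].
Qed.

(** ** Substitutions *)

Definition substitution (X : list cube) F G X' F' (G' : list tm) (r : nat -> pt) (q : nat -> tm) : Prop :=
  cubes_good X X' r /\ topes_good F X' F' r /\
  Forall closed_shapes G' /\ (forall n, closed_shapes (q n)) /\
  forall n A, nth_error G n = Some A -> has_type X' F' G' (q n) (subst r q (shiftn n A)).

Lemma typing_wk X F G a A B : Forall closed_shapes G -> X ∥ F ∥ G ⊢ a ∈ A ->
  X ∥ F ∥ B :: G ⊢ wk a ∈ wk A.
Proof.
  intros c H; unfold wk; rewrite !ren_as_subst.
  eapply (proj1 typing_renaming); eauto using renaming_wk.
Qed.

Lemma typing_cwk X F G a A K p : Forall closed_shapes G -> X ∥ F ∥ G ⊢ a ∈ A ->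
  K :: X ∥ p :: map tshift F ∥ map cwk G ⊢ cwk a ∈ cwk A.
Proof.
  intros c H; unfold cwk at 2 3; rewrite !ren_as_subst.
  eapply (proj1 typing_renaming); eauto using renaming_cwk.
Qed.

Lemma typing_topes X F G a A F' : Forall closed_shapes G ->
  (forall p, In p F -> entails X F' p) -> X ∥ F ∥ G ⊢ a ∈ A -> X ∥ F' ∥ G ⊢ a ∈ A.
Proof.
  intros c h H; rewrite <- (subst_id a), <- (subst_id A).
  eapply (proj1 typing_renaming); eauto using renaming_topes.
Qed.

Lemma equality_wk X F G a b A B : Forall closed_shapes G -> X ∥ F ∥ G ⊢ a ≡ b ∈ A ->
  X ∥ F ∥ B :: G ⊢ wk a ≡ wk b ∈ wk A.
Proof.
  intros c H; unfold wk; rewrite !ren_as_subst.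
  eapply (proj2 typing_renaming); eauto using renaming_wk.
Qed.

Lemma equality_topes X F G a b A F' : Forall closed_shapes G ->
  (forall p, In p F -> entails X F' p) -> X ∥ F ∥ G ⊢ a ≡ b ∈ A -> X ∥ F' ∥ G ⊢ a ≡ b ∈ A.
Proof.
  intros c h H; rewrite <- (subst_id a), <- (subst_id b), <- (subst_id A).
  eapply (proj2 typing_renaming); eauto using renaming_topes.
Qed.

Lemma incl_tail (F : list tope) X p g : In g F -> entails X (p :: F) g.
Proof. intro; apply e_hyp; right; assumption. Qed.

Lemma substitution_up X F G X' F' G' r q A : closed_shapes A ->
  substitution X F G X' F' G' r q ->
  substitution X F (A :: G) X' F' (subst r q A :: G') r (up q).
Proof.
  intros cA (H1 & H2 & H3 & H4 & H5).
  repeat split; auto.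
  - constructor; auto using closed_shapes_subst.
  - intros [|n]; cbn; [exact I|apply closed_shapes_ren; auto].
  - intros [|n] B E; cbn in E.
    + injection E as <-; rewrite shiftn_0, subst_up_wk, <- shiftn_0.
      apply t_var; reflexivity.
    + rewrite shiftn_S, subst_up_wk; apply typing_wk; auto.
Qed.

Lemma substitution_pup X F G X' F' G' r q K p : substitution X F G X' F' G' r q ->
  substitution (K :: X) (p :: map tshift F) (map cwk G)
    (K :: X') (tsubst (pup r) p :: map tshift F') (map cwk G') (pup r) (fun n => cwk (q n)).
Proof.
  intros (H1 & H2 & H3 & H4 & H5).
  split; [intros n L E; eapply has_cube_pup; [exact H1|exact E]|].
  split; [apply topes_good_pup; exact H2|].
  split; [apply closed_shapes_map_cwk; exact H3|].
  split; [intro; apply closed_shapes_ren; auto|].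
  intros n A E; rewrite nth_error_map in E; destruct (nth_error G n) as [A0|] eqn:E0;
    [|discriminate]; injection E as <-.
  rewrite shiftn_cwk, subst_pup_cwk; apply typing_cwk; auto.
Qed.

Lemma substitution_hyp X F G X' F' G' r q p : substitution X F G X' F' G' r q ->
  substitution X (p :: F) G X' (tsubst r p :: F') G' r q.
Proof.
  intros (H1 & H2 & H3 & H4 & H5).
  split; [exact H1|]; split; [apply topes_good_hyp, H2|]; split; [exact H3|].
  split; [exact H4|]; intros n A E; eapply typing_topes; eauto using incl_tail.
Qed.

Lemma typing_substitution :
  (forall X F G a A, X ∥ F ∥ G ⊢ a ∈ A -> Forall closed_shapes G ->
    forall X' F' G' r q, substitution X F G X' F' G' r q ->
    X' ∥ F' ∥ G' ⊢ subst r q a ∈ subst r q A) /\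
  (forall X F G a b A, X ∥ F ∥ G ⊢ a ≡ b ∈ A -> Forall closed_shapes G ->
    forall X' F' G' r q, substitution X F G X' F' G' r q ->
    X' ∥ F' ∥ G' ⊢ subst r q a ≡ subst r q b ∈ subst r q A).
Proof.
  apply closure.
  - intros X F G X' F' G' r q H; apply H.
  - intros X F G X' F' G' r q H; apply H.
  - intros X F G X' F' G' r q H; apply H.
  - intros; apply substitution_up; assumption.
  - intros; apply substitution_pup; assumption.
  - intros; apply substitution_hyp; assumption.
Qed.

(** * Derived rules *)

Lemma cumul_le X F G A i j : i <= j -> X ∥ F ∥ G ⊢ A ∈ Univ i -> X ∥ F ∥ G ⊢ A ∈ Univ j.
Proof. induction 1; auto using t_cumul. Qed.

Lemma cumul_eq_le X F G A B i j :
  i <= j -> X ∥ F ∥ G ⊢ A ≡ B ∈ Univ i -> X ∥ F ∥ G ⊢ A ≡ B ∈ Univ j.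
Proof. induction 1; auto using q_cumul. Qed.

(** Equality of types at an unspecified level: levels of equal types need not agree, by
    cumulativity. *)
Definition tyeq X F G A B : Prop := exists i, X ∥ F ∥ G ⊢ A ≡ B ∈ Univ i.

Lemma tyeq_sym X F G A B : tyeq X F G A B -> tyeq X F G B A.
Proof. intros [i H]; exists i; apply q_sym, H. Qed.

Lemma tyeq_trans X F G A B C : tyeq X F G A B -> tyeq X F G B C -> tyeq X F G A C.
Proof.
  intros [i H] [j K]; exists (max i j).
  eapply q_trans; eapply cumul_eq_le; [|eauto| |eauto]; lia.
Qed.

Lemma tyeq_refl X F G A i : X ∥ F ∥ G ⊢ A ∈ Univ i -> tyeq X F G A A.
Proof. exists i; apply q_refl; assumption. Qed.

Lemma conv_ty X F G a A B : X ∥ F ∥ G ⊢ a ∈ A -> tyeq X F G A B -> X ∥ F ∥ G ⊢ a ∈ B.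
Proof. intros H [i K]; eapply t_conv; eauto. Qed.

Lemma conv_eq X F G a b A B :
  X ∥ F ∥ G ⊢ a ≡ b ∈ A -> tyeq X F G A B -> X ∥ F ∥ G ⊢ a ≡ b ∈ B.
Proof. intros H [i K]; eapply q_conv; eauto. Qed.

(** The instance of [B] at [u] is the value of a function at [u], so the congruence rule for
    application gives its invariance. *)
Lemma inst1_eq X F G A B B' u u' i j :
  X ∥ F ∥ G ⊢ A ∈ Univ i ->
  X ∥ F ∥ A :: G ⊢ B ∈ Univ j -> X ∥ F ∥ A :: G ⊢ B' ∈ Univ j ->
  X ∥ F ∥ A :: G ⊢ B ≡ B' ∈ Univ j ->
  X ∥ F ∥ G ⊢ u ∈ A -> X ∥ F ∥ G ⊢ u' ∈ A -> X ∥ F ∥ G ⊢ u ≡ u' ∈ A ->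
  X ∥ F ∥ G ⊢ inst1 B u ≡ inst1 B' u' ∈ Univ j.
Proof.
  intros HA HB HB' E Hu Hu' Eu.
  pose proof (q_pi_beta _ _ _ _ _ _ _ _ HA HB Hu) as b.
  pose proof (q_pi_beta _ _ _ _ _ _ _ _ HA HB' Hu') as b'.
  pose proof (q_app _ _ _ _ _ _ _ _ _ (q_lam _ _ _ _ _ _ _ _ HA E) Eu) as c.
  cbn in b, b', c. eapply q_trans; [apply q_sym; exact b|].
  eapply q_trans; [exact c|exact b'].
Qed.

Lemma inst1_eq_tm X F G A B b b' u u' i j :
  X ∥ F ∥ G ⊢ A ∈ Univ i -> X ∥ F ∥ A :: G ⊢ B ∈ Univ j ->
  X ∥ F ∥ A :: G ⊢ b ∈ B -> X ∥ F ∥ A :: G ⊢ b' ∈ B -> X ∥ F ∥ A :: G ⊢ b ≡ b' ∈ B ->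
  X ∥ F ∥ G ⊢ u ∈ A -> X ∥ F ∥ G ⊢ u' ∈ A -> X ∥ F ∥ G ⊢ u ≡ u' ∈ A ->
  X ∥ F ∥ G ⊢ inst1 b u ≡ inst1 b' u' ∈ inst1 B u.
Proof.
  intros HA HB Hb Hb' E Hu Hu' Eu.
  pose proof (q_pi_beta _ _ _ _ _ _ _ _ HA Hb Hu) as b1.
  pose proof (q_pi_beta _ _ _ _ _ _ _ _ HA Hb' Hu') as b2.
  pose proof (q_app _ _ _ _ _ _ _ _ _ (q_lam _ _ _ _ _ _ _ _ HA E) Eu) as c.
  eapply q_trans; [apply q_sym; exact b1|].
  eapply q_trans; [exact c|]. eapply q_conv; [exact b2|].
  apply q_sym. eapply inst1_eq; eauto using q_refl.
Qed.

(** A term together with its type.  No annotations exist in the raw syntax, but any pair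
    with first component [t] will do: its first projection equals [t] by computation,
    whichever type [t] is given. *)
Definition Ann (t T : tm) : tm := Fst (Pair t (Refl T)).

Lemma ann_pair X F G t A T i j : Forall closed_shapes G ->
  X ∥ F ∥ G ⊢ t ∈ A -> X ∥ F ∥ G ⊢ A ∈ Univ i -> X ∥ F ∥ G ⊢ T ∈ Univ j ->
  exists k B, X ∥ F ∥ G ⊢ A ∈ Univ k /\ X ∥ F ∥ A :: G ⊢ B ∈ Univ k /\
    X ∥ F ∥ G ⊢ Refl T ∈ inst1 B t.
Proof.
  intros c Ht HA HT; exists (max i (S j)), (wk (Id (Univ j) T T)).
  split; [eapply cumul_le; [|exact HA]; lia|].
  split.
  - eapply cumul_le with (i := S j); [lia|].
    apply (typing_wk _ _ _ _ (Univ (S j))); [exact c|].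
    apply t_id; auto using t_univ.
  - rewrite inst1_wk; apply t_refl, HT.
Qed.

Lemma ann_eq X F G t A T i j : Forall closed_shapes G ->
  X ∥ F ∥ G ⊢ t ∈ A -> X ∥ F ∥ G ⊢ A ∈ Univ i -> X ∥ F ∥ G ⊢ T ∈ Univ j ->
  X ∥ F ∥ G ⊢ Ann t T ≡ t ∈ A.
Proof.
  intros c Ht HA HT; destruct (ann_pair _ _ _ _ _ _ _ _ c Ht HA HT) as (k & B & H1 & H2 & H3).
  eapply q_fst_beta; eauto.
Qed.

Lemma ann_ty X F G t A T i j : Forall closed_shapes G ->
  X ∥ F ∥ G ⊢ t ∈ A -> X ∥ F ∥ G ⊢ A ∈ Univ i -> X ∥ F ∥ G ⊢ T ∈ Univ j ->
  X ∥ F ∥ G ⊢ Ann t T ∈ A.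
Proof.
  intros c Ht HA HT; destruct (ann_pair _ _ _ _ _ _ _ _ c Ht HA HT) as (k & B & H1 & H2 & H3).
  eapply t_fst, t_pair; eauto.
Qed.

(** Eliminations and variables determine their types; the other forms are annotated where
    their type is needed. *)
Definition synth (t : tm) : bool :=
  match t with
  | Var _ | App _ _ | Fst _ | Snd _ | EApp _ _ | J _ _ _ => true
  | _ => false
  end.

Definition ann (t T : tm) : tm := if synth t then t else Ann t T.

(** [p : Id A a b], with the endpoint [b] annotated. *)
Definition ann_path (A a b p : tm) : tm := if synth b then p else Ann p (Id A a (ann b A)).

Definition constant (t : tm) : bool :=
  match t with FunExt _ | RelFunExt _ _ _ _ | Univalence _ => true | _ => false end.

(** * Annotated terms *)

(** [syn e T]: [e] carries enough annotations to determine the type [T] as a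
    syntactic expression.  [chk t T]: [t] is an introduction form for [T], or [e]
    with [syn e T].  [wf A i]: [A] is a type of level [i] built from such terms.
    A change of type happens only at an annotation ([s_cast]).  So these predicates can
    be inverted, which is not possible for derivations of the object theory as long as
    injectivity of its type formers is unknown: there, a redex [App (Lam b) a] does not
    reveal the domain at which [b] is typed. *)
Inductive syn : list cube -> list tope -> list tm -> tm -> tm -> Prop :=
| s_var X F G n A i :
    nth_error G n = Some A -> wf X F G (shiftn n A) i -> syn X F G (Var n) (shiftn n A)
| s_ann X F G t T i :
    synth t = false -> wf X F G T i -> chk X F G t T -> syn X F G (Ann t T) T
| s_cast X F G e S T i :
    syn X F G e S -> wf X F G T i -> tyeq X F G S T -> syn X F G (Ann e T) T
| s_raw X F G c T i :
    constant c = true -> X ∥ F ∥ G ⊢ c ∈ T -> wf X F G T i -> syn X F G (Ann c T) T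
| s_app X F G f u A B i :
    wf X F G A i -> wf X F (A :: G) B i -> syn X F G f (Pi A B) -> chk X F G u A ->
    syn X F G (App f u) (inst1 B (ann u A))
| s_fst X F G p A B i :
    wf X F G A i -> wf X F (A :: G) B i -> syn X F G p (Sig A B) -> syn X F G (Fst p) A
| s_snd X F G p A B i :
    wf X F G A i -> wf X F (A :: G) B i -> syn X F G p (Sig A B) ->
    syn X F G (Snd p) (inst1 B (Fst p))
| s_eapp X F G f s K psi A phi a i :
    is_tope [K] psi -> wf (K :: X) (psi :: map tshift F) (map cwk G) A i ->
    syn X F G f (Ext K psi A phi a) -> has_cube X s K -> entails X F (tinst psi s) ->
    syn X F G (EApp f s) (pinst A s)
| s_J X F G A a b C d p i j :
    wf X F G A i -> chk X F G a A -> chk X F G b A ->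
    wf X F (A :: G) (Id (wk A) (wk a) (Var 0)) i ->
    wf X F (Id (wk A) (wk a) (Var 0) :: A :: G) C j ->
    chk X F G d (inst2 C (ann a A) (Ann (Refl a) (Id A a (ann a A)))) ->
    syn X F G p (Id A a b) ->
    syn X F G (J C d p) (inst2 C (ann b A) (ann_path A a b p))

with chk : list cube -> list tope -> list tm -> tm -> tm -> Prop :=
| c_syn X F G e A : syn X F G e A -> chk X F G e A
| c_ty X F G A i : synth A = false -> wf X F G A i -> chk X F G A (Univ i)
| c_lam X F G A B b i :
    wf X F G A i -> chk X F (A :: G) b B -> chk X F G (Lam b) (Pi A B)
| c_pair X F G A B a b i :
    wf X F G A i -> wf X F (A :: G) B i -> chk X F G a A ->
    chk X F G b (inst1 B (ann a A)) -> chk X F G (Pair a b) (Sig A B)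
| c_refl X F G A a b i :
    wf X F G A i -> chk X F G a A -> chk X F G b A -> X ∥ F ∥ G ⊢ a ≡ b ∈ A ->
    chk X F G (Refl a) (Id A a b)
| c_elam X F G K psi A phi a b i :
    wf X F G (Ext K psi A phi a) i -> is_tope [K] psi -> is_tope [K] phi ->
    chk (K :: X) (psi :: map tshift F) (map cwk G) b A ->
    K :: X ∥ phi :: map tshift F ∥ map cwk G ⊢ b ≡ a ∈ A ->
    chk X F G (ELam b) (Ext K psi A phi a)
| c_recbot X F G A i : wf X F G A i -> entails X F TBot -> chk X F G RecBot A
| c_recor X F G p q a b A i :
    is_tope X p -> is_tope X q -> entails X F (TOr p q) -> wf X F G A i ->
    chk X (p :: F) G a A -> chk X (q :: F) G b A ->
    X ∥ TAnd p q :: F ∥ G ⊢ a ≡ b ∈ A ->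
    chk X F G (RecOr p q a b) A

with wf : list cube -> list tope -> list tm -> tm -> nat -> Prop :=
| wf_ne X F G e i j : syn X F G e (Univ i) -> i <= j -> wf X F G e j
| wf_univ X F G i j : i < j -> wf X F G (Univ i) j
| wf_pi X F G A B i : wf X F G A i -> wf X F (A :: G) B i -> wf X F G (Pi A B) i
| wf_sig X F G A B i : wf X F G A i -> wf X F (A :: G) B i -> wf X F G (Sig A B) i
| wf_id X F G A a b i : wf X F G A i -> chk X F G a A -> chk X F G b A -> wf X F G (Id A a b) i
| wf_ext X F G K psi A phi a i :
    is_tope [K] psi -> is_tope [K] phi -> entails [K] [phi] psi ->
    wf (K :: X) (psi :: map tshift F) (map cwk G) A i ->
    chk (K :: X) (phi :: map tshift F) (map cwk G) a A ->
    wf X F G (Ext K psi A phi a) i.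

Scheme syn_mind := Minimality for syn Sort Prop
with chk_mind := Minimality for chk Sort Prop
with wf_mind := Minimality for wf Sort Prop.
Combined Scheme annotated_ind from syn_mind, chk_mind, wf_mind.

Lemma syn_synth X F G e T : syn X F G e T -> synth e = true.
Proof. destruct 1; reflexivity. Qed.

Lemma inst2_inst1 C b p : inst2 C b p = inst1 (subst PVar (up (scons b Var)) C) p.
Proof.
  unfold inst1, inst2; rewrite subst_subst; apply subst_ext; intro n; [reflexivity|].
  destruct n as [|[|n]]; try reflexivity; cbn; rewrite subst_wk, ?subst_id; reflexivity.
Qed.

Lemma subst_scons_id X F G A a : Forall closed_shapes G -> closed_shapes a ->
  X ∥ F ∥ G ⊢ a ∈ A -> substitution X F (A :: G) X F G PVar (scons a Var).
Proof.
  intros c ca Ha; split; [intros n K E; constructor; exact E|].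
  split; [intros p Hp; rewrite tsubst_id; apply e_hyp, Hp|].
  split; [exact c|]. split; [intros [|n]; cbn; auto|].
  intros [|n] B E; cbn in E.
  - injection E as <-; rewrite shiftn_0, subst_wk, subst_id; exact Ha.
  - rewrite shiftn_S, subst_wk, subst_id; apply t_var, E.
Qed.

Lemma inst2_eq X F G A a C C' b b' p p' i j :
  Forall closed_shapes G ->
  X ∥ F ∥ G ⊢ A ∈ Univ i -> X ∥ F ∥ G ⊢ a ∈ A ->
  X ∥ F ∥ Id (wk A) (wk a) (Var 0) :: A :: G ⊢ C ∈ Univ j ->
  X ∥ F ∥ Id (wk A) (wk a) (Var 0) :: A :: G ⊢ C' ∈ Univ j ->
  X ∥ F ∥ Id (wk A) (wk a) (Var 0) :: A :: G ⊢ C ≡ C' ∈ Univ j ->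
  X ∥ F ∥ G ⊢ b ∈ A -> X ∥ F ∥ G ⊢ b' ∈ A -> X ∥ F ∥ G ⊢ b ≡ b' ∈ A ->
  X ∥ F ∥ G ⊢ p ∈ Id A a b -> X ∥ F ∥ G ⊢ p' ∈ Id A a b' -> X ∥ F ∥ G ⊢ p ≡ p' ∈ Id A a b ->
  X ∥ F ∥ G ⊢ inst2 C b p ≡ inst2 C' b' p' ∈ Univ j.
Proof.
  intros c HA Ha HC HC' EC Hb Hb' Eb Hp Hp' Ep.
  set (I := Id (wk A) (wk a) (Var 0)) in *.
  assert (cA : closed_shapes A) by apply (proj1 derivable_closed_shapes _ _ _ _ _ HA c).
  assert (ca : closed_shapes a) by apply (proj1 derivable_closed_shapes _ _ _ _ _ Ha c).
  assert (cI : closed_shapes I) by (cbn; unfold wk; auto using closed_shapes_ren).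
  assert (HI : X ∥ F ∥ A :: G ⊢ I ∈ Univ i).
  { apply t_id.
    - apply (typing_wk _ _ _ _ (Univ i)); assumption.
    - apply typing_wk; assumption.
    - apply (t_var _ _ (A :: G) 0 A eq_refl). }
  assert (Isub : forall x, inst1 I x = Id A a x).
  { intro x; unfold inst1, I; cbn; rewrite !subst_wk, !subst_id; reflexivity. }
  assert (S1 : forall D x, X ∥ F ∥ I :: A :: G ⊢ D ∈ Univ j -> X ∥ F ∥ G ⊢ x ∈ A ->
     X ∥ F ∥ Id A a x :: G ⊢ subst PVar (up (scons x Var)) D ∈ Univ j).
  { intros D x HD Hx. rewrite <- Isub.
    assert (cx : closed_shapes x) by apply (proj1 derivable_closed_shapes _ _ _ _ _ Hx c).
    eapply (proj1 typing_substitution _ _ _ _ _ HD); [auto|].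
    apply substitution_up; [exact cI|]; apply subst_scons_id; assumption. }
  assert (L : forall D x y, X ∥ F ∥ I :: A :: G ⊢ D ∈ Univ j -> X ∥ F ∥ G ⊢ x ∈ A ->
     X ∥ F ∥ G ⊢ y ∈ Id A a x ->
     X ∥ F ∥ G ⊢ App (App (Lam (Lam D)) x) y ≡ inst2 D x y ∈ Univ j).
  { intros D x y HD Hx Hy.
    assert (Hl : X ∥ F ∥ A :: G ⊢ Lam D ∈ Pi I (Univ j)) by (eapply t_lam; eauto).
    pose proof (q_pi_beta _ _ _ _ _ _ _ _ HA Hl Hx) as e1.
    change (inst1 (Pi I (Univ j)) x) with (Pi (inst1 I x) (Univ j)) in e1; rewrite Isub in e1.
    assert (Hi : X ∥ F ∥ G ⊢ Id A a x ∈ Univ i) by (apply t_id; assumption).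
    eapply q_trans.
    - apply (q_app _ _ _ _ _ _ _ _ _ e1 (q_refl _ _ _ _ _ Hy)).
    - rewrite inst2_inst1; cbn; eapply (q_pi_beta X F G _ (Univ j)); eauto. }
  eapply q_trans; [apply q_sym, L; eassumption|].
  eapply q_trans; [|apply L; eassumption].
  assert (El : X ∥ F ∥ A :: G ⊢ Lam C ≡ Lam C' ∈ Pi I (Univ j)) by (eapply q_lam; eauto).
  pose proof (q_app _ _ _ _ _ _ _ _ _ (q_lam _ _ _ _ _ _ _ _ HA El) Eb) as e2.
  change (inst1 (Pi I (Univ j)) b) with (Pi (inst1 I b) (Univ j)) in e2; rewrite Isub in e2.
  apply (q_app _ _ _ _ _ _ _ _ _ e2 Ep).
Qed.

(** ** Soundness of annotated typing *)

Lemma ann_ok X F G t A i : Forall closed_shapes G ->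
  X ∥ F ∥ G ⊢ t ∈ A -> X ∥ F ∥ G ⊢ A ∈ Univ i ->
  X ∥ F ∥ G ⊢ ann t A ∈ A /\ X ∥ F ∥ G ⊢ ann t A ≡ t ∈ A.
Proof.
  intros; unfold ann; destruct (synth t); split; eauto using ann_ty, ann_eq, q_refl.
Qed.

Lemma sound_closed X F G A i : X ∥ F ∥ G ⊢ A ∈ Univ i -> Forall closed_shapes G ->
  Forall closed_shapes (A :: G).
Proof.
  intros H c; constructor; [apply (proj1 derivable_closed_shapes _ _ _ _ _ H c)|exact c].
Qed.

Ltac use_ann u A :=
  match goal with
  | Hu : has_type _ _ ?G u A, HA : has_type _ _ ?G A _, c : Forall closed_shapes ?G |- _ =>
      destruct (ann_ok _ _ _ _ _ _ c Hu HA)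
  end.

(** The only difference between annotated and plain rules is that instances are taken at
    annotated terms, which equal the original ones. *)
Lemma annotated_sound :
  (forall X F G e T, syn X F G e T -> Forall closed_shapes G -> X ∥ F ∥ G ⊢ e ∈ T) /\
  (forall X F G t T, chk X F G t T -> Forall closed_shapes G -> X ∥ F ∥ G ⊢ t ∈ T) /\
  (forall X F G A i, wf X F G A i -> Forall closed_shapes G -> X ∥ F ∥ G ⊢ A ∈ Univ i).
Proof.
  apply annotated_ind; intros;
    repeat match goal with H : Forall closed_shapes ?G -> _, H' : Forall closed_shapes ?G |- _ =>
      specialize (H H') end;
    try match goal with H : Forall closed_shapes (?A :: ?G) -> _, HA : has_type _ _ ?G ?A _ |- _ =>
      pose proof (sound_closed _ _ _ _ _ HA ltac:(assumption)) end;
    repeat match goal with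
      H : Forall closed_shapes (map cwk ?G) -> _, HG : Forall closed_shapes ?G |- _ =>
      specialize (H (closed_shapes_map_cwk _ HG)) end;
    repeat match goal with H : Forall closed_shapes ?G -> _, H' : Forall closed_shapes ?G |- _ =>
      specialize (H H') end.
  - apply t_var; assumption.
  - eapply ann_ty; eauto.
  - eapply ann_ty; eauto; eapply conv_ty; eauto.
  - eapply ann_ty; eauto.
  - eapply t_conv; [eapply t_app; eassumption|].
    use_ann u A.
    eapply inst1_eq; eauto using q_refl, q_sym.
  - eapply t_fst; eassumption.
  - eapply t_snd; eassumption.
  - eapply t_eapp; eassumption.
  - assert (cI : Forall closed_shapes (Id (wk A) (wk a) (Var 0) :: A :: G)).
    { apply ctx_motive; [| |assumption].
      - match goal with HA : has_type X F G A _ |- _ =>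
          apply (proj1 derivable_closed_shapes _ _ _ _ _ HA); assumption end.
      - match goal with HA : has_type X F G a _ |- _ =>
          apply (proj1 derivable_closed_shapes _ _ _ _ _ HA); assumption end. }
    repeat match goal with H : Forall closed_shapes ?G -> _, H' : Forall closed_shapes ?G |- _ =>
      specialize (H H') end.
    use_ann a A; use_ann b A.
    assert (tyeq X F G (Id A a a) (Id A a (ann a A)))
      by (exists i; apply q_id; eauto using q_refl, q_sym).
    assert (tyeq X F G (Id A a b) (Id A a (ann b A)))
      by (exists i; apply q_id; eauto using q_refl, q_sym).
    assert (X ∥ F ∥ G ⊢ Refl a ∈ Id A a (ann a A)) by (eapply conv_ty; eauto using t_refl).
    assert (X ∥ F ∥ G ⊢ Id A a (ann a A) ∈ Univ i) by (apply t_id; assumption).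
    assert (X ∥ F ∥ G ⊢ Id A a (ann b A) ∈ Univ i) by (apply t_id; assumption).
    assert (X ∥ F ∥ G ⊢ Ann (Refl a) (Id A a (ann a A)) ≡ Refl a ∈ Id A a (ann a A))
      by (eapply ann_eq; eauto).
    assert (X ∥ F ∥ G ⊢ Ann (Refl a) (Id A a (ann a A)) ∈ Id A a (ann a A))
      by (eapply ann_ty; eauto).
    assert (X ∥ F ∥ G ⊢ p ∈ Id A a (ann b A)) by (eapply conv_ty; eauto).
    assert (X ∥ F ∥ G ⊢ ann_path A a b p ∈ Id A a (ann b A))
      by (unfold ann_path; destruct (synth b); eauto using ann_ty).
    assert (X ∥ F ∥ G ⊢ ann_path A a b p ≡ p ∈ Id A a (ann b A))
      by (unfold ann_path; destruct (synth b); eauto using ann_eq, q_refl).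
    eapply t_conv with (A := inst2 C b p).
    + eapply t_J with (A := A) (a := a) (i := i) (j := j); try eassumption.
      eapply t_conv; [eassumption|].
      eapply inst2_eq with (A := A) (a := a) (i := i);
        eauto using q_refl, conv_ty, conv_eq, tyeq_sym, t_refl.
    + eapply inst2_eq with (A := A) (a := a) (i := i);
        eauto using q_refl, q_sym, conv_ty, conv_eq, tyeq_sym.
  - assumption.
  - assumption.
  - eapply t_lam; eauto.
  - eapply t_pair; eauto.
    use_ann a A.
    eapply t_conv; [eassumption|]. eapply inst1_eq; eauto using q_refl.
  - eapply t_conv; [apply t_refl; eassumption|]. apply q_id; eauto using q_refl.
  - eapply t_elam; eauto.
  - eapply t_recbot; eauto.
  - eapply t_recor; eauto.
  - eapply cumul_le; eassumption.
  - eapply cumul_le with (i := S i); [lia|apply t_univ].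
  - apply t_pi; assumption.
  - apply t_sig; assumption.
  - apply t_id; assumption.
  - apply t_ext; assumption.
Qed.

Definition syn_sound := proj1 annotated_sound.
Definition chk_sound := proj1 (proj2 annotated_sound).
Definition wf_sound := proj2 (proj2 annotated_sound).

(** ** Closure under substitution *)

Lemma syn_closed X F G e T : Forall closed_shapes G -> syn X F G e T ->
  closed_shapes e /\ closed_shapes T.
Proof. intros c H; apply (proj1 derivable_closed_shapes _ _ _ _ _ (syn_sound _ _ _ _ _ H c) c). Qed.

Lemma chk_closed X F G e T : Forall closed_shapes G -> chk X F G e T ->
  closed_shapes e /\ closed_shapes T.
Proof. intros c H; apply (proj1 derivable_closed_shapes _ _ _ _ _ (chk_sound _ _ _ _ _ H c) c). Qed.

Lemma wf_closed X F G A i : Forall closed_shapes G -> wf X F G A i -> closed_shapes A.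
Proof. intros c H; apply (proj1 derivable_closed_shapes _ _ _ _ _ (wf_sound _ _ _ _ _ H c) c). Qed.

(** Again renamings come first.  A substitution has to map variables to terms that determine
    their types, since these terms end up in head positions. *)
Section AnnotatedClosure.
Variable good : list cube -> list tope -> list tm -> list cube -> list tope -> list tm ->
  (nat -> pt) -> (nat -> tm) -> Prop.
Hypothesis good_cube : forall X F G X' F' G' r q, good X F G X' F' G' r q ->
  forall n K, nth_error X n = Some K -> has_cube X' (r n) K.
Hypothesis good_tope : forall X F G X' F' G' r q, good X F G X' F' G' r q ->
  forall p, In p F -> entails X' F' (tsubst r p).
Hypothesis good_synth : forall X F G X' F' G' r q, good X F G X' F' G' r q ->
  forall n, synth (q n) = true.
Hypothesis good_ty : forall X F G X' F' G' r q, good X F G X' F' G' r q ->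
  forall a A, Forall closed_shapes G -> X ∥ F ∥ G ⊢ a ∈ A ->
  X' ∥ F' ∥ G' ⊢ subst r q a ∈ subst r q A.
Hypothesis good_eq : forall X F G X' F' G' r q, good X F G X' F' G' r q ->
  forall a b A, Forall closed_shapes G -> X ∥ F ∥ G ⊢ a ≡ b ∈ A ->
  X' ∥ F' ∥ G' ⊢ subst r q a ≡ subst r q b ∈ subst r q A.
Hypothesis good_var : forall X F G X' F' G' r q, good X F G X' F' G' r q ->
  forall n A i, nth_error G n = Some A -> wf X' F' G' (subst r q (shiftn n A)) i ->
  syn X' F' G' (q n) (subst r q (shiftn n A)).
Hypothesis good_up : forall X F G X' F' G' r q A i, closed_shapes A ->
  wf X' F' G' (subst r q A) i -> good X F G X' F' G' r q ->
  good X F (A :: G) X' F' (subst r q A :: G') r (up q).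
Hypothesis good_pup : forall X F G X' F' G' r q K p, good X F G X' F' G' r q ->
  good (K :: X) (p :: map tshift F) (map cwk G)
       (K :: X') (tsubst (pup r) p :: map tshift F') (map cwk G')
       (pup r) (fun n => cwk (q n)).
Hypothesis good_hyp : forall X F G X' F' G' r q p, good X F G X' F' G' r q ->
  good X (p :: F) G X' (tsubst r p :: F') G' r q.

Lemma synth_subst X F G X' F' G' r q t : good X F G X' F' G' r q ->
  synth (subst r q t) = synth t.
Proof. intro g; destruct t; cbn; auto; eapply good_synth, g. Qed.

Lemma subst_ann X F G X' F' G' r q t T : good X F G X' F' G' r q ->
  subst r q (ann t T) = ann (subst r q t) (subst r q T).
Proof.
  intro g; unfold ann; rewrite (synth_subst _ _ _ _ _ _ _ _ t g); destruct (synth t); reflexivity.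
Qed.

Lemma subst_ann_path X F G X' F' G' r q A a b p : good X F G X' F' G' r q ->
  subst r q (ann_path A a b p)
  = ann_path (subst r q A) (subst r q a) (subst r q b) (subst r q p).
Proof.
  intro g; unfold ann_path; rewrite (synth_subst _ _ _ _ _ _ _ _ b g).
  destruct (synth b); [reflexivity|]; cbn; erewrite subst_ann by eassumption; reflexivity.
Qed.

Lemma good_shape X F G X' F' G' r q K p : is_tope [K] p -> good X F G X' F' G' r q ->
  good (K :: X) (p :: map tshift F) (map cwk G)
       (K :: X') (p :: map tshift F') (map cwk G') (pup r) (fun n => cwk (q n)).
Proof.
  intros H g. pose proof (good_pup _ _ _ _ _ _ _ _ K p g) as h.
  erewrite (tsubst_closed K p (pup r)) in h; eauto.
Qed.

Ltac ctx_tac := first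
  [ eassumption
  | eapply good_up; [eassumption| |eassumption]; ih_rec
  | eapply good_shape; [eassumption|eassumption]
  | eapply good_hyp; eassumption ]
with ih_rec := match goal with
  | IH : forall X' F' G' r q, good _ _ _ _ _ _ _ _ -> _ |- _ => solve [eapply IH; eassumption]
  end.

Ltac ih := match goal with
  | IH : forall X' F' G' r q, good _ _ _ _ _ _ _ _ -> _ |- _ => solve [eapply IH; ctx_tac]
  end.

Lemma good_tyeq X F G X' F' G' r q A B : good X F G X' F' G' r q -> Forall closed_shapes G ->
  tyeq X F G A B -> tyeq X' F' G' (subst r q A) (subst r q B).
Proof. intros g c [i H]; exists i; exact (good_eq _ _ _ _ _ _ _ _ g _ _ _ c H). Qed.

Lemma annotated_closure :
  (forall X F G e T, syn X F G e T -> Forall closed_shapes G ->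
    forall X' F' G' r q, good X F G X' F' G' r q ->
    syn X' F' G' (subst r q e) (subst r q T)) /\
  (forall X F G t T, chk X F G t T -> Forall closed_shapes G ->
    forall X' F' G' r q, good X F G X' F' G' r q ->
    chk X' F' G' (subst r q t) (subst r q T)) /\
  (forall X F G A i, wf X F G A i -> Forall closed_shapes G ->
    forall X' F' G' r q, good X F G X' F' G' r q ->
    wf X' F' G' (subst r q A) i).
Proof.
  apply annotated_ind; intros; cbn [subst] in *.
  all: repeat match goal with
    | HA : wf _ _ ?G ?A _, HG : Forall closed_shapes ?G |- _ =>
      lazymatch goal with
      | _ : closed_shapes A |- _ => fail
      | _ => pose proof (wf_closed _ _ _ _ _ HG HA)
      end
    end.
  all: try match goal with HG : Forall closed_shapes ?G |- _ =>
    assert (Forall closed_shapes (map cwk G)) by (apply closed_shapes_map_cwk; exact HG) end.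
  all: try match goal with HG : Forall closed_shapes ?G, HA : closed_shapes ?A,
      H : context [?A :: ?G] |- _ =>
    assert (Forall closed_shapes (A :: G)) by (constructor; assumption) end.
  all: try match goal with
    | HA : wf ?X ?F ?G ?A _, Ha : chk ?X ?F ?G ?a ?A,
      HC : context [Id (wk ?A) (wk ?a) (Var 0) :: ?A :: ?G], HG : Forall closed_shapes ?G |- _ =>
      pose proof (proj1 (chk_closed _ _ _ _ _ HG Ha));
      assert (Forall closed_shapes (Id (wk A) (wk a) (Var 0) :: A :: G))
        by (apply ctx_motive; auto)
    end.
  all: repeat match goal with H : Forall _ _ -> _ , H' : Forall _ _ |- _ => specialize (H H') end.
  all: match goal with g : good ?X ?F ?G ?X' ?F' ?G' ?r ?q |- _ =>
    repeat match goal with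
    | H : context [subst r q (inst1 _ _)] |- _ => rewrite subst_inst1 in H
    end end.
  all: rewrite ?subst_inst1, ?subst_inst2, ?subst_pinst; cbn [subst] in *.
  all: try (erewrite subst_ann_path by eassumption).
  all: try (erewrite subst_ann by eassumption).
  - eapply good_var; eauto.
  - eapply s_ann; [rewrite (synth_subst _ _ _ _ _ _ _ _ _ ltac:(eassumption)); assumption|ih|ih].
  - eapply s_cast; [ih|ih|eapply good_tyeq; eassumption].
  - eapply s_raw; [destruct c; try discriminate; reflexivity|eapply good_ty; eassumption|ih].
  - eapply s_app; ih.
  - eapply s_fst; [ih|ih|ih].
  - eapply s_snd; ih.
  - eapply s_eapp; [eassumption|ih|ih|eapply has_cube_subst; eauto|].
    erewrite <- tinst_closed by eassumption; eapply entails_subst; eauto.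
  - assert (W : wf X' F' (subst r q A :: G')
              (Id (wk (subst r q A)) (wk (subst r q a)) (Var 0)) i).
    { match goal with IH : forall X' F' G' r q, good X F (A :: G) _ _ _ _ _ -> _ |- _ =>
        pose proof (IH X' F' _ r (up q) ltac:(ctx_tac)) as h end.
      rewrite !subst_up_wk in h; exact h. }
    eapply s_J with (a := subst r q a); [ih|ih|ih|exact W| | |ih].
    { match goal with IH : forall X' F' G' r q, good X F (_ :: A :: G) _ _ _ _ _ -> _ |- _ =>
        eapply IH end.
      assert (g : good X F (A :: G) X' F' (subst r q A :: G') r (up q)) by ctx_tac.
      assert (cI : closed_shapes (Id (wk A) (wk a) (Var 0)))
        by (cbn; unfold wk; auto using closed_shapes_ren).
      pose proof (good_up X F (A :: G) X' F' (subst r q A :: G') r (up q) _ i cI) as h.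
      cbn [subst] in h; rewrite !subst_up_wk in h; exact (h W g). }
    match goal with IH : forall X' F' G' r q, good X F G _ _ _ _ _ -> chk _ _ _ (subst r q d) _ |- _ =>
      pose proof (IH _ _ _ _ _ ltac:(eassumption)) as h end.
    rewrite subst_inst2 in h; cbn [subst Ann] in h; unfold Ann in h; cbn [subst] in h.
    erewrite !subst_ann in h by eassumption; exact h.
  - eapply c_syn; ih.
  - eapply c_ty; [rewrite (synth_subst _ _ _ _ _ _ _ _ _ ltac:(eassumption)); assumption|ih].
  - eapply c_lam; ih.
  - eapply c_pair; [ih|ih|ih|].
    match goal with IH : forall X' F' G' r q, good X F G _ _ _ _ _ -> chk _ _ _ (subst r q b) _ |- _ =>
      pose proof (IH _ _ _ _ _ ltac:(eassumption)) as h end.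
    rewrite subst_inst1 in h; erewrite subst_ann in h by eassumption; exact h.
  - eapply c_refl; [ih|ih|ih|eapply good_eq; eassumption].
  - eapply c_elam; [ih|eassumption|eassumption|ih|].
    eapply good_eq; [eapply good_shape; eassumption|assumption|eassumption].
  - eapply c_recbot; [ih|]. change TBot with (tsubst r TBot); eapply entails_subst; eauto.
  - eapply c_recor; [eapply is_tope_subst; eauto|eapply is_tope_subst; eauto| |ih|ih|ih|].
    + change (TOr (tsubst r p) (tsubst r q)) with (tsubst r (TOr p q)); eapply entails_subst; eauto.
    + match goal with g : good _ _ _ _ _ _ _ _ |- _ =>
        apply (good_eq _ _ _ _ _ _ _ _ (good_hyp _ _ _ _ _ _ _ _ (TAnd p q) g)); assumption
      end.
  - eapply wf_ne; [ih|assumption].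
  - eapply wf_univ; assumption.
  - eapply wf_pi; ih.
  - eapply wf_sig; ih.
  - eapply wf_id; ih.
  - eapply wf_ext; [assumption|assumption|assumption|ih|ih].
Qed.
End AnnotatedClosure.

Lemma syn_chk_wf_renaming :
  (forall X F G e T, syn X F G e T -> Forall closed_shapes G ->
    forall X' F' G' r q, renaming X F G X' F' G' r q ->
    syn X' F' G' (subst r q e) (subst r q T)) /\
  (forall X F G t T, chk X F G t T -> Forall closed_shapes G ->
    forall X' F' G' r q, renaming X F G X' F' G' r q ->
    chk X' F' G' (subst r q t) (subst r q T)) /\
  (forall X F G A i, wf X F G A i -> Forall closed_shapes G ->
    forall X' F' G' r q, renaming X F G X' F' G' r q ->
    wf X' F' G' (subst r q A) i).
Proof.
  apply annotated_closure.
  - intros X F G X' F' G' r q H; apply H.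
  - intros X F G X' F' G' r q H; apply H.
  - intros X F G X' F' G' r q (_ & _ & v & H & _) n; rewrite H; reflexivity.
  - intros; eapply (proj1 typing_renaming); eassumption.
  - intros; eapply (proj2 typing_renaming); eassumption.
  - intros X F G X' F' G' r q (_ & _ & v & H3 & H4) n A i E W.
    destruct (H4 n A E) as (A' & E' & e); rewrite <- e in *; rewrite H3; eapply s_var; eauto.
  - intros; apply renaming_up; assumption.
  - intros; apply renaming_pup; assumption.
  - intros; apply renaming_hyp; assumption.
Qed.

Definition annotated_substitution X F G X' F' G' r q : Prop :=
  substitution X F G X' F' G' r q /\ (forall n, synth (q n) = true) /\
  forall n A, nth_error G n = Some A -> syn X' F' G' (q n) (subst r q (shiftn n A)).

Definition syn_ren := proj1 syn_chk_wf_renaming.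
Definition chk_ren := proj1 (proj2 syn_chk_wf_renaming).
Definition wf_ren := proj2 (proj2 syn_chk_wf_renaming).

Lemma syn_wk X F G e T B : Forall closed_shapes G -> syn X F G e T -> syn X F (B :: G) (wk e) (wk T).
Proof. intros; unfold wk; rewrite !ren_as_subst; eapply syn_ren; eauto using renaming_wk. Qed.

Lemma chk_wk X F G e T B : Forall closed_shapes G -> chk X F G e T -> chk X F (B :: G) (wk e) (wk T).
Proof. intros; unfold wk; rewrite !ren_as_subst; eapply chk_ren; eauto using renaming_wk. Qed.

Lemma wf_wk X F G A i B : Forall closed_shapes G -> wf X F G A i -> wf X F (B :: G) (wk A) i.
Proof. intros; unfold wk; rewrite !ren_as_subst; eapply wf_ren; eauto using renaming_wk. Qed.

Lemma syn_cwk X F G e T K p : Forall closed_shapes G -> syn X F G e T ->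
  syn (K :: X) (p :: map tshift F) (map cwk G) (cwk e) (cwk T).
Proof.
  intros; unfold cwk at 2 3; rewrite !ren_as_subst; eapply syn_ren; eauto using renaming_cwk.
Qed.

Lemma wf_cwk X F G A i K p : Forall closed_shapes G -> wf X F G A i ->
  wf (K :: X) (p :: map tshift F) (map cwk G) (cwk A) i.
Proof.
  intros; unfold cwk at 2; rewrite !ren_as_subst; eapply wf_ren; eauto using renaming_cwk.
Qed.

Lemma syn_topes X F G e T F' : Forall closed_shapes G -> topes_good F X F' PVar ->
  syn X F G e T -> syn X F' G e T.
Proof.
  intros c h H; rewrite <- (subst_id e), <- (subst_id T); eapply syn_ren; eauto.
  apply renaming_topes; intros p Hp; rewrite <- (tsubst_id p); auto.
Qed.

Lemma chk_topes X F G e T F' : Forall closed_shapes G -> topes_good F X F' PVar ->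
  chk X F G e T -> chk X F' G e T.
Proof.
  intros c h H; rewrite <- (subst_id e), <- (subst_id T); eapply chk_ren; eauto.
  apply renaming_topes; intros p Hp; rewrite <- (tsubst_id p); auto.
Qed.

Lemma wf_topes X F G A i F' : Forall closed_shapes G -> topes_good F X F' PVar ->
  wf X F G A i -> wf X F' G A i.
Proof.
  intros c h H; rewrite <- (subst_id A); eapply wf_ren; eauto.
  apply renaming_topes; intros p Hp; rewrite <- (tsubst_id p); auto.
Qed.

Lemma syn_chk_wf_substitution :
  (forall X F G e T, syn X F G e T -> Forall closed_shapes G ->
    forall X' F' G' r q, annotated_substitution X F G X' F' G' r q ->
    syn X' F' G' (subst r q e) (subst r q T)) /\
  (forall X F G t T, chk X F G t T -> Forall closed_shapes G ->
    forall X' F' G' r q, annotated_substitution X F G X' F' G' r q ->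
    chk X' F' G' (subst r q t) (subst r q T)) /\
  (forall X F G A i, wf X F G A i -> Forall closed_shapes G ->
    forall X' F' G' r q, annotated_substitution X F G X' F' G' r q ->
    wf X' F' G' (subst r q A) i).
Proof.
  apply annotated_closure.
  - intros X F G X' F' G' r q H; apply H.
  - intros X F G X' F' G' r q H; apply H.
  - intros X F G X' F' G' r q H; apply H.
  - intros X F G X' F' G' r q [H _] a A c Ha; eapply (proj1 typing_substitution); eassumption.
  - intros X F G X' F' G' r q [H _] a b A c Ha; eapply (proj2 typing_substitution); eassumption.
  - intros X F G X' F' G' r q [_ [_ H]] n A i E _; auto.
  - intros X F G X' F' G' r q A i cA W (H1 & H2 & H3).
    assert (c' : Forall closed_shapes G') by apply H1.
    split; [apply substitution_up; assumption|].
    split; [intros [|n]; [reflexivity|]; cbn; unfold wk; rewrite ren_as_subst|].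
    + specialize (H2 n); destruct (q n); cbn in *; congruence.
    + intros [|n] B E; cbn in E.
      * injection E as <-; rewrite shiftn_0, subst_up_wk, <- shiftn_0.
        eapply s_var; [reflexivity|]; rewrite shiftn_0; apply wf_wk; eassumption.
      * rewrite shiftn_S, subst_up_wk; apply syn_wk; auto.
  - intros X F G X' F' G' r q K p (H1 & H2 & H3).
    assert (c' : Forall closed_shapes G') by apply H1.
    split; [apply substitution_pup; assumption|].
    split; [intro n; unfold cwk; specialize (H2 n); destruct (q n); cbn in *; congruence|].
    intros n A E; rewrite nth_error_map in E; destruct (nth_error G n) as [A0|] eqn:E0;
      [|discriminate]; injection E as <-.
    rewrite shiftn_cwk, subst_pup_cwk; apply syn_cwk; auto.
  - intros X F G X' F' G' r q p (H1 & H2 & H3).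
    split; [apply substitution_hyp; assumption|]; split; [exact H2|].
    intros n A E; eapply syn_topes; [apply H1| |apply H3, E].
    intros g Hg; rewrite tsubst_id; apply e_hyp; right; exact Hg.
Qed.

Definition chk_sub := proj1 (proj2 syn_chk_wf_substitution).
Definition wf_sub := proj2 (proj2 syn_chk_wf_substitution).

Lemma syn_ann X F G u A i : wf X F G A i -> chk X F G u A -> syn X F G (ann u A) A.
Proof.
  intros W H; unfold ann; destruct (synth u) eqn:E; [|eapply s_ann; eassumption].
  destruct H; cbn in E; try congruence; assumption.
Qed.

Lemma syn_ann_eq X F G u A i : Forall closed_shapes G -> wf X F G A i -> chk X F G u A ->
  X ∥ F ∥ G ⊢ ann u A ≡ u ∈ A.
Proof.
  intros c W H; eapply ann_ok; eauto using chk_sound, wf_sound.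
Qed.


(** Derivations of the object theory do not presuppose that the types of the context are
    well formed; the rule [s_var] requires it at each variable, and this condition provides
    it. *)
Definition context_ok X F G : Prop := forall n A, nth_error G n = Some A ->
  exists i, wf X F G (shiftn n A) i.

Lemma context_ok_cons X F G A i : Forall closed_shapes G -> wf X F G A i ->
  context_ok X F G -> context_ok X F (A :: G).
Proof.
  intros c W H [|n] B E; cbn in E.
  - injection E as <-; exists i; rewrite shiftn_0; apply wf_wk; assumption.
  - destruct (H n B E) as [j Wj]; exists j; rewrite shiftn_S; apply wf_wk; assumption.
Qed.

Lemma context_ok_shape X F G K p : Forall closed_shapes G -> context_ok X F G ->
  context_ok (K :: X) (p :: map tshift F) (map cwk G).
Proof.
  intros c H n A E; rewrite nth_error_map in E; destruct (nth_error G n) as [A0|] eqn:E0;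
    [|discriminate]; injection E as <-; destruct (H n A0 E0) as [j W]; exists j.
  rewrite shiftn_cwk; apply wf_cwk; assumption.
Qed.

Lemma context_ok_topes X F G F' : Forall closed_shapes G -> topes_good F X F' PVar ->
  context_ok X F G -> context_ok X F' G.
Proof.
  intros c h H n A E; destruct (H n A E) as [j W]; exists j; eapply wf_topes; eassumption.
Qed.

Lemma inst_good X F G A a : Forall closed_shapes G -> context_ok X F G -> syn X F G a A ->
  annotated_substitution X F (A :: G) X F G PVar (scons a Var).
Proof.
  intros c k H; split; [|split].
  - apply subst_scons_id; [exact c|apply (syn_closed _ _ _ _ _ c H)|apply syn_sound; assumption].
  - intros [|n]; [exact (syn_synth _ _ _ _ _ H)|reflexivity].
  - intros [|n] B E; cbn in E.
    + injection E as <-; rewrite shiftn_0, subst_wk, subst_id; exact H.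
    + destruct (k n B E) as [i W].
      rewrite shiftn_S, subst_wk, subst_id; eapply s_var; eassumption.
Qed.

Lemma pinst_good X F G K p s : Forall closed_shapes G -> context_ok X F G ->
  is_tope [K] p -> has_cube X s K -> entails X F (tinst p s) ->
  annotated_substitution (K :: X) (p :: map tshift F) (map cwk G) X F G (scons s PVar) Var.
Proof.
  intros c k Hp Hs He.
  assert (V : forall n A, nth_error (map cwk G) n = Some A -> exists i,
     wf X F G (shiftn n (subst (scons s PVar) Var A)) i /\
     nth_error G n = Some (subst (scons s PVar) Var A) /\
     subst (scons s PVar) Var (shiftn n A) = shiftn n (subst (scons s PVar) Var A)).
  { intros n A E; rewrite nth_error_map in E; destruct (nth_error G n) as [A0|] eqn:E0;
      [|discriminate]; injection E as <-; destruct (k n A0 E0) as [i W]; exists i.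
    rewrite shiftn_cwk, !subst_cwk, !subst_id; auto. }
  split; [|split]; [|reflexivity|].
  - split; [intros [|n] L E; cbn in *; [injection E as <-; exact Hs|constructor; exact E]|].
    split; [intros g [<-|Hg]; [exact He|]|].
    { apply in_map_iff in Hg; destruct Hg as (h & <- & Hh).
      change (entails X F (tinst (tshift h) s)); rewrite tsubst_inst; apply e_hyp, Hh. }
    split; [exact c|]; split; [intro; exact I|].
    intros n A E; destruct (V n A E) as (i & W & E' & ->); apply t_var, E'.
  - intros n A E; destruct (V n A E) as (i & W & E' & ->); eapply s_var; eassumption.
Qed.

Lemma wf_inst1 X F G A B a i : Forall closed_shapes G -> context_ok X F G ->
  closed_shapes A -> syn X F G a A -> wf X F (A :: G) B i -> wf X F G (inst1 B a) i.
Proof. intros; eapply wf_sub; [eassumption|auto|apply inst_good; assumption]. Qed.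

Lemma chk_inst1 X F G A B b a : Forall closed_shapes G -> context_ok X F G ->
  closed_shapes A -> syn X F G a A -> chk X F (A :: G) b B -> chk X F G (inst1 b a) (inst1 B a).
Proof. intros; eapply chk_sub; [eassumption|auto|apply inst_good; assumption]. Qed.

Lemma wf_pinst X F G K p A s i : Forall closed_shapes G -> context_ok X F G ->
  is_tope [K] p -> has_cube X s K -> entails X F (tinst p s) ->
  wf (K :: X) (p :: map tshift F) (map cwk G) A i -> wf X F G (pinst A s) i.
Proof.
  intros; eapply wf_sub; [eassumption|apply closed_shapes_map_cwk; assumption|].
  apply pinst_good; assumption.
Qed.

Lemma chk_pinst X F G K p A a s : Forall closed_shapes G -> context_ok X F G ->
  is_tope [K] p -> has_cube X s K -> entails X F (tinst p s) ->
  chk (K :: X) (p :: map tshift F) (map cwk G) a A -> chk X F G (pinst a s) (pinst A s).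
Proof.
  intros; eapply chk_sub; [eassumption|apply closed_shapes_map_cwk; assumption|].
  apply pinst_good; assumption.
Qed.

Lemma wf_inst2 X F G A a C b p i : Forall closed_shapes G -> context_ok X F G ->
  closed_shapes A -> closed_shapes a ->
  syn X F G b A -> syn X F G p (Id A a b) ->
  wf X F (Id (wk A) (wk a) (Var 0) :: A :: G) C i -> wf X F G (inst2 C b p) i.
Proof.
  intros c k cA ca Hb Hp W.
  assert (cI : closed_shapes (Id (wk A) (wk a) (Var 0)))
    by (cbn; unfold wk; auto using closed_shapes_ren).
  eapply wf_sub; [eassumption|auto|].
  destruct (inst_good _ _ _ _ _ c k Hb) as (H1 & H2 & H3).
  split; [|split].
  - destruct H1 as (h1 & h2 & h3 & h4 & h5); split; [exact h1|]; split; [exact h2|].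
    split; [exact h3|]; split.
    { intros [|n]; cbn; [apply (syn_closed _ _ _ _ _ c Hp)|apply h4]. }
    intros [|n] B E; cbn in E.
    + injection E as <-; rewrite shiftn_0, subst_wk; cbn; rewrite !subst_wk, !subst_id.
      apply syn_sound; assumption.
    + rewrite shiftn_S, subst_wk; apply h5, E.
  - intros [|n]; [exact (syn_synth _ _ _ _ _ Hp)|apply H2].
  - intros [|n] B E; cbn in E.
    + injection E as <-; rewrite shiftn_0, subst_wk; cbn; rewrite !subst_wk, !subst_id; assumption.
    + rewrite shiftn_S, subst_wk; apply H3, E.
Qed.


Lemma ann_path_syn X F G A a b p i : Forall closed_shapes G ->
  wf X F G A i -> chk X F G a A -> chk X F G b A -> syn X F G p (Id A a b) ->
  syn X F G (ann_path A a b p) (Id A a (ann b A)) /\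
  X ∥ F ∥ G ⊢ ann_path A a b p ≡ p ∈ Id A a b /\
  tyeq X F G (Id A a b) (Id A a (ann b A)).
Proof.
  intros c W Ha Hb Hp.
  assert (W' : wf X F G (Id A a (ann b A)) i)
    by (apply wf_id; [exact W|exact Ha|apply c_syn; eapply syn_ann; eassumption]).
  assert (E : tyeq X F G (Id A a b) (Id A a (ann b A))).
  { exists i; apply q_id.
    - apply q_refl, wf_sound; assumption.
    - apply q_refl, chk_sound; assumption.
    - apply q_sym; eapply syn_ann_eq; eassumption. }
  assert (Wb : wf X F G (Id A a b) i) by (apply wf_id; assumption).
  split; [|split]; [| |exact E]; unfold ann_path, ann in *; destruct (synth b) eqn:Eb.
  - exact Hp.
  - eapply s_cast; [exact Hp|exact W'|exact E].
  - apply q_refl, syn_sound; assumption.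
  - eapply ann_eq; [exact c|apply syn_sound; assumption|apply wf_sound; [exact Wb|exact c]|].
    apply wf_sound; [exact W'|exact c].
Qed.

Lemma syn_wf X F G e T : Forall closed_shapes G -> context_ok X F G -> syn X F G e T ->
  exists i, wf X F G T i.
Proof.
  intros c k H; inversion H; subst; eauto.
  - exists i; eapply wf_inst1; eauto using wf_closed, syn_ann.
  - exists i; eapply wf_inst1; eauto using wf_closed.
    eapply s_fst; eassumption.
  - exists i; eapply wf_pinst; eauto.
  - exists j; eapply wf_inst2 with (A := A) (a := a); eauto using wf_closed, syn_ann.
    + eapply proj1, (chk_closed X F G a A); eassumption.
    + eapply ann_path_syn; eassumption.
Qed.

(** ** Erasure of annotations *)

Fixpoint erase (t : tm) : tm :=
  match t with
  | Pi A B => Pi (erase A) (erase B)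
  | Lam b => Lam (erase b)
  | App f a => App (erase f) (erase a)
  | Sig A B => Sig (erase A) (erase B)
  | Pair a b => Pair (erase a) (erase b)
  | Fst p => match p with Pair a (Refl _) => erase a | _ => Fst (erase p) end
  | Snd p => Snd (erase p)
  | Id A a b => Id (erase A) (erase a) (erase b)
  | Refl a => Refl (erase a)
  | J C d p => J (erase C) (erase d) (erase p)
  | Ext K psi A phi a => Ext K psi (erase A) phi (erase a)
  | ELam b => ELam (erase b)
  | EApp f s => EApp (erase f) s
  | RecOr p q a b => RecOr p q (erase a) (erase b)
  | _ => t
  end.

Lemma entails_shape X F K psi phi : is_tope [K] psi -> is_tope [K] phi -> entails [K] [phi] psi ->
  forall p, In p (psi :: map tshift F) -> entails (K :: X) (phi :: map tshift F) p.
Proof.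
  intros Hpsi Hphi E p [<-|H]; [|apply e_hyp; right; exact H].
  assert (C : forall n L, nth_error [K] n = Some L -> has_cube (K :: X) (PVar n) L).
  { intros [|n] L e; [constructor; exact e|destruct n; discriminate]. }
  rewrite <- (tsubst_closed K psi PVar Hpsi eq_refl).
  eapply entails_subst; [exact E|exact C|].
  intros g [<-|[]]; rewrite (tsubst_closed K phi PVar Hphi eq_refl); apply e_hyp; left; reflexivity.
Qed.

Lemma erase_Fst_syn X F G p T : syn X F G p T -> erase (Fst p) = Fst (erase p).
Proof. destruct 1; reflexivity. Qed.

Lemma erase_constant c : constant c = true -> erase c = c.
Proof. destruct c; cbn; congruence. Qed.

Lemma inst1_same X F G A B u v i : X ∥ F ∥ G ⊢ A ∈ Univ i -> X ∥ F ∥ A :: G ⊢ B ∈ Univ i ->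
  X ∥ F ∥ G ⊢ u ∈ A -> X ∥ F ∥ G ⊢ v ∈ A -> X ∥ F ∥ G ⊢ u ≡ v ∈ A ->
  tyeq X F G (inst1 B u) (inst1 B v).
Proof. intros; exists i; eapply inst1_eq; eauto using q_refl. Qed.

(** Substituting the variable of type [A] by itself, now of the equal type [A']. *)
Lemma context_conv X F G A A' B C i : Forall closed_shapes G -> X ∥ F ∥ G ⊢ A ∈ Univ i ->
  X ∥ F ∥ G ⊢ A' ∈ Univ i -> X ∥ F ∥ G ⊢ A ≡ A' ∈ Univ i ->
  X ∥ F ∥ A :: G ⊢ B ∈ C -> X ∥ F ∥ A' :: G ⊢ B ∈ C.
Proof.
  intros c HA HA' E H; rewrite <- (subst_id B), <- (subst_id C).
  pose proof (sound_closed _ _ _ _ _ HA c) as cA.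
  eapply (proj1 typing_substitution _ _ _ _ _ H); [exact cA|].
  split; [intros n K e; constructor; exact e|].
  split; [intros p Hp; rewrite tsubst_id; apply e_hyp, Hp|].
  split; [eapply sound_closed; eassumption|]. split; [intros; exact I|].
  intros [|n] D e; cbn in e; rewrite subst_id.
  - injection e as <-. eapply t_conv; [apply t_var; reflexivity|].
    fold (shiftn 0 A') (shiftn 0 A); rewrite !shiftn_0.
    apply (equality_wk _ _ _ _ _ (Univ i)); [exact c|apply q_sym, E].
  - apply (t_var _ _ (A' :: G) (S n)), e.
Qed.

(** Terms that differ in their annotations only are equal.  This decides most comparisons of
    types, and it leads from the elaborated form of the theorem back to its raw form. *)
Lemma annotated_erase :
  (forall X F G e T, syn X F G e T -> Forall closed_shapes G ->
     X ∥ F ∥ G ⊢ erase e ∈ T /\ X ∥ F ∥ G ⊢ e ≡ erase e ∈ T) /\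
  (forall X F G t T, chk X F G t T -> Forall closed_shapes G ->
     X ∥ F ∥ G ⊢ erase t ∈ T /\ X ∥ F ∥ G ⊢ t ≡ erase t ∈ T) /\
  (forall X F G A i, wf X F G A i -> Forall closed_shapes G ->
     X ∥ F ∥ G ⊢ erase A ∈ Univ i /\ X ∥ F ∥ G ⊢ A ≡ erase A ∈ Univ i).
Proof.
  apply annotated_ind; intros;
    repeat match goal with
      | H : syn ?X ?F ?G ?a ?A, c : Forall closed_shapes ?G |- _ =>
          lazymatch goal with _ : has_type X F G a A |- _ => fail | _ =>
            pose proof (syn_sound _ _ _ _ _ H c) end
      | H : chk ?X ?F ?G ?a ?A, c : Forall closed_shapes ?G |- _ =>
          lazymatch goal with _ : has_type X F G a A |- _ => fail | _ =>
            pose proof (chk_sound _ _ _ _ _ H c) end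
      | H : wf ?X ?F ?G ?A ?i, c : Forall closed_shapes ?G |- _ =>
          lazymatch goal with _ : has_type X F G A (Univ i) |- _ => fail | _ =>
            pose proof (wf_sound _ _ _ _ _ H c) end
      | H : Forall closed_shapes ?G -> _ /\ _, c : Forall closed_shapes ?G |- _ =>
          destruct (H c); clear H
      | HA : has_type _ _ ?G ?A (Univ _), c : Forall closed_shapes ?G,
          H : Forall closed_shapes (?A :: ?G) -> _ |- _ =>
          lazymatch goal with _ : Forall closed_shapes (A :: G) |- _ => fail | _ =>
            pose proof (sound_closed _ _ _ _ _ HA c) end
      | H : Forall closed_shapes (map cwk ?G) -> _, c : Forall closed_shapes ?G |- _ =>
          lazymatch goal with _ : Forall closed_shapes (map cwk G) |- _ => fail | _ =>
            pose proof (closed_shapes_map_cwk _ c) end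
      | H : _ /\ _ |- _ => destruct H
      end.
  - split; [|apply q_refl]; cbn; eapply t_var; eassumption.
  - cbn; split; [assumption|]. eapply q_trans; [eapply ann_eq; eauto|assumption].
  - cbn; split; [eapply conv_ty; eassumption|].
    eapply q_trans; [eapply ann_eq; eauto using conv_ty|eapply conv_eq; eassumption].
  - cbn; rewrite erase_constant by assumption; split; [assumption|eapply ann_eq; eauto].
  - cbn; use_ann u A.
    assert (tyeq X F G (inst1 B u) (inst1 B (ann u A))) by (eapply inst1_same with (A := A); try eassumption; apply q_sym; eassumption).
    assert (tyeq X F G (inst1 B (erase u)) (inst1 B u)) by (eapply inst1_same with (A := A); try eassumption; apply q_sym; eassumption).
    split; [eapply conv_ty; [eapply t_app; eassumption|eapply tyeq_trans; eassumption]|].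
    eapply conv_eq; [eapply q_app; eassumption|assumption].
  - erewrite erase_Fst_syn by eassumption; split; [eapply t_fst; eassumption|eapply q_fst; eassumption].
  - cbn; split; [|eapply q_snd; eassumption].
    assert (tyeq X F G (inst1 B (Fst (erase p))) (inst1 B (Fst p)))
      by (eapply inst1_same with (A := A); eauto using q_sym, q_fst, t_fst).
    eapply conv_ty; [eapply t_snd; eassumption|assumption].
  - cbn; split; [eapply t_eapp; eassumption|].
    eapply q_eapp; eauto using e_refl.
  - cbn. assert (cI : Forall closed_shapes (Id (wk A) (wk a) (Var 0) :: A :: G)).
    { eapply sound_closed; [|eassumption]; eassumption. }
    repeat match goal with H : Forall closed_shapes ?G -> _, H' : Forall closed_shapes ?G |- _ =>
      specialize (H H') end.
    match goal with H : wf _ _ (_ :: _) C j |- _ => pose proof (wf_sound _ _ _ _ _ H cI) end.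
    repeat match goal with H : _ /\ _ |- _ => destruct H end.
    use_ann a A; use_ann b A.
    assert (tyeq X F G (Id A a a) (Id A a (ann a A)))
      by (exists i; apply q_id; eauto using q_refl, q_sym).
    assert (tyeq X F G (Id A a b) (Id A a (ann b A)))
      by (exists i; apply q_id; eauto using q_refl, q_sym).
    assert (X ∥ F ∥ G ⊢ Refl a ∈ Id A a (ann a A)) by (eapply conv_ty; eauto using t_refl).
    assert (X ∥ F ∥ G ⊢ Id A a (ann a A) ∈ Univ i) by (apply t_id; assumption).
    assert (X ∥ F ∥ G ⊢ Id A a (ann b A) ∈ Univ i) by (apply t_id; assumption).
    assert (X ∥ F ∥ G ⊢ Ann (Refl a) (Id A a (ann a A)) ≡ Refl a ∈ Id A a (ann a A))
      by (eapply ann_eq; eauto).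
    assert (X ∥ F ∥ G ⊢ Ann (Refl a) (Id A a (ann a A)) ∈ Id A a (ann a A))
      by (eapply ann_ty; eauto).
    assert (X ∥ F ∥ G ⊢ p ∈ Id A a (ann b A)) by (eapply conv_ty; eauto).
    assert (X ∥ F ∥ G ⊢ ann_path A a b p ∈ Id A a (ann b A))
      by (unfold ann_path; destruct (synth b); eauto using ann_ty).
    assert (X ∥ F ∥ G ⊢ ann_path A a b p ≡ p ∈ Id A a (ann b A))
      by (unfold ann_path; destruct (synth b); eauto using ann_eq, q_refl).
    assert (tyeq X F G (inst2 C (ann a A) (Ann (Refl a) (Id A a (ann a A)))) (inst2 C a (Refl a)))
      by (exists j; eapply inst2_eq with (A := A) (a := a) (i := i);
          eauto using q_refl, conv_ty, conv_eq, tyeq_sym, t_refl).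
    assert (tyeq X F G (inst2 C a (Refl a)) (inst2 (erase C) a (Refl a)))
      by (exists j; eapply inst2_eq with (A := A) (a := a) (i := i);
          eauto using q_refl, t_refl).
    assert (tyeq X F G (inst2 C b p) (inst2 C (ann b A) (ann_path A a b p)))
      by (exists j; eapply inst2_eq with (A := A) (a := a) (i := i);
          eauto using q_refl, q_sym, conv_ty, conv_eq, tyeq_sym).
    assert (tyeq X F G (inst2 (erase C) b (erase p)) (inst2 C b p))
      by (exists j; apply q_sym; eapply inst2_eq with (A := A) (a := a) (i := i);
          eauto using q_refl).
    split.
    + eapply conv_ty; [|eapply tyeq_trans; eassumption].
      eapply t_J with (A := A) (a := a) (i := i) (j := j); eauto using conv_ty, tyeq_trans.
    + eapply conv_eq; [|eassumption].
      eapply q_J with (A := A) (a := a) (i := i) (j := j); eauto using conv_eq, tyeq_trans.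
  - split; assumption.
  - split; assumption.
  - cbn; split; [eapply t_lam; eassumption|eapply q_lam; eassumption].
  - cbn. use_ann a A.
    assert (tyeq X F G (inst1 B (ann a A)) (inst1 B a)) by (eapply inst1_same with (A := A); eassumption).
    assert (tyeq X F G (inst1 B a) (inst1 B (erase a))) by (eapply inst1_same with (A := A); eassumption).
    split; [eapply t_pair|eapply q_pair]; eauto using conv_ty, conv_eq, tyeq_trans.
  - cbn.
    assert (tyeq X F G (Id A (erase a) (erase a)) (Id A a b))
      by (exists i; apply q_id; [apply q_refl|apply q_sym|eapply q_trans; [apply q_sym|]]; eassumption).
    assert (tyeq X F G (Id A a a) (Id A a b))
      by (exists i; apply q_id; [apply q_refl|apply q_refl|]; eassumption).
    split; [eapply conv_ty; [eapply t_refl; eassumption|assumption]|].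
    eapply conv_eq; [eapply q_Refl; eassumption|assumption].
  - cbn.
    assert (E : entails [K] [phi] psi)
      by (match goal with H : wf _ _ _ (Ext _ _ _ _ _) _ |- _ =>
            inversion H; subst; [match goal with P : syn _ _ _ (Ext _ _ _ _ _) _ |- _ => inversion P end|assumption]
          end).
    assert (K :: X ∥ phi :: map tshift F ∥ map cwk G ⊢ erase b ≡ a ∈ A).
    { eapply q_trans; [|eassumption]. apply q_sym.
      eapply equality_topes; [|apply (entails_shape X F K psi phi); assumption|]; assumption. }
    assert (X ∥ F ∥ G ⊢ ELam b ∈ Ext K psi A phi a) by (eapply t_elam; eassumption).
    split; [eapply t_elam; eassumption|eapply q_elam; eassumption].
  - cbn; split; [eapply t_recbot; eassumption|apply q_refl; eapply t_recbot; eassumption].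
  - cbn.
    assert (T1 : X ∥ F ∥ G ⊢ RecOr p q (erase a) (erase b) ∈ A).
    { eapply t_recor; try eassumption.
      eapply q_trans; [|eapply q_trans; [eassumption|]]; [apply q_sym|];
        (eapply equality_topes; [assumption| |eassumption]);
        intros g [<-|Hg]; try (apply e_hyp; right; exact Hg).
      - eapply e_and1, e_hyp; left; reflexivity.
      - eapply e_and2, e_hyp; left; reflexivity. }
    assert (T2 : X ∥ F ∥ G ⊢ RecOr p q a b ∈ A) by (eapply t_recor; eassumption).
    assert (W : forall g x, X ∥ F ∥ G ⊢ x ∈ A -> X ∥ g :: F ∥ G ⊢ x ∈ A).
    { intros g x Hx; eapply typing_topes; [assumption| |exact Hx].
      intros g' Hg; apply e_hyp; right; exact Hg. }
    split; [exact T1|].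
    eapply q_case; [eassumption|exact T2|exact T1| |].
    + eapply q_trans; [eapply q_recor1; [apply W, T2|eassumption|apply e_hyp; left; reflexivity]|].
      eapply q_trans; [eassumption|]. apply q_sym, q_recor1;
        [apply W, T1|eassumption|apply e_hyp; left; reflexivity].
    + eapply q_trans; [eapply q_recor2; [apply W, T2|eassumption|apply e_hyp; left; reflexivity]|].
      eapply q_trans; [eassumption|]. apply q_sym, q_recor2;
        [apply W, T1|eassumption|apply e_hyp; left; reflexivity].
  - split; [eapply cumul_le; eassumption|eapply cumul_eq_le; eassumption].
  - cbn; split; [|apply q_refl]; (eapply cumul_le with (i := S i); [lia|apply t_univ]).
  - cbn; split; [|apply q_pi; assumption].
    apply t_pi; [assumption|]; eapply context_conv with (A := A); eassumption.
  - cbn; split; [|apply q_sig; assumption].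
    apply t_sig; [assumption|]; eapply context_conv with (A := A); eassumption.
  - cbn; split; [|apply q_id; assumption].
    assert (tyeq X F G A (erase A)) by (exists i; assumption).
    apply t_id; eauto using conv_ty.
  - cbn; split; [|apply q_ext; assumption].
    apply t_ext; try assumption.
    assert (K :: X ∥ phi :: map tshift F ∥ map cwk G ⊢ A ≡ erase A ∈ Univ i).
    { eapply equality_topes; [|apply (entails_shape X F K psi phi); assumption|]; assumption. }
    eapply t_conv; eassumption.
Qed.

(** * A decision procedure for the tope layer *)

Scheme Equality for cube.
Scheme Equality for pt.
Scheme Equality for tope.
Scheme Equality for tm.

(** The connectives of [bool] as conditionals: these do not evaluate their second
    argument when the first decides, also under call by value. *)
Notation "a && b" := (if a then b else false) : bool_scope.
Notation "a || b" := (if a then true else b) : bool_scope.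

Lemma and_true (a b : bool) : a && b = true -> a = true /\ b = true.
Proof. destruct a; [auto|discriminate]. Qed.
Lemma or_true (a b : bool) : a || b = true -> a = true \/ b = true.
Proof. destruct a; auto. Qed.

Definition pt_eqb := Eval cbv beta delta [andb internal_nat_beq pt_beq] in pt_beq.
Definition cube_eqb := Eval cbv beta delta [andb cube_beq] in cube_beq.
Definition tope_eqb := Eval cbv beta delta [andb internal_nat_beq pt_beq tope_beq] in tope_beq.
Definition tm_eqb := Eval cbv beta delta [andb internal_nat_beq pt_beq cube_beq tope_beq tm_beq] in tm_beq.

Lemma cube_eqb_eq a b : cube_eqb a b = true -> a = b.
Proof. apply internal_cube_dec_bl. Qed.
Lemma pt_eqb_eq a b : pt_eqb a b = true -> a = b.
Proof. apply internal_pt_dec_bl. Qed.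
Lemma tope_eqb_eq a b : tope_eqb a b = true -> a = b.
Proof. apply internal_tope_dec_bl. Qed.
Lemma tm_eqb_eq a b : tm_eqb a b = true -> a = b.
Proof. apply internal_tm_dec_bl. Qed.

Fixpoint cube_of (X : list cube) (s : pt) : option cube :=
  match s with
  | PVar n => nth_error X n
  | PStar => Some C1
  | PZero | POne => Some C2
  | PPair s t =>
      match cube_of X s, cube_of X t with Some K, Some L => Some (CProd K L) | _, _ => None end
  | PFst s => match cube_of X s with Some (CProd K _) => Some K | _ => None end
  | PSnd s => match cube_of X s with Some (CProd _ L) => Some L | _ => None end
  end.

Lemma cube_of_sound X s : forall K, cube_of X s = Some K -> has_cube X s K.
Proof.
  induction s; intros K H; cbn in H;
    repeat match type of H with context [match ?x with _ => _ end] => destruct x eqn:? end;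
    try discriminate; try (injection H as <-); econstructor; eauto.
Qed.

Definition has_cube_b (X : list cube) (s : pt) (K : cube) : bool :=
  match cube_of X s with Some L => cube_eqb L K | None => false end.

Lemma has_cube_b_sound X s K : has_cube_b X s K = true -> has_cube X s K.
Proof.
  unfold has_cube_b; destruct (cube_of X s) eqn:E; [|discriminate].
  intro H; apply cube_eqb_eq in H; subst; apply cube_of_sound, E.
Qed.

Fixpoint is_tope_b (X : list cube) (p : tope) : bool :=
  match p with
  | TTop | TBot => true
  | TAnd p q | TOr p q => is_tope_b X p && is_tope_b X q
  | TEq s t => match cube_of X s with Some K => has_cube_b X t K | None => false end
  | TLe s t => has_cube_b X s C2 && has_cube_b X t C2
  end.

Lemma is_tope_b_sound X p : is_tope_b X p = true -> is_tope X p.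
Proof.
  induction p; cbn; intro H; try (apply and_true in H; destruct H).
  all: try solve [econstructor; eauto using has_cube_b_sound].
  destruct (cube_of X s) eqn:E; [|discriminate].
  econstructor; [apply cube_of_sound, E|apply has_cube_b_sound, H].
Qed.

(** Normal form of a point with respect to the computation rules for pairs. *)
Fixpoint pnf (s : pt) : pt :=
  match s with
  | PPair s t => PPair (pnf s) (pnf t)
  | PFst s => match pnf s with PPair a _ => a | s' => PFst s' end
  | PSnd s => match pnf s with PPair _ b => b | s' => PSnd s' end
  | _ => s
  end.

(** The tope layer has no rules for symmetry and transitivity of equality; they are
    instances of substitution. *)
Lemma e_sym X F s t K : has_cube X s K -> has_cube X t K ->
  entails X F (TEq s t) -> entails X F (TEq t s).
Proof.
  intros Hs Ht H.
  assert (E : entails X F (tinst (TEq (PVar 0) (pshift s)) t)).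
  { eapply e_subst with (s := s) (K := K); eauto.
    - econstructor; [constructor; reflexivity|].
      eapply has_cube_subst; [|exact Hs]; intros; constructor; assumption.
    - unfold tinst; cbn; rewrite psubst_inst; eapply e_refl; eassumption. }
  unfold tinst in E; cbn in E; rewrite psubst_inst in E; exact E.
Qed.

Lemma e_trans X F s t u K : has_cube X s K -> has_cube X t K -> has_cube X u K ->
  entails X F (TEq s t) -> entails X F (TEq t u) -> entails X F (TEq s u).
Proof.
  intros Hs Ht Hu H H'.
  assert (E : entails X F (tinst (TEq (pshift s) (PVar 0)) u)).
  { eapply e_subst with (s := t) (K := K); eauto.
    - econstructor; [|constructor; reflexivity].
      eapply has_cube_subst; [|exact Hs]; intros; constructor; assumption.
    - unfold tinst; cbn; rewrite psubst_inst; assumption. }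
  unfold tinst in E; cbn in E; rewrite psubst_inst in E; exact E.
Qed.

(** [c] is a point with a hole, the variable 0. *)
Lemma e_cong X F s t K L c : has_cube X s K -> has_cube X t K -> has_cube (K :: X) c L ->
  entails X F (TEq s t) ->
  entails X F (TEq (psubst (scons s PVar) c) (psubst (scons t PVar) c)).
Proof.
  intros Hs Ht Hc H.
  assert (Hcs : has_cube X (psubst (scons s PVar) c) L).
  { eapply has_cube_subst; [|exact Hc]; intros [|n] M E; cbn in *;
      [injection E as <-; assumption|constructor; assumption]. }
  assert (E : entails X F (tinst (TEq (pshift (psubst (scons s PVar) c)) c) t)).
  { eapply e_subst with (s := s) (K := K); eauto.
    - econstructor; [|exact Hc].
      eapply has_cube_subst; [|exact Hcs]; intros; constructor; assumption.
    - unfold tinst; cbn; rewrite psubst_inst; eapply e_refl; eassumption. }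
  unfold tinst in E; cbn in E; rewrite psubst_inst in E; exact E.
Qed.

Lemma e_le_of_eq X F s t : has_cube X s C2 -> has_cube X t C2 ->
  entails X F (TEq s t) -> entails X F (TLe s t).
Proof.
  intros Hs Ht H.
  assert (E : entails X F (tinst (TLe (pshift s) (PVar 0)) t)).
  { eapply e_subst with (s := s) (K := C2); eauto.
    - econstructor; [|constructor; reflexivity].
      eapply has_cube_subst; [|exact Hs]; intros; constructor; assumption.
    - unfold tinst; cbn; rewrite psubst_inst; apply e_le_refl; assumption. }
  unfold tinst in E; cbn in E; rewrite psubst_inst in E; exact E.
Qed.

Lemma has_cube_shift X s K L : has_cube X s K -> has_cube (L :: X) (pshift s) K.
Proof. intro H; eapply has_cube_subst; [|exact H]; intros; constructor; assumption. Qed.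

Lemma pnf_sound X F s : forall K, has_cube X s K ->
  has_cube X (pnf s) K /\ entails X F (TEq s (pnf s)).
Proof.
  induction s; intros K H; cbn; try (split; [exact H|eapply e_refl; exact H]).
  - inversion H as [| | | |? ? ? ? P1 P2| |]; subst.
    destruct (IHs1 _ P1) as [C1' E1], (IHs2 _ P2) as [C2' E2].
    split; [constructor; assumption|].
    eapply e_trans with (t := PPair (pnf s1) s2); try (constructor; eassumption).
    + pose proof (e_cong X F s1 (pnf s1) _ _ (PPair (PVar 0) (pshift s2)) P1 C1'
        ltac:(econstructor; [constructor; reflexivity|apply has_cube_shift; eassumption]) E1) as h.
      cbn in h; rewrite !psubst_inst in h; exact h.
    + pose proof (e_cong X F s2 (pnf s2) _ _ (PPair (pshift (pnf s1)) (PVar 0)) P2 C2'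
        ltac:(econstructor; [apply has_cube_shift; eassumption|constructor; reflexivity]) E2) as h.
      cbn in h; rewrite !psubst_inst in h; exact h.
  - inversion H; subst. match goal with P : has_cube X s (CProd _ _) |- _ => rename P into P0 end.
    destruct (IHs _ P0) as [C E].
    pose proof (e_cong X F s (pnf s) _ _ (PFst (PVar 0)) P0 C
        ltac:(econstructor; constructor; reflexivity) E) as h; cbn in h.
    destruct (pnf s) eqn:Ep; try (split; [econstructor; eassumption|exact h]).
    inversion C; subst; split; [assumption|].
    eapply e_trans; [exact H|econstructor; eassumption|eassumption|exact h|].
    eapply e_fst; eassumption.
  - inversion H; subst. match goal with P : has_cube X s (CProd _ _) |- _ => rename P into P0 end.
    destruct (IHs _ P0) as [C E].
    pose proof (e_cong X F s (pnf s) _ _ (PSnd (PVar 0)) P0 C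
        ltac:(econstructor; constructor; reflexivity) E) as h; cbn in h.
    destruct (pnf s) eqn:Ep; try (split; [econstructor; eassumption|exact h]).
    inversion C; subst; split; [assumption|].
    eapply e_trans; [exact H|econstructor; eassumption|eassumption|exact h|].
    eapply e_snd; eassumption.
Qed.

(** [E] lists known inequalities between normal points of the interval. *)
Definition edges := list (pt * pt).

Definition le_trivial (s t : pt) : bool :=
  pt_eqb s t || pt_eqb s PZero || pt_eqb t POne.

Fixpoint some {A : Type} (f : A -> bool) (l : list A) : bool :=
  match l with [] => false | x :: l => f x || some f l end.

Lemma some_exists {A : Type} (f : A -> bool) l : some f l = true -> exists x, In x l /\ f x = true.
Proof.
  induction l as [|x l IH]; cbn; [discriminate|]; intro H; apply or_true in H; destruct H as [H|H].
  - exists x; auto.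
  - destruct (IH H) as (y & h1 & h2); exists y; auto.
Qed.

Definition reach_step (E : edges) (l : list pt) : list pt :=
  fold_left (fun (l : list pt) (e : pt * pt) => let (a, b) := e in
    if some (pt_eqb b) l then l
    else if some (fun c => le_trivial c a) l then b :: l else l) E l.

Fixpoint reach (n : nat) (E : edges) (l : list pt) : list pt :=
  match n with
  | 0 => l
  | S n => let l' := reach_step E l in if length l' =? length l then l else reach n E l'
  end.

Definition le_dec (E : edges) (s t : pt) : bool :=
  le_trivial s t || some (fun c => le_trivial c t) (reach (length E) E [s]).

(** Points of the interval are equal if each is below the other, points of a product if
    their components are. *)
Fixpoint eq_dec (E : edges) (K : cube) (s t : pt) : bool :=
  match K with
  | C1 => true
  | C2 => le_dec E (pnf s) (pnf t) && le_dec E (pnf t) (pnf s)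
  | CProd K L => eq_dec E K (PFst s) (PFst t) && eq_dec E L (PSnd s) (PSnd t)
  end.

Fixpoint goal_dec (X : list cube) (E : edges) (g : tope) : bool :=
  match g with
  | TTop => true
  | TBot => false
  | TAnd p q => goal_dec X E p && goal_dec X E q
  | TOr p q => (goal_dec X E p && is_tope_b X q) || (is_tope_b X p && goal_dec X E q)
  | TEq s t => match cube_of X s with
               | Some K => has_cube_b X t K && eq_dec E K s t
               | None => false
               end
  | TLe s t => has_cube_b X s C2 && has_cube_b X t C2 && le_dec E (pnf s) (pnf t)
  end.

(** A disjunction such as [s <= t \/ t <= s] is provable without either side being so.
    These are the pairs of points on whose order the search branches. *)
Fixpoint comparisons (g : tope) : list (pt * pt) :=
  match g with
  | TAnd p q | TOr p q => comparisons p ++ comparisons q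
  | TEq s t | TLe s t => [(s, t)]
  | _ => []
  end.

Fixpoint split_goal (X : list cube) (E : edges) (l : list (pt * pt)) (g : tope) : bool :=
  goal_dec X E g || le_dec E POne PZero ||
  match l with
  | [] => false
  | (s, t) :: l =>
      has_cube_b X s C2 && has_cube_b X t C2 &&
      split_goal X ((pnf s, pnf t) :: E) l g && split_goal X ((pnf t, pnf s) :: E) l g
  end.

(** [w] lists hypotheses that still have to be decomposed. *)
Fixpoint entails_dec (n : nat) (X : list cube) (w : list tope) (E : edges) (g : tope) : bool :=
  match n with
  | 0 => false
  | S n =>
      match w with
      | [] => split_goal X E (match g with TOr _ _ => comparisons g | _ => [] end) g
      | TTop :: w => entails_dec n X w E g
      | TBot :: _ => is_tope_b X g
      | TAnd p q :: w => entails_dec n X (p :: q :: w) E g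
      | TOr p q :: w => entails_dec n X (p :: w) E g && entails_dec n X (q :: w) E g
      | TLe s t :: w =>
          if has_cube_b X s C2 && has_cube_b X t C2
          then entails_dec n X w ((pnf s, pnf t) :: E) g else entails_dec n X w E g
      | TEq s t :: w =>
          if has_cube_b X s C2 && has_cube_b X t C2
          then entails_dec n X w ((pnf s, pnf t) :: (pnf t, pnf s) :: E) g
          else entails_dec n X w E g
      end
  end.

(** The number bounds the steps in which the hypotheses are decomposed on a branch. *)
Definition ent (X : list cube) (F : list tope) (g : tope) : bool :=
  is_tope_b X g && entails_dec 200 X F [] g.

Definition edges_ok X F (E : edges) : Prop := forall a b, In (a, b) E ->
  has_cube X a C2 /\ has_cube X b C2 /\ entails X F (TLe a b).

Lemma le_trivial_sound X F s t : has_cube X s C2 -> has_cube X t C2 ->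
  le_trivial s t = true -> entails X F (TLe s t).
Proof.
  intros Hs Ht H; unfold le_trivial in H; apply or_true in H; destruct H as [H|H];
    [apply or_true in H; destruct H as [H|H]|]; apply pt_eqb_eq in H; subst.
  - apply e_le_refl; assumption.
  - apply e_le_zero; assumption.
  - apply e_le_one; assumption.
Qed.

Lemma le_dec_sound X F E s t : edges_ok X F E -> has_cube X s C2 -> has_cube X t C2 ->
  le_dec E s t = true -> entails X F (TLe s t).
Proof.
  intros HE Hs Ht H.
  set (R := fun l : list pt => forall c, In c l -> has_cube X c C2 /\ entails X F (TLe s c)).
  assert (Rs : forall E' l, incl E' E -> R l -> R (reach_step E' l)).
  { intro E'; unfold reach_step; induction E' as [|[a b] E' IH]; intros l I Rl; [exact Rl|]; cbn.
    assert (I' : incl E' E) by (intros x Hx; apply I; right; exact Hx).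
    destruct (some (pt_eqb b) l); [apply IH; assumption|].
    destruct (some _ l) eqn:Ee; [|apply IH; assumption].
    apply IH; [exact I'|]; intros c [<-|Hc]; [|auto].
    apply some_exists in Ee; destruct Ee as (c & Hc & Hl).
    destruct (Rl c Hc) as [Cc Ec]; destruct (HE a b) as (Ca & Cb & Eab); [apply I; left; reflexivity|].
    split; [exact Cb|]; eapply e_le_trans; [exact Ec|].
    eapply e_le_trans; [|exact Eab]; eapply le_trivial_sound; eassumption. }
  assert (Ri : forall n l, R l -> R (reach n E l)).
  { induction n; intros l Rl; cbn; [exact Rl|].
    destruct (_ =? _); [exact Rl|apply IHn, Rs; [apply incl_refl|exact Rl]]. }
  assert (R0 : R [s]) by (intros c [<-|[]]; split; [exact Hs|apply e_le_refl, Hs]).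
  unfold le_dec in H; apply or_true in H; destruct H as [H|H]; [eapply le_trivial_sound; eassumption|].
  apply some_exists in H; destruct H as (c & Hc & Hl).
  destruct (Ri _ _ R0 c Hc) as [Cc Ec]; eapply e_le_trans; [exact Ec|].
  eapply le_trivial_sound; eassumption.
Qed.

Lemma le_dec_pnf_sound X F E s t : edges_ok X F E -> has_cube X s C2 -> has_cube X t C2 ->
  le_dec E (pnf s) (pnf t) = true -> entails X F (TLe s t).
Proof.
  intros HE Hs Ht H.
  destruct (pnf_sound X F s C2 Hs) as [Cs Es], (pnf_sound X F t C2 Ht) as [Ct Et].
  eapply e_le_trans; [apply (e_le_of_eq X F s (pnf s)); assumption|].
  eapply e_le_trans; [exact (le_dec_sound X F E _ _ HE Cs Ct H)|].
  apply e_le_of_eq; [assumption|assumption|]; eapply e_sym; eassumption.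
Qed.

Lemma eq_dec_sound X F E K : forall s t, edges_ok X F E -> has_cube X s K -> has_cube X t K ->
  eq_dec E K s t = true -> entails X F (TEq s t).
Proof.
  induction K; intros s t HE Hs Ht H; cbn in H.
  - eapply e_trans; [exact Hs|constructor|exact Ht|apply e_star; exact Hs|].
    eapply e_sym; [exact Ht|constructor|apply e_star; exact Ht].
  - apply and_true in H; destruct H; apply e_le_anti; eapply le_dec_pnf_sound; eassumption.
  - apply and_true in H; destruct H as [H1 H2].
    assert (Cf : has_cube X (PFst s) K1) by (econstructor; eassumption).
    assert (Cf' : has_cube X (PFst t) K1) by (econstructor; eassumption).
    assert (Cs : has_cube X (PSnd s) K2) by (econstructor; eassumption).
    assert (Cs' : has_cube X (PSnd t) K2) by (econstructor; eassumption).
    apply IHK1 in H1; try assumption. apply IHK2 in H2; try assumption.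
    eapply e_trans with (t := PPair (PFst s) (PSnd s)) (K := CProd K1 K2);
      [exact Hs|constructor; assumption|exact Ht|eapply e_eta; exact Hs|].
    eapply e_trans with (t := PPair (PFst t) (PSnd t)) (K := CProd K1 K2);
      [constructor; assumption|constructor; assumption|exact Ht| |].
    2: { eapply e_sym; [exact Ht|constructor; assumption|eapply e_eta; exact Ht]. }
    eapply e_trans with (t := PPair (PFst t) (PSnd s)) (K := CProd K1 K2);
      try (constructor; assumption).
    + pose proof (e_cong X F _ _ _ _ (PPair (PVar 0) (pshift (PSnd s))) Cf Cf'
        ltac:(econstructor; [constructor; reflexivity|apply has_cube_shift; eassumption]) H1) as h.
      cbn in h; fold (pshift s) in h; rewrite !psubst_inst in h; exact h.
    + pose proof (e_cong X F _ _ _ _ (PPair (pshift (PFst t)) (PVar 0)) Cs Cs'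
        ltac:(econstructor; [apply has_cube_shift; eassumption|constructor; reflexivity]) H2) as h.
      cbn in h; fold (pshift t) in h; rewrite !psubst_inst in h; exact h.
Qed.

Lemma goal_dec_sound X F E g : edges_ok X F E -> goal_dec X E g = true -> entails X F g.
Proof.
  intro HE; induction g; cbn; intro H; try discriminate.
  - apply e_top.
  - apply and_true in H; destruct H; apply e_and; auto.
  - apply or_true in H; destruct H as [H|H]; apply and_true in H; destruct H.
    + apply e_or1; auto using is_tope_b_sound.
    + apply e_or2; auto using is_tope_b_sound.
  - destruct (cube_of X s) eqn:Ec; [|discriminate].
    apply and_true in H; destruct H.
    eapply eq_dec_sound; eauto using cube_of_sound, has_cube_b_sound.
  - apply and_true in H; destruct H as [H H']; apply and_true in H; destruct H.
    eapply le_dec_pnf_sound; eauto using has_cube_b_sound.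
Qed.

Lemma e_absurd X F g : is_tope X g -> entails X F (TLe POne PZero) -> entails X F g.
Proof.
  intros Hg H; apply e_bot; [exact Hg|]; apply e_zero_one, e_le_anti; [|exact H].
  apply e_le_zero; constructor.
Qed.

Lemma edges_ok_incl X F F' E : incl F F' -> edges_ok X F E -> edges_ok X F' E.
Proof.
  intros I H a b Hab; destruct (H a b Hab) as (? & ? & ?); repeat split; auto.
  eapply entails_incl; eassumption.
Qed.

Lemma edge_ok X F s t E : edges_ok X F E -> has_cube X s C2 -> has_cube X t C2 ->
  entails X F (TLe s t) -> edges_ok X F ((pnf s, pnf t) :: E).
Proof.
  intros HE Hs Ht H a b [Hab|Hab]; [|auto]; injection Hab as <- <-.
  destruct (pnf_sound X F s C2 Hs) as [Cs Es], (pnf_sound X F t C2 Ht) as [Ct Et].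
  repeat split; try assumption.
  eapply e_le_trans; [apply e_le_of_eq; [exact Cs|exact Hs|eapply e_sym; eassumption]|].
  eapply e_le_trans; [exact H|apply e_le_of_eq; assumption].
Qed.

Lemma split_goal_sound X l g : is_tope X g -> forall F E, edges_ok X F E ->
  split_goal X E l g = true -> entails X F g.
Proof.
  intro Hg; induction l as [|[s t] l IH]; intros F E HE H; cbn in H;
    repeat (apply or_true in H; destruct H as [H|H]);
    try (eapply goal_dec_sound; eassumption);
    try (apply e_absurd; [exact Hg|eapply le_dec_sound; eauto; constructor]);
    try discriminate.
  repeat (apply and_true in H; let h := fresh in destruct H as [H h]).
  apply has_cube_b_sound in H, H2.
  eapply e_case; [apply (e_le_total X F s t); assumption| |].
  - eapply IH; [|exact H1]; apply edge_ok; try assumption.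
    + eapply edges_ok_incl; [|exact HE]; intros x Hx; right; exact Hx.
    + apply e_hyp; left; reflexivity.
  - eapply IH; [|exact H0]; apply edge_ok; try assumption.
    + eapply edges_ok_incl; [|exact HE]; intros x Hx; right; exact Hx.
    + apply e_hyp; left; reflexivity.
Qed.

Lemma entails_dec_sound n X g : is_tope X g -> forall F w E,
  (forall p, In p w -> entails X F p) -> edges_ok X F E ->
  entails_dec n X w E g = true -> entails X F g.
Proof.
  intro Hg; induction n as [|n IH]; intros F w E Hw HE H; [discriminate|]; cbn in H.
  destruct w as [|p w]; [eapply split_goal_sound; eassumption|].
  assert (Hp : entails X F p) by (apply Hw; left; reflexivity).
  assert (Hw' : forall q, In q w -> entails X F q) by (intros; apply Hw; right; assumption).
  destruct p.
  - eapply IH; eassumption.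
  - apply e_bot; assumption.
  - eapply IH; [| |exact H]; [|assumption].
    intros q [<-|[<-|Hq]]; [eapply e_and1|eapply e_and2|]; eauto.
  - apply and_true in H; destruct H as [H1 H2].
    eapply e_case; [exact Hp| |].
    + eapply IH; [| |exact H1].
      * intros q [<-|Hq]; [apply e_hyp; left; reflexivity|].
        eapply entails_incl; [apply Hw', Hq|intros x Hx; right; exact Hx].
      * eapply edges_ok_incl; [|exact HE]; intros x Hx; right; exact Hx.
    + eapply IH; [| |exact H2].
      * intros q [<-|Hq]; [apply e_hyp; left; reflexivity|].
        eapply entails_incl; [apply Hw', Hq|intros x Hx; right; exact Hx].
      * eapply edges_ok_incl; [|exact HE]; intros x Hx; right; exact Hx.
  - destruct (has_cube_b X s C2 && has_cube_b X t C2) eqn:Ec; [|eapply IH; eassumption].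
    apply and_true in Ec; destruct Ec as [Cs Ct]; apply has_cube_b_sound in Cs, Ct.
    eapply IH; [exact Hw'| |exact H].
    apply edge_ok; [apply edge_ok; [assumption|assumption|assumption|]|assumption|assumption|].
    + apply e_le_of_eq; [assumption|assumption|eapply e_sym; [exact Cs|exact Ct|exact Hp]].
    + apply e_le_of_eq; assumption.
  - destruct (has_cube_b X s C2 && has_cube_b X t C2) eqn:Ec; [|eapply IH; eassumption].
    apply and_true in Ec; destruct Ec as [Cs Ct]; apply has_cube_b_sound in Cs, Ct.
    eapply IH; [exact Hw'| |exact H]; apply edge_ok; assumption.
Qed.

Lemma ent_sound X F g : ent X F g = true -> entails X F g.
Proof.
  unfold ent; intro H; apply and_true in H; destruct H as [Hg H].
  eapply entails_dec_sound; [apply is_tope_b_sound, Hg| | |exact H].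
  - intros p Hp; apply e_hyp, Hp.
  - intros a b [].
Qed.

(** * The type checker *)

(** A context of the checker: an entry [A] carries the number [k] of cube variables by
    which it still has to be weakened, so that entering the scope of a cube variable
    does not traverse the types of the context. *)
Inductive lctx : Type :=
| lnil
| lcons (k : nat) (A : tm) (G : lctx).

Definition delayed (k : nat) (A : tm) : tm :=
  match k with 0 => A | _ => ren (fun n => k + n) (fun n => n) A end.

Fixpoint den (G : lctx) : list tm :=
  match G with lnil => [] | lcons k A G => delayed k A :: den G end.
Coercion den : lctx >-> list.

Fixpoint bump (G : lctx) : lctx :=
  match G with lnil => lnil | lcons k A G => lcons (S k) A (bump G) end.

Lemma den_bump G : den (bump G) = map cwk (den G).
Proof.
  induction G as [|k A G IH]; cbn; [reflexivity|]; rewrite IH; f_equal.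
  destruct k; cbn; unfold cwk; [reflexivity|rewrite ren_ren; reflexivity].
Qed.

Fixpoint lookup (G : lctx) (n : nat) : option tm :=
  match G, n with
  | lnil, _ => None
  | lcons k A _, 0 => Some (delayed k A)
  | lcons _ _ G, S n => lookup G n
  end.

Lemma lookup_den G : forall n, lookup G n = nth_error (den G) n.
Proof. induction G; intros [|n]; cbn; auto. Qed.

Definition as_ann (p : tm) : option (tm * tm) :=
  match p with Pair t (Refl T) => Some (t, T) | _ => None end.

Fixpoint typeof (G : lctx) (e : tm) : option tm :=
  match e with
  | Var n => option_map (shiftn n) (lookup G n)
  | App f u => match typeof G f with Some (Pi A B) => Some (inst1 B (ann u A)) | _ => None end
  | Fst p => match as_ann p with
             | Some (_, T) => Some T
             | None => match typeof G p with Some (Sig A B) => Some A | _ => None end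
             end
  | Snd p => match typeof G p with Some (Sig A B) => Some (inst1 B (Fst p)) | _ => None end
  | EApp f s => match typeof G f with Some (Ext _ _ A _ _) => Some (pinst A s) | _ => None end
  | J C d p => match typeof G p with
               | Some (Id A a b) => Some (inst2 C (ann b A) (ann_path A a b p))
               | _ => None
               end
  | _ => None
  end.

Lemma typeof_syn X F (G : lctx) e T : syn X F G e T -> typeof G e = Some T.
Proof.
  revert X F G e T.
  assert (H : forall X F (G : lctx) e T, syn X F G e T -> typeof G e = Some T); [|exact H].
  intros X F G e; revert X F G; induction e; intros X F G T H; inversion H; subst; cbn [typeof];
    try (erewrite IHe by eassumption); try (erewrite IHe1 by eassumption);
    try (erewrite IHe3 by eassumption); auto.
  - match goal with E : nth_error _ _ = _ |- _ => rewrite lookup_den, E; reflexivity end.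
  - destruct (as_ann e) as [[t U]|] eqn:E; [|reflexivity].
    destruct e; try discriminate;
      match goal with P : syn _ _ _ (Pair _ _) _ |- _ => inversion P end.
Qed.

Definition recast (S T e : tm) : tm := if tm_eqb S T then e else Ann e T.

(** [recast S T] moves from type [S] to [T]; in [cast] the former is computed. *)
Definition cast (G : lctx) (e T : tm) : tm :=
  match typeof G e with Some U => recast U T e | None => e end.

Definition is_type (t : tm) : bool :=
  match t with Univ _ | Pi _ _ | Sig _ _ | Id _ _ _ | Ext _ _ _ _ _ => true | _ => false end.

(** Equality up to annotations. *)
Definition sim (a b : tm) : bool := tm_eqb a b || tm_eqb (erase a) (erase b).

(** The disjunction of the [RecOr] at the head of a term.  Such a term does not reduce until
    one of the sides is known, so conversion branches on it. *)
Fixpoint stuck (e : tm) : option (tope * tope) :=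
  match e with
  | Fst p => match p with
             | Pair t (Refl _) =>
                 match t with RecOr p q _ _ => Some (p, q) | _ => if synth t then stuck t else None end
             | _ => stuck p
             end
  | App f _ => stuck f
  | Snd p => stuck p
  | EApp f _ => stuck f
  | J _ _ p => stuck p
  | _ => None
  end.

(** Neutral terms are compared without the annotations around them. *)
Fixpoint peel (e : tm) : tm :=
  match e with
  | Fst p => match p with
             | Pair t (Refl _) => if synth t then peel t else e
             | _ => e
             end
  | _ => e
  end.

(** Likewise conversion branches on the disjunctions in the tope context, as for the
    boundary of a shape. *)
Fixpoint find_or (F : list tope) : option (tope * tope * list tope) :=
  match F with
  | [] => None
  | TOr p q :: F => Some (p, q, F)
  | p :: F => match find_or F with Some (a, b, F') => Some (a, b, p :: F') | None => None end
  end.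

(** Moves [B] from the context [A' :: G] to [A :: G], where the types are equal but not
    identical: the variable is annotated with its former type. *)
Definition swap_hyp (A A' B : tm) : tm :=
  if tm_eqb A A' then B
  else subst PVar (scons (Ann (Var 0) (wk A')) (fun n => Var (S n))) B.

(** ** Soundness of conversion *)

(** Without injectivity of type formers, the type of an introduction form is compared with
    the type expected by the elimination before the redex is contracted.  Where the
    comparison fails, the term is left as it is. *)

Definition ok X F G : Prop := Forall closed_shapes G /\ context_ok X F G.

Lemma ok_cons X F G A i : ok X F G -> wf X F G A i -> ok X F (A :: G).
Proof.
  intros [c k] W; split; [constructor; eauto using wf_closed|eapply context_ok_cons; eauto].
Qed.

Lemma ok_shape X F G K p : ok X F G -> ok (K :: X) (p :: map tshift F) (map cwk G).
Proof.
  intros [c k]; split; [apply closed_shapes_map_cwk, c|apply context_ok_shape; assumption].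
Qed.

Lemma ok_topes X F G F' : topes_good F X F' PVar -> ok X F G -> ok X F' G.
Proof. intros h [c k]; split; [exact c|eapply context_ok_topes; eauto]. Qed.

Lemma topes_good_cons X F p : topes_good F X (p :: F) PVar.
Proof. intros g Hg; rewrite tsubst_id; apply e_hyp; right; exact Hg. Qed.

Lemma sim_erase a b : sim a b = true -> erase a = erase b.
Proof.
  intro E; apply or_true in E; destruct E as [E|E]; apply tm_eqb_eq in E; congruence.
Qed.

Lemma sim_chk X F G a b T : ok X F G -> chk X F G a T -> chk X F G b T -> sim a b = true ->
  X ∥ F ∥ G ⊢ a ≡ b ∈ T.
Proof.
  intros [c k] Ha Hb E; apply sim_erase in E.
  eapply q_trans; [apply (proj1 (proj2 annotated_erase)); eassumption|].
  rewrite E; apply q_sym, (proj1 (proj2 annotated_erase)); assumption.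
Qed.

Lemma sim_wf X F G A B i : ok X F G -> wf X F G A i -> wf X F G B i -> sim A B = true ->
  X ∥ F ∥ G ⊢ A ≡ B ∈ Univ i.
Proof.
  intros [c k] Ha Hb E; apply sim_erase in E.
  eapply q_trans; [apply (proj2 (proj2 annotated_erase)); eassumption|].
  rewrite E; apply q_sym, (proj2 (proj2 annotated_erase)); assumption.
Qed.

(** The result of reducing [e : T]: the type that it determines may be another form of [T]. *)
Definition red X F G e T c : Prop :=
  exists S, syn X F G c S /\ tyeq X F G S T /\ X ∥ F ∥ G ⊢ e ≡ c ∈ T.

Lemma ok_wf X F G e T : ok X F G -> syn X F G e T -> exists i, wf X F G T i.
Proof. intros [c k]; apply syn_wf; assumption. Qed.

Lemma ok_tyeq X F G A i : ok X F G -> wf X F G A i -> tyeq X F G A A.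
Proof. intros [c k] W; eapply tyeq_refl, wf_sound; eassumption. Qed.

Lemma ann_erase X F G t A T i j : ok X F G -> X ∥ F ∥ G ⊢ t ∈ A ->
  wf X F G A i -> wf X F G T j -> X ∥ F ∥ G ⊢ Ann t T ≡ t ∈ A.
Proof. intros [c k] H W W'; eapply ann_eq; eauto using wf_sound. Qed.

Lemma cast_ok X F G S T e i : ok X F G ->
  syn X F G e S -> tyeq X F G S T -> wf X F G T i ->
  syn X F G (recast S T e) T /\ X ∥ F ∥ G ⊢ e ≡ recast S T e ∈ S.
Proof.
  intros k He E W; destruct (ok_wf _ _ _ _ _ k He) as [j Wj]; unfold recast.
  destruct (tm_eqb S T) eqn:Eb.
  - apply tm_eqb_eq in Eb; subst; split; [exact He|apply q_refl, syn_sound; [assumption|apply k]].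
  - split; [eapply s_cast; eassumption|].
    apply q_sym; eapply ann_erase; eauto. apply syn_sound; [assumption|apply k].
Qed.

Lemma cast_typeof X F (G : lctx) S T e : syn X F G e S -> cast G e T = recast S T e.
Proof. intro H; unfold cast; rewrite (typeof_syn _ _ _ _ _ H); reflexivity. Qed.

(** Inversion of an annotation around an introduction form, resp. a cast. *)
Lemma syn_Ann_inv X F G t T S : syn X F G (Ann t T) S -> S = T /\
  exists i, wf X F G T i /\
  (synth t = false /\ chk X F G t T \/
   constant t = true /\ X ∥ F ∥ G ⊢ t ∈ T \/
   exists S', syn X F G t S' /\ tyeq X F G S' T).
Proof.
  intro H; inversion H; subst; try (split; [reflexivity|exists i; split; [assumption|]]).
  - left; auto.
  - right; right; eauto.
  - right; left; auto.
  - match goal with P : syn _ _ _ (Pair _ _) _ |- _ => inversion P end.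
Qed.

Lemma red_refl X F G e T : ok X F G -> syn X F G e T -> red X F G e T e.
Proof.
  intros k H; destruct (ok_wf _ _ _ _ _ k H) as [i W]; exists T; split; [exact H|].
  split; [eapply ok_tyeq; eassumption|apply q_refl, syn_sound; [exact H|apply k]].
Qed.

Lemma red_step X F G e e' T S c : X ∥ F ∥ G ⊢ e ≡ e' ∈ T -> tyeq X F G S T ->
  red X F G e' S c -> red X F G e T c.
Proof.
  intros H E (S' & H1 & H2 & H3); exists S'; split; [exact H1|].
  split; [eapply tyeq_trans; eassumption|].
  eapply q_trans; [exact H|]; eapply conv_eq; eassumption.
Qed.

Lemma chk_Ann_eq X F G t T i : ok X F G -> wf X F G T i -> chk X F G t T ->
  X ∥ F ∥ G ⊢ ann t T ≡ t ∈ T.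
Proof. intros [c k]; apply syn_ann_eq; assumption. Qed.

(** A redex that has been found by [whnf]: [e] at type [T] equals an annotated
    introduction form. *)
Lemma red_Ann X F G e T t U : ok X F G -> red X F G e T (Ann t U) -> synth t = false ->
  constant t = false ->
  chk X F G t U /\ tyeq X F G U T /\ X ∥ F ∥ G ⊢ e ≡ t ∈ T /\ exists i, wf X F G U i.
Proof.
  intros k (S & H1 & H2 & H3) E1 E2.
  destruct (syn_Ann_inv _ _ _ _ _ _ H1) as (-> & i & W & [[_ H]|[[H _]|(S' & H & _)]]).
  - split; [exact H|split; [exact H2|split; [|eauto]]].
    eapply q_trans; [exact H3|]. eapply conv_eq; [|exact H2].
    eapply ann_erase; eauto; apply chk_sound; [exact H|apply k].
  - congruence.
  - apply syn_synth in H; congruence.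
Qed.

Ltac absurd_syn := match goal with
  | P : syn _ _ _ (Lam _) _ |- _ => inversion P
  | P : syn _ _ _ (Pair _ _) _ |- _ => inversion P
  | P : syn _ _ _ (Refl _) _ |- _ => inversion P
  | P : syn _ _ _ (ELam _) _ |- _ => inversion P
  | P : syn _ _ _ (RecOr _ _ _ _) _ |- _ => inversion P
  | P : syn _ _ _ (Univ _) _ |- _ => inversion P
  | P : syn _ _ _ (Pi _ _) _ |- _ => inversion P
  | P : syn _ _ _ (Sig _ _) _ |- _ => inversion P
  | P : syn _ _ _ (Id _ _ _) _ |- _ => inversion P
  | P : syn _ _ _ (Ext _ _ _ _ _) _ |- _ => inversion P
  end.

Lemma wf_Pi_inv X F G A B i : wf X F G (Pi A B) i -> wf X F G A i /\ wf X F (A :: G) B i.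
Proof. inversion 1; subst; [absurd_syn|auto]. Qed.

Lemma wf_Sig_inv X F G A B i : wf X F G (Sig A B) i -> wf X F G A i /\ wf X F (A :: G) B i.
Proof. inversion 1; subst; [absurd_syn|auto]. Qed.

Lemma wf_Id_inv X F G A a b i : wf X F G (Id A a b) i ->
  wf X F G A i /\ chk X F G a A /\ chk X F G b A.
Proof. inversion 1; subst; [absurd_syn|auto]. Qed.

Lemma wf_Ext_inv X F G K psi A phi a i : wf X F G (Ext K psi A phi a) i ->
  is_tope [K] psi /\ is_tope [K] phi /\ entails [K] [phi] psi /\
  wf (K :: X) (psi :: map tshift F) (map cwk G) A i /\
  chk (K :: X) (phi :: map tshift F) (map cwk G) a A.
Proof. inversion 1; subst; [absurd_syn|auto]. Qed.

Lemma chk_Lam_inv X F G b A B : chk X F G (Lam b) (Pi A B) ->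
  exists i, wf X F G A i /\ chk X F (A :: G) b B.
Proof. inversion 1; subst; [absurd_syn|eauto]. Qed.

Lemma chk_Pair_inv X F G a b A B : chk X F G (Pair a b) (Sig A B) ->
  exists i, wf X F G A i /\ wf X F (A :: G) B i /\ chk X F G a A /\
    chk X F G b (inst1 B (ann a A)).
Proof. inversion 1; subst; [absurd_syn|eauto 6]. Qed.

Lemma chk_Refl_inv X F G a A u v : chk X F G (Refl a) (Id A u v) ->
  a = u /\ exists i, wf X F G A i /\ chk X F G u A /\ chk X F G v A /\ X ∥ F ∥ G ⊢ u ≡ v ∈ A.
Proof. inversion 1; subst; [absurd_syn|eauto 8]. Qed.

Lemma chk_ELam_inv X F G b K psi A phi a : chk X F G (ELam b) (Ext K psi A phi a) ->
  (exists i, wf X F G (Ext K psi A phi a) i) /\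
  chk (K :: X) (psi :: map tshift F) (map cwk G) b A.
Proof. inversion 1; subst; [absurd_syn|eauto]. Qed.

Lemma chk_RecOr_inv X F G p q a b A : chk X F G (RecOr p q a b) A ->
  exists i, wf X F G A i /\ chk X (p :: F) G a A /\ chk X (q :: F) G b A.
Proof.
  inversion 1; subst; [absurd_syn| |eauto].
  match goal with P : wf _ _ _ (RecOr _ _ _ _) _ |- _ => inversion P; subst; absurd_syn end.
Qed.

Lemma syn_App_inv X F G f u T : syn X F G (App f u) T -> exists A B i,
  wf X F G A i /\ wf X F (A :: G) B i /\ syn X F G f (Pi A B) /\ chk X F G u A /\
  T = inst1 B (ann u A).
Proof. inversion 1; subst; eauto 10. Qed.

Lemma syn_Fst_inv X F G p T : as_ann p = None -> syn X F G (Fst p) T ->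
  exists B, syn X F G p (Sig T B).
Proof. intro E; inversion 1; subst; try discriminate; eauto. Qed.

Lemma syn_Snd_inv X F G p T : syn X F G (Snd p) T ->
  exists A B, syn X F G p (Sig A B) /\ T = inst1 B (Fst p).
Proof. inversion 1; subst; eauto. Qed.

Lemma syn_EApp_inv X F G f s T : syn X F G (EApp f s) T -> exists K psi A phi a,
  syn X F G f (Ext K psi A phi a) /\ has_cube X s K /\ entails X F (tinst psi s) /\
  T = pinst A s.
Proof. inversion 1; subst; eauto 10. Qed.

Section Step.
(** The functions below call each other on smaller problems through these parameters;
    the recursion is tied afterwards. *)
Variable whnf : list cube -> list tope -> lctx -> tm -> tm.
Variable whnfTy : list cube -> list tope -> lctx -> tm -> tm.
Variable conv : list cube -> list tope -> lctx -> tm -> tm -> tm -> bool.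
Variable convF : list cube -> list tope -> lctx -> tm -> tm -> tm -> bool.
Variable convTy : list cube -> list tope -> lctx -> tm -> tm -> bool.
Variable convTyF : list cube -> list tope -> lctx -> tm -> tm -> bool.
Variable convNe : list cube -> list tope -> lctx -> tm -> tm -> bool.

Definition whnf' (X : list cube) (F : list tope) (G : lctx) (e : tm) : tm :=
    match e with
    | Fst p =>
        match as_ann p with
        | Some (t, T) =>
            if synth t then whnf X F G t
            else match t with
                 | RecOr p q a b =>
                     if ent X F p then whnf X F G (ann a T)
                     else if ent X F q then whnf X F G (ann b T) else e
                 | _ => e
                 end
        | None =>
            match typeof G p with
            | Some (Sig A' B') =>
                let c := whnf X F G p in
                match c with
                | Fst (Pair (Pair a b) (Refl (Sig A B))) =>
                    if tm_eqb A A' || convTy X F G A A' then whnf X F G (ann a A) else e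
                | _ => Fst (cast G c (Sig A' B'))
                end
            | _ => e
            end
        end
    | Snd p =>
        match typeof G p with
        | Some (Sig A' B') =>
            let c := whnf X F G p in
            match c with
            | Fst (Pair (Pair a b) (Refl (Sig A B))) =>
                if tm_eqb (Sig A B) (Sig A' B') ||
                   convTy X F G (inst1 B (ann a A)) (inst1 B' (Fst p))
                then whnf X F G (ann b (inst1 B (ann a A))) else e
            | _ =>
                Snd (cast G c (Sig A' B'))
            end
        | _ => e
        end
    | App f u =>
        match typeof G f with
        | Some (Pi A B) =>
            let c := whnf X F G f in
            match c with
            | Fst (Pair (Lam b) (Refl (Pi A0 B0))) =>
                if tm_eqb (Pi A0 B0) (Pi A B)
                then whnf X F G (ann (inst1 b (ann u A)) (inst1 B (ann u A)))
                else e
            | _ => App (cast G c (Pi A B)) u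
            end
        | _ => e
        end
    | EApp f s =>
        match typeof G f with
        | Some (Ext K psi A phi a) =>
            if ent X F (tinst phi s) then whnf X F G (ann (pinst a s) (pinst A s))
            else
            let c := whnf X F G f in
            match c with
            | Fst (Pair (ELam b) (Refl (Ext K0 psi0 A0 phi0 a0))) =>
                if cube_eqb K K0 && ent X F (tinst psi0 s) &&
                   (tm_eqb A A0 || convTy X F G (pinst A0 s) (pinst A s))
                then whnf X F G (ann (pinst b s) (pinst A0 s)) else e
            | _ => EApp (cast G c (Ext K psi A phi a)) s
            end
        | _ => e
        end
    | J C d p =>
        match typeof G p with
        | Some (Id A a b) =>
            let c := whnf X F G p in
            match c with
            | Fst (Pair (Refl a1) (Refl (Id A0 a0 b0))) =>
                if tm_eqb (Id A0 a0 b0) (Id A a b) ||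
                   (convTy X F G A0 A && conv X F G A (recast A0 A (ann a0 A0)) a &&
                    conv X F G A (recast A0 A (ann b0 A0)) b)
                then whnf X F G (ann d (inst2 C (ann a A) (Ann (Refl a) (Id A a (ann a A))))) else e
            | _ => J C d (cast G c (Id A a b))
            end
        | _ => e
        end
    | _ => e
    end.

Definition whnfTy' (X : list cube) (F : list tope) (G : lctx) (A : tm) : tm :=
    if synth A then
      match whnf X F G A, typeof G A with
      | Fst (Pair A' (Refl (Univ j))) as c, Some U =>
          if is_type A' && tm_eqb (Univ j) U then A' else cast G c U
      | c, Some U => cast G c U
      | _, _ => A
      end
    else A.

Definition conv' (X : list cube) (F : list tope) (G : lctx) (T a b : tm) : bool :=
    sim a b ||
    let T' := whnfTy X F G T in
    let a1 := recast T T' (ann a T) in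
    let b1 := recast T T' (ann b T) in
    match T' with
    | Pi A B => conv X F (lcons 0 A G) B (App (wk a1) (Var 0)) (App (wk b1) (Var 0))
    | Sig A B =>
        conv X F G A (Fst a1) (Fst b1) &&
        conv X F G (inst1 B (Fst a1)) (Snd a1) (recast (inst1 B (Fst b1)) (inst1 B (Fst a1)) (Snd b1))
    | Ext K psi A _ _ =>
        convF (K :: X) (psi :: map tshift F) (bump G) A
              (EApp (cwk a1) (PVar 0)) (EApp (cwk b1) (PVar 0))
    | Univ _ => convTy X F G a1 b1
    | _ =>
        let a2 := whnf X F G a1 in
        let b2 := whnf X F G b1 in
        match (match stuck a2 with Some d => Some d | None => stuck b2 end) with
        | Some (p, q) =>
            ent X F (TOr p q) && conv X (p :: F) G T a b && conv X (q :: F) G T a b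
        | None => convNe X F G a2 b2
        end
    end.

Definition convF' (X : list cube) (F : list tope) (G : lctx) (T a b : tm) : bool :=
    match find_or F with
    | Some (p, q, F') =>
        is_tope_b X p && is_tope_b X q && convF X (p :: F') G T a b && convF X (q :: F') G T a b
    | None => ent X F TBot || conv X F G T a b
    end.

Definition convTy' (X : list cube) (F : list tope) (G : lctx) (A B : tm) : bool :=
    sim A B ||
    match whnfTy X F G A, whnfTy X F G B with
    | Univ i, Univ j => Nat.eqb i j
    | Pi A1 B1, Pi A2 B2 =>
        convTy X F G A1 A2 && convTy X F (lcons 0 A1 G) B1 (swap_hyp A1 A2 B2)
    | Sig A1 B1, Sig A2 B2 =>
        convTy X F G A1 A2 && convTy X F (lcons 0 A1 G) B1 (swap_hyp A1 A2 B2)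
    | Id A1 a1 b1, Id A2 a2 b2 =>
        convTy X F G A1 A2 &&
        conv X F G A1 a1 (if tm_eqb A1 A2 then a2 else Ann (ann a2 A2) A1) &&
        conv X F G A1 b1 (if tm_eqb A1 A2 then b2 else Ann (ann b2 A2) A1)
    | Ext K1 psi1 A1 phi1 a1, Ext K2 psi2 A2 phi2 a2 =>
        cube_eqb K1 K2 && tope_eqb psi1 psi2 && tope_eqb phi1 phi2 &&
        convTyF (K1 :: X) (psi1 :: map tshift F) (bump G) A1 A2 &&
        convF (K1 :: X) (phi1 :: map tshift F) (bump G) A1 a1
              (if tm_eqb A1 A2 then a2 else Ann (ann a2 A2) A1)
    | A', B' =>
        match synth A', synth B', typeof G A' with
        | true, true, Some (Univ _) => convNe X F G A' B'
        | _, _, _ => false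
        end
    end.

Definition convTyF' (X : list cube) (F : list tope) (G : lctx) (A B : tm) : bool :=
    match find_or F with
    | Some (p, q, F') =>
        is_tope_b X p && is_tope_b X q && convTyF X (p :: F') G A B && convTyF X (q :: F') G A B
    | None => ent X F TBot || convTy X F G A B
    end.

Definition convNe' (X : list cube) (F : list tope) (G : lctx) (a b : tm) : bool :=
    let a := peel a in
    let b := peel b in
    tm_eqb a b ||
    match a, b with
    | App f u, App g v =>
        convNe X F G f g &&
        match typeof G f, typeof G g with
        | Some (Pi A _), Some (Pi A' _) =>
            (tm_eqb A A' || convTy X F G A' A) && conv X F G A u (recast A' A (ann v A'))
        | _, _ => false
        end
    | Fst p, Fst q =>
        match as_ann p, as_ann q with None, None => convNe X F G p q | _, _ => false end
    | Snd p, Snd q => convNe X F G p q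
    | EApp f s, EApp g t =>
        convNe X F G f g &&
        match typeof G f with
        | Some (Ext K _ _ _ _) => has_cube_b X t K && ent X F (TEq s t)
        | _ => false
        end
    | _, _ => false
    end.

Hypothesis IHwhnf : forall X F (G : lctx) e T, ok X F G -> syn X F G e T ->
  red X F G e T (whnf X F G e).
Hypothesis IHwhnfTy : forall X F (G : lctx) A i, ok X F G -> wf X F G A i ->
  wf X F G (whnfTy X F G A) i /\ X ∥ F ∥ G ⊢ A ≡ whnfTy X F G A ∈ Univ i.
Hypothesis IHconv : forall X F (G : lctx) T a b i, ok X F G -> wf X F G T i ->
  chk X F G a T -> chk X F G b T -> conv X F G T a b = true -> X ∥ F ∥ G ⊢ a ≡ b ∈ T.
Hypothesis IHconvF : forall X F (G : lctx) T a b i, ok X F G -> wf X F G T i ->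
  chk X F G a T -> chk X F G b T -> convF X F G T a b = true -> X ∥ F ∥ G ⊢ a ≡ b ∈ T.
Hypothesis IHconvTy : forall X F (G : lctx) A B i, ok X F G -> wf X F G A i -> wf X F G B i ->
  convTy X F G A B = true -> X ∥ F ∥ G ⊢ A ≡ B ∈ Univ i.
Hypothesis IHconvTyF : forall X F (G : lctx) A B i, ok X F G -> wf X F G A i -> wf X F G B i ->
  convTyF X F G A B = true -> X ∥ F ∥ G ⊢ A ≡ B ∈ Univ i.
Hypothesis IHconvNe : forall X F (G : lctx) a b S S', ok X F G -> syn X F G a S -> syn X F G b S' ->
  convNe X F G a b = true ->
  X ∥ F ∥ G ⊢ a ≡ b ∈ S /\ X ∥ F ∥ G ⊢ b ∈ S.


Lemma IHconv_cons X F (G : lctx) A T a b i : ok X F (A :: G) -> wf X F (A :: G) T i ->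
  chk X F (A :: G) a T -> chk X F (A :: G) b T -> conv X F (lcons 0 A G) T a b = true ->
  X ∥ F ∥ A :: G ⊢ a ≡ b ∈ T.
Proof. apply (IHconv X F (lcons 0 A G)). Qed.

Lemma IHconvTy_cons X F (G : lctx) A T U i : ok X F (A :: G) -> wf X F (A :: G) T i ->
  wf X F (A :: G) U i -> convTy X F (lcons 0 A G) T U = true -> X ∥ F ∥ A :: G ⊢ T ≡ U ∈ Univ i.
Proof. apply (IHconvTy X F (lcons 0 A G)). Qed.

Lemma IHconvF_shape X F (G : lctx) T a b i : ok X F (map cwk G) -> wf X F (map cwk G) T i ->
  chk X F (map cwk G) a T -> chk X F (map cwk G) b T -> convF X F (bump G) T a b = true ->
  X ∥ F ∥ map cwk G ⊢ a ≡ b ∈ T.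
Proof. rewrite <- den_bump; apply IHconvF. Qed.

Lemma IHconvTyF_shape X F (G : lctx) T U i : ok X F (map cwk G) -> wf X F (map cwk G) T i ->
  wf X F (map cwk G) U i -> convTyF X F (bump G) T U = true -> X ∥ F ∥ map cwk G ⊢ T ≡ U ∈ Univ i.
Proof. rewrite <- den_bump; apply IHconvTyF. Qed.

Lemma wf_le X F G A i j : wf X F G A i -> i <= j -> wf X F G A j.
Proof.
  intros H; revert j; induction H; intros j' L.
  - eapply wf_ne; [eassumption|lia].
  - eapply wf_univ; lia.
  - apply wf_pi; auto.
  - apply wf_sig; auto.
  - apply wf_id; auto.
  - apply wf_ext; auto.
Qed.

Lemma convTy_tyeq X F (G : lctx) A B i j : ok X F G -> wf X F G A i -> wf X F G B j ->
  convTy X F G A B = true -> tyeq X F G A B.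
Proof.
  intros k W W' H; exists (max i j); eapply IHconvTy; eauto; eapply wf_le; eauto; lia.
Qed.

Lemma same_tyeq X F (G : lctx) A B i j : ok X F G -> wf X F G A i -> wf X F G B j ->
  tm_eqb A B || convTy X F G A B = true -> tyeq X F G A B.
Proof.
  intros k W W' H; apply or_true in H; destruct H as [H|H].
  - apply tm_eqb_eq in H; subst; eapply ok_tyeq; eassumption.
  - eapply convTy_tyeq; eassumption.
Qed.

Ltac bash N := repeat match goal with
  | |- red _ _ _ _ _ (match ?x with _ => _ end) => is_var x; destruct x; try exact N
  end.

Lemma whnf_app X F (G : lctx) f u A B i : ok X F G -> wf X F G A i -> wf X F (A :: G) B i ->
  syn X F G f (Pi A B) -> chk X F G u A ->
  red X F G (App f u) (inst1 B (ann u A)) (whnf' X F G (App f u)).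
Proof.
  intros k WA WB Hf Hu.
  assert (Hua : syn X F G (ann u A) A) by (eapply syn_ann; eauto).
  assert (cA : closed_shapes A) by (eapply wf_closed; [apply k|exact WA]).
  assert (Wr : wf X F G (inst1 B (ann u A)) i) by (eapply wf_inst1; eauto; apply k).
  assert (Sf : X ∥ F ∥ G ⊢ f ∈ Pi A B) by (apply syn_sound; [exact Hf|apply k]).
  assert (Su : X ∥ F ∥ G ⊢ u ∈ A) by (apply chk_sound; [exact Hu|apply k]).
  assert (Sua : X ∥ F ∥ G ⊢ ann u A ∈ A) by (apply syn_sound; [exact Hua|apply k]).
  assert (SA : X ∥ F ∥ G ⊢ A ∈ Univ i) by (apply wf_sound; [exact WA|apply k]).
  assert (kA : ok X F (A :: G)) by (eapply ok_cons; eauto).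
  assert (SB : X ∥ F ∥ A :: G ⊢ B ∈ Univ i) by (apply wf_sound; [exact WB|apply kA]).
  assert (Eu : X ∥ F ∥ G ⊢ ann u A ≡ u ∈ A) by (eapply chk_Ann_eq; eauto).
  assert (Er : tyeq X F G (inst1 B u) (inst1 B (ann u A)))
    by (exists i; eapply inst1_eq; eauto using q_refl, q_sym).
  cbn [whnf']; rewrite (typeof_syn _ _ _ _ _ Hf).
  pose proof (IHwhnf _ _ _ _ _ k Hf) as Rf; remember (whnf X F G f) as c eqn:Ec; clear Ec.
  assert (N : red X F G (App f u) (inst1 B (ann u A)) (App (cast G c (Pi A B)) u)).
  { destruct Rf as (S & H1 & H2 & H3); rewrite (cast_typeof _ _ _ _ _ _ H1).
    destruct (cast_ok _ _ _ _ _ _ i k H1 H2) as [H4 H5]; [apply wf_pi; assumption|].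
    exists (inst1 B (ann u A)); split; [eapply s_app; eauto|].
    split; [eapply ok_tyeq; eauto|]. eapply conv_eq; [|exact Er].
    eapply q_app; [|apply q_refl, Su]. eapply q_trans; [exact H3|].
    eapply conv_eq; [exact H5|exact H2]. }
  assert (Z : red X F G (App f u) (inst1 B (ann u A)) (App f u))
    by (apply red_refl; [exact k|eapply s_app; eauto]).
  cbn zeta; bash N.
  match goal with |- context [tm_eqb (Pi ?x1 ?x2) (Pi A B)] => rename x1 into A0, x2 into B0 end.
  match type of Rf with context [Lam ?x] => rename x into b end.
  destruct (red_Ann _ _ _ _ _ _ _ k Rf eq_refl eq_refl) as (Cb & Tb & Eb & j & Wb).
  destruct (chk_Lam_inv _ _ _ _ _ _ Cb) as (i0' & WA0 & Cbody).
  destruct (tm_eqb (Pi A0 B0) (Pi A B)) eqn:Eq.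
  - apply tm_eqb_eq in Eq; injection Eq; intros; subst A0 B0.
    assert (Hr : syn X F G (ann (inst1 b (ann u A)) (inst1 B (ann u A))) (inst1 B (ann u A))).
    { eapply syn_ann; [exact Wr|]; eapply chk_inst1; eauto; apply k. }
    eapply red_step; [|eapply ok_tyeq; eauto|apply IHwhnf; [exact k|exact Hr]].
    assert (Sb : X ∥ F ∥ A :: G ⊢ b ∈ B) by (apply chk_sound; [assumption|apply kA]).
    eapply q_trans; [eapply conv_eq; [eapply q_app; [exact Eb|apply q_refl, Su]|exact Er]|].
    eapply q_trans; [eapply conv_eq; [eapply q_pi_beta; eauto|exact Er]|].
    eapply q_trans; [eapply conv_eq; [|exact Er]; eapply inst1_eq_tm;
       [exact SA|exact SB|exact Sb|exact Sb|apply q_refl, Sb|exact Su|exact Sua|apply q_sym, Eu]|].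
    apply q_sym; eapply chk_Ann_eq; eauto. eapply chk_inst1; eauto; apply k.
  - exact Z.
Qed.

Lemma whnf_Ann X F (G : lctx) t T S : ok X F G -> syn X F G (Ann t T) S ->
  red X F G (Ann t T) S (whnf' X F G (Ann t T)).
Proof.
  intros k H; pose proof (red_refl _ _ _ _ _ k H) as Z.
  destruct (syn_Ann_inv _ _ _ _ _ _ H) as (-> & i & W & [[E C]|[[E C]|(S' & C & E)]]).
  - cbn [whnf' Ann as_ann]; rewrite E; destruct t; try exact Z.
    destruct (chk_RecOr_inv _ _ _ _ _ _ _ _ C) as (j & _ & C1 & C2).
    assert (Sr : X ∥ F ∥ G ⊢ RecOr p q t1 t2 ∈ T) by (apply chk_sound; [exact C|apply k]).
    assert (Er : X ∥ F ∥ G ⊢ Ann (RecOr p q t1 t2) T ≡ RecOr p q t1 t2 ∈ T)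
      by (eapply ann_erase; eauto).
    assert (step : forall r t, entails X F r -> chk X (r :: F) G t T ->
       (X ∥ F ∥ G ⊢ t ∈ T -> X ∥ F ∥ G ⊢ RecOr p q t1 t2 ≡ t ∈ T) ->
       red X F G (Ann (RecOr p q t1 t2) T) T (whnf X F G (ann t T))).
    { intros r t Hr Ct Et.
      assert (C' : chk X F G t T).
      { eapply chk_topes; [apply k| |exact Ct].
        intros g [<-|Hg]; rewrite tsubst_id; [exact Hr|apply e_hyp, Hg]. }
      eapply red_step; [|eapply ok_tyeq; eauto|apply IHwhnf; [exact k|eapply syn_ann; eauto]].
      eapply q_trans; [exact Er|].
      eapply q_trans; [apply Et; apply chk_sound; [exact C'|apply k]|].
      apply q_sym; eapply chk_Ann_eq; eauto. }
    destruct (ent X F p) eqn:E1; [|destruct (ent X F q) eqn:E2; [|exact Z]].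
    + apply ent_sound in E1; eapply step; eauto; intro; eapply q_recor1; eauto.
    + apply ent_sound in E2; eapply step; eauto; intro; eapply q_recor2; eauto.
  - cbn [whnf' Ann as_ann]; destruct t; try discriminate; exact Z.
  - assert (Es : synth t = true) by (eapply syn_synth; exact C).
    cbn [whnf' Ann as_ann]; rewrite Es.
    eapply red_step; [|exact E|apply IHwhnf; eauto].
    eapply ann_erase; eauto; eapply conv_ty; [|exact E]; apply syn_sound; [exact C|apply k].
Qed.

Lemma as_ann_none p X F G S : syn X F G p S -> as_ann p = None.
Proof. intro H; destruct p; try reflexivity; inversion H. Qed.

Lemma whnf_fst X F (G : lctx) p A B i : ok X F G -> wf X F G A i -> wf X F (A :: G) B i ->
  syn X F G p (Sig A B) -> red X F G (Fst p) A (whnf' X F G (Fst p)).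
Proof.
  intros k WA WB Hp.
  assert (Z : red X F G (Fst p) A (Fst p)) by (apply red_refl; [exact k|eapply s_fst; eauto]).
  cbn [whnf']; rewrite (as_ann_none _ _ _ _ _ Hp), (typeof_syn _ _ _ _ _ Hp).
  pose proof (IHwhnf _ _ _ _ _ k Hp) as R; remember (whnf X F G p) as c eqn:Ec; clear Ec.
  assert (N : red X F G (Fst p) A (Fst (cast G c (Sig A B)))).
  { destruct R as (S & H1 & H2 & H3); rewrite (cast_typeof _ _ _ _ _ _ H1).
    destruct (cast_ok _ _ _ _ _ _ i k H1 H2) as [H4 H5]; [apply wf_sig; assumption|].
    exists A; split; [eapply s_fst; eauto|]; split; [eapply ok_tyeq; eauto|].
    eapply q_fst; eapply q_trans; [exact H3|]; eapply conv_eq; [exact H5|exact H2]. }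
  cbn zeta; bash N.
  match type of R with red _ _ _ _ _ (Fst (Pair (Pair ?x1 ?x2) (Refl (Sig ?x3 ?x4)))) =>
    rename x1 into a, x2 into b, x3 into A0, x4 into B0 end.
  destruct (red_Ann _ _ _ _ _ _ _ k R eq_refl eq_refl) as (C & T & E & j & W).
  destruct (chk_Pair_inv _ _ _ _ _ _ _ C) as (l & WA0 & WB0 & Ca & Cb).
  destruct (tm_eqb A0 A || convTy X F G A0 A) eqn:Ez; [|exact Z].
  assert (TA : tyeq X F G A0 A) by (eapply same_tyeq; eauto).
  eapply red_step; [|exact TA|apply IHwhnf; [exact k|eapply syn_ann; eauto]].
  eapply q_trans; [eapply q_fst; exact E|]. eapply conv_eq; [|exact TA].
  eapply q_trans; [|apply q_sym; eapply chk_Ann_eq; eauto].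
  assert (Sa : X ∥ F ∥ G ⊢ a ∈ A0) by (apply chk_sound; [exact Ca|apply k]).
  assert (SA0 : X ∥ F ∥ G ⊢ A0 ∈ Univ l) by (apply wf_sound; [exact WA0|apply k]).
  assert (SB0 : X ∥ F ∥ A0 :: G ⊢ B0 ∈ Univ l)
    by (apply wf_sound; [exact WB0|eapply ok_cons; eauto]).
  eapply q_fst_beta; eauto.
  eapply conv_ty; [apply chk_sound; [exact Cb|apply k]|].
  exists l; eapply inst1_eq; eauto using q_refl.
  - apply syn_sound; [eapply syn_ann; eauto|apply k].
  - eapply chk_Ann_eq; eauto.
Qed.

Lemma whnf_snd X F (G : lctx) p A B i : ok X F G -> wf X F G A i -> wf X F (A :: G) B i ->
  syn X F G p (Sig A B) ->
  red X F G (Snd p) (inst1 B (Fst p)) (whnf' X F G (Snd p)).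
Proof.
  intros k WA WB Hp.
  assert (Z : red X F G (Snd p) (inst1 B (Fst p)) (Snd p))
    by (apply red_refl; [exact k|eapply s_snd with (A := A) (B := B); eauto]).
  assert (cA : closed_shapes A) by (eapply wf_closed; [apply k|exact WA]).
  assert (kA : ok X F (A :: G)) by (eapply ok_cons; eauto).
  assert (SA : X ∥ F ∥ G ⊢ A ∈ Univ i) by (apply wf_sound; [exact WA|apply k]).
  assert (SB : X ∥ F ∥ A :: G ⊢ B ∈ Univ i) by (apply wf_sound; [exact WB|apply kA]).
  assert (Hf : syn X F G (Fst p) A) by (eapply s_fst; eauto).
  assert (Sf : X ∥ F ∥ G ⊢ Fst p ∈ A) by (apply syn_sound; [exact Hf|apply k]).
  assert (Wr : wf X F G (inst1 B (Fst p)) i) by (eapply wf_inst1; eauto; apply k).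
  cbn [whnf']; rewrite (typeof_syn _ _ _ _ _ Hp).
  pose proof (IHwhnf _ _ _ _ _ k Hp) as R; remember (whnf X F G p) as c eqn:Ec; clear Ec.
  assert (N : red X F G (Snd p) (inst1 B (Fst p)) (Snd (cast G c (Sig A B)))).
  { destruct R as (S & H1 & H2 & H3); rewrite (cast_typeof _ _ _ _ _ _ H1).
    destruct (cast_ok _ _ _ _ _ _ i k H1 H2) as [H4 H5]; [apply wf_sig; assumption|].
    assert (E : X ∥ F ∥ G ⊢ p ≡ recast S (Sig A B) c ∈ Sig A B)
      by (eapply q_trans; [exact H3|]; eapply conv_eq; [exact H5|exact H2]).
    exists (inst1 B (Fst (recast S (Sig A B) c))); split; [eapply s_snd with (A := A) (B := B); eauto|].
    split; [|eapply q_snd; exact E].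
    exists i; eapply inst1_eq; eauto using q_refl.
    - eapply t_fst, syn_sound; [exact H4|apply k].
    - apply q_sym; eapply q_fst; exact E. }
  cbn zeta; bash N.
  match type of R with red _ _ _ _ _ (Fst (Pair (Pair ?x1 ?x2) (Refl (Sig ?x3 ?x4)))) =>
    rename x1 into a, x2 into b, x3 into A0, x4 into B0 end.
  destruct (red_Ann _ _ _ _ _ _ _ k R eq_refl eq_refl) as (C & T & E & j & W).
  destruct (chk_Pair_inv _ _ _ _ _ _ _ C) as (l & WA0 & WB0 & Ca & Cb).
  match goal with |- context [if ?x then _ else _] => destruct x eqn:Ez; [|exact Z] end.
  assert (Sa : X ∥ F ∥ G ⊢ a ∈ A0) by (apply chk_sound; [exact Ca|apply k]).
  assert (Ha : syn X F G (ann a A0) A0) by (eapply syn_ann; eauto).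
  assert (Saa : X ∥ F ∥ G ⊢ ann a A0 ∈ A0) by (apply syn_sound; [exact Ha|apply k]).
  assert (Ea : X ∥ F ∥ G ⊢ ann a A0 ≡ a ∈ A0) by (eapply chk_Ann_eq; eauto).
  assert (SA0 : X ∥ F ∥ G ⊢ A0 ∈ Univ l) by (apply wf_sound; [exact WA0|apply k]).
  assert (kA0 : ok X F (A0 :: G)) by (eapply ok_cons; eauto).
  assert (SB0 : X ∥ F ∥ A0 :: G ⊢ B0 ∈ Univ l) by (apply wf_sound; [exact WB0|apply kA0]).
  assert (cA0 : closed_shapes A0) by (eapply wf_closed; [apply k|exact WA0]).
  assert (W0 : wf X F G (inst1 B0 (ann a A0)) l) by (eapply wf_inst1; eauto; apply k).
  assert (Sb : X ∥ F ∥ G ⊢ b ∈ inst1 B0 (ann a A0)) by (apply chk_sound; [exact Cb|apply k]).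
  assert (Tb : tyeq X F G (inst1 B0 (ann a A0)) (inst1 B0 a))
    by (exists l; eapply inst1_eq; eauto using q_refl).
  assert (Sb' : X ∥ F ∥ G ⊢ b ∈ inst1 B0 a) by (eapply conv_ty; eauto).
  assert (Tr : tyeq X F G (inst1 B0 (ann a A0)) (inst1 B (Fst p))).
  { apply or_true in Ez; destruct Ez as [Ez|Ez]; [|eapply convTy_tyeq; eauto].
    apply tm_eqb_eq in Ez; injection Ez; intros; subst A0 B0.
    exists i; eapply inst1_eq; eauto using q_refl. eapply q_trans; [exact Ea|].
    apply q_sym; eapply q_trans; [eapply q_fst; exact E|]. eapply q_fst_beta; eauto. }
  eapply red_step; [|exact Tr|apply IHwhnf; [exact k|eapply syn_ann; eauto]].
  eapply q_trans; [eapply q_snd; exact E|].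
  eapply conv_eq; [|exact Tr]. eapply q_trans; [|apply q_sym; eapply chk_Ann_eq; eauto].
  eapply conv_eq; [eapply q_snd_beta; eauto|]. apply tyeq_sym, Tb.
Qed.

Lemma whnf_eapp X F (G : lctx) f s K psi A phi a i : ok X F G ->
  is_tope [K] psi -> wf (K :: X) (psi :: map tshift F) (map cwk G) A i ->
  syn X F G f (Ext K psi A phi a) -> has_cube X s K -> entails X F (tinst psi s) ->
  red X F G (EApp f s) (pinst A s) (whnf' X F G (EApp f s)).
Proof.
  intros k Hpsi WA Hf Hs He.
  assert (H0 : syn X F G (EApp f s) (pinst A s)) by (eapply s_eapp with (K := K) (psi := psi) (A := A) (phi := phi) (a := a); eauto).
  assert (Z : red X F G (EApp f s) (pinst A s) (EApp f s)) by (apply red_refl; assumption).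
  assert (Wr : wf X F G (pinst A s) i) by (eapply wf_pinst; eauto; apply k).
  destruct (ok_wf _ _ _ _ _ k Hf) as [j WE].
  destruct (wf_Ext_inv _ _ _ _ _ _ _ _ _ WE) as (_ & Hphi & Hpp & WA' & Ca).
  assert (Sf : X ∥ F ∥ G ⊢ f ∈ Ext K psi A phi a) by (apply syn_sound; [exact Hf|apply k]).
  cbn [whnf']; rewrite (typeof_syn _ _ _ _ _ Hf).
  destruct (ent X F (tinst phi s)) eqn:Ephi.
  { apply ent_sound in Ephi.
    assert (Cs : chk X F G (pinst a s) (pinst A s)) by (eapply chk_pinst; eauto; apply k).
    eapply red_step; [|eapply ok_tyeq; eauto|apply IHwhnf; [exact k|eapply syn_ann; eauto]].
    eapply q_trans; [eapply q_ext_boundary; eauto|].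
    apply q_sym; eapply chk_Ann_eq; eauto. }
  clear Ephi.
  pose proof (IHwhnf _ _ _ _ _ k Hf) as R; remember (whnf X F G f) as c eqn:Ec; clear Ec.
  assert (N : red X F G (EApp f s) (pinst A s) (EApp (cast G c (Ext K psi A phi a)) s)).
  { destruct R as (S & H1 & H2 & H3); rewrite (cast_typeof _ _ _ _ _ _ H1).
    destruct (cast_ok _ _ _ _ _ _ j k H1 H2 WE) as [H4 H5].
    exists (pinst A s); split; [eapply s_eapp with (K := K) (psi := psi) (A := A) (phi := phi) (a := a); eauto|]; split; [eapply ok_tyeq; eauto|].
    eapply q_eapp; [|exact Hs|exact Hs|eapply e_refl; exact Hs|exact He].
    eapply q_trans; [exact H3|]; eapply conv_eq; [exact H5|exact H2]. }
  cbn zeta; bash N.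
  match type of R with red _ _ _ _ _ (Fst (Pair (ELam ?x1) (Refl (Ext ?x2 ?x3 ?x4 ?x5 ?x6)))) =>
    rename x1 into b, x2 into K0, x3 into psi0, x4 into A0, x5 into phi0, x6 into a0 end.
  destruct (red_Ann _ _ _ _ _ _ _ k R eq_refl eq_refl) as (C & T & E & l & W).
  destruct (chk_ELam_inv _ _ _ _ _ _ _ _ _ C) as (_ & Cb).
  match goal with |- context [if ?x then _ else _] => destruct x eqn:Ez; [|exact Z] end.
  apply and_true in Ez; destruct Ez as [Ez E3]; apply and_true in Ez; destruct Ez as [E1 E2].
  apply cube_eqb_eq in E1; subst K0; apply ent_sound in E2.
  destruct (wf_Ext_inv _ _ _ _ _ _ _ _ _ W) as (Hpsi0 & _ & _ & WA0 & _).
  assert (Wr0 : wf X F G (pinst A0 s) l) by (eapply wf_pinst; eauto; apply k).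
  assert (Tr : tyeq X F G (pinst A0 s) (pinst A s)).
  { apply or_true in E3; destruct E3 as [E3|E3]; [|eapply convTy_tyeq; eauto].
    apply tm_eqb_eq in E3; subst A0; eapply ok_tyeq; eauto. }
  assert (Cs : chk X F G (pinst b s) (pinst A0 s)) by (eapply chk_pinst; eauto; apply k).
  eapply red_step; [|exact Tr|apply IHwhnf; [exact k|eapply syn_ann; eauto]].
  eapply conv_eq; [|exact Tr].
  eapply q_trans; [|apply q_sym; eapply chk_Ann_eq; eauto].
  eapply q_trans.
  - eapply q_eapp with (K := K) (psi := psi0); [|exact Hs|exact Hs|eapply e_refl; exact Hs|exact E2].
    eapply conv_eq; [exact E|apply tyeq_sym, T].
  - eapply q_ext_beta; [apply chk_sound; [exact C|apply k]| |exact Hs|exact E2].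
    apply chk_sound; [exact Cb|apply closed_shapes_map_cwk, k].
Qed.

Lemma whnf_J X F (G : lctx) A a b C d p i j : ok X F G ->
  wf X F G A i -> chk X F G a A -> chk X F G b A ->
  wf X F (A :: G) (Id (wk A) (wk a) (Var 0)) i ->
  wf X F (Id (wk A) (wk a) (Var 0) :: A :: G) C j ->
  chk X F G d (inst2 C (ann a A) (Ann (Refl a) (Id A a (ann a A)))) ->
  syn X F G p (Id A a b) ->
  red X F G (J C d p) (inst2 C (ann b A) (ann_path A a b p)) (whnf' X F G (J C d p)).
Proof.
  intros k WA Ca Cb WI WC Cd Hp.
  assert (H0 : syn X F G (J C d p) (inst2 C (ann b A) (ann_path A a b p)))
    by (eapply s_J with (a := a); eauto).
  pose proof (red_refl _ _ _ _ _ k H0) as Z.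
  assert (c : Forall closed_shapes G) by apply k.
  assert (SA : X ∥ F ∥ G ⊢ A ∈ Univ i) by (apply wf_sound; assumption).
  assert (Sa : X ∥ F ∥ G ⊢ a ∈ A) by (apply chk_sound; assumption).
  assert (Sb : X ∥ F ∥ G ⊢ b ∈ A) by (apply chk_sound; assumption).
  assert (cA : closed_shapes A) by (eapply wf_closed; eauto).
  assert (ca : closed_shapes a) by (eapply proj1, (chk_closed X F G a A); eauto).
  assert (kI : ok X F (Id (wk A) (wk a) (Var 0) :: A :: G))
    by (eapply ok_cons; [eapply ok_cons; eauto|eauto]).
  assert (SC : X ∥ F ∥ Id (wk A) (wk a) (Var 0) :: A :: G ⊢ C ∈ Univ j)
    by (apply wf_sound; [exact WC|apply kI]).
  assert (Hb : syn X F G (ann b A) A) by (eapply syn_ann; eauto).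
  assert (Ha : syn X F G (ann a A) A) by (eapply syn_ann; eauto).
  assert (Eb : X ∥ F ∥ G ⊢ ann b A ≡ b ∈ A) by (eapply chk_Ann_eq; eauto).
  assert (Ea : X ∥ F ∥ G ⊢ ann a A ≡ a ∈ A) by (eapply chk_Ann_eq; eauto).
  assert (Sba : X ∥ F ∥ G ⊢ ann b A ∈ A) by (apply syn_sound; assumption).
  assert (Saa : X ∥ F ∥ G ⊢ ann a A ∈ A) by (apply syn_sound; assumption).
  assert (Sp : X ∥ F ∥ G ⊢ p ∈ Id A a b) by (apply syn_sound; assumption).
  destruct (ann_path_syn _ _ _ _ _ _ _ _ c WA Ca Cb Hp) as (Hq & Eq & Tq).
  assert (WIb : wf X F G (Id A a b) i) by (apply wf_id; assumption).
  assert (Wr : wf X F G (inst2 C (ann b A) (ann_path A a b p)) j)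
    by (eapply wf_inst2 with (A := A) (a := a); eauto; apply k).
  assert (Sq : X ∥ F ∥ G ⊢ ann_path A a b p ∈ Id A a (ann b A)) by (apply syn_sound; assumption).
  assert (WIa : wf X F G (Id A a (ann a A)) i) by (apply wf_id; auto using c_syn).
  assert (Ta : tyeq X F G (Id A a a) (Id A a (ann a A)))
    by (exists i; apply q_id; auto using q_refl, q_sym).
  assert (Cr : chk X F G (Refl a) (Id A a (ann a A)))
    by (eapply c_refl; eauto using c_syn, q_sym).
  set (ra := Ann (Refl a) (Id A a (ann a A))) in *.
  assert (Hra : syn X F G ra (Id A a (ann a A))) by (eapply s_ann; eauto).
  assert (Sra : X ∥ F ∥ G ⊢ ra ∈ Id A a (ann a A)) by (apply syn_sound; assumption).
  assert (Era : X ∥ F ∥ G ⊢ ra ≡ Refl a ∈ Id A a (ann a A))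
    by (eapply ann_erase; eauto; apply chk_sound; assumption).
  assert (Sr : X ∥ F ∥ G ⊢ Refl a ∈ Id A a a) by (apply t_refl; assumption).
  assert (W0 : wf X F G (inst2 C (ann a A) ra) j) by (eapply wf_inst2 with (A := A) (a := a); eauto; apply k).
  assert (T0 : tyeq X F G (inst2 C (ann a A) ra) (inst2 C a (Refl a))).
  { exists j; eapply inst2_eq with (A := A) (a := a) (i := i); eauto using q_refl. }
  assert (Sd : X ∥ F ∥ G ⊢ d ∈ inst2 C a (Refl a))
    by (eapply conv_ty; [apply chk_sound; eassumption|exact T0]).
  assert (T1 : tyeq X F G (inst2 C b p) (inst2 C (ann b A) (ann_path A a b p))).
  { exists j; eapply inst2_eq with (A := A) (a := a) (i := i);
      eauto using q_refl, q_sym, conv_ty, tyeq_sym. }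
  cbn [whnf']; rewrite (typeof_syn _ _ _ _ _ Hp).
  pose proof (IHwhnf _ _ _ _ _ k Hp) as R; remember (whnf X F G p) as cc eqn:Ec; clear Ec.
  assert (N : red X F G (J C d p) (inst2 C (ann b A) (ann_path A a b p))
                (J C d (cast G cc (Id A a b)))).
  { destruct R as (S & H1 & H2 & H3); rewrite (cast_typeof _ _ _ _ _ _ H1).
    destruct (cast_ok _ _ _ _ _ _ i k H1 H2 WIb) as [H4 H5].
    set (p' := recast S (Id A a b) cc) in *.
    assert (E : X ∥ F ∥ G ⊢ p ≡ p' ∈ Id A a b)
      by (eapply q_trans; [exact H3|]; eapply conv_eq; [exact H5|exact H2]).
    destruct (ann_path_syn _ _ _ _ _ _ _ _ c WA Ca Cb H4) as (Hq' & Eq' & _).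
    assert (Sp' : X ∥ F ∥ G ⊢ p' ∈ Id A a b) by (apply syn_sound; assumption).
    exists (inst2 C (ann b A) (ann_path A a b p')); split; [eapply s_J with (a := a); eauto|].
    split.
    - exists j; eapply inst2_eq with (A := A) (a := a) (i := i); eauto using q_refl.
      + apply syn_sound; assumption.
      + eapply conv_eq; [|exact Tq].
        eapply q_trans; [exact Eq'|]; eapply q_trans; [apply q_sym, E|apply q_sym, Eq].
    - eapply conv_eq; [|exact T1].
      eapply q_J with (A := A) (a := a) (b := b); eauto using q_refl. }
  cbn zeta; bash N.
  match type of R with red _ _ _ _ _ (Fst (Pair (Refl ?x1) (Refl (Id ?x2 ?x3 ?x4)))) =>
    rename x1 into a1, x2 into A0, x3 into a0, x4 into b0 end.
  destruct (red_Ann _ _ _ _ _ _ _ k R eq_refl eq_refl) as (C0 & T & E & l & W).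
  destruct (chk_Refl_inv _ _ _ _ _ _ _ C0) as (-> & l' & WA0 & Ca0 & Cb0 & E0).
  match goal with |- context [if ?x then _ else _] => destruct x eqn:Ez; [|exact Z] end.
  assert (facts : X ∥ F ∥ G ⊢ a0 ≡ a ∈ A /\ X ∥ F ∥ G ⊢ a ≡ b ∈ A).
  { apply or_true in Ez; destruct Ez as [Ez|Ez].
    - apply tm_eqb_eq in Ez; injection Ez; intros; subst A0 a0 b0.
      split; [apply q_refl; assumption|exact E0].
    - apply and_true in Ez; destruct Ez as [Ez E3]; apply and_true in Ez;
        destruct Ez as [E1 E2].
      assert (TA : tyeq X F G A0 A) by (eapply convTy_tyeq; eauto).
      assert (casts : forall x, chk X F G x A0 ->
        chk X F G (recast A0 A (ann x A0)) A /\ X ∥ F ∥ G ⊢ recast A0 A (ann x A0) ≡ x ∈ A).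
      { intros x Cx. destruct (cast_ok X F G A0 A (ann x A0) i k) as [h1 h2];
          [eapply syn_ann; eauto|exact TA|exact WA|]. split; [apply c_syn, h1|].
        eapply conv_eq; [|exact TA]. eapply q_trans; [apply q_sym, h2|].
        eapply chk_Ann_eq; eauto. }
      destruct (casts a0 Ca0) as [c1 c2], (casts b0 Cb0) as [c3 c4].
      assert (e1 : X ∥ F ∥ G ⊢ a0 ≡ a ∈ A)
        by (eapply q_trans; [apply q_sym, c2|]; eapply IHconv; eauto).
      assert (e2 : X ∥ F ∥ G ⊢ b0 ≡ b ∈ A)
        by (eapply q_trans; [apply q_sym, c4|]; eapply IHconv; eauto).
      split; [exact e1|]. eapply q_trans; [apply q_sym, e1|].
      eapply q_trans; [eapply conv_eq; [exact E0|exact TA]|exact e2]. }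
  destruct facts as [F1 F2].
  assert (Tab : tyeq X F G (Id A a a) (Id A a b))
    by (exists i; apply q_id; auto using q_refl).
  assert (Sa0 : X ∥ F ∥ G ⊢ Refl a0 ∈ Id A a b).
  { eapply conv_ty; [|exact T]. apply chk_sound; assumption. }
  assert (Ep : X ∥ F ∥ G ⊢ p ≡ Refl a ∈ Id A a b).
  { eapply q_trans; [exact E|]. eapply conv_eq; [eapply q_conv; [apply q_Refl; exact F1|]|exact Tab].
    apply q_id; eauto using q_refl. }
  assert (T2 : tyeq X F G (inst2 C a (Refl a)) (inst2 C b p)).
  { exists j; eapply inst2_eq with (A := A) (a := a) (i := i); eauto using q_refl.
    apply q_sym; eapply conv_eq; [exact Ep|apply tyeq_sym, Tab]. }
  assert (Tr : tyeq X F G (inst2 C (ann a A) ra) (inst2 C (ann b A) (ann_path A a b p)))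
    by (eapply tyeq_trans; [exact T0|eapply tyeq_trans; [exact T2|exact T1]]).
  eapply red_step; [|exact Tr|apply IHwhnf; [exact k|eapply syn_ann; eauto]].
  eapply conv_eq; [|exact T1].
  eapply q_trans; [eapply q_J with (A := A) (a := a) (b := b); eauto using q_refl|].
  eapply conv_eq; [|exact T2].
  eapply q_trans; [eapply q_J_beta with (A := A) (a := a); eauto|].
  apply q_sym; eapply conv_eq; [eapply chk_Ann_eq; eauto|exact T0].
Qed.

Lemma whnf_step X F (G : lctx) e T : ok X F G -> syn X F G e T -> red X F G e T (whnf' X F G e).
Proof.
  intros k H; inversion H; subst.
  - apply red_refl; assumption.
  - apply whnf_Ann; assumption.
  - apply whnf_Ann; assumption.
  - apply whnf_Ann; assumption.
  - eapply whnf_app; eauto.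
  - eapply whnf_fst; eauto.
  - eapply whnf_snd; eauto.
  - eapply whnf_eapp; eauto.
  - eapply whnf_J; eauto.
Qed.

Lemma whnfTy_step X F (G : lctx) A i : ok X F G -> wf X F G A i ->
  wf X F G (whnfTy' X F G A) i /\ X ∥ F ∥ G ⊢ A ≡ whnfTy' X F G A ∈ Univ i.
Proof.
  intros k W; unfold whnfTy'.
  assert (Z : wf X F G A i /\ X ∥ F ∥ G ⊢ A ≡ A ∈ Univ i)
    by (split; [exact W|apply q_refl, wf_sound; [exact W|apply k]]).
  destruct (synth A) eqn:Es; [|exact Z].
  inversion W as [? ? ? ? j ? HA L| | | | |]; subst; try discriminate.
  rewrite (typeof_syn _ _ _ _ _ HA).
  pose proof (IHwhnf _ _ _ _ _ k HA) as R; remember (whnf X F G A) as c eqn:Ec; clear Ec.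
  destruct (ok_wf _ _ _ _ _ k HA) as [l WU].
  assert (N : wf X F G (cast G c (Univ j)) i /\ X ∥ F ∥ G ⊢ A ≡ cast G c (Univ j) ∈ Univ i).
  { destruct R as (S & H1 & H2 & H3); rewrite (cast_typeof _ _ _ _ _ _ H1).
    destruct (cast_ok _ _ _ _ _ _ l k H1 H2 WU) as [H4 H5].
    split; [eapply wf_ne; eauto|]. eapply cumul_eq_le; [exact L|].
    eapply q_trans; [exact H3|]; eapply conv_eq; [exact H5|exact H2]. }
  repeat match goal with
  | |- wf _ _ _ (match ?x with _ => _ end) _ /\ _ => is_var x; destruct x; try exact N
  end.
  match goal with |- context [if ?x then _ else _] => destruct x eqn:Ez; [|exact N] end.
  apply and_true in Ez; destruct Ez as [E1 E2]; apply tm_eqb_eq in E2; injection E2 as ->.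
  match type of R with red _ _ _ _ _ (Fst (Pair ?x _)) => rename x into A' end.
  assert (Es' : synth A' = false) by (destruct A'; cbn in *; congruence).
  assert (Ek : constant A' = false) by (destruct A'; cbn in *; congruence).
  destruct (red_Ann _ _ _ _ _ _ _ k R Es' Ek) as (C & T & E & l' & W').
  split; [|eapply cumul_eq_le; [exact L|exact E]].
  eapply wf_le; [|exact L].
  inversion C; subst; cbn in E1; try discriminate; try assumption.
  match goal with P : syn _ _ _ A' _ |- _ => apply syn_synth in P; congruence end.
Qed.

Lemma syn_app_var X F G f A B i : ok X F G -> wf X F G (Pi A B) i -> syn X F G f (Pi A B) ->
  syn X F (A :: G) (App (wk f) (Var 0)) B.
Proof.
  intros k W Hf; destruct (wf_Pi_inv _ _ _ _ _ _ W) as [WA WB].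
  assert (kA : ok X F (A :: G)) by (eapply ok_cons; eauto).
  assert (e : inst1 (ren (fun n => n) (upren S) B) (ann (Var 0) (wk A)) = B).
  { unfold inst1; rewrite subst_ren; rewrite <- (subst_id B) at 2.
    apply subst_ext; [reflexivity|]; intros [|m]; reflexivity. }
  rewrite <- e.
  assert (V : syn X F (A :: G) (Var 0) (wk A)).
  { eapply s_var; [reflexivity|]; rewrite shiftn_0; apply wf_wk; [apply k|exact WA]. }
  destruct k as [c k].
  assert (W' : wf X F (A :: G) (wk (Pi A B)) i) by (apply wf_wk; assumption).
  destruct (wf_Pi_inv _ _ _ _ _ _ W') as [WA' WB'].
  eapply s_app; [exact WA'|exact WB'| |apply c_syn, V].
  apply (syn_wk _ _ _ _ (Pi A B)); assumption.
Qed.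

(** Extensionality of functions, by the eta rule.  The same is done for extension types. *)
Lemma eta_pi X F G f g A B i : ok X F G -> wf X F G (Pi A B) i ->
  syn X F G f (Pi A B) -> syn X F G g (Pi A B) ->
  X ∥ F ∥ A :: G ⊢ App (wk f) (Var 0) ≡ App (wk g) (Var 0) ∈ B ->
  X ∥ F ∥ G ⊢ f ≡ g ∈ Pi A B.
Proof.
  intros k W Hf Hg E; destruct (wf_Pi_inv _ _ _ _ _ _ W) as [WA WB].
  eapply q_trans; [apply q_pi_eta, syn_sound; [exact Hf|apply k]|].
  eapply q_trans; [|apply q_sym, q_pi_eta, syn_sound; [exact Hg|apply k]].
  eapply q_lam; [apply wf_sound; [exact WA|apply k]|exact E].
Qed.

Lemma pinst_upren A : pinst (ren (upren S) (fun n => n) A) (PVar 0) = A.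
Proof.
  unfold pinst; rewrite subst_ren; rewrite <- (subst_id A) at 2.
  apply subst_ext; [intros [|m]; reflexivity|reflexivity].
Qed.

Lemma tinst_var K p : is_tope [K] p -> tinst p (PVar 0) = p.
Proof. intro H; apply (tsubst_closed K); [exact H|reflexivity]. Qed.

Lemma syn_eapp_var X F G f K psi A phi a i : ok X F G -> wf X F G (Ext K psi A phi a) i ->
  syn X F G f (Ext K psi A phi a) ->
  syn (K :: X) (psi :: map tshift F) (map cwk G) (EApp (cwk f) (PVar 0)) A.
Proof.
  intros k W Hf.
  assert (W' : wf (K :: X) (psi :: map tshift F) (map cwk G) (cwk (Ext K psi A phi a)) i)
    by (apply wf_cwk; [apply k|exact W]).
  destruct (wf_Ext_inv _ _ _ _ _ _ _ _ _ W') as (Hpsi & _ & _ & WA' & _).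
  rewrite <- (pinst_upren A).
  eapply s_eapp; [exact Hpsi|exact WA'| |constructor; reflexivity|].
  - apply (syn_cwk _ _ _ _ (Ext K psi A phi a)); [apply k|exact Hf].
  - rewrite (tinst_var K) by exact Hpsi; apply e_hyp; left; reflexivity.
Qed.

Lemma eta_ext X F G f g K psi A phi a i : ok X F G -> wf X F G (Ext K psi A phi a) i ->
  syn X F G f (Ext K psi A phi a) -> syn X F G g (Ext K psi A phi a) ->
  K :: X ∥ psi :: map tshift F ∥ map cwk G ⊢ EApp (cwk f) (PVar 0) ≡ EApp (cwk g) (PVar 0) ∈ A ->
  X ∥ F ∥ G ⊢ f ≡ g ∈ Ext K psi A phi a.
Proof.
  intros k W Hf Hg E; destruct (wf_Ext_inv _ _ _ _ _ _ _ _ _ W) as (Hpsi & Hphi & Hpp & WA & Ca).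
  assert (Sf : X ∥ F ∥ G ⊢ f ∈ Ext K psi A phi a) by (apply syn_sound; [exact Hf|apply k]).
  eapply q_trans; [apply q_ext_eta, Sf|].
  eapply q_trans; [|apply q_sym, q_ext_eta, syn_sound; [exact Hg|apply k]].
  apply q_elam; [|exact E].
  eapply t_elam; [apply wf_sound; [exact W|apply k]| |].
  - apply syn_sound; [eapply syn_eapp_var; eauto|apply closed_shapes_map_cwk, k].
  - pose proof (typing_cwk _ _ _ _ _ K phi (proj1 k) Sf) as h; cbn in h.
    eapply q_ext_boundary with (s := PVar 0) in h;
      [|constructor; reflexivity|rewrite (tinst_var K) by exact Hphi; apply e_hyp; left; reflexivity].
    rewrite !pinst_upren in h; exact h.
Qed.

Lemma conv_step X F (G : lctx) T a b i : ok X F G -> wf X F G T i ->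
  chk X F G a T -> chk X F G b T -> conv' X F G T a b = true -> X ∥ F ∥ G ⊢ a ≡ b ∈ T.
Proof.
  intros k W Ca Cb H; unfold conv' in H.
  apply or_true in H; destruct H as [H|H].
  { eapply sim_chk; eassumption. }
  destruct (IHwhnfTy _ _ _ _ _ k W) as [W' ET]; remember (whnfTy X F G T) as T' eqn:eT; clear eT.
  assert (TT : tyeq X F G T T') by (eexists; exact ET).
  destruct (cast_ok _ _ _ _ _ (ann a T) _ k ltac:(eapply syn_ann; eauto) TT W') as [Ha Ea].
  destruct (cast_ok _ _ _ _ _ (ann b T) _ k ltac:(eapply syn_ann; eauto) TT W') as [Hb Eb].
  cbn zeta in H.
  set (a1 := recast T T' (ann a T)) in *; set (b1 := recast T T' (ann b T)) in *.
  assert (Goal1 : X ∥ F ∥ G ⊢ a1 ≡ b1 ∈ T' -> X ∥ F ∥ G ⊢ a ≡ b ∈ T).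
  { intro E. eapply q_trans; [apply q_sym; eapply chk_Ann_eq; eauto|].
    eapply q_trans; [|eapply chk_Ann_eq; eauto].
    eapply q_trans; [exact Ea|]; eapply q_trans; [|apply q_sym, Eb].
    eapply conv_eq; [exact E|apply tyeq_sym, TT]. }
  pose proof (IHwhnf _ _ _ _ _ k Ha) as Ra; pose proof (IHwhnf _ _ _ _ _ k Hb) as Rb.
  assert (NE : convNe X F G (whnf X F G a1) (whnf X F G b1) = true ->
    X ∥ F ∥ G ⊢ a ≡ b ∈ T).
  { intro E; apply Goal1.
    destruct Ra as (S1 & h1 & h2 & h3), Rb as (S2 & h4 & h5 & h6).
    eapply q_trans; [exact h3|]; eapply q_trans; [|apply q_sym, h6].
    eapply conv_eq; [eapply (IHconvNe _ _ _ _ _ _ _ k h1 h4 E)|exact h2]. }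
  assert (STUCK : forall p q,
    ent X F (TOr p q) && conv X (p :: F) G T a b && conv X (q :: F) G T a b = true ->
    X ∥ F ∥ G ⊢ a ≡ b ∈ T).
  { intros p q E; apply and_true in E; destruct E as [E E2]; apply and_true in E;
      destruct E as [E0 E1]; apply ent_sound in E0.
    assert (br : forall r, conv X (r :: F) G T a b = true -> X ∥ r :: F ∥ G ⊢ a ≡ b ∈ T).
    { intros r Er; pose proof (topes_good_cons X F r) as h.
      eapply IHconv; [eapply ok_topes; eauto|eapply wf_topes; eauto; apply k|
        eapply chk_topes; eauto; apply k|eapply chk_topes; eauto; apply k|exact Er]. }
    eapply q_case; [exact E0|apply chk_sound; [exact Ca|apply k]|apply chk_sound; [exact Cb|apply k]| |];
      auto. }
  destruct T'; cbn beta iota in H;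
    try (destruct (match stuck (whnf X F G a1) with Some d => Some d
                   | None => stuck (whnf X F G b1) end) as [[? ?]|];
         [eapply STUCK; exact H|apply NE; exact H]).
  - apply Goal1; eapply IHconvTy; [exact k| | |exact H]; eapply wf_ne; eauto.
  - apply Goal1. destruct (wf_Pi_inv _ _ _ _ _ _ W') as [WA WB].
    eapply eta_pi; eauto. eapply IHconv_cons; [eapply ok_cons; eauto|exact WB| | |exact H];
      apply c_syn; eapply syn_app_var; eauto.
  - apply Goal1. destruct (wf_Sig_inv _ _ _ _ _ _ W') as [WA WB].
    apply and_true in H; destruct H as [H1 H2].
    assert (kA : ok X F (T'1 :: G)) by (eapply ok_cons; eauto).
    assert (cA : closed_shapes T'1) by (eapply wf_closed; [apply k|exact WA]).
    assert (Ha' : syn X F G (Fst a1) T'1) by (eapply s_fst; eauto).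
    assert (Hb' : syn X F G (Fst b1) T'1) by (eapply s_fst; eauto).
    assert (E1 : X ∥ F ∥ G ⊢ Fst a1 ≡ Fst b1 ∈ T'1)
      by (eapply IHconv; eauto using c_syn).
    assert (Wa : wf X F G (inst1 T'2 (Fst a1)) i) by (eapply wf_inst1; eauto; apply k).
    assert (Sa : X ∥ F ∥ G ⊢ Fst a1 ∈ T'1) by (apply syn_sound; [exact Ha'|apply k]).
    assert (Sb : X ∥ F ∥ G ⊢ Fst b1 ∈ T'1) by (apply syn_sound; [exact Hb'|apply k]).
    assert (SB : X ∥ F ∥ T'1 :: G ⊢ T'2 ∈ Univ i) by (apply wf_sound; [exact WB|apply kA]).
    assert (SA : X ∥ F ∥ G ⊢ T'1 ∈ Univ i) by (apply wf_sound; [exact WA|apply k]).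
    assert (TB : tyeq X F G (inst1 T'2 (Fst b1)) (inst1 T'2 (Fst a1)))
      by (exists i; eapply inst1_eq; eauto using q_refl, q_sym).
    assert (Hsb : syn X F G (Snd b1) (inst1 T'2 (Fst b1)))
      by (eapply s_snd with (A := T'1) (B := T'2); eauto).
    assert (Hsa : syn X F G (Snd a1) (inst1 T'2 (Fst a1)))
      by (eapply s_snd with (A := T'1) (B := T'2); eauto).
    destruct (cast_ok _ _ _ _ _ _ _ k Hsb TB Wa) as [Hc Ec].
    assert (E2 : X ∥ F ∥ G ⊢ Snd a1 ≡ Snd b1 ∈ inst1 T'2 (Fst a1)).
    { eapply q_trans; [eapply IHconv; [exact k|exact Wa|apply c_syn, Hsa|apply c_syn, Hc|exact H2]|].
      apply q_sym; eapply conv_eq; [exact Ec|exact TB]. }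
    eapply q_trans; [apply q_sig_eta, syn_sound; [exact Ha|apply k]|].
    eapply q_trans; [|apply q_sym, q_sig_eta, syn_sound; [exact Hb|apply k]].
    eapply q_pair; eauto.
  - apply Goal1. destruct (wf_Ext_inv _ _ _ _ _ _ _ _ _ W') as (Hpsi & Hphi & Hpp & WA & C).
    eapply eta_ext; eauto.
    eapply IHconvF_shape; [apply ok_shape, k|exact WA| | |exact H]; apply c_syn; eapply syn_eapp_var; eauto.
Qed.

Lemma topes_good_split X F p q F' : find_or F = Some (p, q, F') ->
  entails X F (TOr p q) /\
  (is_tope X q -> topes_good F X (p :: F') PVar) /\
  (is_tope X p -> topes_good F X (q :: F') PVar) /\
  topes_good (p :: F') X (p :: F) PVar /\ topes_good (q :: F') X (q :: F) PVar.
Proof.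
  intro H.
  assert (In (TOr p q) F /\ (forall g, In g F' -> In g F) /\
          (forall g, In g F -> g = TOr p q \/ In g F')) as (H1 & H2 & H3).
  { revert p q F' H; induction F as [|h F IH]; intros p q F' H; [discriminate|]; cbn in H.
    destruct h; try (destruct (find_or F) as [[[? ?] ?]|]; [|discriminate];
      injection H as -> -> <-; destruct (IH _ _ _ eq_refl) as (z1 & z2 & z3);
      split; [right; exact z1|]; split;
      [intros g [<-|Hg]; [left; reflexivity|right; auto]
      |intros g [<-|Hg]; [right; left; reflexivity|destruct (z3 _ Hg); auto; right; right; assumption]]).
    injection H as -> -> ->. split; [left; reflexivity|]; split; [intros; right; assumption|].
    intros g [<-|Hg]; auto. }
  split; [apply e_hyp, H1|]. unfold topes_good.
  split; [|split; [|split]].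
  - intros T g Hg; rewrite tsubst_id; destruct (H3 _ Hg) as [->|?].
    + apply e_or1; [exact T|apply e_hyp; left; reflexivity].
    + apply e_hyp; right; assumption.
  - intros T g Hg; rewrite tsubst_id; destruct (H3 _ Hg) as [->|?].
    + apply e_or2; [exact T|apply e_hyp; left; reflexivity].
    + apply e_hyp; right; assumption.
  - intros g [<-|Hg]; rewrite tsubst_id; apply e_hyp; [left; reflexivity|right; auto].
  - intros g [<-|Hg]; rewrite tsubst_id; apply e_hyp; [left; reflexivity|right; auto].
Qed.

Lemma equality_topes' X F G a b A F' : Forall closed_shapes G -> topes_good F X F' PVar ->
  X ∥ F ∥ G ⊢ a ≡ b ∈ A -> X ∥ F' ∥ G ⊢ a ≡ b ∈ A.
Proof.
  intros c h; apply equality_topes; [exact c|]; intros p Hp; rewrite <- (tsubst_id p); auto.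
Qed.

Lemma convF_step X F (G : lctx) T a b i : ok X F G -> wf X F G T i ->
  chk X F G a T -> chk X F G b T -> convF' X F G T a b = true -> X ∥ F ∥ G ⊢ a ≡ b ∈ T.
Proof.
  intros k W Ca Cb H; unfold convF' in H.
  destruct (find_or F) as [[[p q] F']|] eqn:Ef.
  - repeat (apply and_true in H; let h := fresh "E" in destruct H as [H h]).
    apply is_tope_b_sound in H, E1.
    destruct (topes_good_split X F p q F' Ef) as (h0 & h1 & h2 & h3 & h4).
    specialize (h1 E1); specialize (h2 H).
    eapply q_case; [exact h0|apply chk_sound; [exact Ca|apply k]|apply chk_sound; [exact Cb|apply k]| |].
    + eapply equality_topes'; [apply k|exact h3|].
      eapply IHconvF; [eapply ok_topes; eauto|eapply wf_topes; eauto; apply k|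
        eapply chk_topes; eauto; apply k|eapply chk_topes; eauto; apply k|assumption].
    + eapply equality_topes'; [apply k|exact h4|].
      eapply IHconvF; [eapply ok_topes; eauto|eapply wf_topes; eauto; apply k|
        eapply chk_topes; eauto; apply k|eapply chk_topes; eauto; apply k|assumption].
  - apply or_true in H; destruct H as [H|H]; [|eapply IHconv; eauto].
    apply ent_sound in H; apply q_bot; [exact H| |]; apply chk_sound; eauto; apply k.
Qed.

Lemma convTyF_step X F (G : lctx) A B i : ok X F G -> wf X F G A i -> wf X F G B i ->
  convTyF' X F G A B = true -> X ∥ F ∥ G ⊢ A ≡ B ∈ Univ i.
Proof.
  intros k WA WB H; unfold convTyF' in H.
  destruct (find_or F) as [[[p q] F']|] eqn:Ef.
  - repeat (apply and_true in H; let h := fresh "E" in destruct H as [H h]).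
    apply is_tope_b_sound in H, E1.
    destruct (topes_good_split X F p q F' Ef) as (h0 & h1 & h2 & h3 & h4).
    specialize (h1 E1); specialize (h2 H).
    eapply q_case; [exact h0|apply wf_sound; [exact WA|apply k]|apply wf_sound; [exact WB|apply k]| |].
    + eapply equality_topes'; [apply k|exact h3|].
      eapply IHconvTyF; [eapply ok_topes; eauto|eapply wf_topes; eauto; apply k|
        eapply wf_topes; eauto; apply k|assumption].
    + eapply equality_topes'; [apply k|exact h4|].
      eapply IHconvTyF; [eapply ok_topes; eauto|eapply wf_topes; eauto; apply k|
        eapply wf_topes; eauto; apply k|assumption].
  - apply or_true in H; destruct H as [H|H]; [|eapply IHconvTy; eauto].
    apply ent_sound in H; apply q_bot; [exact H| |]; apply wf_sound; eauto; apply k.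
Qed.

Lemma wk_as_subst A : subst PVar (fun n => Var (S n)) A = wk A.
Proof. unfold wk; rewrite ren_as_subst; reflexivity. Qed.

Lemma swap_hyp_ok X F G A A' B i j : ok X F G -> wf X F G A i -> wf X F G A' i ->
  X ∥ F ∥ G ⊢ A ≡ A' ∈ Univ i -> wf X F (A' :: G) B j ->
  wf X F (A :: G) (swap_hyp A A' B) j /\
  (forall C, X ∥ F ∥ A :: G ⊢ C ≡ swap_hyp A A' B ∈ Univ j -> wf X F (A :: G) C j ->
     (X ∥ F ∥ G ⊢ Pi A C ≡ Pi A' B ∈ Univ (max i j)) /\
     (X ∥ F ∥ G ⊢ Sig A C ≡ Sig A' B ∈ Univ (max i j))).
Proof.
  intros k WA WA' E WB; unfold swap_hyp; destruct (tm_eqb A A') eqn:Eb.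
  { apply tm_eqb_eq in Eb; subst; split; [exact WB|]; intros C EC WC.
    assert (SA : X ∥ F ∥ G ⊢ A' ∈ Univ (max i j))
      by (eapply cumul_le; [|apply wf_sound; [exact WA|apply k]]; lia).
    assert (EC' : X ∥ F ∥ A' :: G ⊢ C ≡ B ∈ Univ (max i j))
      by (eapply cumul_eq_le; [|exact EC]; lia).
    split; [apply q_pi|apply q_sig]; auto using q_refl. }
  assert (kA : ok X F (A :: G)) by (eapply ok_cons; eauto).
  assert (kA' : ok X F (A' :: G)) by (eapply ok_cons; eauto).
  assert (WwA : wf X F (A :: G) (wk A) i) by (apply wf_wk; [apply k|exact WA]).
  assert (WwA' : wf X F (A :: G) (wk A') i) by (apply wf_wk; [apply k|exact WA']).
  assert (V : syn X F (A :: G) (Var 0) (wk A)).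
  { eapply s_var; [reflexivity|]; rewrite shiftn_0; exact WwA. }
  assert (Ew : X ∥ F ∥ A :: G ⊢ wk A ≡ wk A' ∈ Univ i)
    by (apply (equality_wk _ _ _ _ _ (Univ i)); [apply k|exact E]).
  assert (V' : syn X F (A :: G) (Ann (Var 0) (wk A')) (wk A'))
    by (eapply s_cast; [exact V|exact WwA'|eexists; exact Ew]).
  set (sg := scons (Ann (Var 0) (wk A')) (fun n => Var (S n))) in *.
  assert (sg_wk : forall C, subst PVar sg (wk C) = wk C)
    by (intro C; unfold sg; rewrite subst_wk; apply wk_as_subst).
  assert (good : annotated_substitution X F (A' :: G) X F (A :: G) PVar sg).
  { split; [|split].
    - split; [intros m K e; constructor; exact e|].
      split; [intros p Hp; rewrite tsubst_id; apply e_hyp, Hp|].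
      split; [apply kA|].
      split; [intros [|m]; [apply (syn_closed _ _ _ _ _ (proj1 kA) V')|exact I]|].
      intros [|m] B0 e; cbn in e.
      + injection e as <-; rewrite shiftn_0, sg_wk.
        apply syn_sound; [exact V'|apply kA].
      + rewrite shiftn_S, sg_wk, <- shiftn_S.
        apply (t_var X F (A :: G) (S m)); exact e.
    - intros [|m]; reflexivity.
    - intros [|m] B0 e; cbn in e.
      + injection e as <-; rewrite shiftn_0, sg_wk; exact V'.
      + destruct (proj2 k m B0 e) as [l Wl].
        rewrite shiftn_S, sg_wk, <- shiftn_S.
        eapply s_var; [exact e|]; rewrite shiftn_S; apply wf_wk; [apply k|exact Wl]. }
  split; [eapply wf_sub; [exact WB|apply kA'|exact good]|].
  intros C EC WC.
  assert (SA : X ∥ F ∥ G ⊢ A ∈ Univ i) by (apply wf_sound; [exact WA|apply k]).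
  assert (SB : X ∥ F ∥ A' :: G ⊢ B ∈ Univ j) by (apply wf_sound; [exact WB|apply kA']).
  (* [B] renamed into [A :: G], where the variable is converted silently *)
  assert (R : forall D, X ∥ F ∥ A' :: G ⊢ D ∈ Univ j -> X ∥ F ∥ A :: G ⊢ D ∈ Univ j).
  { intros D HD. rewrite <- (subst_id D).
    eapply (proj1 typing_substitution _ _ _ _ (Univ j) HD); [apply kA'|].
    split; [intros m K e; constructor; exact e|].
    split; [intros p Hp; rewrite tsubst_id; apply e_hyp, Hp|].
    split; [apply kA|]; split; [intro; exact I|].
    intros [|m] B0 e; rewrite subst_id; cbn in e.
    - injection e as <-; rewrite shiftn_0; eapply conv_ty; [|eexists; exact Ew].
      apply syn_sound; [exact V|apply kA].
    - apply (t_var X F (A :: G) (S m)); exact e. }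
  assert (ES : X ∥ F ∥ A :: G ⊢ subst PVar sg B ≡ B ∈ Univ j).
  { pose proof (R _ SB) as SB'.
    assert (h : X ∥ F ∥ wk A :: A :: G ⊢ ren (fun n => n) (upren S) B ∈ Univ j).
    { rewrite ren_as_subst.
      eapply (proj1 typing_renaming _ _ _ _ (Univ j) SB'); [apply kA|].
      rewrite <- up_var. unfold wk; rewrite ren_as_subst.
      apply renaming_up, renaming_wk. }
    assert (e1 : inst1 (ren (fun n => n) (upren S) B) (Var 0) = B).
    { unfold inst1; rewrite subst_ren; rewrite <- (subst_id B) at 2.
      apply subst_ext; [reflexivity|]; intros [|m]; reflexivity. }
    assert (e2 : inst1 (ren (fun n => n) (upren S) B) (Ann (Var 0) (wk A')) = subst PVar sg B).
    { unfold inst1; rewrite subst_ren.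
      apply subst_ext; [reflexivity|]; intros [|m]; reflexivity. }
    rewrite <- e2. rewrite <- e1 at 2.
    assert (SwA : X ∥ F ∥ A :: G ⊢ wk A ∈ Univ i) by (apply wf_sound; [exact WwA|apply kA]).
    assert (S0 : X ∥ F ∥ A :: G ⊢ Var 0 ∈ wk A) by (apply syn_sound; [exact V|apply kA]).
    eapply inst1_eq; [exact SwA|exact h|exact h|apply q_refl, h| |exact S0|].
    - eapply ann_ty; [apply kA|exact S0|exact SwA|apply wf_sound; [exact WwA'|apply kA]].
    - eapply ann_erase; eauto. }
  assert (SA' : X ∥ F ∥ G ⊢ A ∈ Univ (max i j)) by (eapply cumul_le; [|exact SA]; lia).
  assert (E' : X ∥ F ∥ G ⊢ A ≡ A' ∈ Univ (max i j)) by (eapply cumul_eq_le; [|exact E]; lia).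
  assert (EC' : X ∥ F ∥ A :: G ⊢ C ≡ B ∈ Univ (max i j))
    by (eapply cumul_eq_le; [|eapply q_trans; [exact EC|exact ES]]; lia).
  split; [apply q_pi|apply q_sig]; assumption.
Qed.

Lemma convTy_step X F (G : lctx) A B i : ok X F G -> wf X F G A i -> wf X F G B i ->
  convTy' X F G A B = true -> X ∥ F ∥ G ⊢ A ≡ B ∈ Univ i.
Proof.
  intros k WA WB H; unfold convTy' in H.
  apply or_true in H; destruct H as [H|H].
  { eapply sim_wf; eassumption. }
  destruct (IHwhnfTy _ _ _ _ _ k WA) as [W1 E1], (IHwhnfTy _ _ _ _ _ k WB) as [W2 E2].
  remember (whnfTy X F G A) as A1 eqn:e; clear e; remember (whnfTy X F G B) as B1 eqn:e; clear e.
  eapply q_trans; [exact E1|]; eapply q_trans; [|apply q_sym, E2]; clear E1 E2 WA WB A B.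
  assert (casts : forall A2 A3 x, wf X F G A2 i -> wf X F G A3 i ->
    X ∥ F ∥ G ⊢ A2 ≡ A3 ∈ Univ i -> chk X F G x A3 ->
    let x' := if tm_eqb A2 A3 then x else Ann (ann x A3) A2 in
    chk X F G x' A2 /\ X ∥ F ∥ G ⊢ x' ≡ x ∈ A2).
  { intros A2 A3 x WA WB E Cx; cbn zeta; destruct (tm_eqb A2 A3) eqn:Eb.
    - apply tm_eqb_eq in Eb; subst; split; [exact Cx|apply q_refl, chk_sound; [exact Cx|apply k]].
    - assert (TA : tyeq X F G A3 A2) by (eexists; apply q_sym; exact E).
      assert (h : syn X F G (ann x A3) A3) by (eapply syn_ann; eauto).
      split; [apply c_syn; eapply s_cast; [exact h|exact WA|exact TA]|].
      eapply conv_eq; [|exact TA]. eapply q_trans; [|eapply chk_Ann_eq; eauto].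
      eapply ann_erase; eauto; apply syn_sound; [exact h|apply k]. }
  assert (NE : match synth A1, synth B1, typeof G A1 with
        | true, true, Some (Univ _) => convNe X F G A1 B1 | _, _, _ => false end = true ->
     X ∥ F ∥ G ⊢ A1 ≡ B1 ∈ Univ i).
  { intro E; destruct (synth A1) eqn:s1; [|discriminate]; destruct (synth B1) eqn:s2; [|discriminate].
    inversion W1 as [? ? ? ? j1 ? h1 L1| | | | |]; subst; try discriminate.
    inversion W2 as [? ? ? ? j2 ? h2 L2| | | | |]; subst; try discriminate.
    rewrite (typeof_syn _ _ _ _ _ h1) in E.
    eapply cumul_eq_le; [exact L1|]. apply (IHconvNe _ _ _ _ _ _ _ k h1 h2 E). }
  destruct A1; try (apply NE; exact H); destruct B1; try (cbn in H; discriminate H); try (apply NE; exact H).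
  - apply Nat.eqb_eq in H; subst; apply q_refl, wf_sound; [exact W1|apply k].
  - apply and_true in H; destruct H as [H1 H2].
    destruct (wf_Pi_inv _ _ _ _ _ _ W1) as [V1 V2], (wf_Pi_inv _ _ _ _ _ _ W2) as [V3 V4].
    pose proof (IHconvTy _ _ _ _ _ _ k V1 V3 H1) as E.
    destruct (swap_hyp_ok _ _ _ _ _ _ _ _ k V1 V3 E V4) as [V5 V6].
    rewrite <- (Nat.max_id i); apply V6; [|exact V2].
    eapply IHconvTy_cons; eauto; eapply ok_cons; eauto.
  - apply and_true in H; destruct H as [H1 H2].
    destruct (wf_Sig_inv _ _ _ _ _ _ W1) as [V1 V2], (wf_Sig_inv _ _ _ _ _ _ W2) as [V3 V4].
    pose proof (IHconvTy _ _ _ _ _ _ k V1 V3 H1) as E.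
    destruct (swap_hyp_ok _ _ _ _ _ _ _ _ k V1 V3 E V4) as [V5 V6].
    rewrite <- (Nat.max_id i); apply V6; [|exact V2].
    eapply IHconvTy_cons; eauto; eapply ok_cons; eauto.
  - repeat (apply and_true in H; let h := fresh "h" in destruct H as [H h]).
    destruct (wf_Id_inv _ _ _ _ _ _ _ W1) as (V1 & V2 & V3), (wf_Id_inv _ _ _ _ _ _ _ W2) as (V4 & V5 & V6).
    pose proof (IHconvTy _ _ _ _ _ _ k V1 V4 H) as E.
    destruct (casts _ _ _ V1 V4 E V5) as [C1 D1], (casts _ _ _ V1 V4 E V6) as [C2 D2].
    apply q_id; [exact E| |].
    + eapply q_trans; [|exact D1]; eapply IHconv; eauto.
    + eapply q_trans; [|exact D2]; eapply IHconv; eauto.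
  - repeat (apply and_true in H; let h := fresh "h" in destruct H as [H h]).
    apply cube_eqb_eq in H; apply tope_eqb_eq in h1, h2; subst.
    destruct (wf_Ext_inv _ _ _ _ _ _ _ _ _ W1) as (P1 & P2 & P3 & V1 & V2).
    destruct (wf_Ext_inv _ _ _ _ _ _ _ _ _ W2) as (_ & _ & _ & V3 & V4).
    pose proof (ok_shape _ _ _ K0 psi0 k) as k1; pose proof (ok_shape _ _ _ K0 phi0 k) as k2.
    pose proof (IHconvTyF_shape _ _ _ _ _ _ k1 V1 V3 h0) as E.
    assert (Tp : topes_good (psi0 :: map tshift F) (K0 :: X) (phi0 :: map tshift F) PVar).
    { intros g [<-|Hg]; rewrite tsubst_id; [|apply e_hyp; right; exact Hg].
      rewrite <- (tsubst_id psi0); eapply entails_subst; [exact P3| |].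
      - intros [|m] L e; cbn in e; [injection e as <-; constructor; reflexivity|destruct m; discriminate].
      - intros g [<-|[]]; rewrite tsubst_id; apply e_hyp; left; reflexivity. }
    apply q_ext; auto.
    assert (V1' : wf (K0 :: X) (phi0 :: map tshift F) (map cwk G) A1_1 i)
      by (eapply wf_topes; [apply k1|exact Tp|exact V1]).
    assert (V3' : wf (K0 :: X) (phi0 :: map tshift F) (map cwk G) B1_1 i)
      by (eapply wf_topes; [apply k1|exact Tp|exact V3]).
    assert (E' : K0 :: X ∥ phi0 :: map tshift F ∥ map cwk G ⊢ A1_1 ≡ B1_1 ∈ Univ i)
      by (eapply equality_topes'; [apply k1|exact Tp|exact E]).
    destruct (tm_eqb A1_1 B1_1) eqn:Eb.
    + apply tm_eqb_eq in Eb; subst; eapply IHconvF_shape; eauto.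
    + assert (TA : tyeq (K0 :: X) (phi0 :: map tshift F) (map cwk G) B1_1 A1_1)
        by (eexists; apply q_sym; exact E').
      assert (hs : syn (K0 :: X) (phi0 :: map tshift F) (map cwk G) (ann B1_2 B1_1) B1_1)
        by (eapply syn_ann; eauto).
      eapply q_trans; [eapply IHconvF_shape; [exact k2|exact V1'|exact V2|apply c_syn; eapply s_cast;
         [exact hs|exact V1'|exact TA]|exact h]|].
      eapply conv_eq; [|exact TA]. eapply q_trans; [|eapply chk_Ann_eq; eauto].
      eapply ann_erase; eauto; apply syn_sound; [exact hs|apply k2].
Qed.

Lemma peel_ok X F (G : lctx) : forall e T, ok X F G -> syn X F G e T ->
  exists T', syn X F G (peel e) T' /\ X ∥ F ∥ G ⊢ e ≡ peel e ∈ T /\ tyeq X F G T' T.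
Proof.
  fix IH 1; intros e T k H.
  assert (Z : exists T', syn X F G e T' /\ X ∥ F ∥ G ⊢ e ≡ e ∈ T /\ tyeq X F G T' T).
  { destruct (ok_wf _ _ _ _ _ k H) as [i W].
    exists T; split; [exact H|split; [apply q_refl, syn_sound; [exact H|apply k]|eapply ok_tyeq; eauto]]. }
  destruct e as [| | | | | | | p | | | | | | | | | | | |]; try exact Z.
  destruct p as [| | | | | |t r| | | | | | | | | | | | |]; try exact Z.
  destruct r as [| | | | | | | | | |U| | | | | | | | |]; try exact Z.
  cbn [peel]; destruct (synth t) eqn:Es; [|exact Z].
  destruct (syn_Ann_inv _ _ _ _ _ _ H) as (-> & i & W & [[E _]|[[E _]|(S' & C & E)]]);
    [congruence|destruct t; discriminate|].
  destruct (IH t S' k C) as (T' & h1 & h2 & h3); exists T'; split; [exact h1|].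
  split; [|eapply tyeq_trans; eassumption].
  eapply q_trans; [|eapply conv_eq; [exact h2|exact E]].
  eapply ann_erase; eauto; eapply conv_ty; [apply syn_sound; [exact C|apply k]|exact E].
Qed.

Lemma peel_at X F G : forall e T U j, ok X F G -> syn X F G e T ->
  X ∥ F ∥ G ⊢ peel e ∈ U -> X ∥ F ∥ G ⊢ U ∈ Univ j ->
  X ∥ F ∥ G ⊢ e ∈ U /\ X ∥ F ∥ G ⊢ e ≡ peel e ∈ U.
Proof.
  fix IH 1; intros e T U j k H Hp HU.
  assert (Z : X ∥ F ∥ G ⊢ e ∈ U -> X ∥ F ∥ G ⊢ e ∈ U /\ X ∥ F ∥ G ⊢ e ≡ e ∈ U)
    by (split; [|apply q_refl]; assumption).
  destruct e as [| | | | | | | p | | | | | | | | | | | |]; try (apply Z, Hp).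
  destruct p as [| | | | | |t r| | | | | | | | | | | | |]; try (apply Z, Hp).
  destruct r as [| | | | | | | | | |V| | | | | | | | |]; try (apply Z, Hp).
  cbn [peel] in *; destruct (synth t) eqn:Es; [|apply Z, Hp].
  destruct (syn_Ann_inv _ _ _ _ _ _ H) as (-> & i & W & [[E _]|[[E _]|(S' & C & E)]]);
    [congruence|destruct t; discriminate|].
  destruct (IH t S' U j k C Hp HU) as [h1 h2].
  assert (SV : X ∥ F ∥ G ⊢ V ∈ Univ i) by (apply wf_sound; [exact W|apply k]).
  split; [eapply ann_ty; eauto; apply k|].
  eapply q_trans; [|exact h2]. eapply ann_eq; eauto; apply k.
Qed.

Lemma pinst_eq X F G K psi A s t i : is_tope [K] psi -> Forall closed_shapes G ->
  K :: X ∥ psi :: map tshift F ∥ map cwk G ⊢ A ∈ Univ i ->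
  has_cube X s K -> has_cube X t K -> entails X F (TEq s t) ->
  entails X F (tinst psi s) -> entails X F (tinst psi t) ->
  X ∥ F ∥ G ⊢ pinst A s ≡ pinst A t ∈ Univ i.
Proof.
  intros Hp c HA Hs Ht E Es Et.
  assert (HU : forall p, K :: X ∥ p ∥ map cwk G ⊢ Univ i ∈ Univ (S i)) by (intro; apply t_univ).
  assert (HE : X ∥ F ∥ G ⊢ ELam A ∈ Ext K psi (Univ i) TBot RecBot).
  { eapply t_elam with (i := S i).
    - apply t_ext; [exact Hp|apply w_bot| |apply HU|].
      + apply e_bot; [exact Hp|apply e_hyp; left; reflexivity].
      + eapply t_recbot; [apply e_hyp; left; reflexivity|apply HU].
    - exact HA.
    - apply q_bot; [apply e_hyp; left; reflexivity| |].
      + assert (psi_bot : forall g, In g (psi :: map tshift F) ->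
          entails (K :: X) (TBot :: map tshift F) g).
        { intros g [<-|Hg]; [|apply e_hyp; right; exact Hg].
          apply e_bot; [|apply e_hyp; left; reflexivity].
          rewrite <- (tsubst_id psi); eapply is_tope_subst; [|exact Hp].
          intros [|m] L e; cbn in e; [injection e as <-; constructor; reflexivity|destruct m; discriminate]. }
        eapply typing_topes; [apply closed_shapes_map_cwk, c|exact psi_bot|exact HA].
      + eapply t_recbot; [apply e_hyp; left; reflexivity|apply HU]. }
  pose proof (q_ext_beta _ _ _ _ _ _ _ _ _ _ HE HA Hs Es) as e1.
  pose proof (q_ext_beta _ _ _ _ _ _ _ _ _ _ HE HA Ht Et) as e2.
  pose proof (q_eapp _ _ _ _ _ _ _ _ _ _ _ _ (q_refl _ _ _ _ _ HE) Hs Ht E Es) as e3.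
  cbn in e1, e2, e3.
  eapply q_trans; [apply q_sym, e1|]; eapply q_trans; [exact e3|exact e2].
Qed.

Lemma convNe_step X F (G : lctx) a b S S' : ok X F G -> syn X F G a S -> syn X F G b S' ->
  convNe' X F G a b = true -> X ∥ F ∥ G ⊢ a ≡ b ∈ S /\ X ∥ F ∥ G ⊢ b ∈ S.
Proof.
  intros k Ha0 Hb0 H; unfold convNe' in H; cbn zeta in H.
  destruct (peel_ok X F G a S k Ha0) as (T1 & Ha & e1 & t1).
  destruct (peel_ok X F G b S' k Hb0) as (T2 & Hb & _ & _).
  destruct (ok_wf _ _ _ _ _ k Ha0) as [l WS].
  assert (L : X ∥ F ∥ G ⊢ peel a ≡ peel b ∈ T1 /\ X ∥ F ∥ G ⊢ peel b ∈ T1).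
  2: { destruct L as [L1 L2].
       destruct (peel_at X F G b S' S l k Hb0) as [h1 h2];
         [eapply conv_ty; eauto|apply wf_sound; [exact WS|apply k]|].
       split; [|exact h1]. eapply q_trans; [exact e1|].
       eapply q_trans; [eapply conv_eq; [exact L1|exact t1]|apply q_sym, h2]. }
  clear Ha0 Hb0 e1 t1 WS l S S'.
  remember (peel a) as a1 eqn:e; clear e; remember (peel b) as b1 eqn:e; clear e; clear a b.
  apply or_true in H; destruct H as [H|H].
  { apply tm_eqb_eq in H; subst; split; [apply q_refl|]; apply syn_sound; try exact Ha; apply k. }
  destruct a1 as [| | | |f u| | |p|p| | | | | |f s| | | | |]; try discriminate H;
    destruct b1 as [| | | |g v| | |q|q| | | | | |g t| | | | |]; try discriminate H.
  - apply and_true in H; destruct H as [H1 H2].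
    destruct (syn_App_inv _ _ _ _ _ _ Ha) as (A1 & B1 & i1 & WA1 & WB1 & P1 & C1 & ->).
    destruct (syn_App_inv _ _ _ _ _ _ Hb) as (A2 & B2 & i2 & WA2 & WB2 & P2 & C2 & ->).
    rewrite (typeof_syn _ _ _ _ _ P1), (typeof_syn _ _ _ _ _ P2) in H2.
    apply and_true in H2; destruct H2 as [H2 H3].
    assert (TA : tyeq X F G A2 A1).
    { apply or_true in H2; destruct H2 as [E|E]; [|eapply convTy_tyeq; eauto].
      apply tm_eqb_eq in E; subst; eapply ok_tyeq; eauto. }
    destruct (cast_ok _ _ _ _ _ (ann v A2) _ k ltac:(eapply syn_ann; eauto) TA WA1) as [h1 h2].
    assert (E : X ∥ F ∥ G ⊢ u ≡ v ∈ A1).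
    { eapply q_trans; [eapply IHconv; [exact k|exact WA1|exact C1|apply c_syn, h1|exact H3]|].
      eapply conv_eq; [|exact TA]. eapply q_trans; [apply q_sym, h2|]; eapply chk_Ann_eq; eauto. }
    destruct (IHconvNe _ _ _ _ _ _ _ k P1 P2 H1) as [Ef Sg].
    assert (SB : X ∥ F ∥ A1 :: G ⊢ B1 ∈ Univ i1) by (apply wf_sound; [exact WB1|eapply ok_cons; eauto]).
    assert (SA : X ∥ F ∥ G ⊢ A1 ∈ Univ i1) by (apply wf_sound; [exact WA1|apply k]).
    assert (Su : X ∥ F ∥ G ⊢ u ∈ A1) by (apply chk_sound; [exact C1|apply k]).
    assert (Sv : X ∥ F ∥ G ⊢ v ∈ A1)
      by (eapply conv_ty; [apply chk_sound; [exact C2|apply k]|exact TA]).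
    assert (Sau : X ∥ F ∥ G ⊢ ann u A1 ∈ A1) by (apply syn_sound; [eapply syn_ann; eauto|apply k]).
    assert (Eu : X ∥ F ∥ G ⊢ ann u A1 ≡ u ∈ A1) by (eapply chk_Ann_eq; eauto).
    assert (Tu : tyeq X F G (inst1 B1 u) (inst1 B1 (ann u A1)))
      by (exists i1; eapply inst1_eq; eauto using q_refl, q_sym).
    assert (Tv : tyeq X F G (inst1 B1 v) (inst1 B1 u))
      by (exists i1; eapply inst1_eq; eauto using q_refl, q_sym).
    split; [eapply conv_eq; [eapply q_app; [exact Ef|exact E]|exact Tu]|].
    eapply conv_ty; [eapply t_app; [exact Sg|exact Sv]|eapply tyeq_trans; eassumption].
  - destruct (as_ann p) as [[t U]|] eqn:E1; destruct (as_ann q) as [[t' U']|] eqn:E2;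
      try discriminate H.
    destruct (syn_Fst_inv _ _ _ _ _ E1 Ha) as (B & P1), (syn_Fst_inv _ _ _ _ _ E2 Hb) as (B' & P2).
    destruct (IHconvNe _ _ _ _ _ _ _ k P1 P2 H) as [E S2].
    split; [eapply q_fst, E|eapply t_fst, S2].
  - destruct (syn_Snd_inv _ _ _ _ _ Ha) as (A1 & B1 & P1 & ->).
    destruct (syn_Snd_inv _ _ _ _ _ Hb) as (A2 & B2 & P2 & ->).
    destruct (IHconvNe _ _ _ _ _ _ _ k P1 P2 H) as [E S2].
    split; [eapply q_snd, E|]. eapply conv_ty; [eapply t_snd, S2|].
    destruct (ok_wf _ _ _ _ _ k P1) as [i W]; destruct (wf_Sig_inv _ _ _ _ _ _ W) as [WA WB].
    assert (SB : X ∥ F ∥ A1 :: G ⊢ B1 ∈ Univ i) by (apply wf_sound; [exact WB|eapply ok_cons; eauto]).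
    assert (S1 : X ∥ F ∥ G ⊢ p ∈ Sig A1 B1) by (apply syn_sound; [exact P1|apply k]).
    exists i; eapply inst1_eq;
      [apply wf_sound; [exact WA|apply k]|exact SB|exact SB|apply q_refl, SB|eapply t_fst, S2|
       eapply t_fst, S1|apply q_sym; eapply q_fst, E].
  - apply and_true in H; destruct H as [H1 H].
    destruct (syn_EApp_inv _ _ _ _ _ _ Ha) as (K & psi & A & phi & a & P1 & Q1 & R1 & ->).
    destruct (syn_EApp_inv _ _ _ _ _ _ Hb) as (K' & psi' & A' & phi' & a' & P2 & Q2 & R2 & ->).
    rewrite (typeof_syn _ _ _ _ _ P1) in H.
    apply and_true in H; destruct H as [H2 H3].
    apply has_cube_b_sound in H2; apply ent_sound in H3.
    destruct (IHconvNe _ _ _ _ _ _ _ k P1 P2 H1) as [E Sg].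
    split; [eapply q_eapp; [exact E|exact Q1|exact H2|exact H3|exact R1]|].
    destruct (ok_wf _ _ _ _ _ k P1) as [i W].
    destruct (wf_Ext_inv _ _ _ _ _ _ _ _ _ W) as (Hpsi & _ & _ & WA & _).
    assert (R3 : entails X F (tinst psi t)).
    { eapply e_subst with (s := s) (K := K); eauto.
      rewrite <- (tsubst_id psi); eapply is_tope_subst; [|exact Hpsi].
      intros [|m] L e; cbn in e; [injection e as <-; constructor; reflexivity|destruct m; discriminate]. }
    eapply conv_ty; [eapply t_eapp; [exact Sg|exact H2|exact R3]|].
    exists i; eapply pinst_eq; [exact Hpsi|apply k| |exact H2|exact Q1| |exact R3|exact R1].
    + apply wf_sound; [exact WA|apply closed_shapes_map_cwk, k].
    + eapply e_sym; [exact Q1|exact H2|exact H3].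
Qed.

End Step.

(** Applications and projections of a variable do not reduce.  Recognizing them avoids the
    computation of types along long spines. *)
Fixpoint rigid (e : tm) : bool :=
  match e with
  | Var _ => true
  | App f _ => rigid f
  | Fst p | Snd p => rigid p
  | _ => false
  end.

Record checker : Type := Checker {
  whnf : list cube -> list tope -> lctx -> tm -> tm;
  whnfTy : list cube -> list tope -> lctx -> tm -> tm;
  conv : list cube -> list tope -> lctx -> tm -> tm -> tm -> bool;
  convF : list cube -> list tope -> lctx -> tm -> tm -> tm -> bool;
  convTy : list cube -> list tope -> lctx -> tm -> tm -> bool;
  convTyF : list cube -> list tope -> lctx -> tm -> tm -> bool;
  convNe : list cube -> list tope -> lctx -> tm -> tm -> bool }.

Record sound (c : checker) : Prop := Sound {
  whnf_sound : forall X F (G : lctx) e T, ok X F G -> syn X F G e T -> red X F G e T (whnf c X F G e);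
  whnfTy_sound : forall X F (G : lctx) A i, ok X F G -> wf X F G A i ->
    wf X F G (whnfTy c X F G A) i /\ X ∥ F ∥ G ⊢ A ≡ whnfTy c X F G A ∈ Univ i;
  conv_sound : forall X F (G : lctx) T a b i, ok X F G -> wf X F G T i ->
    chk X F G a T -> chk X F G b T -> conv c X F G T a b = true -> X ∥ F ∥ G ⊢ a ≡ b ∈ T;
  convF_sound : forall X F (G : lctx) T a b i, ok X F G -> wf X F G T i ->
    chk X F G a T -> chk X F G b T -> convF c X F G T a b = true -> X ∥ F ∥ G ⊢ a ≡ b ∈ T;
  convTy_sound : forall X F (G : lctx) A B i, ok X F G -> wf X F G A i -> wf X F G B i ->
    convTy c X F G A B = true -> X ∥ F ∥ G ⊢ A ≡ B ∈ Univ i;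
  convTyF_sound : forall X F (G : lctx) A B i, ok X F G -> wf X F G A i -> wf X F G B i ->
    convTyF c X F G A B = true -> X ∥ F ∥ G ⊢ A ≡ B ∈ Univ i;
  convNe_sound : forall X F (G : lctx) a b S S', ok X F G -> syn X F G a S -> syn X F G b S' ->
    convNe c X F G a b = true -> X ∥ F ∥ G ⊢ a ≡ b ∈ S /\ X ∥ F ∥ G ⊢ b ∈ S }.

(** The argument bounds the depth of recursion.  When it is exhausted, reduction stops and
    tests fail. *)
Fixpoint check_with (n : nat) : checker :=
  match n with
  | 0 => Checker (fun _ _ _ e => e) (fun _ _ _ A => A) (fun _ _ _ _ _ _ => false)
           (fun _ _ _ _ _ _ => false) (fun _ _ _ _ _ => false) (fun _ _ _ _ _ => false)
           (fun _ _ _ _ _ => false)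
  | S n =>
      let (w, wt, c, cf, ct, ctf, cn) := check_with n in
      Checker (fun X F G e => if rigid e then e else whnf' w c ct X F G e) (whnfTy' w) (conv' w wt c cf ct cn) (convF' c cf)
        (convTy' wt c cf ct ctf cn) (convTyF' ct ctf) (convNe' c ct cn)
  end.

Lemma check_with_sound n : sound (check_with n).
Proof.
  induction n as [|n IH].
  - constructor; cbn; try discriminate.
    + intros X F G; apply red_refl.
    + intros X F G A i k W; split; [exact W|apply q_refl, wf_sound; [exact W|apply k]].
  - destruct IH as [h1 h2 h3 h4 h5 h6 h7]; cbn [check_with]; destruct (check_with n); cbn in *.
    constructor; cbn.
    + intros X F G e T k H; destruct (rigid e); [apply red_refl; assumption|].
      eapply whnf_step; eassumption.
    + eapply whnfTy_step; eassumption.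
    + eapply conv_step; eassumption.
    + eapply convF_step; eassumption.
    + eapply convTy_step; eassumption.
    + eapply convTyF_step; eassumption.
    + eapply convNe_step; eassumption.
Qed.

(** * Elaboration *)

(** The type of a term is to be found, or it is given, or the term is to be a type. *)
Inductive mode : Type := MInfer | MCheck (T : tm) | MType.

Definition const_type (t : tm) : option tm :=
  match t with
  | FunExt i => Some (funext i 0 0)
  | RelFunExt i K psi phi =>
      if is_tope_b [K] psi && is_tope_b [K] phi && ent [K] [phi] psi
      then Some (relfunext i K psi phi 0 0) else None
  | _ => None
  end.

Notation "'let*' p := a 'in' b" := (match a with Some p => b | _ => None end)
  (at level 200, p pattern, a at level 100, b at level 200).
Notation "'assert*' a 'in' b" := (if a then b else None) (at level 200, a at level 100, b at level 200).

Section Elab.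
Variable c : checker.

(** The term [t] introduces [T1]; [T] is the type against which it is checked. *)
Definition intro (T1 T t : tm) : tm := if tm_eqb T1 T then t else Ann (Ann t T1) T.

Definition finish X F G (m : mode) (e U : tm) : option (tm * tm) :=
  match m with
  | MInfer => Some (e, U)
  | MCheck T => if tm_eqb U T then Some (e, T)
                else assert* convTyF c X F G U T in Some (Ann e T, T)
  | MType => match whnfTy c X F G U with Univ i => Some (recast U (Univ i) e, Univ i) | _ => None end
  end.

Definition finishTy X F G (m : mode) (A : tm) (i : nat) : option (tm * tm) :=
  match m with
  | MInfer => Some (Ann A (Univ i), Univ i)
  | MCheck T => match whnfTy c X F G T with
                | Univ j => assert* i <=? j in Some (intro (Univ j) T A, T)
                | _ => None
                end
  | MType => Some (A, Univ i)
  end.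

(** Bidirectional type checking of raw terms, which annotates them on the way.  The result
    consists of the annotated term and its type, which for the mode [MCheck T] is [T] and
    for the mode [MType] a universe.  Since the result is derivable by itself, its relation
    to the raw term does not matter for a proof; for a statement it is checked at the end. *)
Fixpoint elab (t : tm) (X : list cube) (F : list tope) (G : lctx) (m : mode) {struct t} :
    option (tm * tm) :=
  match t with
  | Var k => let* A := lookup G k in finish X F G m (Var k) (shiftn k A)
  | Univ i => finishTy X F G m (Univ i) (S i)
  | Pi A B =>
      let* (A, Univ i) := elab A X F G MType in
      let* (B, Univ j) := elab B X F (lcons 0 A G) MType in
      finishTy X F G m (Pi A B) (max i j)
  | Sig A B =>
      let* (A, Univ i) := elab A X F G MType in
      let* (B, Univ j) := elab B X F (lcons 0 A G) MType in
      finishTy X F G m (Sig A B) (max i j)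
  | Id A a b =>
      let* (A, Univ i) := elab A X F G MType in
      let* (a, _) := elab a X F G (MCheck A) in
      let* (b, _) := elab b X F G (MCheck A) in
      finishTy X F G m (Id A a b) i
  | Ext K psi A phi a =>
      assert* is_tope_b [K] psi && is_tope_b [K] phi && ent [K] [phi] psi in
      let* (A, Univ i) := elab A (K :: X) (psi :: map tshift F) (bump G) MType in
      let* (a, _) := elab a (K :: X) (phi :: map tshift F) (bump G) (MCheck A) in
      finishTy X F G m (Ext K psi A phi a) i
  | Lam b =>
      match m with
      | MCheck T =>
          match whnfTy c X F G T with
          | Pi A B =>
              let* (b, _) := elab b X F (lcons 0 A G) (MCheck B) in
              Some (intro (Pi A B) T (Lam b), T)
          | _ => None
          end
      | _ => None
      end
  | Pair a b =>
      match m with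
      | MCheck T =>
          match whnfTy c X F G T with
          | Sig A B =>
              let* (a, _) := elab a X F G (MCheck A) in
              let* (b, _) := elab b X F G (MCheck (inst1 B (ann a A))) in
              Some (intro (Sig A B) T (Pair a b), T)
          | _ => None
          end
      | _ => None
      end
  | ELam b =>
      match m with
      | MCheck T =>
          match whnfTy c X F G T with
          | Ext K psi A phi a =>
              let* (b, _) := elab b (K :: X) (psi :: map tshift F) (bump G) (MCheck A) in
              assert* convF c (K :: X) (phi :: map tshift F) (bump G) A b a in
              Some (intro (Ext K psi A phi a) T (ELam b), T)
          | _ => None
          end
      | _ => None
      end
  | Refl a =>
      match m with
      | MInfer =>
          let* (a, A) := elab a X F G MInfer in Some (Ann (Refl a) (Id A a a), Id A a a)
      | MCheck T =>
          match whnfTy c X F G T with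
          | Id A u v =>
              let* (a, _) := elab a X F G (MCheck A) in
              assert* convF c X F G A a u && convF c X F G A u v in
              Some (intro (Id A u v) T (Refl u), T)
          | _ => None
          end
      | MType => None
      end
  | RecBot =>
      match m with
      | MCheck T => assert* ent X F TBot in Some (RecBot, T)
      | _ => None
      end
  | RecOr p q a b =>
      match m with
      | MCheck T =>
          assert* is_tope_b X p && is_tope_b X q && ent X F (TOr p q) in
          let* (a, _) := elab a X (p :: F) G (MCheck T) in
          let* (b, _) := elab b X (q :: F) G (MCheck T) in
          assert* convF c X (p :: q :: F) G T a b in
          Some (RecOr p q a b, T)
      | _ => None
      end
  | App f u =>
      let* (f, U) := elab f X F G MInfer in
      match whnfTy c X F G U with
      | Pi A B =>
          let* (u, _) := elab u X F G (MCheck A) in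
          finish X F G m (App (recast U (Pi A B) f) u) (inst1 B (ann u A))
      | _ => None
      end
  | EApp f s =>
      let* (f, U) := elab f X F G MInfer in
      match whnfTy c X F G U with
      | Ext K psi A phi a =>
          assert* has_cube_b X s K && ent X F (tinst psi s) in
          finish X F G m (EApp (recast U (Ext K psi A phi a) f) s) (pinst A s)
      | _ => None
      end
  | Snd p =>
      let* (p, U) := elab p X F G MInfer in
      match whnfTy c X F G U with
      | Sig A B =>
          let p := recast U (Sig A B) p in finish X F G m (Snd p) (inst1 B (Fst p))
      | _ => None
      end
  | J C d p =>
      let* (p, U) := elab p X F G MInfer in
      match whnfTy c X F G U with
      | Id A a b =>
          let* (C, Univ j) := elab C X F (lcons 0 (Id (wk A) (wk a) (Var 0)) (lcons 0 A G)) MType in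
          let* (d, _) := elab d X F G (MCheck (inst2 C (ann a A) (Ann (Refl a) (Id A a (ann a A))))) in
          let p := recast U (Id A a b) p in
          finish X F G m (J C d p) (inst2 C (ann b A) (ann_path A a b p))
      | _ => None
      end
  | Fst p =>
      match p with
      | Pair a (Refl U) =>
          let* (U, Univ _) := elab U X F G MType in
          match const_type a with
          | Some V => assert* tm_eqb (erase U) V in finish X F G m (Ann a U) U
          | None => let* (a, _) := elab a X F G (MCheck U) in finish X F G m (ann a U) U
          end
      | _ =>
          let* (p, U) := elab p X F G MInfer in
          match whnfTy c X F G U with
          | Sig A B => finish X F G m (Fst (recast U (Sig A B) p)) A
          | _ => None
          end
      end
  | FunExt _ | RelFunExt _ _ _ _ | Univalence _ => None
  end.

(** ** Soundness of elaboration *)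

Hypothesis csound : sound c.

Definition mode_ok X F (G : list tm) (m : mode) : Prop :=
  match m with MCheck T => exists i, wf X F G T i | _ => True end.

Definition elab_ok X F (G : list tm) (m : mode) (e T : tm) : Prop :=
  match m with
  | MInfer => syn X F G e T
  | MCheck T0 => T = T0 /\ chk X F G e T
  | MType => exists i, T = Univ i /\ wf X F G e i
  end.

Lemma whnfTy_ok X F (G : lctx) A i : ok X F G -> wf X F G A i ->
  wf X F G (whnfTy c X F G A) i /\ tyeq X F G A (whnfTy c X F G A).
Proof.
  intros k W; destruct (whnfTy_sound _ csound _ _ _ _ _ k W) as [h1 h2].
  split; [exact h1|exists i; exact h2].
Qed.

Lemma intro_ok X F (G : lctx) T1 T t i j : ok X F G -> synth t = false -> wf X F G T1 i ->
  wf X F G T j -> tyeq X F G T T1 -> chk X F G t T1 -> chk X F G (intro T1 T t) T.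
Proof.
  intros k Es W1 W E H; unfold intro; destruct (tm_eqb T1 T) eqn:Eb.
  - apply tm_eqb_eq in Eb; subst; exact H.
  - apply c_syn; eapply s_cast; [eapply s_ann|eassumption|apply tyeq_sym]; eassumption.
Qed.

Lemma finish_ok X F (G : lctx) m e U e' T : ok X F G -> mode_ok X F G m -> syn X F G e U ->
  finish X F G m e U = Some (e', T) -> elab_ok X F G m e' T.
Proof.
  intros k M H E; destruct (ok_wf _ _ _ _ _ k H) as [i W]; destruct m as [|T0|]; cbn in *.
  - injection E as -> ->; exact H.
  - destruct M as [j W0]; destruct (tm_eqb U T0) eqn:Eb.
    + injection E as -> ->; apply tm_eqb_eq in Eb; subst; split; [reflexivity|apply c_syn, H].
    + destruct (convTyF c X F G U T0) eqn:Ec; [|discriminate]; injection E as <- <-.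
      split; [reflexivity|]; apply c_syn; eapply s_cast; [exact H|exact W0|].
      exists (max i j); eapply (convTyF_sound _ csound); [exact k| | |exact Ec];
        eapply wf_le; try eassumption; lia.
  - destruct (whnfTy_ok _ _ _ _ _ k W) as [W1 E1].
    destruct (whnfTy c X F G U) as [|j| | | | | | | | | | | | | | | | | |]; try discriminate.
    injection E as <- <-; exists j; split; [reflexivity|].
    eapply wf_ne; [|apply le_n]. apply (cast_ok _ _ _ _ _ e _ k H E1 W1).
Qed.

Lemma finishTy_ok X F (G : lctx) m A i e' T : ok X F G -> mode_ok X F G m -> wf X F G A i ->
  synth A = false -> finishTy X F G m A i = Some (e', T) -> elab_ok X F G m e' T.
Proof.
  intros k M W Es E; destruct m as [|T0|]; cbn in *.
  - injection E as <- <-; eapply s_ann; [exact Es|apply (wf_univ _ _ _ _ (S i)); lia|].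
    apply c_ty; assumption.
  - destruct M as [j0 W0]; destruct (whnfTy_ok _ _ _ _ _ k W0) as [W1 E1].
    destruct (whnfTy c X F G T0) as [|j| | | | | | | | | | | | | | | | | |]; try discriminate.
    destruct (i <=? j) eqn:L; [|discriminate]; injection E as <- <-; apply Nat.leb_le in L.
    split; [reflexivity|]; eapply intro_ok; eauto; apply c_ty; [exact Es|eapply wf_le; eassumption].
  - injection E as <- <-; exists i; auto.
Qed.

Lemma ok_bump X F (G : lctx) K p : ok X F G -> ok (K :: X) (p :: map tshift F) (bump G).
Proof. rewrite den_bump; apply ok_shape. Qed.

Lemma shape_good X F K psi phi : is_tope [K] psi -> is_tope [K] phi -> entails [K] [phi] psi ->
  topes_good (psi :: map tshift F) (K :: X) (phi :: map tshift F) PVar.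
Proof. intros h1 h2 h3 p Hp; rewrite tsubst_id; exact (entails_shape X F K psi phi h1 h2 h3 p Hp). Qed.

Lemma motive_ok X F (G : lctx) A a i : ok X F G -> wf X F G A i -> chk X F G a A ->
  wf X F (A :: G) (Id (wk A) (wk a) (Var 0)) i.
Proof.
  intros [cl k] W H; apply wf_id; [apply wf_wk; assumption|apply chk_wk; assumption|].
  apply c_syn; rewrite <- shiftn_0; eapply s_var; [reflexivity|].
  rewrite shiftn_0; apply wf_wk; eassumption.
Qed.

Lemma const_type_ok X F G a V : const_type a = Some V -> constant a = true /\ X ∥ F ∥ G ⊢ a ∈ V.
Proof.
  destruct a; cbn; try discriminate; intro E.
  - injection E as <-; split; [reflexivity|apply t_funext].
  - destruct (is_tope_b [K] psi) eqn:E1; [|discriminate].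
    destruct (is_tope_b [K] phi) eqn:E2; [|discriminate].
    destruct (ent [K] [phi] psi) eqn:E3; [|discriminate]; injection E as <-.
    split; [reflexivity|]; apply t_relfunext;
      [apply is_tope_b_sound|apply is_tope_b_sound|apply ent_sound]; assumption.
Qed.

Ltac step H E :=
  match type of H with
  | match elab ?t ?X ?F ?G ?m with _ => _ end = Some _ =>
      destruct (elab t X F G m) as [[? ?]|] eqn:E; [|discriminate H]
  | (if ?b then _ else _) = Some _ => destruct b eqn:E; [|discriminate H]
  end.
Ltac univ H := match type of H with
  | match ?V with Univ _ => _ | _ => _ end = Some _ =>
      destruct V as [|?| | | | | | | | | | | | | | | | | |]; try discriminate H
  end.

Lemma elab_sound : forall t X F (G : lctx) m e T, ok X F G -> mode_ok X F G m ->
  elab t X F G m = Some (e, T) -> elab_ok X F G m e T.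
Proof.
  fix IH 1; intros t X F G m e T k M H.
  assert (App_ty : forall f U, syn X F G f U -> exists i, wf X F G (whnfTy c X F G U) i /\
            syn X F G (recast U (whnfTy c X F G U) f) (whnfTy c X F G U)).
  { intros f U Hf; destruct (ok_wf _ _ _ _ _ k Hf) as [i W].
    destruct (whnfTy_ok _ _ _ _ _ k W) as [W1 E1]; exists i; split; [exact W1|].
    apply (cast_ok _ _ _ _ _ f _ k Hf E1 W1). }
  destruct t as [n|i|A B|b|f u|A B|a b|p|p|A a b|a|C d p|K psi A phi a|b|f s| |p q a b| | | ];
    cbn [elab] in H; try discriminate H.
  - rewrite lookup_den in H; destruct (nth_error (den G) n) as [A|] eqn:E; [|discriminate].
    destruct (proj2 k n A E) as [i W].
    eapply finish_ok; [exact k|exact M|eapply s_var; eassumption|exact H].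
  - refine (finishTy_ok _ _ _ _ _ _ _ _ k M _ _ H); [|reflexivity]; apply wf_univ; lia.
  - step H E1; univ H. destruct (IH _ _ _ _ MType _ _ k I E1) as (l & Ei & WA); injection Ei as ->.
    step H E2; univ H.
    destruct (IH _ _ _ (lcons 0 t G) MType _ _ (ok_cons _ _ _ _ _ k WA) I E2) as (l' & Ej & WB).
    injection Ej as ->.
    refine (finishTy_ok _ _ _ _ _ _ _ _ k M _ _ H); [|reflexivity].
    apply wf_pi; [eapply wf_le; [exact WA|lia]|eapply wf_le; [exact WB|lia]].
  - destruct m as [|T0|]; try discriminate; destruct M as [i0 W0].
    destruct (whnfTy_ok _ _ _ _ _ k W0) as [W1 E1].
    destruct (whnfTy c X F G T0) as [| |A B| | | | | | | | | | | | | | | | |]; try discriminate.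
    destruct (wf_Pi_inv _ _ _ _ _ _ W1) as [WA WB].
    step H E2; injection H as <- <-.
    destruct (IH _ _ _ (lcons 0 A G) (MCheck B) _ _ (ok_cons _ _ _ _ _ k WA) (ex_intro _ _ WB) E2) as [-> C].
    split; [reflexivity|]; eapply intro_ok; eauto; eapply c_lam; eassumption.
  - step H E1. pose proof (IH _ _ _ _ MInfer _ _ k I E1) as Hf; cbn in Hf.
    destruct (App_ty _ _ Hf) as (i & W & Hc).
    destruct (whnfTy c X F G t0) as [| |A B| | | | | | | | | | | | | | | | |]; try discriminate.
    destruct (wf_Pi_inv _ _ _ _ _ _ W) as [WA WB].
    step H E2; destruct (IH _ _ _ _ _ _ _ k (ex_intro _ _ WA : mode_ok X F G (MCheck A)) E2) as [-> C].
    eapply finish_ok; [exact k|exact M| |exact H]; eapply s_app; eassumption.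
  - step H E1; univ H. destruct (IH _ _ _ _ MType _ _ k I E1) as (l & Ei & WA); injection Ei as ->.
    step H E2; univ H.
    destruct (IH _ _ _ (lcons 0 t G) MType _ _ (ok_cons _ _ _ _ _ k WA) I E2) as (l' & Ej & WB).
    injection Ej as ->.
    refine (finishTy_ok _ _ _ _ _ _ _ _ k M _ _ H); [|reflexivity].
    apply wf_sig; [eapply wf_le; [exact WA|lia]|eapply wf_le; [exact WB|lia]].
  - destruct m as [|T0|]; try discriminate; destruct M as [i0 W0].
    destruct (whnfTy_ok _ _ _ _ _ k W0) as [W1 E1].
    destruct (whnfTy c X F G T0) as [| | | | |A B| | | | | | | | | | | | | |]; try discriminate.
    destruct (wf_Sig_inv _ _ _ _ _ _ W1) as [WA WB].
    step H E2; destruct (IH _ _ _ _ _ _ _ k (ex_intro _ _ WA : mode_ok X F G (MCheck A)) E2) as [-> Ca].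
    step H E3; injection H as <- <-.
    assert (WI : wf X F G (inst1 B (ann t A)) i0).
    { eapply wf_inst1; [apply k|apply k|eapply wf_closed; [apply k|exact WA]| |exact WB].
      eapply syn_ann; eassumption. }
    destruct (IH _ _ _ _ _ _ _ k (ex_intro _ _ WI : mode_ok X F G (MCheck _)) E3) as [-> Cb].
    split; [reflexivity|]; eapply intro_ok; eauto; eapply c_pair; eassumption.
  - assert (Z : forall p', elab p' X F G MInfer = elab p X F G MInfer -> 
       (let* (p, U) := elab p X F G MInfer in
        match whnfTy c X F G U with
        | Sig A B => finish X F G m (Fst (recast U (Sig A B) p)) A
        | _ => None
        end) = Some (e, T) -> elab_ok X F G m e T).
    { intros _ _ H'; step H' E1. pose proof (IH _ _ _ _ MInfer _ _ k I E1) as Hf; cbn in Hf.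
      destruct (App_ty _ _ Hf) as (i & W & Hc).
      destruct (whnfTy c X F G t0) as [| | | | |A B| | | | | | | | | | | | | |]; try discriminate.
      destruct (wf_Sig_inv _ _ _ _ _ _ W) as [WA WB].
      eapply finish_ok; [exact k|exact M| |exact H']; eapply s_fst; eassumption. }
    destruct p as [| | | | | |a r| | | | | | | | | | | | |]; try (apply (Z _ eq_refl H)).
    destruct r as [| | | | | | | | | |U| | | | | | | | |]; try (apply (Z _ eq_refl H)).
    clear Z; step H E1; univ H.
    destruct (IH _ _ _ _ MType _ _ k I E1) as (l & Ei & WU); injection Ei as ->.
    destruct (const_type a) as [V|] eqn:Ea.
    + step H E2; apply tm_eqb_eq in E2; subst V.
      destruct (const_type_ok X F G _ _ Ea) as [Ec Ha].
      eapply finish_ok; [exact k|exact M| |exact H]; eapply s_raw; [exact Ec| |exact WU].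
      eapply t_conv; [exact Ha|apply q_sym, (proj2 (proj2 annotated_erase)); [exact WU|apply k]].
    + step H E2; destruct (IH _ _ _ _ _ _ _ k (ex_intro _ _ WU : mode_ok X F G (MCheck _)) E2) as [-> Ca].
      eapply finish_ok; [exact k|exact M| |exact H]; eapply syn_ann; eassumption.
  - step H E1. pose proof (IH _ _ _ _ MInfer _ _ k I E1) as Hf; cbn in Hf.
    destruct (App_ty _ _ Hf) as (i & W & Hc).
    destruct (whnfTy c X F G t0) as [| | | | |A B| | | | | | | | | | | | | |]; try discriminate.
    destruct (wf_Sig_inv _ _ _ _ _ _ W) as [WA WB].
    eapply finish_ok; [exact k|exact M| |exact H]; eapply s_snd; eassumption.
  - step H E1; univ H. destruct (IH _ _ _ _ MType _ _ k I E1) as (l & Ei & WA); injection Ei as ->.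
    step H E2; destruct (IH _ _ _ _ _ _ _ k (ex_intro _ _ WA : mode_ok X F G (MCheck _)) E2) as [-> Ca].
    step H E3; destruct (IH _ _ _ _ _ _ _ k (ex_intro _ _ WA : mode_ok X F G (MCheck _)) E3) as [-> Cb].
    refine (finishTy_ok _ _ _ _ _ _ _ _ k M _ _ H); [|reflexivity]; apply wf_id; assumption.
  - destruct m as [|T0|]; try discriminate.
    + step H E1; injection H as <- <-. pose proof (IH _ _ _ _ MInfer _ _ k I E1) as Ha; cbn in Ha.
      destruct (ok_wf _ _ _ _ _ k Ha) as [i W].
      eapply s_ann; [reflexivity|eapply wf_id; eauto using c_syn|].
      eapply c_refl; eauto using c_syn; apply q_refl, syn_sound; [exact Ha|apply k].
    + destruct M as [i0 W0]. destruct (whnfTy_ok _ _ _ _ _ k W0) as [W1 E1].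
      destruct (whnfTy c X F G T0) as [| | | | | | | | |A u v| | | | | | | | | |]; try discriminate.
      destruct (wf_Id_inv _ _ _ _ _ _ _ W1) as (WA & Cu & Cv).
      step H E2; destruct (IH _ _ _ _ _ _ _ k (ex_intro _ _ WA : mode_ok X F G (MCheck _)) E2) as [-> Ca].
      step H E3; injection H as <- <-; apply and_true in E3; destruct E3 as [_ E3].
      split; [reflexivity|]; eapply intro_ok; eauto; eapply c_refl; eauto.
      eapply (convF_sound _ csound); eassumption.
  - step H E1. pose proof (IH _ _ _ _ MInfer _ _ k I E1) as Hf; cbn in Hf.
    destruct (App_ty _ _ Hf) as (i & W & Hc).
    destruct (whnfTy c X F G t0) as [| | | | | | | | |A a b| | | | | | | | | |]; try discriminate.
    destruct (wf_Id_inv _ _ _ _ _ _ _ W) as (WA & Ca & Cb).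
    pose proof (motive_ok _ _ _ _ _ _ k WA Ca) as WI.
    step H E2; univ H.
    destruct (IH _ _ _ (lcons 0 (Id (wk A) (wk a) (Var 0)) (lcons 0 A G)) MType _ _
      (ok_cons _ _ _ _ _ (ok_cons _ _ _ _ _ k WA) WI) I E2) as (l' & Ej & WC); injection Ej as ->.
    step H E3.
    assert (WD : wf X F G (inst2 t1 (ann a A) (Ann (Refl a) (Id A a (ann a A)))) l').
    { assert (h : syn X F G (ann a A) A) by (eapply syn_ann; eassumption).
      apply (wf_inst2 X F G A a); [apply k|apply k|eapply wf_closed; [apply k|exact WA]|
        apply (chk_closed _ _ _ _ _ (proj1 k) Ca)|exact h| |exact WC].
      assert (WI' : wf X F G (Id A a (ann a A)) i) by (apply wf_id; auto using c_syn).
      eapply s_ann; [reflexivity|exact WI'|].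
      eapply c_refl; eauto using c_syn; apply q_sym; eapply chk_Ann_eq; eauto. }
    destruct (IH _ _ _ _ _ _ _ k (ex_intro _ _ WD : mode_ok X F G (MCheck _)) E3) as [-> Cd].
    eapply finish_ok; [exact k|exact M| |exact H]; eapply s_J; eassumption.
  - step H E0. apply and_true in E0; destruct E0 as [E0 h3]; apply and_true in E0; destruct E0 as [h1 h2].
    apply is_tope_b_sound in h1, h2; apply ent_sound in h3.
    step H E1; univ H.
    destruct (IH _ _ _ _ MType _ _ (ok_bump _ _ _ _ _ k) I E1) as (l & Ei & WA); injection Ei as ->.
    assert (WA' : wf (K :: X) (phi :: map tshift F) (bump G) t l).
    { eapply wf_topes; [apply (ok_bump _ _ _ K psi k)|exact (shape_good X F K psi phi h1 h2 h3)|exact WA]. }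
    step H E2.
    destruct (IH _ _ _ _ _ _ _ (ok_bump _ _ _ _ _ k) (ex_intro _ _ WA' : mode_ok _ _ _ (MCheck _)) E2)
      as [-> Ca].
    rewrite den_bump in *.
    refine (finishTy_ok _ _ _ _ _ _ _ _ k M _ _ H); [|reflexivity]; apply wf_ext; assumption.
  - destruct m as [|T0|]; try discriminate; destruct M as [i0 W0].
    destruct (whnfTy_ok _ _ _ _ _ k W0) as [W1 E1].
    destruct (whnfTy c X F G T0) as [| | | | | | | | | | | |K psi A phi a| | | | | | |]; try discriminate.
    destruct (wf_Ext_inv _ _ _ _ _ _ _ _ _ W1) as (h1 & h2 & h3 & WA & Ca).
    rewrite <- den_bump in WA, Ca.
    step H E2.
    destruct (IH _ _ _ _ _ _ _ (ok_bump _ _ _ _ _ k) (ex_intro _ _ WA : mode_ok _ _ _ (MCheck _)) E2)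
      as [-> Cb].
    step H E3; injection H as <- <-.
    pose proof (shape_good X F K psi phi h1 h2 h3) as g.
    assert (E : K :: X ∥ phi :: map tshift F ∥ bump G ⊢ t ≡ a ∈ A).
    { eapply (convF_sound _ csound); [apply ok_bump, k| | |exact Ca|exact E3].
      - eapply wf_topes; [apply (ok_bump _ _ _ K psi k)|exact g|exact WA].
      - eapply chk_topes; [apply (ok_bump _ _ _ K psi k)|exact g|exact Cb]. }
    rewrite den_bump in *.
    split; [reflexivity|]; eapply intro_ok; eauto; eapply c_elam; eassumption.
  - step H E1. pose proof (IH _ _ _ _ MInfer _ _ k I E1) as Hf; cbn in Hf.
    destruct (App_ty _ _ Hf) as (i & W & Hc).
    destruct (whnfTy c X F G t0) as [| | | | | | | | | | | |K psi A phi a| | | | | | |]; try discriminate.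
    destruct (wf_Ext_inv _ _ _ _ _ _ _ _ _ W) as (h1 & h2 & h3 & WA & Ca).
    step H E2; apply and_true in E2; destruct E2 as [E2 E3].
    eapply finish_ok; [exact k|exact M| |exact H]; apply (s_eapp X F G _ s K psi A phi a i h1 WA Hc).
    + apply has_cube_b_sound, E2.
    + apply ent_sound, E3.
  - destruct m as [|T0|]; try discriminate; destruct M as [i0 W0].
    step H E1; injection H as <- <-; split; [reflexivity|].
    eapply c_recbot; [exact W0|apply ent_sound, E1].
  - destruct m as [|T0|]; try discriminate; destruct M as [i0 W0].
    step H E0. apply and_true in E0; destruct E0 as [E0 h3]; apply and_true in E0; destruct E0 as [h1 h2].
    apply is_tope_b_sound in h1, h2; apply ent_sound in h3.
    assert (g : forall r, topes_good F X (r :: F) PVar) by (intro; apply topes_good_cons).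
    assert (W : forall r, wf X (r :: F) G T0 i0) by (intro r; eapply wf_topes; [apply k|apply g|exact W0]).
    step H E1; destruct (IH _ _ _ _ _ _ _ (ok_topes _ _ _ _ (g p) k)
      (ex_intro _ _ (W p) : mode_ok _ _ _ (MCheck _)) E1) as [-> Ca].
    step H E2; destruct (IH _ _ _ _ _ _ _ (ok_topes _ _ _ _ (g q) k)
      (ex_intro _ _ (W q) : mode_ok _ _ _ (MCheck _)) E2) as [-> Cb].
    step H E3; injection H as <- <-; split; [reflexivity|].
    eapply c_recor; eauto.
    assert (gp : topes_good (p :: F) X (p :: q :: F) PVar).
    { intros x [<-|Hx]; rewrite tsubst_id; apply e_hyp; cbn; auto. }
    assert (gq : topes_good (q :: F) X (p :: q :: F) PVar).
    { intros x [<-|Hx]; rewrite tsubst_id; apply e_hyp; cbn; auto. }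
    eapply equality_topes; [apply k| |eapply (convF_sound _ csound); [| | | |exact E3]].
    + intros x [<-|[<-|Hx]].
      * eapply e_and1, e_hyp; left; reflexivity.
      * eapply e_and2, e_hyp; left; reflexivity.
      * apply e_hyp; right; exact Hx.
    + eapply ok_topes; [exact gq|]; eapply ok_topes; [apply g|exact k].
    + eapply wf_topes; [apply k|exact gq|apply W].
    + eapply chk_topes; [apply k|exact gp|exact Ca].
    + eapply chk_topes; [apply k|exact gq|exact Cb].
Qed.

End Elab.

(** * Raising universe levels *)

(** Every rule holds at all levels, and the levels in it may be shifted together.  So a
    theorem about the lowest universe holds for every universe. *)
Fixpoint raise (k : nat) (t : tm) : tm :=
  match t with
  | Var n => Var n
  | Univ i => Univ (i + k)
  | Pi A B => Pi (raise k A) (raise k B)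
  | Lam b => Lam (raise k b)
  | App f a => App (raise k f) (raise k a)
  | Sig A B => Sig (raise k A) (raise k B)
  | Pair a b => Pair (raise k a) (raise k b)
  | Fst p => Fst (raise k p)
  | Snd p => Snd (raise k p)
  | Id A a b => Id (raise k A) (raise k a) (raise k b)
  | Refl a => Refl (raise k a)
  | J C d p => J (raise k C) (raise k d) (raise k p)
  | Ext K psi A phi a => Ext K psi (raise k A) phi (raise k a)
  | ELam b => ELam (raise k b)
  | EApp f s => EApp (raise k f) s
  | RecBot => RecBot
  | RecOr p q a b => RecOr p q (raise k a) (raise k b)
  | FunExt i => FunExt (i + k)
  | RelFunExt i K psi phi => RelFunExt (i + k) K psi phi
  | Univalence i => Univalence (i + k)
  end.

Lemma raise_ren k t : forall r q, raise k (ren r q t) = ren r q (raise k t).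
Proof. induction t; intros; cbn; f_equal; auto. Qed.

Lemma raise_subst k t : forall r q, raise k (subst r q t) = subst r (fun n => raise k (q n)) (raise k t).
Proof.
  assert (E : forall q : nat -> tm, (fun n => raise k (up q n)) = up (fun n => raise k (q n))).
  { intro q; apply functional_extensionality; intros [|n]; cbn; [reflexivity|apply raise_ren]. }
  assert (E' : forall q : nat -> tm, (fun n => raise k (cwk (q n))) = (fun n => cwk (raise k (q n)))).
  { intro q; apply functional_extensionality; intro n; apply raise_ren. }
  induction t; intros; cbn; f_equal; auto;
    rewrite ?IHt, ?IHt1, ?IHt2, ?E, ?E'; reflexivity.
Qed.

Lemma raise_wk k A : raise k (wk A) = wk (raise k A).
Proof. apply raise_ren. Qed.

Lemma raise_cwk k A : raise k (cwk A) = cwk (raise k A).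
Proof. apply raise_ren. Qed.

Lemma map_raise_cwk k G : map (raise k) (map cwk G) = map cwk (map (raise k) G).
Proof. rewrite !map_map; apply map_ext; intro; apply raise_cwk. Qed.

Lemma raise_inst1 k B a : raise k (inst1 B a) = inst1 (raise k B) (raise k a).
Proof.
  unfold inst1; rewrite raise_subst; f_equal.
  apply functional_extensionality; intros [|n]; reflexivity.
Qed.

Lemma raise_inst2 k C b p : raise k (inst2 C b p) = inst2 (raise k C) (raise k b) (raise k p).
Proof.
  unfold inst2; rewrite raise_subst; f_equal.
  apply functional_extensionality; intros [|[|n]]; reflexivity.
Qed.

Lemma raise_pinst k b s : raise k (pinst b s) = pinst (raise k b) s.
Proof. apply raise_subst. Qed.

Lemma typing_raise k :
  (forall X F G a A, X ∥ F ∥ G ⊢ a ∈ A ->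
     X ∥ F ∥ map (raise k) G ⊢ raise k a ∈ raise k A) /\
  (forall X F G a b A, X ∥ F ∥ G ⊢ a ≡ b ∈ A ->
     X ∥ F ∥ map (raise k) G ⊢ raise k a ≡ raise k b ∈ raise k A).
Proof.
  apply typing_ind; intros; cbn [raise map] in *;
    rewrite ?raise_inst1, ?raise_inst2, ?raise_pinst, ?raise_wk, ?raise_cwk, ?map_raise_cwk in *;
    cbn [raise] in *; try solve [econstructor; eauto].
  rewrite raise_ren; apply t_var; rewrite nth_error_map, H; reflexivity.
Qed.

(** * Checking a sequence of lemmas *)

Fixpoint scoped (n : nat) (t : tm) : bool :=
  match t with
  | Var m => m <? n
  | Pi A B | Sig A B => scoped n A && scoped (S n) B
  | Lam b => scoped (S n) b
  | App a b | Pair a b | RecOr _ _ a b | Ext _ _ a _ b => scoped n a && scoped n b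
  | Fst p | Snd p | Refl p | ELam p | EApp p _ => scoped n p
  | Id A a b => scoped n A && scoped n a && scoped n b
  | J C d p => scoped (S (S n)) C && scoped n d && scoped n p
  | Univ _ | RecBot | FunExt _ | RelFunExt _ _ _ _ | Univalence _ => true
  end.

Lemma subst_scoped t : forall n r q q', scoped n t = true ->
  (forall m, m < n -> q m = q' m) -> subst r q t = subst r q' t.
Proof.
  assert (Hup : forall n q q', (forall m, m < n -> q m = q' m) -> forall m, m < S n -> up q m = up q' m).
  { intros n q q' h [|m] L; cbn; [reflexivity|]; rewrite h by lia; reflexivity. }
  assert (Hcwk : forall n q q', (forall m, m < n -> q m = q' m) ->
    forall m, m < n -> cwk (q m) = cwk (q' m)).
  { intros n q q' h m L; rewrite h by exact L; reflexivity. }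
  induction t; intros k r u u' H h; cbn in H |- *;
    repeat match goal with E : _ = true |- _ => apply and_true in E; destruct E end;
    f_equal; eauto.
  apply Nat.ltb_lt in H; auto.
Qed.

(** Each lemma is placed in the context of the lemmas before it, and refers to them as
    variables. *)
Record entry := Entry { statement : dtm; proof : dtm }.

Fixpoint checked (c : checker) (l : list entry) (k : nat) (G : lctx) (goal : tm) : bool :=
  match l with
  | [] => false
  | e :: l =>
      match elab c (statement e 0 k) [] [] G MType with
      | Some (T, Univ _) =>
          match elab c (proof e 0 k) [] [] G (MCheck T) with
          | Some _ => match l with
                      | [] => tm_eqb (erase T) goal
                      | _ => checked c l (S k) (lcons 0 T G) goal
                      end
          | None => false
          end
      | _ => false
      end
  end.

(** The proofs are substituted for the variables one after the other.  This leaves the goal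
    unchanged, as it is closed. *)
Lemma checked_sound c : sound c -> forall goal, scoped 0 goal = true ->
  forall l k (G : lctx) q, ok [] [] G -> substitution [] [] G [] [] [] PVar q ->
  checked c l k G goal = true -> exists t, [] ∥ [] ∥ [] ⊢ t ∈ goal.
Proof.
  intros cs goal Sg; induction l as [|e l IH]; intros k G q o s H; [discriminate|]; cbn in H.
  destruct (elab c (statement e 0 k) [] [] G MType) as [[T U]|] eqn:ET; [|discriminate].
  destruct (elab_sound c cs _ _ _ _ MType _ _ o I ET) as (i & -> & W).
  destruct (elab c (proof e 0 k) [] [] G (MCheck T)) as [[t T']|] eqn:Et; [|discriminate].
  destruct (elab_sound c cs _ _ _ _ (MCheck T) _ _ o (ex_intro _ i W : mode_ok [] [] G (MCheck T)) Et) as [-> C].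
  assert (D : [] ∥ [] ∥ G ⊢ t ∈ T) by (apply chk_sound; [exact C|apply o]).
  pose proof (proj1 typing_substitution _ _ _ _ _ D (proj1 o) _ _ _ _ _ s) as D'.
  destruct l as [|e' l].
  - apply tm_eqb_eq in H; subst goal; exists (subst PVar q t).
    assert (E : [] ∥ [] ∥ G ⊢ T ≡ erase T ∈ Univ i)
      by (apply (proj2 (proj2 annotated_erase)); [exact W|apply o]).
    pose proof (proj2 typing_substitution _ _ _ _ _ _ E (proj1 o) _ _ _ _ _ s) as E'.
    rewrite <- (subst_id (erase T)), (subst_scoped _ 0 PVar Var q Sg) by lia.
    eapply t_conv; [exact D'|exact E'].
  - eapply (IH (S k) (lcons 0 T G) (scons (subst PVar q t) q)); [eapply ok_cons; eassumption| |exact H].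
    destruct s as (s1 & s2 & s3 & s4 & s5); split; [exact s1|split; [exact s2|split; [exact s3|split]]].
    + intros [|n]; cbn; [|apply s4].
      apply closed_shapes_subst; [exact s4|]. apply (chk_closed _ _ _ _ _ (proj1 o) C).
    + intros [|n] A E; cbn in E.
      * injection E as <-; rewrite shiftn_0, subst_wk; exact D'.
      * rewrite shiftn_S, subst_wk; apply s5, E.
Qed.

Local Open Scope stt_scope.

(** * Identity types, contractible types and equivalences *)

Notation "f @ a" := (app f a) (at level 40, left associativity) : stt_scope.
Notation "f $ s" := (eapp f s) (at level 38, left associativity) : stt_scope.
Notation "'λ' x .. y ',' b" := (lam (fun x => .. (lam (fun y => b)) ..))
  (at level 200, x binder, y binder, b at level 200) : stt_scope.

Definition asc (t T : dtm) : dtm := fun c n => Ann (t c n) (T c n).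
Definition FE : dtm := fun _ _ => Ann (FunExt 0) (Defs.funext 0 0 0).
Definition RFE K psi phi : dtm :=
  fun _ _ => Ann (RelFunExt 0 K psi phi) (Defs.relfunext 0 K psi phi 0 0).
(** Path induction used directly.  It is fit for final steps only: two such terms are
    convertible only if their motives are. *)
Definition tr (M : dtm -> dtm) (m p : dtm) : dtm := jel (fun y _ => M y) m p.
Definition sym (A x p : dtm) : dtm := jel (fun y _ => eqt A y x) (refl x) p.
Definition concat (A x p q : dtm) : dtm := jel (fun z _ => eqt A x z) p q.
Definition ap (B : dtm) (f : dtm -> dtm) (x p : dtm) : dtm :=
  jel (fun y _ => eqt B (f x) (f y)) (refl (f x)) p.

(** A lemma is used as the variable whose level is its position in [library]. *)
Definition transport := fst (var 0).
Definition transportRefl := snd (var 0).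
Definition contrPath := var 1.
Definition retractContr := var 2.
Definition sigContr := var 3.
Definition contrPaths := var 4.
Definition contrFiber := var 5.
Definition isContrContr := var 6.
Definition pointwise := var 7.
Definition psym A x y p := fst (var 8) @ A @ x @ y @ p.
Definition psymRefl A x := snd (var 8) @ A @ x.
Definition pconcat A x y z p q := fst (var 9) @ A @ x @ y @ z @ p @ q.
Definition pconcatRefl A x y p := snd (var 9) @ A @ x @ y @ p.
Definition pap A B f x y p := fst (var 10) @ A @ B @ f @ x @ y @ p.
Definition papRefl A B f x := snd (var 10) @ A @ B @ f @ x.
Definition fiberPath := var 11.
Definition qinv := var 12.
Definition segalFill := var 13.

(** A map from the fiber of [f] over [y] to the paths from [x] to [g y], and one back.
    The latter is conjugated by [ε] so that the round trip on the fiber is the identity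
    although [η] and [ε] are not assumed to satisfy a triangle identity. *)
Definition qinvTo A B f g η x y p :=
  pconcat A x (g @ (f @ x)) (g @ y) (psym A (g @ (f @ x)) x (η @ x)) (pap B A g (f @ x) y p).
Definition qinvFrom A B f g η ε x y r :=
  let a := g @ (f @ x) in
  pconcat B (f @ x) (f @ (g @ y)) y
    (pconcat B (f @ x) (f @ a) (f @ (g @ y)) (psym B (f @ a) (f @ x) (ε @ (f @ x)))
       (pap A B f a (g @ y) (pconcat A a x (g @ y) (η @ x) r)))
    (ε @ y).

(** Transport is proved together with its computation rule.  For the lemmas that use
    it, it is then a variable, and two transports are compared argument by argument. *)
Definition transport_entry : entry :=
  Entry (Σ t : (Π A : U 0, Π M : (A ⇒ U 0), Π x : A, Π y : A, eqt A x y ⇒ M @ x ⇒ M @ y),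
           Π A : U 0, Π M : (A ⇒ U 0), Π x : A, Π m : M @ x, eqt (M @ x) (t @ A @ M @ x @ x @ (refl x) @ m) m)
    ⟪ λ A M x y p m, tr (app M) m p, λ A M x m, refl m ⟫.

Definition contrPath_entry : entry :=
  Entry (Π A : U 0, isContr A ⇒ Π x : A, Π y : A, eqt A x y)
    (λ A h x y, concat A x (sym A (fst h) (snd h @ x)) (snd h @ y)).

Definition retractContr_entry : entry :=
  Entry (Π A : U 0, Π B : U 0, Π f : (A ⇒ B), Π g : (B ⇒ A), (Π b : B, eqt B (f @ (g @ b)) b) ⇒
         isContr A ⇒ isContr B)
    (λ A B f g H h, ⟪ f @ fst h, λ b, concat B (f @ fst h)
        (ap B (app f) (fst h) (snd h @ (g @ b))) (H @ b) ⟫).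

Definition sigContr_entry : entry :=
  Entry (Π A : U 0, Π M : (A ⇒ U 0), isContr A ⇒ (Π a : A, isContr (M @ a)) ⇒ isContr (Σ a : A, M @ a))
    (λ A M h m, let z0 := ⟪ fst h, fst (m @ fst h) ⟫ in
       ⟪ z0, λ z, jel (fun a _ => Π w : M @ a, eqt (Σ a : A, M @ a) z0 ⟪ a, w ⟫)
           (λ w, ap (Σ a : A, M @ a) (fun w => ⟪ fst h, w ⟫)
               (fst (m @ fst h)) (snd (m @ fst h) @ w))
           (snd h @ fst z) @ snd z ⟫).

Definition contrPaths_entry : entry :=
  Entry (Π A : U 0, isContr A ⇒ Π x : A, Π y : A, isContr (eqt A x y))
    (λ A h x y, ⟪ concat A x (sym A (fst h) (snd h @ x)) (snd h @ y),
       λ q, jel (fun y q => eqt (eqt A x y) (concat A x (sym A (fst h) (snd h @ x)) (snd h @ y)) q)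
         (jel (fun x p => eqt (eqt A x x) (concat A x (sym A (fst h) p) p) (refl x))
            (refl (refl (fst h))) (snd h @ x)) q ⟫).

(** A fiber is a retract of the total space: transport leads into it, and the loop along
    which its own points are transported is trivial because the base is contractible. *)
Definition contrFiber_entry : entry :=
  Entry (Π W : U 0, Π T : (W ⇒ U 0), isContr (Σ w : W, T @ w) ⇒ isContr W ⇒ Π w : W, isContr (T @ w))
    (λ W T hs hw w, retractContr @ (Σ w : W, T @ w) @ (T @ w)
       @ (λ z, transport @ W @ T @ fst z @ w @ (contrPath @ W @ hw @ fst z @ w) @ snd z)
       @ (λ t, ⟪ w, t ⟫)
       @ (λ t, concat (T @ w) (transport @ W @ T @ w @ w @ (contrPath @ W @ hw @ w @ w) @ t)
              (ap (T @ w) (fun p => transport @ W @ T @ w @ w @ p @ t) (contrPath @ W @ hw @ w @ w)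
                (contrPath @ eqt W w w @ (contrPaths @ W @ hw @ w @ w) @ (contrPath @ W @ hw @ w @ w) @ refl w))
              (transportRefl @ W @ T @ w @ t))
       @ hs).

Definition isContrContr_entry : entry :=
  Entry (Π A : U 0, isContr A ⇒ isContr (isContr A))
    (λ A h, sigContr @ A @ (λ x, Π y : A, eqt A x y) @ h
       @ (λ x, FE @ A @ (λ y, eqt A x y) @ (contrPaths @ A @ h @ x))).

(** By extensionality for contractible types, the functions with a pointwise path from
    [f] form a contractible type, in which [f] and [g] are connected by a path. *)
Definition pointwise_entry : entry :=
  Entry (Π A : U 0, Π B : (A ⇒ U 0), Π f : (Π x : A, B @ x), Π g : (Π x : A, B @ x),
         (Π x : A, eqt (B @ x) (f @ x) (g @ x)) ⇒ eqt (Π x : A, B @ x) f g)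
    (λ A B f g H,
       let T := (Π x : A, Σ y : B @ x, eqt (B @ x) (f @ x) y) in
       ap (Π x : A, B @ x) (fun h => λ x, fst (h @ x)) (asc (λ x, ⟪ f @ x, refl (f @ x) ⟫) T)
         (contrPath @ T
           @ (FE @ A @ (λ x, Σ y : B @ x, eqt (B @ x) (f @ x) y) @
             (λ x, ⟪ ⟪ f @ x, refl (f @ x) ⟫,
                λ z, jel (fun y p => eqt (Σ y : B @ x, eqt (B @ x) (f @ x) y) ⟪ f @ x, refl (f @ x) ⟫ ⟪ y, p ⟫)
                   (refl ⟪ f @ x, refl (f @ x) ⟫) (snd z) ⟫))
           @ (λ x, ⟪ f @ x, refl (f @ x) ⟫) @ (λ x, ⟪ g @ x, H @ x ⟫))).

(** As with transport, operations on paths that occur in a statement come with their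
    computation rules, so that the statement need not be compared under path
    induction. *)
Definition psym_entry : entry :=
  Entry (Σ s : (Π A : U 0, Π x : A, Π y : A, eqt A x y ⇒ eqt A y x),
           Π A : U 0, Π x : A, eqt (eqt A x x) (refl x) (s @ A @ x @ x @ refl x))
    ⟪ λ A x y p, sym A x p, λ A x, refl (refl x) ⟫.

Definition pconcat_entry : entry :=
  Entry (Σ c : (Π A : U 0, Π x : A, Π y : A, Π z : A, eqt A x y ⇒ eqt A y z ⇒ eqt A x z),
           Π A : U 0, Π x : A, Π y : A, Π p : eqt A x y, eqt (eqt A x y) p (c @ A @ x @ y @ y @ p @ refl y))
    ⟪ λ A x y z p q, concat A x p q, λ A x y p, refl p ⟫.

Definition pap_entry : entry :=
  Entry (Σ a : (Π A : U 0, Π B : U 0, Π f : (A ⇒ B), Π x : A, Π y : A, eqt A x y ⇒ eqt B (f @ x) (f @ y)),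
           Π A : U 0, Π B : U 0, Π f : (A ⇒ B), Π x : A,
             eqt (eqt B (f @ x) (f @ x)) (refl (f @ x)) (a @ A @ B @ f @ x @ x @ refl x))
    ⟪ λ A B f x y p, ap B (app f) x p, λ A B f x, refl (refl (f @ x)) ⟫.

Definition fiberPath_entry : entry :=
  Entry (Π A : U 0, Π B : U 0, Π f : (A ⇒ B), Π g : (B ⇒ A), Π η : (Π x : A, eqt A (g @ (f @ x)) x),
         Π ε : (Π y : B, eqt B (f @ (g @ y)) y), Π x : A, Π y : B, Π p : eqt B (f @ x) y,
         eqt (eqt B (f @ x) y) (qinvFrom A B f g η ε x y (qinvTo A B f g η x y p)) p)
    (λ A B f g η ε x y p,
      jel (fun y p => eqt (eqt B (f @ x) y) (qinvFrom A B f g η ε x y (qinvTo A B f g η x y p)) p)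
        (let a := g @ (f @ x) in let e := ε @ (f @ x) in let fx := f @ x in
         let goal r := eqt (eqt B fx fx) (qinvFrom A B f g η ε x fx r) (refl fx) in
         let goal' l := eqt (eqt B fx fx) (pconcat B fx (f @ a) fx l e) (refl fx) in
         let goal'' m := goal' (pconcat B fx (f @ a) (f @ a) (psym B (f @ a) fx e) m) in
         tr (fun m => goal (pconcat A x a a (psym A a x (η @ x)) m))
          (tr goal
           (jel (fun x q => goal'' (pap A B f a a (pconcat A a x a q (psym A a x q))))
             (tr (fun q => goal'' (pap A B f a a (pconcat A a a a (refl a) q)))
               (tr (fun q => goal'' (pap A B f a a q))
                 (tr goal''
                   (tr goal'
                     (jel (fun w e => eqt (eqt B w w) (pconcat B w (f @ a) w (psym B (f @ a) w e) e) (refl w))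
                       (tr (fun q => eqt (eqt B (f @ a) (f @ a)) (pconcat B (f @ a) (f @ a) (f @ a) q (refl (f @ a))) (refl (f @ a)))
                         (tr (fun q => eqt (eqt B (f @ a) (f @ a)) q (refl (f @ a))) (refl (refl (f @ a)))
                            (pconcatRefl B (f @ a) (f @ a) (refl (f @ a))))
                         (psymRefl B (f @ a)))
                       e)
                     (pconcatRefl B fx (f @ a) (psym B (f @ a) fx e)))
                   (papRefl A B f a))
                 (pconcatRefl A a a (refl a)))
               (psymRefl A a))
             (η @ x))
           (pconcatRefl A x a (psym A a x (η @ x))))
          (papRefl B A g fx))
        p).

(** The fiber over [y] is a retract of the type of paths into [g y]. *)
Definition qinv_entry : entry :=
  Entry (Π A : U 0, Π B : U 0, Π f : (A ⇒ B), Π g : (B ⇒ A),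
         (Π x : A, eqt A (g @ (f @ x)) x) ⇒ (Π y : B, eqt B (f @ (g @ y)) y) ⇒ isEquiv A B (app f))
    (λ A B f g η ε, λ y,
       retractContr @ (Σ x : A, eqt A x (g @ y)) @ (Σ x : A, eqt B (f @ x) y)
         @ (λ z, ⟪ fst z, qinvFrom A B f g η ε (fst z) y (snd z) ⟫)
         @ (λ z, ⟪ fst z, qinvTo A B f g η (fst z) y (snd z) ⟫)
         @ (λ z, ap (Σ x : A, eqt B (f @ x) y) (fun p => ⟪ fst z, p ⟫)
              (qinvFrom A B f g η ε (fst z) y (qinvTo A B f g η (fst z) y (snd z)))
              (fiberPath @ A @ B @ f @ g @ η @ ε @ fst z @ y @ snd z))
         @ ⟪ ⟪ g @ y, refl (g @ y) ⟫, λ z, jel (fun b r => eqt (Σ x : A, eqt A x b) ⟪ b, refl b ⟫ ⟪ fst z, r ⟫)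
               (refl ⟪ fst z, refl (fst z) ⟫) (snd z) ⟫).

(** The fiber of the restriction map over [d] consists of triangles with a path from their
    restriction to [d]; transport along this path turns them into triangles that restrict
    to [d] judgmentally, and these are a retract. *)
Definition segalFill_entry : entry :=
  Entry (Π A : U 0, isSegal A ⇒ Π d : sections square Horn (fun _ => A),
           isContr (ext square Delta2 (fun _ => A) Horn (eapp d)))
    (λ A h d, retractContr
       @ (Σ f : sections square Delta2 (fun _ => A), eqt (sections square Horn (fun _ => A)) (elam (eapp f)) d)
       @ (ext square Delta2 (fun _ => A) Horn (eapp d))
       @ (λ z, tr (fun d => ext square Delta2 (fun _ => A) Horn (eapp d)) (elam (eapp (fst z))) (snd z))
       @ (λ e, ⟪ elam (eapp e), refl d ⟫)
       @ (λ e, refl e) @ (h @ d)).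

Definition lib0 : list entry :=
  [transport_entry; contrPath_entry; retractContr_entry; sigContr_entry; contrPaths_entry; contrFiber_entry; isContrContr_entry;
   pointwise_entry; psym_entry; pconcat_entry; pap_entry; fiberPath_entry; qinv_entry; segalFill_entry].

(** * Strict horn filling and cocartesian arrows *)

(** The flag [op] reverses the direction of the interval, which exchanges the factors of
    the base, cocartesian and cartesian arrows, and the first and the last vertex of a
    simplex.  Every construction that depends on it is carried out for the family over
    the base in the order [A], [B]; for [op = true] the given family lives over the
    product in the other order. *)
Definition family (op : bool) (F : dtm) : dtm -> dtm -> dtm :=
  fun x y => F @ if op then ⟪ y, x ⟫ else ⟪ x, y ⟫.
Definition baseT (op : bool) (A B : dtm) : dtm := if op then B ⊗ A else A ⊗ B.
Definition forFam (op : bool) (body : dtm -> dtm -> dtm -> (dtm -> dtm -> dtm) -> dtm) : dtm :=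
  Π A : U 0, Π B : U 0, Π F : (baseT op A B ⇒ U 0), body A B F (family op F).
Definition lamFam (op : bool) (body : dtm -> dtm -> dtm -> (dtm -> dtm -> dtm) -> dtm) : dtm :=
  λ A B F, body A B F (family op F).

Definition segalT (A : dtm) : dtm := Π d : sections square Horn (fun _ => A),
           isContr (ext square Delta2 (fun _ => A) Horn (eapp d)).

(** Source and target of the interval in the direction [op]; [tc] and [sc] are the
    coordinates of a triangle in which its first edge is [sc = e0] and its last edge is
    [tc = e1], and [mk] is the point with given coordinates. *)
Definition E0 (op : bool) : pt := if op then POne else PZero.
Definition e0 (op : bool) : dpt := if op then p1 else p0.
Definition e1 (op : bool) : dpt := if op then p0 else p1.
Definition tc (op : bool) (z : dpt) : dpt := if op then psnd z else pfst z.
Definition sc (op : bool) (z : dpt) : dpt := if op then pfst z else psnd z.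
Definition mk (op : bool) (t s : dpt) : dpt := if op then ppair s t else ppair t s.
Definition TZero (op : bool) : tope := TEq (PVar 0) (E0 op).
Definition SZero (op : bool) : tope := TEq (if op then PFst (PVar 0) else PSnd (PVar 0)) (E0 op).
(** The edges 01 and 02 of a triangle, in the direction [op]. *)
Definition LHorn (op : bool) : tope := TOr (SZero op) (TEq (PSnd (PVar 0)) (PFst (PVar 0))).
Definition simplices (phi : tope) (T a : dpt -> dtm) : dtm := ext square Delta2 T phi a.
Definition horn (op : bool) (f g : dpt -> dtm) : dpt -> dtm :=
  fun z => recor (teq (sc op z) (e0 op)) (teq (tc op z) (e1 op)) (f (tc op z)) (g (sc op z)).
Definition lhorn (op : bool) (f h : dpt -> dtm) : dpt -> dtm :=
  fun z => recor (teq (sc op z) (e0 op)) (teq (psnd z) (pfst z)) (f (tc op z)) (h (tc op z)).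
Definition from (op : bool) (T : dpt -> dtm) (x : dtm) : dtm := ext C2 TTop T (TZero op) (fun _ => x).
Definition dhomO (op : bool) (T : dpt -> dtm) (e e' : dtm) : dtm :=
  if op then dhom T e' e else dhom T e e'.
Definition dhom2O (op : bool) (T f g h : dpt -> dtm) : dtm :=
  if op then dhom2 T g f h else dhom2 T f g h.
Definition cocartArr (op : bool) : dtm -> (dtm -> dtm) -> (dpt -> dtm) -> (dpt -> dtm) -> dtm :=
  if op then isCartArr else isCocartArr.
Definition isLeft (op : bool) (A B : dtm) (P : dtm -> dtm -> dtm) (b : dtm) (u f : dpt -> dtm) : dtm :=
  cocartArr op A (left B P) u (fun t => ⟪ b, f t ⟫).

(** Triangles with degenerate edge 01 and with edge 02 equal to [h]. *)
Definition unitT (op : bool) (B x : dtm) (h : dpt -> dtm) : dtm :=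
  simplices (LHorn op) (fun _ => B) (lhorn op (fun _ => x) h).
Definition unitsT (op : bool) (B : dtm) : dtm :=
  Π x : B, Π h : from op (fun _ => B) x, isContr (unitT op B x (eapp h)).

Definition lifts (op : bool) (P : dtm -> dtm -> dtm) (f h r1 r2 : dpt -> dtm) : dtm :=
  simplices (LHorn op) (fun z => P (r1 z) (r2 z)) (lhorn op f h).
(** The strict form of being cocartesian for the projection to [A]: [f] over [(u, id)] is
    edge 01 of a unique filler over every triangle of [A × B] that extends [(u, id)].
    In contrast to [isLeft] the triangle of [B] is given, so that no total types occur and
    triangles can be composed by reparametrization. *)
Definition fillsHorns (op : bool) (A B : dtm) (P : dtm -> dtm -> dtm) (b : dtm) (u f : dpt -> dtm) : dtm :=
  Π r1 : simplices (SZero op) (fun _ => A) (fun z => u (tc op z)),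
  Π r2 : simplices (SZero op) (fun _ => B) (fun _ => b),
  Π h : from op (fun t => P (r1 $ mk op t t) (r2 $ mk op t t)) (f (e0 op)),
  isContr (lifts op P f (eapp h) (eapp r1) (eapp r2)).

Definition arrow (op : bool) (A x y : dtm) : dtm := dhomO op (fun _ => A) x y.
Definition comma (op : bool) (A a : dtm) : dtm := Σ x : A, arrow op A a x.
Definition forComma (op : bool) (body : dtm -> dtm -> (dtm -> dtm -> dtm) -> dtm) : dtm :=
  forFam op (fun A B _ P => Π a : A, Π b : B,
    body (comma op A a) (comma (negb op) B b) (fun x y => P (fst x) (fst y))).
Definition lamComma (op : bool) (body : dtm -> dtm -> (dtm -> dtm -> dtm) -> dtm) : dtm :=
  lamFam op (fun A B F P => λ a b,
    body (comma op A a) (comma (negb op) B b) (fun x y => P (fst x) (fst y))).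

(** The two mirror images of a lemma are neighbours in [library]. *)
Definition pairAt (n : nat) (op : bool) : dtm := var (n + if op then 1 else 0).

Definition unitFill := pairAt 14.
Definition cocartToFills := pairAt 16.
Definition fillsToCocart := pairAt 18.
Definition cocartToFillsComma := pairAt 20.
Definition fillsToCocartComma := pairAt 22.

(** A triangle [τ] with degenerate edge 01 fills an inner horn, as does the degenerate
    triangle on its last edge.  Both are equal because inner fillers are unique, and along
    the path between them edge 02 is transported as well. *)
Definition unitFill_entry (op : bool) : entry :=
  Entry (Π B : U 0, segalT B ⇒ unitsT op B)
    (λ B sg x h, ⟪ elam (fun z => h $ sc op z), λ τ,
       let d := horn op (fun _ => x) (fun s => τ $ mk op (e1 op) s) in
       let K := simplices Horn (fun _ => B) d in
       transport @ K
         @ (λ μ, eqt (unitT op B x (fun t => μ $ mk op t t))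
                   (elam (fun z => μ $ mk op (sc op z) (sc op z))) (elam (eapp μ)))
         @ elam (fun z => τ $ mk op (e1 op) (sc op z)) @ elam (eapp τ)
         @ (contrPath @ K @ (sg @ elam d) @ elam (fun z => τ $ mk op (e1 op) (sc op z)) @ elam (eapp τ))
         @ refl (elam (fun z => τ $ mk op (e1 op) (sc op z))) ⟫).

(** Being cocartesian for the projection to [A] gives a contractible type of fillers
    together with their triangles in [B].  The latter have a degenerate edge, so they
    form a contractible type too, and [contrFiber] fixes one of them. *)
Definition cocartToFills_type (op : bool) (A B : dtm) (P : dtm -> dtm -> dtm) : dtm :=
  unitsT op B ⇒ Π x : A, Π y : A, Π u : dhomO op (fun _ => A) x y, Π b : B,
           Π f : sections C2 TTop (fun t => P (u $ t) b),
           isLeft op A B P b (eapp u) (eapp f) ⇒ fillsHorns op A B P b (eapp u) (eapp f).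
Definition cocartToFills_proof (op : bool) (A B : dtm) (P : dtm -> dtm -> dtm) : dtm :=
  λ un x y u b f c r1 r2 h,
       let v t := r1 $ mk op (e1 op) t in
       let h2 t := ⟪ r2 $ mk op t t, h $ t ⟫ in
       let e := ⟪ r2 $ mk op (e1 op) (e1 op), h $ e1 op ⟫ in
       let Z := Σ g : dhomO op (fun t => left B P (v t)) ⟪ b, f $ e1 op ⟫ e,
                 dhom2O op (fun z => left B P (r1 $ z)) (fun t => ⟪ b, f $ t ⟫) (eapp g) h2 in
       let W := unitT op B b (fun t => r2 $ mk op t t) in
       let T ρ := lifts op P (eapp f) (eapp h) (eapp r1) (eapp ρ) in
       contrFiber @ W @ (λ ρ, T ρ)
         @ (retractContr @ Z @ (Σ ρ : W, T ρ)
              @ (λ z, ⟪ elam (fun q => fst (snd z $ q)), elam (fun q => snd (snd z $ q)) ⟫)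
              @ (λ k, ⟪ elam (fun t => ⟪ fst k $ mk op (e1 op) t, snd k $ mk op (e1 op) t ⟫),
                        elam (fun q => ⟪ fst k $ q, snd k $ q ⟫) ⟫)
              @ (λ k, refl k)
              @ (c @ (r1 $ mk op (e1 op) (e1 op)) @ elam v @ elam (fun t => r1 $ mk op t t)
                   @ elam (eapp r1) @ e @ elam h2))
         @ (un @ b @ elam (fun t => r2 $ mk op t t))
         @ elam (eapp r2).
Definition cocartToFills_entry (op : bool) : entry :=
  Entry (forFam op (fun A B _ => cocartToFills_type op A B)) (lamFam op (fun A B _ => cocartToFills_proof op A B)).
Definition cocartToFillsComma_entry (op : bool) : entry :=
  Entry (forComma op (cocartToFills_type op)) (lamComma op (cocartToFills_proof op)).

(** The converse: a filler in the total type is a triangle of [B] with a degenerate edge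
    and a filler over it. *)
Definition fillsToCocart_type (op : bool) (A B : dtm) (P : dtm -> dtm -> dtm) : dtm :=
  unitsT op B ⇒ Π x : A, Π y : A, Π u : dhomO op (fun _ => A) x y, Π b : B,
           Π f : sections C2 TTop (fun t => P (u $ t) b),
           fillsHorns op A B P b (eapp u) (eapp f) ⇒ isLeft op A B P b (eapp u) (eapp f).
Definition fillsToCocart_proof (op : bool) (A B : dtm) (P : dtm -> dtm -> dtm) : dtm :=
  λ un x y u b f c x' v w r e h,
       let W := unitT op B b (fun t => fst (h $ t)) in
       let T ρ := lifts op P (eapp f) (fun t => snd (h $ t)) (eapp r) (eapp ρ) in
       let Z := Σ g : dhomO op (fun t => left B P (v $ t)) ⟪ b, f $ e1 op ⟫ e,
                 dhom2O op (fun z => left B P (r $ z)) (fun t => ⟪ b, f $ t ⟫) (eapp g) (eapp h) in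
       retractContr @ (Σ ρ : W, T ρ) @ Z
         @ (λ k, ⟪ elam (fun t => ⟪ fst k $ mk op (e1 op) t, snd k $ mk op (e1 op) t ⟫),
                   elam (fun q => ⟪ fst k $ q, snd k $ q ⟫) ⟫)
         @ (λ z, ⟪ elam (fun q => fst (snd z $ q)), elam (fun q => snd (snd z $ q)) ⟫)
         @ (λ z, refl z)
         @ (sigContr @ W @ (λ ρ, T ρ) @ (un @ b @ elam (fun t => fst (h $ t)))
              @ (λ ρ, c @ elam (eapp r) @ elam (eapp ρ) @ elam (fun t => snd (h $ t)))).
Definition fillsToCocart_entry (op : bool) : entry :=
  Entry (forFam op (fun A B _ => fillsToCocart_type op A B)) (lamFam op (fun A B _ => fillsToCocart_proof op A B)).
Definition fillsToCocartComma_entry (op : bool) : entry :=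
  Entry (forComma op (fillsToCocart_type op)) (lamComma op (fillsToCocart_proof op)).

Definition both (e : bool -> entry) : list entry := [e false; e true].
Definition lib1 : list entry :=
  both unitFill_entry ++ both cocartToFills_entry ++ both fillsToCocart_entry ++ both cocartToFillsComma_entry ++ both fillsToCocartComma_entry.

(** * Closure properties of horn filling *)

Definition le (op : bool) (s t : dpt) : dtope :=
  fun c => if op then TLe (t c) (s c) else TLe (s c) (t c).
(** The value of [f] at the minimum of [q] and [s] in the direction [op]. *)
Definition atMin (op : bool) (q s : dpt) (f : dpt -> dtm) : dtm := recor (le op q s) (le op s q) (f q) (f s).
Definition rfe K psi phi (A a c : dpt -> dtm) : dtm := RFE K psi phi @ elam A @ elam a @ elam c.

Definition overBase (op : bool) (P : dtm -> dtm -> dtm) : dtm -> dtm :=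
  fun z => if op then P (snd z) (fst z) else P (fst z) (snd z).
Definition innerT (op : bool) (A B : dtm) (P : dtm -> dtm -> dtm) : dtm :=
  isInner (baseT op A B) (overBase op P).
Definition innerFill (op : bool) (inn : dtm) (r1 r2 d : dpt -> dtm) : dtm :=
  inn @ elam (fun z => if op then ⟪ r2 z, r1 z ⟫ else ⟪ r1 z, r2 z ⟫) @ elam d.

(** A let-binding of the object theory, as a beta redex.  The bound term is checked once
    and stays a variable, instead of being copied into all types that mention it. *)
Definition letIn (T a C : dtm) (b : dtm -> dtm) : dtm := asc (lam b) (Π x : T, C) @ a.

Definition fillsCancel := pairAt 24.
Definition fillsUnit := pairAt 26.

(** In a triangle [φ] over an identity of [B], if the edges 01 and 02 fill horns, then so
    does the edge 12.  Given a horn at 1, with [g] on 12 and [h] on 13, the triangle [i]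
    composes 01 with [h]; edge 02 then fills 023, edge 01 fills the rest of the tetrahedron,
    and its face 123 is the required filler.

    The tetrahedron is encoded as a family of triangles 01x, where x runs from 2 to 3: it
    has [φ] at one end and [i] at the other, and relative function extensionality says that
    such a family exists uniquely when each of its members does.  The edges 0x form a square
    between 02 and 03, the edges 1x one between 12 and 13.  Each square is cut along its
    diagonal into a triangle [δ] with a degenerate edge and a filler over [δ].  The first
    square can be chosen uniquely because 02 fills horns, and the family for a given first
    square because 01 does; the second square determines the family by inner filling.  So
    the type of second squares is a retract of a contractible type, and its fiber over the
    degenerate [δ] on [h] is the type of fillers of 123. *)
Definition fillsCancel_entry (op : bool) : entry :=
  Entry (forFam op (fun A B F P => segalT A ⇒ innerT op A B P ⇒
           Π r0 : sections square Delta2 (fun _ => A), Π b : B,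
           Π φ : sections square Delta2 (fun z => P (r0 $ z) b),
           fillsHorns op A B P b (fun t => r0 $ mk op t (e0 op)) (fun t => φ $ mk op t (e0 op)) ⇒
           fillsHorns op A B P b (fun t => r0 $ mk op t t) (fun t => φ $ mk op t t) ⇒
           fillsHorns op A B P b (fun t => r0 $ mk op (e1 op) t) (fun t => φ $ mk op (e1 op) t)))
    (lamFam op (fun A B F P => λ sg inn r0 b φ c01 c02 r1 r2 h,
       let tc := tc op in let sc := sc op in let mk := mk op in let e0 := e0 op in let e1 := e1 op in
       let f t := φ $ mk t e0 in
       let g t := φ $ mk e1 t in
       let slice s := simplices Horn (fun _ => A)
            (horn op (fun t => r0 $ mk t e0) (fun q => atMin op q s (fun m => r1 $ mk q m))) in
       let goal := isContr (lifts op P g (eapp h) (eapp r1) (eapp r2)) in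
       (* the triangles 01x of [A] *)
       letIn (ext C2 TTop slice (TZero op) (fun _ => elam (eapp r0)))
         (fst (rfe C2 TTop (TZero op) slice (fun _ => elam (eapp r0))
            (fun s => sg @ elam (horn op (fun t => r0 $ mk t e0) (fun q => atMin op q s (fun m => r1 $ mk q m))))))
         goal (fun R =>
       let R1 s z := R $ s $ z in
       let R2 s z := atMin op (sc z) s (fun m => r2 $ mk (sc z) m) in
       letIn (simplices Horn (fun z => P (R1 e1 z) (R2 e1 z)) (horn op f (eapp h)))
         (fst (innerFill op inn (R1 e1) (R2 e1) (horn op f (eapp h)))) goal (fun i =>
       (* squares between the edges 02 and 03 *)
       let Uj := simplices Horn (fun z => P (R1 (tc z) (mk (sc z) (sc z))) (r2 $ mk (sc z) (sc z)))
                   (horn op (fun _ => φ $ mk e0 e0) (fun t => i $ mk t t)) in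
       let cUj := innerFill op inn (fun z => R1 (tc z) (mk (sc z) (sc z))) (fun z => r2 $ mk (sc z) (sc z))
                   (horn op (fun _ => φ $ mk e0 e0) (fun t => i $ mk t t)) in
       let Lj δ := lifts op P (fun t => φ $ mk t t) (fun t => δ $ mk t t)
                     (fun z => R1 (sc z) (mk (tc z) (tc z))) (eapp r2) in
       let Jsq := Σ δ : Uj, Lj δ in
       let cJsq := sigContr @ Uj @ (λ δ, Lj δ) @ cUj
            @ (λ δ, c02 @ elam (fun z => R1 (sc z) (mk (tc z) (tc z))) @ elam (eapp r2) @ elam (fun t => δ $ mk t t)) in
       (* the square [x] glued from its two triangles *)
       let sq x t s := recor (le op s t) (le op t s) (snd x $ mk t s) (fst x $ mk s t) in
       let ends (s : dpt) := recor (Defs.teq s e0) (Defs.teq s e1) (elam (eapp φ)) (elam (eapp i)) in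
       let W x := ext C2 TTop (fun s => lifts op P f (fun t => sq x t s) (R1 s) (R2 s)) boundary1 ends in
       let cW x := rfe C2 TTop boundary1 (fun s => lifts op P f (fun t => sq x t s) (R1 s) (R2 s)) ends
            (fun s => c01 @ elam (R1 s) @ elam (R2 s) @ elam (fun t => sq x t s)) in
       (* squares between the edges 12 and 13 *)
       let Uk := simplices Horn (fun z => P (r1 $ mk (sc z) (sc z)) (r2 $ mk (sc z) (sc z)))
                   (horn op (fun _ => φ $ mk e1 e0) (eapp h)) in
       let cUk := innerFill op inn (fun z => r1 $ mk (sc z) (sc z)) (fun z => r2 $ mk (sc z) (sc z))
                   (horn op (fun _ => φ $ mk e1 e0) (eapp h)) in
       let Lk δ := lifts op P g (fun t => δ $ mk t t) (eapp r1) (eapp r2) in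
       let Ksq := Σ δ : Uk, Lk δ in
       (* the family determined by a second square *)
       let fill x := rfe C2 TTop boundary1
            (fun s => simplices Horn (fun z => P (R1 s z) (R2 s z)) (horn op f (fun q => sq x q s))) ends
            (fun s => innerFill op inn (R1 s) (R2 s) (horn op f (fun q => sq x q s))) in
       let T x := ext C2 TTop (fun s => simplices Horn (fun z => P (R1 s z) (R2 s z)) (horn op f (fun q => sq x q s))) boundary1 ends in
       contrFiber @ Uk @ (λ δ, Lk δ)
         @ (retractContr @ (Σ x : Jsq, W x) @ Ksq
              @ (λ w, ⟪ elam (fun z => snd w $ tc z $ mk e1 (sc z)), elam (fun z => snd w $ sc z $ mk e1 (tc z)) ⟫)
              @ (λ x, letIn (T x) (fst (fill x)) (Σ x : Jsq, W x) (fun F => ⟪ ⟪ elam (fun z => F $ tc z $ mk (sc z) (sc z)),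
                          elam (fun z => F $ sc z $ mk (tc z) (tc z)) ⟫,
                        elam (fun s => elam (fun z => F $ s $ z)) ⟫))
              @ (λ x, refl x)
              @ (sigContr @ Jsq @ (λ x, W x) @ cJsq @ (λ x, cW x)))
         @ cUk
         @ elam (fun z => h $ sc z))))).

(** In a triangle with degenerate edge 01, the edges 12 and 02 are equal, by uniqueness of
    inner fillers in the base and then in the family; a property of one passes to the
    other along that path. *)
Definition fillsUnit_entry (op : bool) : entry :=
  Entry (forFam op (fun A B F P => segalT A ⇒ innerT op A B P ⇒ Π x : A, Π b : B, Π e : P x b,
           Π r : simplices (SZero op) (fun _ => A) (fun _ => x),
           Π φ : simplices (SZero op) (fun z => P (r $ z) b) (fun _ => e),
           fillsHorns op A B P b (fun t => r $ mk op (e1 op) t) (fun t => φ $ mk op (e1 op) t) ⇒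
           fillsHorns op A B P b (fun t => r $ mk op t t) (fun t => φ $ mk op t t)))
    (lamFam op (fun A B F P => λ sg inn x b e r φ,
       let tc := tc op in let sc := sc op in let mk := mk op in let e0 := e0 op in let e1 := e1 op in
       let d := horn op (fun _ => x) (fun s => r $ mk e1 s) in
       let D := horn op (fun _ => e) (fun s => φ $ mk e1 s) in
       let Z1 := simplices Horn (fun _ => A) d in
       let Z2 ρ := simplices Horn (fun z => P (ρ $ z) b) D in
       let Z := Σ ρ : Z1, Z2 ρ in
       let M z := fillsHorns op A B P b (fun t => fst z $ mk t t) (fun t => snd z $ mk t t) in
       let z0 := ⟪ elam (fun z => r $ mk e1 (sc z)), elam (fun z => φ $ mk e1 (sc z)) ⟫ in
       let z1 := ⟪ elam (eapp r), elam (eapp φ) ⟫ in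
       transport @ Z @ (λ z, M z) @ z0 @ z1
         @ (contrPath @ Z @ (sigContr @ Z1 @ (λ ρ, Z2 ρ) @ (sg @ elam d)
                @ (λ ρ, innerFill op inn (eapp ρ) (fun _ => b) D)) @ z0 @ z1))).

Definition lib2 : list entry := [
  fillsCancel_entry false; fillsCancel_entry true;
  fillsUnit_entry false; fillsUnit_entry true
].

(** * Cocartesian lifts *)

Definition flip (P : dtm -> dtm -> dtm) : dtm -> dtm -> dtm := fun y x => P x y.
Definition onLeft (op : bool) (A B : dtm) (P : dtm -> dtm -> dtm) : dtm :=
  if op then isCartOnRight B A (flip P) else isCocartOnLeft A B P.
Definition freeT (op : bool) (A B : dtm) (P : dtm -> dtm -> dtm) : dtm :=
  liftsFreeIso (baseT op A B) (overBase op P).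
(** Horn filling over degenerate triangles only, which suffices to determine the target. *)
Definition fillsVerticalHorns (op : bool) (P : dtm -> dtm -> dtm) (b : dtm) (u f : dpt -> dtm) : dtm :=
  Π h : from op (fun t => P (u t) b) (f (e0 op)),
    isContr (lifts op P f (eapp h) (fun z => u (tc op z)) (fun _ => b)).

Definition cocartLift := pairAt 28.
Definition liftsFill := pairAt 30.
Definition isoInd := var 32.
Definition isoPath := var 33.
Definition roundTrip := pairAt 34.
Definition uniqueTarget := pairAt 36.
Definition unitComma := pairAt 38.
Definition baseChangeIso := var 40.
Definition baseChange := var 41.

(** A cocartesian lift for the projection to [A] is [B]-vertical only up to a path.  The
    path is eliminated to obtain a lift over [id_b] on the nose. *)
Definition cocartLift_entry (op : bool) : entry :=
  Entry (forFam op (fun A B F P => onLeft op A B P ⇒ Π x : A, Π y : A, Π u : arrow op A x y, Π b : B, Π e : P x b,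
           Σ e' : P y b, Σ f : dhomO op (fun t => P (u $ t) b) e e', isLeft op A B P b (eapp u) (eapp f)))
    (lamFam op (fun A B F P => λ H x y u b e,
       let L := if op then snd (fst H) @ y @ x @ u @ ⟪ b, e ⟫ else snd (fst H) @ x @ y @ u @ ⟪ b, e ⟫ in
       let e' := fst L in
       let f := fst (snd L) in
       let c := snd (snd L) in
       let V := if op then snd H @ y @ x @ u @ e' @ ⟪ b, e ⟫ @ f @ c
                else snd H @ x @ y @ u @ ⟪ b, e ⟫ @ e' @ f @ c in
       let T g := Π f2 : sections C2 TTop (fun t => P (u $ t) (g $ t)),
             cocartArr op A (left B P) (eapp u) (fun t => ⟪ g $ t, f2 $ t ⟫) ⇒
             Σ e' : P y (g $ e0 op), Σ f : dhomO op (fun t => P (u $ t) (g $ e0 op)) (f2 $ e0 op) e',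
               isLeft op A B P (g $ e0 op) (eapp u) (eapp f) in
       transport @ arrows B @ (λ g, T g) @ idArr (fst V) @ elam (fun t => fst (f $ t))
         @ (sym (arrows B) (elam (fun t => fst (f $ t))) (snd V))
         @ (λ f2 c, ⟪ f2 $ e1 op, elam (eapp f2), c ⟫)
         @ elam (fun t => snd (f $ t)) @ c)).

(** For an arrow [α] of the comma type, the targets of the lifts along [snd (α t)] form an
    arrow that fills horns.  It is the edge 12 of the triangle of lifts, whose edge 01 is the
    lift at the start of [α]; the edge 02 is the diagonal, which is edge 02 of another
    triangle: one with degenerate edge 01 and with edge 12 the lift at the end of [α]. *)
Definition liftsFill_entry (op : bool) : entry :=
  Entry (forFam op (fun A B F P => segalT A ⇒ innerT op A B P ⇒ unitsT op B ⇒ Π H : onLeft op A B P,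
           Π x : A, Π b : B, Π e : P x b, Π α : arrows (comma op A x),
           fillsHorns op A B P b (fun t => fst (α $ t))
             (fun t => fst (cocartLift op @ A @ B @ F @ H @ x @ fst (α $ t) @ snd (α $ t) @ b @ e))))
    (lamFam op (fun A B F P => λ sg inn un H x b e α,
       let L t := cocartLift op @ A @ B @ F @ H @ x @ fst (α $ t) @ snd (α $ t) @ b @ e in
       let arr t := fst (snd (L t)) in
       let tc := tc op in let sc := sc op in
       let pc t := cocartToFills op @ A @ B @ F @ un @ x @ fst (α $ t) @ snd (α $ t) @ b @ elam (eapp (arr t)) @ snd (snd (L t)) in
       fillsCancel op @ A @ B @ F @ sg @ inn
         @ elam (fun z => snd (α $ sc z) $ tc z) @ b @ elam (fun z => arr (sc z) $ tc z)
         @ pc (e0 op)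
         @ (fillsUnit op @ A @ B @ F @ sg @ inn @ x @ b @ e
              @ elam (fun z => snd (α $ tc z) $ sc z) @ elam (fun z => arr (tc z) $ sc z) @ pc (e1 op)))).

(** Induction on isomorphisms in a fiber: every one is equal to an identity. *)
Definition isoInd_entry : entry :=
  Entry (Π Q : U 0, isEquiv Q (biinvertibles Q) (fun e => ⟪ e, e, idIso e ⟫) ⇒
         Π M : (biinvertibles Q ⇒ U 0), (Π e : Q, M @ ⟪ e, e, idIso e ⟫) ⇒ Π β : biinvertibles Q, M @ β)
    (λ Q c M m β,
       let e := fst (fst (c @ β)) in
       transport @ biinvertibles Q @ M @ ⟪ e, e, idIso e ⟫ @ β @ snd (fst (c @ β)) @ (m @ e)).

(** The horn fillers [τ] and [τ'] compare the targets of [f] and [f'] in both directions, by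
    [k] and [k'].  Along a tetrahedron, a filler of the horn [(f, f)] with last edge
    [m = k' k] is constructed; the degenerate filler has the identity as last edge, and
    fillers are unique. *)
Definition roundTrip_entry (op : bool) : entry :=
  Entry (forFam op (fun A B F P => innerT op A B P ⇒ Π u : arrows A, Π b : B, Π e : P (u $ e0 op) b,
           Π f : from op (fun t => P (u $ t) b) e, Π f' : from op (fun t => P (u $ t) b) e,
           fillsVerticalHorns op P b (eapp u) (eapp f) ⇒
           Π τ : lifts op P (eapp f) (eapp f') (fun z => u $ tc op z) (fun _ => b),
           Π τ' : lifts op P (eapp f') (eapp f) (fun z => u $ tc op z) (fun _ => b),
           dhom2O op (fun _ => P (u $ e1 op) b) (fun t => τ $ mk op (e1 op) t)
             (fun t => τ' $ mk op (e1 op) t) (fun _ => f $ e1 op)))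
    (lamFam op (fun A B F P => λ inn u b e f f' vc τ τ',
       let tc := tc op in let sc := sc op in let mk := mk op in let e0 := e0 op in let e1 := e1 op in
       let Q := P (u $ e1) b in
       let k t := τ $ mk e1 t in
       let k' t := τ' $ mk e1 t in
       let ut z := u $ tc z in
       let goal := dhom2O op (fun _ => Q) k k' (fun _ => f $ e1) in
       letIn (simplices Horn (fun _ => Q) (horn op k k'))
         (fst (innerFill op inn (fun _ => u $ e1) (fun _ => b) (horn op k k'))) goal (fun m =>
       let slice s := simplices Horn (fun z => P (ut z) b)
            (horn op (eapp f) (fun q => atMin op q s (fun r => m $ mk q r))) in
       letIn (ext C2 TTop slice (TZero op) (fun _ => elam (eapp τ)))
         (fst (rfe C2 TTop (TZero op) slice (fun _ => elam (eapp τ))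
             (fun s => innerFill op inn ut (fun _ => b) (horn op (eapp f) (fun q => atMin op q s (fun r => m $ mk q r))))))
         goal (fun σ =>
       let I := simplices Horn (fun z => P (ut z) b) (horn op (eapp f') k') in
       let T μ := Σ n : lifts op P (eapp f) (fun t => μ $ mk t t) ut (fun _ => b),
                    dhom2O op (fun _ => Q) k k' (fun t => n $ mk e1 t) in
       let x1 := elam (fun z => σ $ sc z $ mk (tc z) (tc z)) in
       let x2 := elam (eapp τ') in
       letIn (T τ')
         (transport @ I @ (λ μ, T μ) @ x1 @ x2
            @ (contrPath @ I @ innerFill op inn ut (fun _ => b) (horn op (eapp f') k') @ x1 @ x2)
            @ ⟪ elam (fun z => σ $ sc z $ z), elam (eapp m) ⟫)
         goal (fun y =>
       let N := lifts op P (eapp f) (eapp f) ut (fun _ => b) in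
       let deg := elam (fun z => f $ tc z) in
       transport @ N @ (λ n, dhom2O op (fun _ => Q) k k' (fun t => n $ mk e1 t)) @ elam (eapp (fst y)) @ deg
         @ (contrPath @ N @ (vc @ elam (eapp f)) @ elam (eapp (fst y)) @ deg)
         @ elam (eapp (snd y))))))).

Definition isoPath_entry : entry :=
  Entry (Π Q : U 0, isEquiv Q (biinvertibles Q) (fun e => ⟪ e, e, idIso e ⟫) ⇒
         Π x : Q, Π y : Q, Π k : hom Q x y, Π k' : hom Q y x,
         hom2 Q (eapp k) (eapp k') (fun _ => x) ⇒ hom2 Q (eapp k') (eapp k) (fun _ => y) ⇒ eqt Q x y)
    (λ Q c x y k k' h h',
       isoInd @ Q @ c @ (λ β, eqt Q (fst β) (fst (snd β))) @ (λ x, refl x)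
         @ ⟪ x, y, k, ⟪ k', h ⟫, ⟪ k', h' ⟫ ⟫).

Definition uniqueTarget_entry (op : bool) : entry :=
  Entry (forFam op (fun A B F P => innerT op A B P ⇒ freeT op A B P ⇒ Π u : arrows A, Π b : B, Π e : P (u $ e0 op) b,
           Π f : from op (fun t => P (u $ t) b) e, Π f' : from op (fun t => P (u $ t) b) e,
           fillsVerticalHorns op P b (eapp u) (eapp f) ⇒ fillsVerticalHorns op P b (eapp u) (eapp f') ⇒
           if op then eqt (P (u $ e1 op) b) (f' $ e1 op) (f $ e1 op)
           else eqt (P (u $ e1 op) b) (f $ e1 op) (f' $ e1 op)))
    (lamFam op (fun A B F P => λ inn free u b e f f' vc vc',
       let Q := P (u $ e1 op) b in
       let goal := if op then eqt Q (f' $ e1 op) (f $ e1 op) else eqt Q (f $ e1 op) (f' $ e1 op) in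
       letIn (lifts op P (eapp f) (eapp f') (fun z => u $ tc op z) (fun _ => b)) (fst (vc @ elam (eapp f'))) goal (fun τ =>
       letIn (lifts op P (eapp f') (eapp f) (fun z => u $ tc op z) (fun _ => b)) (fst (vc' @ elam (eapp f))) goal (fun τ' =>
       let k := elam (fun t => τ $ mk op (e1 op) t) in
       let k' := elam (fun t => τ' $ mk op (e1 op) t) in
       let h := roundTrip op @ A @ B @ F @ inn @ u @ b @ e @ f @ f' @ vc @ τ @ τ' in
       let h' := roundTrip op @ A @ B @ F @ inn @ u @ b @ e @ f' @ f @ vc' @ τ' @ τ in
       let z := asc (if op then ⟪ b, u $ e1 op ⟫ else ⟪ u $ e1 op, b ⟫) (baseT op A B) in
       let Qz := overBase op P z in
       if op then isoPath @ Qz @ (free @ z) @ (f' $ e1 op) @ (f $ e1 op) @ k @ k' @ h' @ h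
       else isoPath @ Qz @ (free @ z) @ (f $ e1 op) @ (f' $ e1 op) @ k @ k' @ h @ h')))).

Definition lib3 : list entry := [
  cocartLift_entry false; cocartLift_entry true; liftsFill_entry false; liftsFill_entry true; isoInd_entry; isoPath_entry;
  roundTrip_entry false; roundTrip_entry true; uniqueTarget_entry false; uniqueTarget_entry true
].

(** * Base change *)

(** A triangle in a comma type is a family of triangles of [A], constant at the end where
    the arrows are based; relative function extensionality applies. *)
Definition unitComma_entry (op : bool) : entry :=
  Entry (Π A : U 0, unitsT (negb op) A ⇒ Π a : A, unitsT (negb op) (comma op A a))
    (λ A un a x h,
       let o := negb op in
       let T t := unitT o A (snd x $ t) (fun s => snd (h $ s) $ t) in
       let c := fun _ : dpt => elam (fun _ => a) in
       retractContr @ ext C2 TTop T (TZero op) c @ unitT o (comma op A a) x (eapp h)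
         @ (λ w, elam (fun z => ⟪ w $ e1 op $ z, elam (fun t => w $ t $ z) ⟫))
         @ (λ k, elam (fun t => elam (fun z => snd (k $ z) $ t)))
         @ (λ k, refl k)
         @ rfe C2 TTop (TZero op) T c (fun t => un @ (snd x $ t) @ elam (fun s => snd (h $ s) $ t))).

(** Here [κ] composes [f'] with the comparison arrow, [θ] composes the result with [g'],
    and [ω] fills the horn of [f'] and the diagonal of [θ]; the claim is about the side of
    the square [ω] opposite to the source of [f']. *)
Definition baseChangeGoal (A B : dtm) (P : dtm -> dtm -> dtm) (y x : dtm) (u v : dpt -> dtm) (e4 f' κ : dtm) : dtm :=
  Π g' : from false (fun s => P x (v s)) e4,
  fillsHorns true B A (fun b a => P a b) x v (eapp g') ⇒
  Π θ : simplices Horn (fun z => P (u (pfst z)) (v (psnd z))) (horn false (fun t => κ $ ppair t t) (eapp g')),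
  Π ω : simplices (LHorn false) (fun z => P (u (pfst z)) (v (psnd z)))
           (lhorn false (eapp f') (fun t => θ $ ppair t t)),
  fillsHorns true B A (fun b a => P a b) x v (fun s => ω $ ppair p1 s).
Definition baseChangeMotive (A B : dtm) (P : dtm -> dtm -> dtm) (y x : dtm) (u v : dpt -> dtm) (e3 e4 k : dtm) : dtm :=
  Π f' : ext C2 TTop (fun t => P (u t) y) (TZero true) (fun _ => e3),
  fillsHorns false A B P y u (eapp f') ⇒
  Π κ : simplices Horn (fun z => P (u (pfst z)) y) (horn false (eapp f') (eapp k)),
  baseChangeGoal A B P y x u v e4 f' κ.

(** Where the comparison arrow is an isomorphism it may be assumed to be an identity.
    Then [κ] is degenerate, and [θ] and [ω] are fillers of the same horn; hence the opposite
    side of [ω] is [g']. *)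
Definition baseChangeIso_entry : entry :=
  Entry (forFam false (fun A B F P => innerT false A B P ⇒ freeT false A B P ⇒
      Π x0 : A, Π x : A, Π u : hom A x0 x, Π y : B, Π y0 : B, Π v : hom B y y0,
      Π e3 : P x y, Π e4 : P x y, Π k : hom (P x y) e3 e4, isIso (P x y) e3 e4 k ⇒
      baseChangeMotive A B P y x (eapp u) (eapp v) e3 e4 k))
    (lamFam false (fun A B F P => λ inn free x0 x u y y0 v e3 e4 k iso,
       let z := asc ⟪ x, y ⟫ (A ⊗ B) in
       isoInd @ overBase false P z @ (free @ z)
         @ (λ β, baseChangeMotive A B P y x (eapp u) (eapp v) (fst β) (fst (snd β)) (fst (snd (snd β))))
         @ (λ e f' pc κ,
              let u1 z := u $ pfst z in
              let K := simplices Horn (fun z => P (u1 z) y) (horn false (eapp f') (fun _ => e)) in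
              let deg := elam (fun z => f' $ pfst z) in
              transport @ K @ (λ κ, baseChangeGoal A B P y x (eapp u) (eapp v) e f' κ) @ deg @ κ
                @ (contrPath @ K @ innerFill false inn u1 (fun _ => y) (horn false (eapp f') (fun _ => e)) @ deg @ κ)
                @ (λ g' pg θ ω,
                     let L := lifts false P (eapp f') (fun t => θ $ ppair t t) u1 (fun z => v $ psnd z) in
                     transport @ L @ (λ ω, fillsHorns true B A (fun b a => P a b) x (eapp v) (fun s => ω $ ppair p1 s))
                       @ elam (eapp θ) @ ω
                       @ (contrPath @ L @ (pc @ elam u1 @ elam (fun z => v $ psnd z) @ elam (fun t => θ $ ppair t t))
                            @ elam (eapp θ) @ ω) @ pg))
         @ ⟪ e3, e4, k, iso ⟫)).

(** The square [w] over [u × v] has cocartesian sides over [u] and the cartesian side [g]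
    over [v] at the source of [u].  Its side at the target of [u] is then cartesian: it
    agrees with a cartesian lift [g'] up to the comparison arrow, an isomorphism. *)
Definition baseChange_entry : entry :=
  Entry (forFam false (fun A B F P => innerT false A B P ⇒ freeT false A B P ⇒ comparisonsAreIsos A B P ⇒
      onLeft true B A (fun b a => P a b) ⇒ unitsT false B ⇒ unitsT true A ⇒
      Π x0 : A, Π x : A, Π u : hom A x0 x, Π y : B, Π y0 : B, Π v : hom B y y0,
      Π e : P x0 y0, Π e1 : P x y0, Π f : dhom (fun t => P (u $ t) y0) e e1,
      isLeft false A B P y0 (eapp u) (eapp f) ⇒
      Π e2 : P x0 y, Π g : dhom (fun t => P x0 (v $ t)) e2 e,
      isLeft true B A (fun b a => P a b) x0 (eapp v) (eapp g) ⇒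
      Π e3 : P x y, Π f' : dhom (fun t => P (u $ t) y) e2 e3,
      isLeft false A B P y (eapp u) (eapp f') ⇒
      Π w : ext C2 TTop (fun s => from false (fun t => P (u $ t) (v $ s)) (g $ s)) boundary1
              (fun s => recor (Defs.teq s p0) (Defs.teq s p1) (elam (eapp f')) (elam (eapp f))),
      fillsHorns true B A (fun b a => P a b) x (eapp v) (fun s => w $ s $ p1)))
    (lamFam false (fun A B F P => λ inn free cmp onR unB unA x0 x u y y0 v e e1 f cf e2 g cg e3 f' cf' w,
       let P' := fun b a => P a b in
       let goal := fillsHorns true B A P' x (eapp v) (fun s => w $ s $ p1) in
       letIn (Σ e4 : P x y, Σ g' : dhomO true (fun t => P x (v $ t)) e1 e4, isLeft true B A P' x (eapp v) (eapp g'))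
         (cocartLift true @ B @ A @ F @ onR @ y0 @ y @ v @ x @ e1) goal (fun L =>
       let e4 := fst L in let g' := fst (snd L) in let cg' := snd (snd L) in
       letIn (fillsHorns true B A P' x (eapp v) (eapp g'))
         (cocartToFills true @ B @ A @ F @ unA @ y0 @ y @ v @ x @ elam (eapp g') @ cg') goal (fun pg =>
       letIn (fillsHorns false A B P y (eapp u) (eapp f'))
         (cocartToFills false @ A @ B @ F @ unB @ x0 @ x @ u @ y @ elam (eapp f') @ cf') goal (fun pf =>
       letIn (simplices (LHorn true) (fun z => P (u $ pfst z) (v $ psnd z)) (lhorn true (eapp g') (fun t => w $ t $ t)))
         (fst (pg @ elam (fun z => v $ psnd z) @ elam (fun z => u $ pfst z) @ elam (fun t => w $ t $ t))) goal (fun θ =>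
       letIn (lifts false P (eapp f') (fun t => θ $ ppair t p0) (fun z => u $ pfst z) (fun _ => y))
         (fst (pf @ elam (fun z => u $ pfst z) @ elam (fun _ => y) @ elam (fun t => θ $ ppair t p0))) goal (fun κ =>
       let k := elam (fun s => κ $ ppair p1 s) in
       baseChangeIso @ A @ B @ F @ inn @ free @ x0 @ x @ u @ y @ y0 @ v @ e3 @ e4 @ k
         @ (cmp @ x0 @ x @ u @ y @ y0 @ v @ e @ e1 @ f @ cf @ e2 @ g @ cg @ e3 @ f' @ cf' @ e4 @ g' @ cg' @ k
              @ ⟪ elam (fun t => ⟪ u $ t, y, θ $ ppair t p0 ⟫), elam (fun t => ⟪ u $ t, v $ t, w $ t $ t ⟫),
                  elam (fun z => ⟪ u $ pfst z, y, κ $ z ⟫),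
                  elam (fun z => ⟪ u $ pfst z, v $ psnd z, θ $ z ⟫),
                  elam (fun z => ⟪ u $ psnd z, v $ pfst z, w $ pfst z $ psnd z ⟫) ⟫)
         @ elam (eapp f') @ pf @ elam (eapp κ) @ elam (eapp g') @ pg @ elam (eapp θ)
         @ elam (fun z => w $ psnd z $ pfst z)))))))).

Definition lib4 := both unitComma_entry ++ [baseChangeIso_entry; baseChange_entry].

(** * The section determined by an element *)

(** The hypotheses of the theorem, as variables of the object theory. *)
Record setting : Type := Setting {
  tA : dtm; tB : dtm; tF : dtm; hsA : dtm; hsB : dtm; hinn : dtm; hfree : dtm;
  hL : dtm; hR : dtm; hcmp : dtm; ta : dtm; tb : dtm }.

Definition fam (c : setting) : dtm -> dtm -> dtm := family false (tF c).
Definition op_fam (c : setting) : dtm -> dtm -> dtm := fun y x => fam c x y.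
Definition forMain (body : setting -> dtm) : dtm :=
  forFam false (fun A B F P => Π sA : segalT A, Π sB : segalT B, Π inn : innerT false A B P,
    Π free : freeT false A B P, Π oL : onLeft false A B P, Π oR : onLeft true B A (fun b a => P a b),
    Π cmp : comparisonsAreIsos A B P, Π a : A, Π b : B, body (Setting A B F sA sB inn free oL oR cmp a b)).
Definition lamMain (body : setting -> dtm) : dtm :=
  lamFam false (fun A B F P => λ sA sB inn free oL oR cmp a b, body (Setting A B F sA sB inn free oL oR cmp a b)).
Definition atMain (l : dtm) (c : setting) : dtm :=
  l @ tA c @ tB c @ tF c @ hsA c @ hsB c @ hinn c @ hfree c @ hL c @ hR c @ hcmp c @ ta c @ tb c.
Definition atL (l : bool -> dtm) (c : setting) : dtm := l false @ tA c @ tB c @ tF c.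
Definition atR (l : bool -> dtm) (c : setting) : dtm := l true @ tB c @ tA c @ tF c.

Definition tX (c : setting) : dtm := coslice (tA c) (ta c).
Definition tY (c : setting) : dtm := slice (tB c) (tb c).
Definition famXY (c : setting) : dtm -> dtm -> dtm := fun x y => fam c (fst x) (fst y).
Definition x0 (c : setting) : dtm := asc (idPoint (ta c)) (tX c).
Definition y0 (c : setting) : dtm := asc (idPoint (tb c)) (tY c).
Definition unA (c : setting) : dtm := unitFill true @ tA c @ hsA c.
Definition unB (c : setting) : dtm := unitFill false @ tB c @ hsB c.
Definition unX (c : setting) : dtm := unitComma false @ tA c @ unA c @ ta c.
Definition unY (c : setting) : dtm := unitComma true @ tB c @ unB c @ tb c.

Definition liftR (c : setting) (e y : dtm) : dtm :=
  atR cocartLift c @ hR c @ tb c @ fst y @ snd y @ ta c @ e.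
Definition liftLeft (c : setting) (x y e : dtm) : dtm :=
  atL cocartLift c @ hL c @ ta c @ fst x @ snd x @ fst y @ e.
(** The section with value [x_! (y^* e)] at [(x, y)]. *)
Definition sec (c : setting) (e x y : dtm) : dtm := fst (liftLeft c x y (fst (liftR c e y))).

Definition secLeft := var 42.
Definition secRight := var 43.
Definition evSec := var 44.
Definition secEv := var 45.
Definition propPair := var 46.
Definition isSecContr := var 47.

Definition secLeft_entry : entry :=
  Entry (forMain (fun c => Π e : fam c (ta c) (tb c), Π α : arrows (tX c), Π y : tY c,
           isLeftCocartArr (tX c) (tY c) (famXY c) y (eapp α) (fun t => sec c e (α $ t) y)))
    (lamMain (fun c => λ e α y,
       atL fillsToCocartComma c @ ta c @ tb c @ unY c @ (α $ p0) @ (α $ p1) @ elam (eapp α) @ y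
         @ elam (fun t => sec c e (α $ t) y)
         @ (λ r1 r2 h, atL liftsFill c @ hsA c @ hinn c @ unB c @ hL c @ ta c @ fst y @ fst (liftR c e y) @ α
              @ elam (fun z => fst (r1 $ z)) @ elam (fun z => fst (r2 $ z)) @ elam (eapp h)))).

(** Before [x_!] is applied, the arrow [y^* e] is cartesian by the mirror image of
    [liftsFill]; base change carries this along [x_!]. *)
Definition secRight_entry : entry :=
  Entry (forMain (fun c => Π e : fam c (ta c) (tb c), Π x : tX c, Π β : arrows (tY c),
           isRightCartArr (tX c) (tY c) (famXY c) x (eapp β) (fun t => sec c e x (β $ t))))
    (lamMain (fun c => λ e x β,
       let v := elam (fun t => fst (β $ t)) in
       let g := elam (fun t => fst (liftR c e (β $ t))) in
       let L t := liftLeft c x (β $ t) (fst (liftR c e (β $ t))) in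
       letIn (fillsHorns true (tB c) (tA c) (op_fam c) (fst x) (fun t => fst (β $ t)) (fun t => sec c e x (β $ t)))
        (baseChange @ tA c @ tB c @ tF c @ hinn c @ hfree c @ hcmp c @ hR c @ unB c @ unA c @ ta c @ fst x @ snd x
           @ fst (β $ p0) @ fst (β $ p1) @ v
           @ fst (liftR c e (β $ p1)) @ fst (L p1) @ fst (snd (L p1)) @ snd (snd (L p1))
           @ fst (liftR c e (β $ p0)) @ g
           @ (atR fillsToCocart c @ unA c @ fst (β $ p1) @ fst (β $ p0) @ v @ ta c @ g
               @ (atR liftsFill c @ hsB c @ hinn c @ unA c @ hR c @ tb c @ ta c @ e @ β))
           @ fst (L p0) @ fst (snd (L p0)) @ snd (snd (L p0))
           @ elam (fun s => elam (fun t => fst (snd (L s)) $ t)))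
        (isRightCartArr (tX c) (tY c) (famXY c) x (eapp β) (fun t => sec c e x (β $ t))) (fun pc =>
       atR fillsToCocartComma c @ tb c @ ta c @ unX c @ (β $ p1) @ (β $ p0) @ elam (eapp β) @ x
         @ elam (fun t => sec c e x (β $ t))
         @ (λ r1 r2 h, pc @ elam (fun z => fst (r1 $ z)) @ elam (fun z => fst (r2 $ z)) @ elam (eapp h))))).

(** The arrow of the slice from [y] to the identity, through the restrictions of [y] to the
    intervals from [t] to 1. *)
Definition maxArrow (c : setting) (y : dtm) : dpt -> dtm :=
  fun t => ⟪ snd y $ t, elam (fun s => atMin true t s (eapp (snd y))) ⟫.
(** The arrow of the coslice from the identity to [x]. *)
Definition minArrow (c : setting) (x : dtm) : dpt -> dtm :=
  fun t => ⟪ snd x $ t, elam (fun s => atMin false t s (eapp (snd x))) ⟫.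

(** Identity arrows fill horns over identities, as fibers are Segal types. *)
Definition unFiber (c : setting) (op : bool) (x y e h : dtm) : dtm :=
  unitFill op @ fam c x y @ (λ d, hinn c @ elam (fun _ => ⟪ x, y ⟫) @ elam (eapp d)) @ e @ h.

Definition verticalR (c : setting) (e y : dtm) : dtm :=
  λ h, atR cocartToFills c @ unA c @ tb c @ fst y @ snd y @ ta c @ elam (eapp (fst (snd (liftR c e y))))
         @ snd (snd (liftR c e y)) @ elam (fun z => snd y $ psnd z) @ elam (fun _ => ta c) @ elam (eapp h).
Definition verticalL (c : setting) (x y e : dtm) : dtm :=
  λ h, atL cocartToFills c @ unB c @ ta c @ fst x @ snd x @ fst y @ elam (eapp (fst (snd (liftLeft c x y e))))
         @ snd (snd (liftLeft c x y e)) @ elam (fun z => snd x $ pfst z) @ elam (fun _ => fst y) @ elam (eapp h).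

Definition evSec_type (c : setting) : dtm :=
  Π e : fam c (ta c) (tb c), eqt (fam c (ta c) (tb c)) (sec c e (x0 c) (y0 c)) e.
(** The identity of [e] is a lift of an identity, and the target of a lift is unique. *)
Definition evSec_entry : entry :=
  Entry (forMain evSec_type)
    (lamMain (fun c => λ e,
       let Q := fam c (ta c) (tb c) in
       let r := fst (liftR c e (y0 c)) in
       let pR := atR uniqueTarget c @ hinn c @ hfree c @ elam (fun _ => tb c) @ ta c @ e
            @ elam (eapp (fst (snd (liftR c e (y0 c))))) @ elam (fun _ => e)
            @ verticalR c e (y0 c) @ (λ h, unFiber c true (ta c) (tb c) e (elam (eapp h))) in
       asc (λ r p, concat Q (fst (liftLeft c (x0 c) (y0 c) r))
         (atL uniqueTarget c @ hinn c @ hfree c @ elam (fun _ => ta c) @ tb c @ r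
            @ elam (eapp (fst (snd (liftLeft c (x0 c) (y0 c) r)))) @ elam (fun _ => r)
            @ verticalL c (x0 c) (y0 c) r @ (λ h, unFiber c false (ta c) (tb c) r (elam (eapp h))))
         (sym Q e p)) (Π r : Q, Π p : eqt Q e r, eqt Q (fst (liftLeft c (x0 c) (y0 c) r)) e) @ r @ pR)).

Definition secEv_type (c : setting) : dtm :=
  Π s : (Π x : tX c, Π y : tY c, famXY c x y),
  isTwoSidedSection (tX c) (tY c) (famXY c) s ⇒ Π x : tX c, Π y : tY c,
  eqt (famXY c x y) (sec c (s @ x0 c @ y0 c) x y) (s @ x @ y).
(** A two-sided section [s] sends [maxArrow] to a cartesian lift of [e = s id id], whence
    [s id y = y^* e], and [minArrow] to a cocartesian lift of the latter. *)
Definition secEv_entry : entry :=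
  Entry (forMain secEv_type)
    (lamMain (fun c => λ s h x y,
       let e := s @ x0 c @ y0 c in
       let Q := famXY c x y in
       let f t := s @ x0 c @ maxArrow c y t in
       let g t := s @ minArrow c x t @ y in
       let pR := atR uniqueTarget c @ hinn c @ hfree c @ elam (eapp (snd y)) @ ta c @ e
            @ elam (eapp (fst (snd (liftR c e y)))) @ elam f
            @ verticalR c e y
            @ (λ h', atR cocartToFillsComma c @ tb c @ ta c @ unX c @ y0 c @ y @ elam (maxArrow c y) @ x0 c @ elam f
                 @ (snd h @ x0 c @ elam (maxArrow c y))
                 @ elam (fun z => maxArrow c y (psnd z)) @ elam (fun _ => x0 c) @ elam (eapp h')) in
       let pL := atL uniqueTarget c @ hinn c @ hfree c @ elam (eapp (snd x)) @ fst y @ (s @ x0 c @ y)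
            @ elam (eapp (fst (snd (liftLeft c x y (s @ x0 c @ y))))) @ elam g
            @ verticalL c x y (s @ x0 c @ y)
            @ (λ h', atL cocartToFillsComma c @ ta c @ tb c @ unY c @ x0 c @ x @ elam (minArrow c x) @ y @ elam g
                 @ (fst h @ elam (minArrow c x) @ y)
                 @ elam (fun z => minArrow c x (pfst z)) @ elam (fun _ => y) @ elam (eapp h')) in
       jel (fun r _ => eqt Q (fst (liftLeft c x y r)) (s @ x @ y)) pL pR)).

Definition propPair_entry : entry :=
  Entry (Π A : U 0, Π M : (A ⇒ U 0), (Π a : A, M @ a ⇒ isContr (M @ a)) ⇒
         Π z : (Σ a : A, M @ a), Π w : (Σ a : A, M @ a), eqt A (fst z) (fst w) ⇒ eqt (Σ a : A, M @ a) z w)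
    (λ A M h z w p, jel (fun a _ => Π m : M @ a, eqt (Σ a : A, M @ a) z ⟪ a, m ⟫)
       (λ m, ap (Σ a : A, M @ a) (fun m => ⟪ fst z, m ⟫) (snd z)
           (contrPath @ (M @ fst z) @ (h @ fst z @ snd z) @ snd z @ m)) p @ snd w).

Definition lib5 := [secLeft_entry; secRight_entry; evSec_entry; secEv_entry; propPair_entry].

(** * The equivalence *)

(** An iterated dependent product [Z] together with a contraction of its last codomain. *)
Inductive tele : Type := Leaf (Z c : dtm) | Bind (A : dtm) (k : dtm -> tele).
Fixpoint teleType (T : tele) : dtm :=
  match T with
  | Leaf Z _ => Z
  | Bind A k => Π x : A, teleType (k x)
  end.
Fixpoint teleContr (T : tele) : dtm :=
  match T with
  | Leaf _ c => c
  | Bind A k => FE @ A @ (λ x, teleType (k x)) @ (λ x, teleContr (k x))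
  end.

Definition cocartTele (op : bool) (X : dtm) (Q : dtm -> dtm) (u f : dpt -> dtm) (c : dtm) : tele :=
  Bind X (fun x => Bind (dhomO op (fun _ => X) (u (e1 op)) x) (fun v =>
  Bind (dhomO op (fun _ => X) (u (e0 op)) x) (fun w =>
  Bind (dhom2O op (fun _ => X) u (eapp v) (eapp w)) (fun r => Bind (Q x) (fun e =>
  Bind (dhomO op (fun t => Q (w $ t)) (f (e0 op)) e) (fun h =>
    let Z := Σ g : dhomO op (fun t => Q (v $ t)) (f (e1 op)) e,
               dhom2O op (fun z => Q (r $ z)) f (eapp g) (eapp h) in
    Leaf (isContr Z) (isContrContr @ Z @ (c @ x @ v @ w @ r @ e @ h)))))))).

(** Being a two-sided section is a product of statements of contractibility, hence a
    proposition: contractible once it holds. *)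
Definition isSecContr_entry : entry :=
  Entry (forMain (fun c => Π s : (Π x : tX c, Π y : tY c, famXY c x y),
           isTwoSidedSection (tX c) (tY c) (famXY c) s ⇒ isContr (isTwoSidedSection (tX c) (tY c) (famXY c) s)))
    (lamMain (fun c => λ s h,
       let X := tX c in let Y := tY c in let P := famXY c in
       let T1 := Bind (arrows X) (fun u => Bind Y (fun y =>
                   cocartTele false X (left Y P) (eapp u) (fun t => ⟪ y, s @ (u $ t) @ y ⟫) (fst h @ u @ y))) in
       let T2 := Bind X (fun x => Bind (arrows Y) (fun v =>
                   cocartTele true Y (right X P) (eapp v) (fun t => ⟪ x, s @ x @ (v $ t) ⟫) (snd h @ x @ v))) in
       letIn (isContr (teleType T1)) (teleContr T1) (isContr (isTwoSidedSection X Y P s)) (fun c1 =>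
       letIn (isContr (teleType T2)) (teleContr T2) (isContr (isTwoSidedSection X Y P s)) (fun c2 =>
       sigContr @ teleType T1 @ (λ _, teleType T2) @ c1 @ (λ _, c2))))).

Definition sections2 (c : setting) : dtm := twoSidedSections (tX c) (tY c) (famXY c).
Definition section := var 48.
Definition sectionPath := var 49.
Definition evEquiv := var 50.

Definition section_type (c : setting) : dtm :=
  Π e : fam c (ta c) (tb c), Σ g : sections2 c,
  Π x : tX c, Π y : tY c, eqt (famXY c x y) (fst g @ x @ y) (sec c e x y).
Definition section_entry : entry :=
  Entry (forMain section_type)
    (lamMain (fun c => λ e,
       ⟪ ⟪ λ x y, sec c e x y, atMain secLeft c @ e, atMain secRight c @ e ⟫, λ x y, refl (sec c e x y) ⟫)).

Definition sectionPath_type (c : setting) : dtm :=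
  Π g : sections2 c, Π s : sections2 c,
  (Π x : tX c, Π y : tY c, eqt (famXY c x y) (fst g @ x @ y) (fst s @ x @ y)) ⇒ eqt (sections2 c) g s.
Definition sectionPath_entry : entry :=
  Entry (forMain sectionPath_type)
    (lamMain (fun c => λ g s p,
       let X := tX c in let Y := tY c in let P := famXY c in
       propPair @ (Π x : X, Π y : Y, P x y) @ (λ s, isTwoSidedSection X Y P s) @ atMain isSecContr c @ g @ s
         @ (pointwise @ X @ (λ x, Π y : Y, P x y) @ fst g @ fst s
              @ (λ x, pointwise @ Y @ (λ y, P x y) @ (fst g @ x) @ (fst s @ x) @ (p @ x))))).

Definition evEquiv_entry : entry :=
  Entry (forMain (fun c => isEquiv (sections2 c) (fam c (ta c) (tb c))
                             (fun s => fst s @ idPoint (ta c) @ idPoint (tb c))))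
    (lamMain (fun c =>
       let S := sections2 c in
       let Q := fam c (ta c) (tb c) in
       let f s := fst s @ x0 c @ y0 c in
       let goal := isEquiv S Q f in
       asc (λ L path se es,
         qinv @ S @ Q @ (λ s, f s) @ (λ e, fst (L @ e))
           @ asc (λ s, path @ fst (L @ f s) @ s
                @ (λ x y, concat (famXY c x y) (fst (fst (L @ f s)) @ x @ y) (snd (L @ f s) @ x @ y)
                        (se @ fst s @ snd s @ x @ y))) (Π s : S, eqt S (fst (L @ f s)) s)
           @ asc (λ e, concat Q (f (fst (L @ e))) (snd (L @ e) @ x0 c @ y0 c) (es @ e))
               (Π e : Q, eqt Q (f (fst (L @ e))) e))
         (section_type c ⇒ sectionPath_type c ⇒ secEv_type c ⇒ evSec_type c ⇒ goal)
         @ atMain section c @ atMain sectionPath c @ atMain secEv c @ atMain evSec c)).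

Definition main_entry : entry :=
  Entry (Π A : U 0, Π B : U 0, isRezk A ⇒ isRezk B ⇒
    Π Fam : (A ⊗ B ⇒ U 0),
    let P := fun x y => app Fam ⟪ x, y ⟫ in
    isTwoSided A B P ⇒
    Π a : A, Π b : B,
      isEquiv
        (twoSidedSections (coslice A a) (slice B b) (fun u v => P (fst u) (fst v)))
        (P a b)
        (fun s => app (app (fst s) (idPoint a)) (idPoint b)))
    (λ A B rA rB F H a b,
       evEquiv @ A @ B @ F @ (segalFill @ A @ fst rA) @ (segalFill @ B @ fst rB)
         @ fst (fst H) @ snd (fst H) @ fst (snd H) @ fst (snd (snd H)) @ snd (snd (snd H)) @ a @ b).

Definition lib6 := [isSecContr_entry; section_entry; sectionPath_entry; evEquiv_entry; main_entry].

Definition library : list entry := lib0 ++ lib1 ++ lib2 ++ lib3 ++ lib4 ++ lib5 ++ lib6.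

(** * The theorem *)

(** The depth 400 is ample. *)
Lemma library_checked :
  checked (check_with 400) library 0 lnil (statement main_entry 0 0) = true.
Proof. vm_compute. reflexivity. Qed.

Theorem theorem6p6 (i : nat) :
  provable (
    Π A : U i, Π B : U i, isRezk A ⇒ isRezk B ⇒
    Π Fam : (A ⊗ B ⇒ U i),
    let P := fun x y => app Fam ⟪ x, y ⟫ in
    isTwoSided A B P ⇒
    Π a : A, Π b : B,
      isEquiv
        (twoSidedSections (coslice A a) (slice B b) (fun u v => P (fst u) (fst v)))
        (P a b)
        (fun s => app (app (fst s) (idPoint a)) (idPoint b))).
Proof.
  destruct (checked_sound _ (check_with_sound 400) (statement main_entry 0 0) eq_refl
              library 0 lnil Var) as [t H].
  - split; [constructor|intros [|n] A E; discriminate].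
  - repeat split; [intros [|n] ? E; discriminate|intros ? []|constructor|intros [|n] ? E; discriminate].
  - exact library_checked.
  - (* the raised statement is the goal, by computation *)
    exists (raise i t); exact (proj1 (typing_raise i) _ _ _ _ _ H).
Qed.
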